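(* Let $(\boldsymbol{X}_k)_{k\in\mathbb{Z}_+}$, $\boldsymbol{X}_k=[X_{k,1},X_{k,2}]^\top$, be a $2$-type Galton--Watson process with immigration with $\boldsymbol{X}_0=[0,0]^\top$, offspring vectors $[\xi_{k,j,i,1},\xi_{k,j,i,2}]^\top$ ($k,j\in\mathbb{N}$, $i\in\{1,2\}$) and immigration vectors $[\varepsilon_{k,1},\varepsilon_{k,2}]^\top$ ($k\in\mathbb{N}$), as defined in the context. Suppose that: - $\mathbb{E}(\xi_{1,1,1,1}^2)<\infty$, $\mathbb{E}(\xi_{1,1,2,2}^2)<\infty$, $\mathbb{E}(\varepsilon_{1,1}^2)<\infty$, and $\mathbb{E}(\varepsilon_{1,2}^{1+\delta})<\infty$ for some $\delta\in(0,\infty)$; - $\mathbb{E}(\xi_{1,1,1,1})=1$, $\mathbb{E}(\xi_{1,1,2,2})=1$, and $\xi_{1,1,2,1}=0$ almost surely; - there exists $a_{2,1}\in\mathbb{R}_+$ such that $\xi_{1,1,1,2}=a_{2,1}$ almost surely. Then $$\left(\begin{bmatrix}n^{-1}X_{\lfloor nt\rfloor,1}\\ n^{-2}X_{\lfloor nt\rfloor,2}\end{bmatrix}\right)_{t\in\mathbb{R}_+}\stackrel{\mathcal{D}}{\longrightarrow}\left(\begin{bmatrix}\mathcal{X}_{t,1}\\ a_{2,1}\int_0^t\mathcal{X}_{s,1}\,\mathrm{d}s\end{bmatrix}\right)_{t\in\mathbb{R}_+}\qquad\text{as } n\to\infty,$$ where $(\mathcal{X}_{t,1})_{t\in\mathbb{R}_+}$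 is the pathwise unique strong solution of the stochastic differential equation $$\mathrm{d}\mathcal{X}_{t,1}=\mathbb{E}(\varepsilon_{1,1})\,\mathrm{d}t+\sqrt{\operatorname{Var}(\xi_{1,1,1,1})\,\mathcal{X}_{t,1}^+}\;\mathrm{d}\mathcal{W}_{t,1},\qquad t\in\mathbb{R}_+,\qquad \mathcal{X}_{0,1}=0,$$ and $(\mathcal{W}_{t,1})_{t\in\mathbb{R}_+}$ is a standard Wiener process.
   Context: $\mathbb{Z}_+$, $\mathbb{N}$, $\mathbb{R}_+$ denote the non-negative integers, the positive integers and the non-negative reals; $x^+$ is the positive part of $x\in\mathbb{R}$. $2$-type Galton--Watson process with immigration: let $\{\boldsymbol{\xi}_{k,j,1},\boldsymbol{\xi}_{k,j,2},\boldsymbol{\varepsilon}_k:k,j\in\mathbb{N}\}$ be independent $\mathbb{Z}_+^2$-valued random vectors such that $\{\boldsymbol{\xi}_{k,j,i}:k,j\in\mathbb{N}\}$ for each $i\in\{1,2\}$, and $\{\boldsymbol{\varepsilon}_k:k\in\mathbb{N}\}$, consist of identically distributed random vectors. Write $\boldsymbol{\xi}_{k,j,i}=[\xi_{k,j,i,1},\xi_{k,j,i,2}]^\top$ and $\boldsymbol{\varepsilon}_k=[\varepsilon_{k,1},\varepsilon_{k,2}]^\top$. Then $\boldsymbol{X}_0=[0,0]^\top$ and $\boldsymbol{X}_k=\sum_{j=1}^{X_{k-1,1}}\boldsymbol{\xi}_{k,j,1}+\sum_{j=1}^{X_{k-1,2}}\boldsymbol{\xi}_{k,j,2}+\boldsymbol{\varepsilon}_k$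 for $k\in\mathbb{N}$, with empty sums equal to zero. $D(\mathbb{R}_+,\mathbb{R}^d)$ is the space of càdlàg functions (right continuous with left limits) $\mathbb{R}_+\to\mathbb{R}^d$, endowed with the Skorokhod $J_1$ topology and its Borel $\sigma$-algebra. Here $f_n\to f$ in $J_1$ iff there are continuous strictly increasing $\lambda_n:\mathbb{R}_+\to\mathbb{R}_+$ with $\lambda_n(0)=0$, $\lim_{t\to\infty}\lambda_n(t)=\infty$, $\sup_{t\in\mathbb{R}_+}|\lambda_n(t)-t|\to0$ and $\sup_{t\in[0,K]}\|f_n(\lambda_n(t))-f(t)\|\to0$ for all $K>0$. For càdlàg processes, $\stackrel{\mathcal{D}}{\longrightarrow}$ denotes weak convergence of their distributions on $D(\mathbb{R}_+,\mathbb{R}^2)$. *)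

(* Defs.v *)
From HB Require Import structures.
From mathcomp Require Import all_boot all_order all_algebra.
From mathcomp Require Import all_classical all_reals all_analysis.

Set Implicit Arguments.
Unset Strict Implicit.
Unset Printing Implicit Defensive.

Import Order.TTheory GRing.Theory Num.Theory.
Import numFieldNormedType.Exports.

Local Open Scope classical_set_scope.
Local Open Scope ring_scope.

(** * Families of random elements *)

Definition mutually_independent d d' (Omega : measurableType d)
    (T : measurableType d') (R : realType) (P : probability Omega R)
    (I : eqType) (X : I -> Omega -> T) : Prop :=
  forall (s : seq I) (A : I -> set T), uniq s ->
    (forall i, measurable (A i)) ->
    P (\bigcap_(i in [set` s]) (X i @^-1` A i)) =
    (\prod_(i <- s) P (X i @^-1` A i))%E.

Definition identically_distributed d d' (Omega : measurableType d)
    (T : measurableType d') (R : realType) (P : probability Omega R)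
    (X Y : Omega -> T) : Prop :=
  forall A, measurable A -> P (X @^-1` A) = P (Y @^-1` A).

(** * Two-type Galton-Watson processes with immigration

  The indices [k, j : nat] start at [0]: [xi k j i] is the offspring vector
  xi_{k+1,j+1,i} and [eps k] the immigration vector eps_{k+1}.  The types 1
  and 2 are [ord0] and [ord_max] in ['I_2]; vectors of Z_+^2 are pairs. *)

Definition gw_family (Omega : Type) (xi : nat -> nat -> 'I_2 -> Omega -> nat * nat)
    (eps : nat -> Omega -> nat * nat)
    (a : (nat * nat * 'I_2) + nat) : Omega -> nat * nat :=
  match a with
  | inl (k, j, i) => xi k j i
  | inr k => eps k
  end.

Definition gw_family_law d (Omega : measurableType d) (R : realType)
    (P : probability Omega R) (xi : nat -> nat -> 'I_2 -> Omega -> nat * nat)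
    (eps : nat -> Omega -> nat * nat) : Prop :=
  [/\ forall a, measurable_fun [set: Omega] (gw_family xi eps a),
      mutually_independent P (gw_family xi eps),
      forall i k j, identically_distributed P (xi k j i) (xi 0%N 0%N i) &
      forall k, identically_distributed P (eps k) (eps 0%N)].

Fixpoint gw_process (Omega : Type) (xi : nat -> nat -> 'I_2 -> Omega -> nat * nat)
    (eps : nat -> Omega -> nat * nat) (k : nat) (w : Omega) : nat * nat :=
  if k is k'.+1 then
    let x := gw_process xi eps k' w in
    \sum_(j < x.1) xi k' j ord0 w + \sum_(j < x.2) xi k' j ord_max w + eps k' w
  else (0%N, 0%N).

(** * The Skorokhod space D(R_+, R^2) with the J1 topology

  Paths are functions on [R] that vanish on the negative half-line, so that
  they correspond one-to-one to functions on R_+. *)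

Definition cadlag (R : realType) (f : R -> R * R) : Prop :=
  (forall t : R, 0 <= t -> f x @[x --> t^'+] --> f t) /\
  (forall t : R, 0 < t -> exists l : R * R, f x @[x --> t^'-] --> l).

Record skorokhod (R : realType) := Skorokhod {
  path_of :> R -> R * R ;
  path_of_neg : forall t : R, t < 0 -> path_of t = 0 ;
  path_of_cadlag : cadlag path_of }.

Definition time_change (R : realType) (lam : R -> R) : Prop :=
  [/\ lam 0 = 0,
      {within `[0, +oo[, continuous lam},
      (forall s t : R, 0 <= s -> s < t -> lam s < lam t) &
      lam t @[t --> +oo] --> +oo].

Definition J1_cvg (R : realType) (f_ : nat -> skorokhod R) (f : skorokhod R) : Prop :=
  exists lam : nat -> R -> R,
    [/\ forall n, time_change (lam n),
        (forall e : R, 0 < e ->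
           \forall n \near \oo, forall t : R, 0 <= t -> `|lam n t - t| <= e) &
        (forall K e : R, 0 < K -> 0 < e ->
           \forall n \near \oo, forall t : R, 0 <= t <= K ->
             `|f_ n (lam n t) - f t| <= e)].

(** J1 is metrizable, hence sequential: its open sets are exactly the
  sequentially open ones. *)
Definition J1_open (R : realType) (U : set (skorokhod R)) : Prop :=
  forall (f : skorokhod R) (f_ : nat -> skorokhod R),
    U f -> J1_cvg f_ f -> \forall n \near \oo, U (f_ n).

Lemma J1_openT (R : realType) : J1_open [set: skorokhod R].
Proof. by move=> f f_ _ _; near=> n. Unshelve. all: by end_near. Qed.

Lemma J1_openI (R : realType) : setI_closed (@J1_open R).
Proof.
move=> U V oU oV f f_ [Uf Vf] ff.
by apply: filterS2 (oU _ _ Uf ff) (oV _ _ Vf ff) => n.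
Qed.

Lemma J1_open_bigU (R : realType) (I : Type) (U : I -> set (skorokhod R)) :
  (forall i, J1_open (U i)) -> J1_open (\bigcup_i U i).
Proof.
move=> oU f f_ [i _ Uif] ff.
by apply: filterS (oU i _ _ Uif ff) => n Uin; exists i.
Qed.

HB.instance Definition _ (R : realType) := gen_eqMixin (skorokhod R).
HB.instance Definition _ (R : realType) := gen_choiceMixin (skorokhod R).
HB.instance Definition _ (R : realType) :=
  @isOpenTopological.Build (skorokhod R) (@J1_open R)
    (@J1_openT R) (@J1_openI R) (@J1_open_bigU R).

(** Weak convergence of the distributions on D(R_+, R^2) of the processes
  [X n] to the distribution of [X].  [Z n] and [Z] are these processes seen as
  random elements of the Skorokhod space with its Borel sigma-algebra
  [<<s open>>]; they are determined by [X n] and [X]. *)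
Definition cvg_in_law_skorokhod (R : realType)
    d (Omega : measurableType d) (P : probability Omega R)
    (X_ : nat -> R -> Omega -> R * R)
    d' (Omega' : measurableType d') (P' : probability Omega' R)
    (X : R -> Omega' -> R * R) : Prop :=
  exists (Z_ : nat -> Omega -> skorokhod R) (Z : Omega' -> skorokhod R),
    [/\ (forall n w (t : R), 0 <= t -> Z_ n w t = X_ n t w) /\
        (forall w (t : R), 0 <= t -> Z w t = X t w),
        (forall n (B : set (skorokhod R)), <<s open >> B -> measurable (Z_ n @^-1` B)),
        (forall B : set (skorokhod R), <<s open >> B -> measurable (Z @^-1` B)) &
        forall F : skorokhod R -> R, continuous F ->
          (exists M : R, forall f, `|F f| <= M) ->
          ('E_P[F \o Z_ n] @[n --> \oo] --> 'E_P'[F \o Z])%E].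

(** * Filtrations and Wiener processes

  Times are real numbers; only their values on R_+ matter. *)

Section filtrations.
Context (R : realType) d (Omega : measurableType d) (P : probability Omega R).
Implicit Types (F : R -> set_system Omega) (X : R -> Omega -> R).

Definition is_filtration F : Prop :=
  [/\ forall t : R, 0 <= t -> sigma_algebra [set: Omega] (F t),
      forall t : R, 0 <= t -> F t `<=` measurable &
      forall s t : R, 0 <= s -> s <= t -> F s `<=` F t].

Definition null_sets : set_system Omega :=
  [set N | measurable N /\ P N = 0%E].

Definition usual_conditions F : Prop :=
  null_sets `<=` F 0 /\
  (forall t : R, 0 <= t -> F t = \bigcap_(s in [set s | t < s]) F s).

Definition natural_filtration X (t : R) : set_system Omega :=
  <<s [set A | exists2 s : R, 0 <= s <= t &
        exists2 B : set R, measurable B & A = X s @^-1` B] >>.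

Definition augmented_filtration X (t : R) : set_system Omega :=
  <<s natural_filtration X t `|` null_sets >>.

Definition adapted F X : Prop :=
  forall t : R, 0 <= t -> forall B : set R, measurable B -> F t (X t @^-1` B).

Definition continuous_paths X : Prop :=
  forall w, {within `[0, +oo[, continuous (fun t => X t w)}.

(** [normal_prob m s] has standard deviation [s]. *)
Definition wiener_process F (W : R -> Omega -> R) : Prop :=
  [/\ is_filtration F /\ adapted F W,
      continuous_paths W,
      {ae P, forall w, W 0 w = 0},
      forall s t : R, 0 <= s -> s < t -> forall A (B : set R), F s A -> measurable B ->
        P (A `&` [set w | B (W t w - W s w)]) =
        (P A * P [set w | B (W t w - W s w)%R])%E &
      forall s t : R, 0 <= s -> s < t -> forall B : set R, measurable B ->
        P [set w | B (W t w - W s w)] = normal_prob 0 (Num.sqrt (t - s)) B].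

Definition standard_wiener_process (W : R -> Omega -> R) : Prop :=
  wiener_process (natural_filtration W) W.

End filtrations.

(** * The Ito integral *)

(** The process t |-> \sum_(i < m) zeta_i 1_(t_i, t_(i+1)](t). *)
Record simple_process (R : realType) (Omega : Type) := SimpleProcess {
  sp_size : nat ;
  sp_time : nat -> R ;
  sp_coef : nat -> Omega -> R }.

Section ito.
Context (R : realType) d (Omega : measurableType d) (P : probability Omega R).
Implicit Types (F : R -> set_system Omega) (S : simple_process R Omega).
Implicit Types (W H I X : R -> Omega -> R).

Definition simple_predictable F S : Prop :=
  [/\ 0 <= sp_time S 0%N,
      forall i, (i < sp_size S)%N -> sp_time S i < sp_time S i.+1,
      forall i, (i < sp_size S)%N -> forall B : set R, measurable B ->
        F (sp_time S i) (sp_coef S i @^-1` B) &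
      exists M : R, forall i w, (i < sp_size S)%N -> `|sp_coef S i w| <= M].

Definition simple_value S (t : R) (w : Omega) : R :=
  \sum_(i < sp_size S) sp_coef S i w * \1_(`]sp_time S i, sp_time S i.+1]) t.

Definition simple_integral S W (t : R) (w : Omega) : R :=
  \sum_(i < sp_size S) sp_coef S i w *
    (W (Num.min (sp_time S i.+1) t) w - W (Num.min (sp_time S i) t) w).

(** [I] is (a continuous version of) the stochastic integral of [H] against
  the [F]-Wiener process [W], for an [F]-progressively measurable [H] with
  almost surely locally square-integrable paths: simple processes [S n]
  approximate [H] in L^2([0, T]) in probability, and their integrals converge
  to [I] uniformly on [0, T] in probability, for all [T]. *)
Definition ito_integral F W H I : Prop :=
  [/\ adapted F I, continuous_paths I &
      exists S : nat -> simple_process R Omega,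
        [/\ forall n, simple_predictable F (S n),
            (forall T e : R, 0 <= T -> 0 < e ->
              P [set w | (e%:E <= \int[lebesgue_measure]_(s in `[0%R, T])
                                    ((simple_value (S n) s w - H s w) ^+ 2)%:E)%E]
              @[n --> \oo] --> 0%E) &
            (forall T e : R, 0 <= T -> 0 < e ->
              P [set w | exists2 t : R, 0 <= t <= T &
                           e <= `|simple_integral (S n) W t w - I t w|]
              @[n --> \oo] --> 0%E)]].

(** * Stochastic differential equations
    dX_t = b(X_t) dt + sigma(X_t) dW_t, X_0 = x0 *)

Definition sde_solution F W (b sigma : R -> R) (x0 : R) X : Prop :=
  [/\ adapted F X, continuous_paths X,
      {ae P, forall w, X 0 w = x0},
      {ae P, forall w, forall t : R, 0 <= t ->
        (\int[lebesgue_measure]_(s in `[0%R, t])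
           (`|b (X s w)| + sigma (X s w) ^+ 2)%:E < +oo)%E} &
      exists2 I, ito_integral F W (fun s w => sigma (X s w)) I &
        {ae P, forall w, forall t : R, 0 <= t ->
          X t w = x0 + \int[lebesgue_measure]_(s in `[0, t]) b (X s w) + I t w}].

Definition strong_solution W (b sigma : R -> R) (x0 : R) X : Prop :=
  sde_solution (augmented_filtration P W) W b sigma x0 X.

End ito.

Definition pathwise_uniqueness (R : realType) (b sigma : R -> R) (x0 : R) : Prop :=
  forall (d : measure_display) (Omega : measurableType d) (P : probability Omega R)
    (F : R -> set_system Omega) (W X Y : R -> Omega -> R),
    usual_conditions P F -> wiener_process P F W ->
    sde_solution P F W b sigma x0 X -> sde_solution P F W b sigma x0 Y ->
    {ae P, forall w, forall t : R, 0 <= t -> X t w = Y t w}.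

Definition strong_existence (R : realType) (b sigma : R -> R) (x0 : R) : Prop :=
  forall (d : measure_display) (Omega : measurableType d) (P : probability Omega R)
    (W : R -> Omega -> R),
    standard_wiener_process P W -> exists X, strong_solution P W b sigma x0 X.

(* Main.v *)
Require Import Defs.
From HB Require Import structures.
From mathcomp Require Import all_boot all_order all_algebra.
From mathcomp Require Import all_classical all_reals all_analysis.
From mathcomp Require Import measurable_realfun ring lra zify.

(* Subtracting its mean 1 from each offspring number and comparing the resulting
   martingale increments by Yamada and Watanabe's function (a smooth
   approximation of the absolute value whose second derivative at [x] is at most
   a small multiple of [1 / |x|]) replaces the first type by a process whose
   population size is frozen on [r.+1] blocks per unit of rescaled time, up to an
   error that is small uniformly in [n] once [r] is large.  By Lindeberg's
   replacement inside each block, the frozen process at the ends of the blocks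
   converges in law to the Euler scheme of the equation.  The Yamada-Watanabe
   estimate also compares Euler schemes with each other and with solutions, which
   gives pathwise uniqueness, strong existence and the limit [r -> oo].  The
   second type is [a21] times the accumulated first type, up to a martingale and
   an immigration part of smaller order.  Finally, bounded lower semicontinuous
   functions on the Skorokhod space are increasing limits of functions that are
   Lipschitz for uniform convergence on compact sets, for which the comparison of
   the step paths with their skeletons suffices. *)

Set Implicit Arguments.
Unset Strict Implicit.
Unset Printing Implicit Defensive.

Import Order.TTheory GRing.Theory Num.Theory.
Import numFieldNormedType.Exports.

Local Open Scope classical_set_scope.
Local Open Scope ring_scope.

(** The coefficient [sqrt (v * max x 0)] is only Hoelder of exponent 1/2, so second moments of a
    difference cannot be closed by Gronwall's inequality. But a difference [x] of two processes
    driven by the same noise has quadratic variation of rate at most [v * |x|], which a test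
    function with [f2 x * |x| <= k] reduces to [v * k]. The same mechanism compares the two
    populations: fed with the same offspring variables, they differ only through the individuals
    whose index lies between the two sizes. Offspring numbers have second moments only, so Taylor
    remainders are measured by [cubic_rem]: its mean at scale [1 / n] is negligible against
    [1 / n ^ 2], while about [n ^ 2] individuals reproduce up to a fixed time. As sizes are
    unbounded, the estimates bear on stopped sums with a deterministic number of terms per
    generation, and a bootstrap at the first bad generation shows that stopping is rare. Limits are
    taken with [n] going to infinity for fixed [r], and [r] going to infinity afterwards; constants
    are therefore chosen with [r] before [n]. *)

Notation meas_fun := (measurable_fun setT).

(** * Integrals and independence *)

Section nonnegative_integrals.
Context {d} {T : measurableType d} {R : realType}.
Local Open Scope ereal_scope.
Implicit Types (mu : {measure set T -> \bar R}) (f g : T -> \bar R).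
Import HBNNSimple.

Lemma ge0_integral_mono mu f g :
  (forall x, 0 <= f x) -> (forall x, f x <= g x) ->
  \int[mu]_x f x <= \int[mu]_x g x.
Proof.
move=> f0 fg; have g0 x : 0 <= g x by exact: le_trans (fg x).
rewrite !ge0_integralTE//; apply: ereal_sup_le => r [/= h hf <-].
by exists h => // x; apply: le_trans (fg x).
Qed.

Lemma ge0_integral_le_cst (P : probability T R) f (c : R) :
  (forall x, 0 <= f x) -> (forall x, f x <= c%:E) -> \int[P]_x f x <= c%:E.
Proof.
move=> f0 fc; apply: (le_trans (ge0_integral_mono P f0 fc)).
by rewrite integral_cst//= [X in _ * X]probability_setT mule1.
Qed.

Lemma markov_set mu (A : set T) f (c : R) : (0 < c)%R -> measurable A ->
  (forall x, 0 <= f x) -> (forall x, A x -> c%:E <= f x) ->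
  c%:E * mu A <= \int[mu]_x f x.
Proof.
move=> c0 mA f0 Af; rewrite -[A in mu A]setIT -integral_indic// -ge0_integralZl//=.
- apply: ge0_integral_mono => x; first by rewrite mule_ge0// lee_fin// ltW.
  rewrite indicE; case: (boolP (x \in A)) => [/set_mem/Af|_]; rewrite ?mule1//.
  by rewrite mule0.
- exact/measurable_EFinP/measurable_indic.
- by rewrite lee_fin ltW.
Qed.
End nonnegative_integrals.

Section independence.
Context {d} {T : measurableType d} {R : realType} (P : probability T R).
Implicit Types F G : set_system T.
Local Open Scope ereal_scope.

Definition sub_algebra F := sigma_algebra [set: T] F /\ F `<=` @measurable d T.

(** Encoded through the measurable type [g_sigma_algebraType F], so that the closure lemmas about
    [measurable_fun] apply to measurability with respect to a sub-sigma-algebra. *)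
Definition meas_wrt F d' (T' : measurableType d') (f : T -> T') :=
  measurable_fun [set: g_sigma_algebraType F] (f : g_sigma_algebraType F -> T').

Definition indep_of F d' (T' : measurableType d') (V : T -> T') :=
  forall A B, F A -> measurable B -> P (A `&` V @^-1` B) = P A * P (V @^-1` B).

Lemma meas_wrtP F d' (T' : measurableType d') (f : T -> T') :
  sub_algebra F -> meas_wrt F f <-> (forall B, measurable B -> F (f @^-1` B)).
Proof.
move=> [sF FT]; have FE := sigma_algebra_id sF; split=> [mf B mB|mf _ B mB].
  by have := mf measurableT B mB; rewrite setTI /measurable/= FE.
by rewrite setTI /measurable/= FE; exact: mf.
Qed.

Lemma sub_meas_wrt F d' (T' : measurableType d') (f : T -> T') :
  sub_algebra F -> meas_wrt F f -> measurable_fun [set: T] f.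
Proof. by move=> sF /(meas_wrtP _ sF) mf _ B mB; rewrite setTI; apply/sF.2/mf. Qed.

Lemma meas_wrt_sub F G d' (T' : measurableType d') (f : T -> T') :
  sub_algebra F -> sub_algebra G -> F `<=` G ->
  meas_wrt F f -> meas_wrt G f.
Proof.
by move=> sF sG FG /(meas_wrtP _ sF) mf; apply/meas_wrtP => // B /mf /FG.
Qed.

Lemma indep_of_comp F d' (T' : measurableType d') d2 (T2 : measurableType d2)
    (V : T -> T') (f : T' -> T2) :
  meas_fun f -> indep_of F V -> indep_of F (f \o V).
Proof.
move=> mf iV A B FA mB; rewrite comp_preimage; apply: iV => //.
by rewrite -[_ @^-1` _]setTI; exact: mf.
Qed.

(** The joint law of the identity map into [(T, F)] and of [V] is a product measure, by uniqueness
    on rectangles; Tonelli's theorem concludes. This freezing lemma takes the place of conditional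
    expectations given [F]. *)
Lemma decoupling F d' (T' : measurableType d') (V : T -> T')
    (h : g_sigma_algebraType F * T' -> \bar R) :
  sub_algebra F -> meas_fun V -> indep_of F V ->
  meas_fun h -> (forall z, 0 <= h z) ->
  \int[P]_w h (w, V w) = \int[P]_w \int[P]_w' h (w, V w').
Proof.
move=> sF mV iV mh h0.
have mX : measurable_fun [set: T] (id : T -> g_sigma_algebraType F).
  by move=> _ B; rewrite setTI /measurable/= (sigma_algebra_id sF.1) => /sF.2.
pose X : {mfun T >-> g_sigma_algebraType F} := mfun_Sub (mem_set mX).
pose V' : {mfun T >-> T'} := mfun_Sub (mem_set mV).
have mXV : measurable_fun [set: T] (fun w => (X w, V' w)).
  exact: measurable_fun_pair.
pose XV : {mfun T >-> (g_sigma_algebraType F * T')%type} := mfun_Sub (mem_set mXV).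
transitivity (\int[distribution P XV]_z h z).
  by rewrite ge0_integral_distribution.
transitivity (\int[distribution P X \x distribution P V']_z h z).
  apply: eq_measure_integral => A mA _; apply/esym/product_measure_unique => //.
  move=> B C mB mC; rewrite /distribution /pushforward /=.
  have FB : F B by move: mB; rewrite /measurable/= (sigma_algebra_id sF.1).
  exact: iV FB mC.
rewrite fubini_tonelli1// ge0_integral_distribution//; last 2 first.
- exact: measurable_fun_fubini_tonelli_F.
- by move=> y; exact: integral_ge0.
apply: eq_integral => w _ /=; rewrite /fubini_F ge0_integral_distribution//.
exact: measurableT_comp mh (measurable_pair1 _).
Qed.

(** Both sides are finite measures in [A], a restriction and a multiple of [P], which agree on the
    pi-system [G]. *)
Lemma product_rule_generated G (C : set T) :
  G `<=` measurable -> setI_closed G -> measurable C ->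
  (forall A, G A -> P (A `&` C) = P A * P C) ->
  forall A, <<s G >> A -> P (A `&` C) = P A * P C.
Proof.
move=> Gm GI mC GC.
(* The whole space is added as the exhausting sequence that uniqueness of measures asks for. *)
pose G' := G `|` [set setT].
have G'm : G' `<=` measurable by move=> A [/Gm//|->].
have G'I : setI_closed G'.
  move=> A B [GA|->] [GB|->]; rewrite ?setIT ?setTI; first by left; exact: GI.
  - by left.
  - by left.
  - by right.
have PC : P C \is a fin_num by exact: fin_num_measure.
pose r := NngNum (fine_ge0 (measure_ge0 P C)).
have PCr : P C = (r%:num)%:E by rewrite /= fineK.
move=> A sA; rewrite PCr muleC.
apply: (@g_sigma_algebra_measure_unique _ R T G' G'm (fun=> setT) _ _
  (mrestr P mC) (mscale r P)).
- by move=> i; right.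
- by rewrite bigcup_const.
- exact: G'I.
- move=> B [GB|->]; rewrite -[LHS]/(P (_ `&` C)) -[RHS]/((r%:num)%:E * P _).
    by rewrite GC// PCr muleC.
  by rewrite setTI probability_setT mule1.
- by move=> n; rewrite -[X in X < _]/(P (_ `&` C)) setTI PCr ltry.
- by apply: sub_sigma_algebra2 sA => B GB; left.
Qed.

End independence.

(** * One step of Ito's formula *)

Section ito_step.
Context {d} {T : measurableType d} {R : realType} (P : probability T R).

(* [y ^+ 2 * min 1 |y|] is at most [y ^+ 2] and [|y| ^+ 3]: it bounds the
   second-order Taylor remainder both for small and for large increments. *)
Definition cubic_rem (y : R) : R := y ^+ 2 * Num.min 1 `|y|.

Definition taylor2 (f f1 f2 : R -> R) (C : R) := forall x y,
  `|f (x + y) - f x - f1 x * y - f2 x / 2 * y ^+ 2| <= C * cubic_rem y.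

Lemma cubic_rem_ge0 y : 0 <= cubic_rem y.
Proof. by rewrite /cubic_rem mulr_ge0 ?sqr_ge0// le_min ler01 normr_ge0. Qed.

Lemma measurable_cubic_rem : meas_fun cubic_rem.
Proof.
apply: measurable_funM; first exact: measurable_funX.
by apply: measurable_minr => //; exact: measurableT_comp.
Qed.

Definition centered (V : T -> R) (s : R) :=
  [/\ P.-integrable setT (EFin \o V), (\int[P]_w (V w)%:E = 0)%E &
      (\int[P]_w (V w ^+ 2)%:E = s%:E)%E].

Lemma centered_measurable V s : centered V s -> meas_fun V.
Proof. by case=> /integrableP[/measurable_EFinP]. Qed.

Lemma integral_quadratic_le V s (f e : T -> R) (a b c : R) :
  centered V s -> meas_fun e ->
  (forall w, 0 <= f w) -> (forall w, 0 <= e w) ->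
  (forall w, f w <= a + b * V w + c * V w ^+ 2 + e w) ->
  (\int[P]_w (f w)%:E <= (a + c * s)%:E + \int[P]_w (e w)%:E)%E.
Proof.
move=> cV me f0 e0 fle; have mV := centered_measurable cV.
have [iV V0 V2] := cV.
(* If [e] has infinite integral the bound is trivial; otherwise every term is integrable and
   linearity applies. *)
have [->|] := eqVneq (\int[P]_w (e w)%:E)%E +oo%E; first by rewrite addey// leey.
rewrite -ltey => efin.
have ie : P.-integrable setT (fun w => (e w)%:E).
  apply/integrableP; split; first exact/measurable_EFinP.
  by under eq_integral do rewrite /= ger0_norm//.
have iV2 : P.-integrable setT (fun w => (V w ^+ 2)%:E).
  apply/integrableP; split.
    by apply/measurable_EFinP; exact: measurable_funX.
  under eq_integral do rewrite /= ger0_norm ?sqr_ge0//.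
  by rewrite V2 ltry.
have ia : P.-integrable setT (fun=> a%:E).
  exact: finite_measure_integrable_cst.
have ibV : P.-integrable setT (fun w => (b * V w)%:E).
  by under eq_fun do rewrite EFinM; exact: integrableZl.
have icV : P.-integrable setT (fun w => (c * V w ^+ 2)%:E).
  by under eq_fun do rewrite EFinM; exact: integrableZl.
have iab : P.-integrable setT (fun w => (a + b * V w)%:E).
  by under eq_fun do rewrite EFinD; exact: integrableD.
have iabc : P.-integrable setT (fun w => (a + b * V w + c * V w ^+ 2)%:E).
  by under eq_fun do rewrite EFinD; exact: integrableD.
apply: (@le_trans _ _ (\int[P]_w (a + b * V w + c * V w ^+ 2 + e w)%:E)%E).
  by apply: ge0_integral_mono => w; rewrite lee_fin// fle.
under eq_integral do rewrite EFinD.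
rewrite integralD//.
under eq_integral do rewrite EFinD.
rewrite integralD//.
under eq_integral do rewrite EFinD.
rewrite integralD//.
rewrite integral_cst// [X in (_ * X)%E]probability_setT mule1.
under eq_integral do rewrite EFinM.
rewrite integralZl// V0 mule0 adde0.
under [X in (_ + X + _)%E]eq_integral do rewrite EFinM.
by rewrite integralZl// V2.
Qed.

Lemma ito_step_fixed V s (f f1 f2 : R -> R) C (x k : R) :
  centered V s -> taylor2 f f1 f2 C -> 0 <= C -> (forall y, 0 <= f y) ->
  (\int[P]_w (f (x + k * V w))%:E <=
   (f x + k ^+ 2 * s * (f2 x / 2))%:E + C%:E * \int[P]_w (cubic_rem (k * V w))%:E)%E.
Proof.
move=> cV Tf C0 f0; have mV := centered_measurable cV.
have mc : meas_fun (fun w => cubic_rem (k * V w)).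
  apply: measurableT_comp; first exact: measurable_cubic_rem.
  exact: measurable_funM.
rewrite -ge0_integralZl//=; last 2 first.
- exact/measurable_EFinP.
- by move=> w _; rewrite lee_fin cubic_rem_ge0.
rewrite (_ : k ^+ 2 * s * (f2 x / 2) = (k ^+ 2 * (f2 x / 2)) * s); last by ring.
apply: (@integral_quadratic_le V s _ (fun w => C * cubic_rem (k * V w)) (f x) (f1 x * k)) => //.
- exact: measurable_funM.
- by move=> w; rewrite mulr_ge0// cubic_rem_ge0.
- move=> w; have := Tf x (k * V w); rewrite ler_norml => /andP[_].
  rewrite exprMn; lra.
Qed.

(** Decoupling freezes [D] and [K]; the first-order term then vanishes because [V] is centered. The
    remainder bound [q] is a function of the coefficient since [K] is random. *)
Lemma ito_step F V s (f f1 f2 : R -> R) C (q : R -> R) (D K : T -> R) :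
  sub_algebra F -> indep_of P F V ->
  centered V s -> taylor2 f f1 f2 C -> 0 <= C -> (forall y, 0 <= f y) ->
  meas_fun f ->
  meas_wrt F D -> meas_wrt F K ->
  (forall k, \int[P]_w (cubic_rem (k * V w))%:E <= (q k)%:E)%E ->
  (\int[P]_w (f (D w + K w * V w))%:E <=
   \int[P]_w (f (D w) + K w ^+ 2 * s * (f2 (D w) / 2) + C * q (K w))%:E)%E.
Proof.
move=> sF iV cV Tf C0 f0 mf mD mK hq; have mV := centered_measurable cV.
pose h (z : g_sigma_algebraType F * R) := (f (D z.1 + K z.1 * z.2))%:E.
rewrite (_ : (\int[P]_w _)%E = (\int[P]_w h (w, V w))%E) // (decoupling sF mV iV); last 2 first.
- apply/measurable_EFinP; apply: measurableT_comp => //.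
  apply: measurable_funD; first exact: (measurableT_comp mD).
  by apply: measurable_funM => //; exact: (measurableT_comp mK).
- by move=> z; rewrite /h lee_fin.
apply: ge0_integral_mono => w; first by apply: integral_ge0 => w' _; rewrite /h lee_fin.
apply: le_trans (ito_step_fixed (D w) (K w) cV Tf C0 f0) _.
rewrite [X in (_ <= X)%E]EFinD. 

rewrite leeD2lE// EFinM; apply: lee_pmul => //.
by apply: integral_ge0 => w' _; rewrite lee_fin cubic_rem_ge0.
Qed.
End ito_step.

Section real_integrals.
Context {d} {T : measurableType d} {R : realType} (mu : {measure set T -> \bar R}).
Implicit Types f g : T -> R.

Lemma ge0_integral_scale f (c : R) : 0 <= c -> meas_fun f ->
  (forall w, 0 <= f w) ->
  (\int[mu]_w (c * f w)%:E = c%:E * \int[mu]_w (f w)%:E)%E.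
Proof.
move=> c0 mf f0; under eq_integral do rewrite EFinM.
apply: ge0_integralZl => //; first exact/measurable_EFinP.
by move=> w _; rewrite lee_fin.
Qed.

Lemma ge0_integral_add f g : meas_fun f -> meas_fun g ->
  (forall w, 0 <= f w) -> (forall w, 0 <= g w) ->
  (\int[mu]_w (f w + g w)%:E = \int[mu]_w (f w)%:E + \int[mu]_w (g w)%:E)%E.
Proof.
move=> mf mg f0 g0; under eq_integral do rewrite EFinD.
by apply: ge0_integralD => //; first [exact/measurable_EFinP|move=> w _; rewrite lee_fin].
Qed.

Lemma ge0_integral_sum_ord n (f : nat -> T -> R) :
  (forall i, meas_fun (f i)) -> (forall i w, 0 <= f i w) ->
  (\int[mu]_w (\sum_(i < n) f i w)%:E = \sum_(i < n) \int[mu]_w (f i w)%:E)%E.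
Proof.
move=> mf f0; elim: n => [|n IH].
  by under eq_integral do rewrite big_ord0; rewrite big_ord0 integral0.
under eq_integral do rewrite big_ord_recr/=.
rewrite big_ord_recr/= -IH; apply: ge0_integral_add => //.
- by apply: measurable_sum => i; exact: mf.
- by move=> w; apply: sumr_ge0.
Qed.
End real_integrals.

(** * Properties that hold outside a small event *)

Section most.
Context {d} {T : measurableType d} {R : realType} (P : probability T R).
Implicit Types Q : T -> Prop.

(* [Q] holds outside an event of probability at most [e]; [Q] itself need not
   be measurable. *)
Definition most (e : R) Q := exists B : set T,
  [/\ measurable B, (P B <= e%:E)%E & forall w, ~ B w -> Q w].

Lemma most_imp e Q Q' : (forall w, Q w -> Q' w) -> most e Q -> most e Q'.
Proof. by move=> QQ [B [mB PB BQ]]; exists B; split=> // w /BQ /QQ. Qed.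

Lemma most_le e e' Q : e <= e' -> most e Q -> most e' Q.
Proof.
by move=> ee [B [mB PB BQ]]; exists B; split=> //; apply: le_trans PB _; rewrite lee_fin.
Qed.

Lemma most_true e Q : 0 <= e -> (forall w, Q w) -> most e Q.
Proof. by move=> e0 h; exists set0; split=> //; rewrite measure0 lee_fin. Qed.

Lemma most_and e e' Q Q' : most e Q -> most e' Q' -> most (e + e') (fun w => Q w /\ Q' w).
Proof.
move=> [B [mB PB BQ]] [B' [mB' PB' BQ']]; exists (B `|` B'); split.
- exact: measurableU.
- rewrite EFinD; apply: le_trans (leeD PB PB').
  exact: (@measureU2 _ _ _ P).
- by move=> w /not_orP[? ?]; split; [exact: BQ|exact: BQ'].
Qed.

Lemma most_all n (e : nat -> R) (Q : nat -> T -> Prop) :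
  (forall i, (i < n)%N -> most (e i) (Q i)) ->
  most (\sum_(i < n) e i) (fun w => forall i, (i < n)%N -> Q i w).
Proof.
elim: n => [_|n IH h]; first by rewrite big_ord0; exact: most_true.
rewrite big_ord_recr/=; apply: most_imp (most_and (IH _) (h n (ltnSn n))) => [w|i ?].
  by move=> [h1 h2] i; rewrite ltnS leq_eqVlt => /predU1P[->//|/h1].
by apply: h; exact: ltnW.
Qed.

Lemma most_ae Q : {ae P, forall w, Q w} -> most 0 Q.
Proof.
move=> [B [mB PB BQ]]; exists B; split=> //; first by rewrite PB.
by move=> w; apply: contra_notP => /BQ.
Qed.

Lemma most_measurable e (A : set T) : measurable A -> (P A <= e%:E)%E -> most e (~` A).
Proof. by move=> mA PA; exists A; split. Qed.

Lemma most_markov (f : T -> R) (c e : R) : 0 < c -> meas_fun f ->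
  (forall w, 0 <= f w) -> (\int[P]_w (f w)%:E <= (c * e)%:E)%E ->
  most e (fun w => f w < c).
Proof.
move=> c0 mf f0 fe; pose B := [set w | c <= f w].
have mB : measurable B.
  by rewrite -[B]setTI; exact: measurable_fun_le.
exists B; split=> // [|w /negP]; last by rewrite -ltNge.
have : (c%:E * P B <= (c * e)%:E)%E.
  by apply: le_trans fe; apply: markov_set => // w; rewrite lee_fin.
by rewrite EFinM lee_pmul2l// lte_fin.
Qed.

(** The bad event is the increasing union over [n] of the intersections of the [B k] with [k >= n],
    each of probability at most [e]. A limit in [k] can thus be taken along a random subsequence
    without enlarging [e]. *)
Lemma most_io e (Q : nat -> T -> Prop) : (forall k, most e (Q k)) ->
  most e (fun w => forall n, exists2 k, (n <= k)%N & Q k w).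
Proof.
move=> mQ; have /choice[B hB] := mQ.
pose C n := \bigcap_(k in [set k | (n <= k)%N]) B k.
have mC n : measurable (C n).
  by apply: bigcap_measurable => [|k _]; [exists n => /=|case: (hB k)].
exists (\bigcup_n C n); split.
- exact: bigcupT_measurable.
- have ndC : nondecreasing_seq C.
    by move=> m n mn; apply/subsetPset => w Cw k /= nk; apply: Cw => /=; exact: leq_trans nk.
  have cv := @nondecreasing_cvg_mu _ _ _ P C mC (bigcupT_measurable C mC) ndC.
  rewrite -(cvg_lim _ cv)//; apply: lime_le.
    by apply/cvg_ex; exists (P (\bigcup_n C n)).
  apply: nearW => n; apply: le_trans (_ : P (B n) <= _)%E; last by case: (hB n).
  apply: le_measure; rewrite ?inE//; first by case: (hB n).
  by move=> w; apply => /=.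
- move=> w nC n; apply: contrapT => h; apply: nC; exists n => // k /= nk.
  by apply: contrapT => nB; apply: h; exists k => //; case: (hB k) => _ _; apply.
Qed.

Lemma ae_most Q : (forall e, 0 < e -> most e Q) -> {ae P, forall w, Q w}.
Proof.
move=> mQ; have /choice[B hB] : forall k : nat, exists B : set T,
    [/\ measurable B, (P B <= (k.+1%:R^-1)%:E)%E & forall w, ~ B w -> Q w].
  by move=> k; apply: mQ; rewrite invr_gt0.
exists (\bigcap_k B k); split.
- by apply: bigcap_measurable => // k _; case: (hB k).
- have mBB : measurable (\bigcap_k B k) by apply: bigcap_measurable => // k _; case: (hB k).
  apply/eqP; rewrite eq_le measure_ge0 andbT; apply/lee_addgt0Pr => x x0; rewrite add0e.
  have [k] := ltr_add_invr x0; rewrite add0r => kx.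
  apply: le_trans (_ : P (B k) <= _)%E.
    by apply: le_measure; rewrite ?inE//; [case: (hB k)|move=> w; exact].
  by case: (hB k) => _ h _; apply: le_trans h _; rewrite lee_fin ltW.
- by move=> w nQ k _; apply: contrapT => nB; apply: nQ; case: (hB k) => _ _; apply.
Qed.

End most.

Lemma meas_countable_index d (T : measurableType d) d' (T' : measurableType d')
    (N : T -> nat) (g : nat -> T -> T') :
  meas_fun N -> (forall k, meas_fun (g k)) ->
  meas_fun (fun w => g (N w) w).
Proof.
move=> mN mg _ B mB; rewrite setTI.
rewrite (_ : _ @^-1` B = \bigcup_k (N @^-1` [set k] `&` g k @^-1` B)).
  apply: bigcupT_measurable => k; apply: measurableI; rewrite -[_ @^-1` _]setTI.
    exact: mN.
  exact: mg.
by apply/seteqP; split=> [w Bw|w [k _ []]/= <-//]; exists (N w).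
Qed.

(** * Test functions *)

Section taylor.
Context {R : realType}.
Implicit Types f g : R -> R.

Lemma is_derive_continuous f (df : R -> R) :
  (forall x : R, is_derive x 1 f (df x)) -> continuous f.
Proof. by move=> fd x; apply: differentiable_continuous; apply/derivable1_diffP; case: (fd x). Qed.

Lemma is_derive_comp_eq f g (x a b c : R) : is_derive x 1 g b ->
  is_derive (g x) 1 f a -> c = a * b -> is_derive x 1 (fun x => f (g x)) c.
Proof. by move=> dg df ->; exact: is_derive1_comp. Qed.

Lemma mean_value f (df : R -> R) : (forall x : R, is_derive x 1 f (df x)) ->
  forall x y, exists2 c, `|c - x| <= `|y - x| & f y - f x = df c * (y - x).
Proof.
move=> fd x y; have fc := is_derive_continuous fd.
have [xy|yx|->] := ltgtP x y.
- have [c /itvP cxy e] := MVT xy (fun z _ => fd z) (continuous_subspaceT fc).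
  by exists c => //; rewrite !ger0_norm ?subr_ge0 ?cxy// lerD2r cxy.
- have [c /itvP cxy e] := MVT yx (fun z _ => fd z) (continuous_subspaceT fc).
  exists c; last by rewrite -opprB e -mulrN opprB.
  by rewrite !ler0_norm ?subr_le0 ?cxy// lerN2 lerD2r cxy.
- by exists y; rewrite ?subrr ?mulr0.
Qed.

Lemma lipschitz_derive f (df : R -> R) L : (forall x : R, is_derive x 1 f (df x)) ->
  (forall x, `|df x| <= L) -> forall x y, `|f x - f y| <= L * `|x - y|.
Proof.
move=> fd dfL x y; have [c _ ->] := mean_value fd y x.
by rewrite normrM ler_wpM2r.
Qed.

(** For [|y| <= 1] the mean value theorem is applied to the remainder and then to [f1], and the
    Lipschitz constant of [f2] gives a cubic bound; for larger [y] the bound [M] of [f2] gives a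
    quadratic one. *)
Lemma taylor2_of_derive f f1 f2 (L M : R) :
  (forall x : R, is_derive x 1 f (f1 x)) -> (forall x : R, is_derive x 1 f1 (f2 x)) ->
  (forall x y, `|f2 x - f2 y| <= L * `|x - y|) -> (forall x, `|f2 x| <= M) ->
  taylor2 f f1 f2 (L + 2 * M).
Proof.
move=> d1 d2 f2L f2M x y.
have M0 : 0 <= M by exact: le_trans (f2M 0).
have L0 : 0 <= L by have := f2L 1 0; rewrite subr0 normr1 mulr1; apply: le_trans.
have y2 : y ^+ 2 = `|y| * `|y| by rewrite -expr2 real_normK ?num_real.
have [y1|y1] := leP `|y| 1; last first.
  have [c cy e] := mean_value d1 x (x + y).
  have [c' _ e'] := mean_value d2 x c.
  have -> : f (x + y) - f x - f1 x * y - f2 x / 2 * y ^+ 2 =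
      f2 c' * (c - x) * y - f2 x / 2 * y ^+ 2.
    by rewrite e (_ : x + y - x = y) -?e'; ring.
  rewrite /cubic_rem (min_l (ltW y1)) mulr1.
  apply: le_trans (ler_normB _ _) _; rewrite y2 !normrM !normr_id.
  have {}cy : `|c - x| <= `|y| by move: cy; rewrite (_ : x + y - x = y)//; ring.
  have -> : (L + 2 * M) * (`|y| * `|y|) =
      L * (`|y| * `|y|) + (M * `|y| * `|y| + M * 1 * (`|y| * `|y|)) by ring.
  apply: ler_wpDl; first by rewrite !mulr_ge0.
  apply: lerD; first by rewrite ler_wpM2r// ler_pM.
  rewrite ler_wpM2r ?mulr_ge0// ler_pM// ger0_norm// invf_le1 ?ler1n// ltr0n.
pose g t := f (x + t) - f x - f1 x * t - f2 x / 2 * t ^+ 2.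
pose g1 t := f1 (x + t) - f1 x - f2 x * t.
have shift (h h1 : R -> R) (dh : forall z : R, is_derive z 1 h (h1 z)) (t : R) :
    is_derive t (1 : R) (fun t : R => h (x + t)) (h1 (x + t)).
  have := @is_deriveD R R^o R^o (cst x) id t 1 0 1 _ _; rewrite add0r => dxt.
  by have := @is_derive1_comp R h (fun t => x + t) t _ 1 (dh _) (dxt _ _); rewrite mulr1; apply.
have dg (t : R) : is_derive t (1 : R) g (g1 t).
  have := shift _ _ d1 t => ?.
  apply: is_derive_eq; rewrite /g1 /GRing.scale/=.
  by field.
have [c] := mean_value dg 0 y.
rewrite !subr0 => cy; rewrite {2}/g addr0 subrr mulr0 expr0n/= mulr0 !subr0 -/(g y) => ->.
have [c'] := mean_value (shift _ _ d2) 0 c.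
rewrite !subr0 addr0 /g1 => cc' ->; rewrite -mulrBl /cubic_rem (min_r y1) !normrM.
have -> : (L + 2 * M) * (y ^+ 2 * `|y|) = L * `|y| * `|y| * `|y| + 2 * M * (y ^+ 2 * `|y|).
  by rewrite y2; ring.
apply: ler_wpDr; first by rewrite y2 !mulr_ge0.
rewrite ler_wpM2r// ler_pM//.
apply: le_trans (f2L _ _) _; rewrite addrAC subrr add0r ler_wpM2l//.
exact: le_trans cy.
Qed.
End taylor.

(** * The function of Yamada and Watanabe *)

Section convex_functions.
Context {R : realType}.
Implicit Types x y : R.

Let s y : R := Num.sqrt (1 + y ^+ 2).
Let asinh y : R := ln (y + s y).
(** The primitive of [asinh] that vanishes at 0. Its second derivative [1 / sqrt (1 + y ^ 2)] is at
    most [1 / |y|], yet its slope grows without bound, like a logarithm. *)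
Let h y : R := y * asinh y - s y + 1.

Let s_gt0 y : 0 < s y.
Proof. by rewrite sqrtr_gt0 ltr_pwDl// sqr_ge0. Qed.

Let s_sqr y : s y ^+ 2 = 1 + y ^+ 2.
Proof. by rewrite sqr_sqrtr// addr_ge0// sqr_ge0. Qed.

Let s_ge y : `|y| <= s y.
Proof. by rewrite -[`|y|]sqrtr_sqr ler_wsqrtr// lerDr. Qed.

Let s_ge1 y : 1 <= s y.
Proof. by rewrite -[1]sqrtr1 ler_wsqrtr// lerDl sqr_ge0. Qed.

Let ys_gt0 y : 0 < y + s y.
Proof.
have := s_gt0 y; have := s_sqr y; have := s_ge y; rewrite ler_norml => /andP[+ _].
by case: (ltgtP y 0) => [y0|y0|->]; nra.
Qed.

Let is_derive_s y : is_derive y (1 : R) s (y / s y).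
Proof.
have p : 0 < 1 + y ^+ 2 by rewrite ltr_pwDl// sqr_ge0.
have d1 : is_derive y (1 : R) (fun y : R => 1 + y ^+ 2) (2 * y).
  by apply: is_derive_eq; rewrite /GRing.scale/=; ring.
apply: (is_derive_comp_eq d1 (is_derive1_sqrt p)).
by rewrite -/(s y); field; rewrite gt_eqF.
Qed.

Let is_derive_asinh y : is_derive y (1 : R) asinh (s y)^-1.
Proof.
have := is_derive_s y => ?.
have d1 : is_derive y (1 : R) (fun y : R => y + s y) (1 + y / s y).
  by apply: is_derive_eq.
apply: (is_derive_comp_eq d1 (is_derive1_ln (ys_gt0 y))) => /=.
by field; rewrite !gt_eqF.
Qed.

Let is_derive_h y : is_derive y (1 : R) h (asinh y).
Proof.
have := is_derive_s y => ?; have := is_derive_asinh y => ?.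
by apply: is_derive_eq; rewrite /GRing.scale/=; field; rewrite gt_eqF.
Qed.

Let is_derive_inv_s y : is_derive y (1 : R) (fun y => (s y)^-1) (- y / s y ^+ 3).
Proof.
have := is_derive_s y => ?; have sy0 : s y != 0 by rewrite gt_eqF.
have := @is_deriveV R s y _ _ sy0 (is_derive_s y) => ?.
by apply: is_derive_eq; rewrite /GRing.scale/=; field.
Qed.

Let inv_s_lipschitz x y : `|(s x)^-1 - (s y)^-1| <= 1 * `|x - y|.
Proof.
apply: lipschitz_derive is_derive_inv_s _ x y => z.
rewrite normrM normrN normfV (ger0_norm (exprn_ge0 3 (ltW (s_gt0 z)))).
rewrite ler_pdivrMr ?exprn_gt0// mul1r; apply: le_trans (s_ge z) _.
by rewrite exprS ler_peMr ?exprn_ege1// ltW.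
Qed.

Let inv_s_le1 y : (s y)^-1 <= 1.
Proof. by rewrite invf_le1. Qed.

Let asinhN y : asinh (- y) = - asinh y.
Proof.
have sN : s (- y) = s y by rewrite /s sqrrN.
rewrite /asinh sN -lnV ?posrE//; congr ln.
apply: (mulfI (lt0r_neq0 (ys_gt0 y))); rewrite divff ?lt0r_neq0//.
by have := s_sqr y; nra.
Qed.

Let hN y : h (- y) = h y.
Proof. by rewrite /h asinhN /s sqrrN mulrNN. Qed.

Let h0 : h 0 = 0.
Proof. by rewrite /h mul0r /s expr0n addr0 sqrtr1; ring. Qed.

Let asinh_ge_ln y : 0 < y -> ln y <= asinh y.
Proof. by move=> y0; rewrite ler_ln ?posrE// lerDl ltW. Qed.

Let asinh_ge0 y : 0 <= y -> 0 <= asinh y.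
Proof. by move=> y0; apply: ln_ge0; rewrite ler_wpDl. Qed.

Let h_cont : continuous h.
Proof. exact: is_derive_continuous is_derive_h. Qed.

Let h_ge (y0 y l : R) : 0 <= y0 -> y0 <= y ->
  (forall c, y0 <= c -> l <= asinh c) -> l * (y - y0) <= h y - h y0.
Proof.
move=> y00 y0y lc.
have [c /itvP cy ->] := MVT_segment y0y (fun z _ => is_derive_h z) (continuous_subspaceT h_cont).
by rewrite ler_wpM2r ?subr_ge0// lc// cy.
Qed.

Let h_ge0 y : 0 <= h y.
Proof.
wlog y0 : y / 0 <= y.
  by move=> H; case: (leP 0 y) => [/H//|y0]; rewrite -hN H// oppr_ge0 ltW.
by have := h_ge (lexx 0) y0 asinh_ge0; rewrite h0 mul0r subr0.
Qed.

(* Yamada and Watanabe's function; its second derivative is [k / sqrt (a^2 + x^2)]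
   with [a] exponentially small in [1 / k]. *)
Lemma yamada_watanabe_function (k r : R) : 0 < k -> 0 < r ->
  exists f f1 f2 : R -> R, exists2 M : R, 0 < M &
  [/\ taylor2 f f1 f2 (3 * M), meas_fun f /\ meas_fun f2,
      f 0 = 0 /\ (forall y, 0 <= f y),
      (forall y, `|y| - r <= f y) &
      [/\ forall y, 0 <= f2 y, forall y, f2 y * `|y| <= k, forall y, f2 y <= M &
         forall x y, `|f2 x - f2 y| <= M * `|x - y|]].
Proof.
(* Beyond [y0] the slope of [h] is at least [ln y0 = 1 / k], so [k * a * h (x / a)] has slope at
   least 1 once [|x| >= a * y0 = r]. *)
move=> k0 r0; pose y0 := expR k^-1; pose a := r / y0.
have y00 : 0 < y0 by exact: expR_gt0.
have a0 : 0 < a by rewrite divr_gt0.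
have an0 : a != 0 by rewrite gt_eqF.
pose M := k / a + k / a ^+ 2.
have ka0 : 0 < k / a by rewrite divr_gt0.
have kaa0 : 0 < k / a ^+ 2 by rewrite divr_gt0// exprn_gt0.
have M0 : 0 < M by rewrite addr_gt0.
pose f x := k * a * h (x / a); pose f1 x := k * asinh (x / a).
pose f2 x := k / a * (s (x / a))^-1.
have dxa (x : R) : is_derive x (1 : R) (fun x : R => x / a) a^-1.
  by apply: is_derive_eq; rewrite /GRing.scale/=; ring.
have df (x : R) : is_derive x (1 : R) f (f1 x).
  have := is_derive_comp_eq (dxa x) (is_derive_h (x / a)) erefl => ?.
  by apply: is_derive_eq; rewrite /f1 /GRing.scale/=; field.
have df1 (x : R) : is_derive x (1 : R) f1 (f2 x).
  have := is_derive_comp_eq (dxa x) (is_derive_asinh (x / a)) erefl => ?.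
  by apply: is_derive_eq; rewrite /f2 /GRing.scale/=; field; rewrite an0 gt_eqF.
have f2M y : f2 y <= M.
  by rewrite (le_trans (y := k / a))// ?lerDl ?(ltW kaa0)// ler_piMr// ltW.
have f20 y : 0 <= f2 y by rewrite mulr_ge0 ?(ltW ka0)// invr_ge0 ltW.
have f2L x y : `|f2 x - f2 y| <= M * `|x - y|.
  rewrite -mulrBr normrM (gtr0_norm ka0).
  apply: le_trans (ler_wpM2l (ltW ka0) (inv_s_lipschitz _ _)) _.
  rewrite mul1r -mulrBl normrM normfV (gtr0_norm a0) mulrCA mulrA mulrC.
  rewrite [leLHS](_ : _ = k / a ^+ 2 * `|x - y|); last by field.
  by rewrite ler_wpM2r// lerDr ltW.
exists f, f1, f2, M => //; split.
- rewrite (_ : 3 * M = M + 2 * M); last by ring.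
  by apply: (taylor2_of_derive df df1 f2L) => y; rewrite ger0_norm.
- split.
    apply: continuous_measurable_fun; exact: is_derive_continuous df.
  apply: continuous_measurable_fun.
  apply: (@is_derive_continuous _ _ (fun x => k / a * (- (x / a) / s (x / a) ^+ 3 * a^-1))) => x.
  have := is_derive_comp_eq (dxa x) (is_derive_inv_s (x / a)) erefl => ?.
  exact: is_derive_eq.
- split; first by rewrite /f mul0r h0 mulr0.
  by move=> y; rewrite /f mulr_ge0 ?h_ge0// ltW// mulr_gt0.
- move=> y; rewrite /f; have hE : h (y / a) = h (`|y| / a).
    by case: (ger0P y) => // _; rewrite mulNr hN.
  have [ya|ya] := leP y0 (`|y| / a); last first.
    apply: (@le_trans _ _ 0); last by rewrite mulr_ge0 ?h_ge0// ltW// mulr_gt0.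
    rewrite subr_le0; apply: ltW; move: ya; rewrite ltr_pdivrMr// /a.
    by rewrite mulrC divfK// gt_eqF.
  have kl c : y0 <= c -> k^-1 <= asinh c.
    move=> yc; have c0 : 0 < c by exact: lt_le_trans yc.
    by apply: le_trans (asinh_ge_ln c0); rewrite -[k^-1]expRK ler_ln ?posrE.
  have := h_ge (ltW y00) ya kl; have := h_ge0 y0; rewrite hE => hy0 H.
  have {}H : k^-1 * (`|y| / a - y0) <= h (`|y| / a) by lra.
  have := ler_wpM2l (ltW (mulr_gt0 k0 a0)) H.
  rewrite [X in X <= _ -> _](_ : _ = `|y| - r)//.
  rewrite /a; field.
  by rewrite !gt_eqF.
- split=> // y; have ay : `|y| <= a * s (y / a).
    apply: le_trans (_ : a * `|y / a| <= _); last by rewrite ler_wpM2l// ltW.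
    by rewrite normrM normfV (gtr0_norm a0) mulrCA divff// mulr1.
  have sy0 := s_gt0 (y / a); have as0 : 0 < a * s (y / a) by rewrite mulr_gt0.
  rewrite (_ : f2 y * `|y| = k * (`|y| / (a * s (y / a)))); last first.
    by rewrite /f2; field; rewrite an0 gt_eqF.
  by rewrite ler_piMr ?(ltW k0)// ler_pdivrMr// mul1r.
Qed.
End convex_functions.

(** * Gaussian moments *)

Section gaussian_moments.
Context {R : realType}.
Let mu := @lebesgue_measure R.

(** The Radon-Nikodym derivative of the normal law and the density [normal_pdf] have the same
    integrals over measurable sets, hence agree almost everywhere. *)
Lemma integral_normal_prob (m s : R) (f : R -> \bar R) :
  meas_fun f -> (forall x, 0 <= f x)%E ->
  (\int[normal_prob m s]_x f x = \int[mu]_x (f x * (normal_pdf m s x)%:E))%E.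
Proof.
move=> mf f0; pose nu : {finite_measure set (measurableTypeR R) -> \bar R} := normal_prob m s.
have numu : nu `<< mu := normal_prob_dominates m s.
rewrite -(Radon_Nikodym_SigmaFinite.change_of_variables numu f0 measurableT mf).
have fint := Radon_Nikodym_SigmaFinite.f_integrable numu.
have pm : meas_fun (fun x => (normal_pdf m s x)%:E).
  by apply/measurable_EFinP; exact: measurable_normal_pdf.
have /= ae : ae_eq mu setT (Radon_Nikodym_SigmaFinite.f nu mu) (fun x => (normal_pdf m s x)%:E).
  apply: integral_ae_eq => // E _ mE.
  by rewrite -Radon_Nikodym_SigmaFinite.f_integral.
apply: ae_eq_integral => //.
- apply: emeasurable_funM => //; exact: measurable_int fint.
- exact: emeasurable_funM.
- by apply: filterS ae => x /= + _; move=> ->.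
Qed.

Variables (s : R) (s0 : 0 < s).
Let p := normal_pdf 0 s.
Let pk := normal_peak s.

Let pE x : p x = pk * expR (- x ^+ 2 / (s ^+ 2 *+ 2)).
Proof. by rewrite /p normal_pdfE ?gt_eqF// /normal_fun subr0. Qed.

Let is_derive_p (x : R) : is_derive x (1 : R) p (- x / s ^+ 2 * p x).
Proof.
have -> : p = fun x => pk * expR (- x ^+ 2 / (s ^+ 2 *+ 2)) by apply/funext => y; exact: pE.
have d1 : is_derive x (1 : R) (fun x : R => - x ^+ 2 / (s ^+ 2 *+ 2)) (- x / s ^+ 2).
  by apply: is_derive_eq; rewrite /GRing.scale/= -mulr_natr; field; rewrite gt_eqF.
have := is_derive_comp_eq d1 (is_derive_expR _) erefl => ?.
by apply: is_derive_eq; rewrite /GRing.scale/=; ring.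
Qed.

Let p_cont : continuous p.
Proof. exact: is_derive_continuous is_derive_p. Qed.

Let p_ge0 x : 0 <= p x. Proof. exact: normal_pdf_ge0. Qed.

Let pN x : p (- x) = p x. Proof. by rewrite !pE sqrrN. Qed.

Let pk_le : pk <= s^-1.
Proof.
rewrite /pk /normal_peak lef_pV2 ?posrE ?sqrtr_gt0 ?mulrn_wgt0 ?mulr_gt0 ?pi_gt0 ?exprn_gt0//.
have {1}-> : s = Num.sqrt (s ^+ 2) by rewrite sqrtr_sqr gtr0_norm.
rewrite ler_wsqrtr//.
have := @pi_ge2 R; have : 0 < s ^+ 2 by rewrite exprn_gt0.
rewrite -mulr_natr => ? ?; nra.
Qed.

(** With [u = x ^ 2 / (4 * s ^ 2)] the density is [pk * exp (- 2 * u)], and [u <= exp u]. The decay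
    of order 4 makes the primitives used for the moments vanish at infinity. *)
Let p_bound x : 0 < x -> p x <= pk * ((4 * s ^+ 2) ^+ 2 / x ^+ 4).
Proof.
move=> x0; rewrite pE ler_wpM2l ?normal_peak_ge0//.
set u := x ^+ 2 / (4 * s ^+ 2).
have u0 : 0 < u by rewrite divr_gt0 ?mulr_gt0 ?exprn_gt0.
have -> : - x ^+ 2 / (s ^+ 2 *+ 2) = - (u + u).
  by rewrite /u -mulr_natr; field; rewrite gt_eqF.
rewrite expRN expRD; have eu : u <= expR u by apply: le_trans (expR_ge1Dx _); lra.
rewrite [leRHS](_ : _ = (u * u)^-1); last by rewrite /u; field; rewrite !gt_eqF.
have uu : u * u <= expR u * expR u by rewrite ler_pM// ltW.
by rewrite lef_pV2// posrE mulr_gt0// expR_gt0.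
Qed.

Let xp_cvg0 n : (n < 4)%N -> (fun x => x ^+ n * p x) x @[x --> +oo] --> (0 : R).
Proof.
move=> n4; set K := pk * (4 * s ^+ 2) ^+ 2.
have Kinv : K * x^-1 @[x --> +oo] --> (0 : R).
  rewrite -(mulr0 K); apply: cvgMr; apply/(@gtr0_cvgV0 _ _ _ _ id); last exact: cvg_id.
  exact: nbhs_pinfty_gt.
apply: (@squeeze_cvgr _ _ _ _ (cst 0) (fun x => K * x^-1)) => //; last exact: cvg_cst.
near=> x.
have x1 : 1 <= x by near: x; exact: nbhs_pinfty_ge.
have x0 : 0 < x by exact: lt_le_trans x1.
rewrite mulr_ge0 ?exprn_ge0//= ?(ltW x0)//.
apply: le_trans (_ : x ^+ 3 * p x <= _); first by rewrite ler_wpM2r// ler_weXn2l.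
apply: le_trans (ler_wpM2l _ (p_bound x0)) _; first by rewrite exprn_ge0// ltW.
by rewrite /K le_eqVlt; apply/orP; left; apply/eqP; field; rewrite gt_eqF.
Unshelve. all: by end_near. Qed.

Let FTC2y (f F : R -> R) (a l : R) : (forall x, a <= x -> 0 <= f x) ->
  (forall x : R, is_derive x (1 : R) F (f x)) -> continuous f ->
  F x @[x --> +oo] --> l ->
  (\int[mu]_(x in `[a, +oo[) (f x)%:E = (l - F a)%:E)%E.
Proof.
move=> f0 dF cf Fl; rewrite EFinB; apply: ge0_continuous_FTC2y => //.
- exact: continuous_subspaceT.
- by apply: cvg_at_right_filter; exact: is_derive_continuous dF _.
- by move=> x _; rewrite derive1E; case: (dF x).
Qed.

Let xnp_cont n : continuous (fun x : R => x ^+ n * p x).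
Proof. by move=> x; apply: cvgM; [exact: exprn_continuous|exact: p_cont]. Qed.

(** On the half-line [x ^ 3 * p x] has the explicit primitive [F]; the exact value of the moment is
    [4 * s ^ 4 * pk], and the peak [pk] is at most [1 / s]. *)
Lemma normal_abs3 : (\int[normal_prob 0 s]_x (`|x| ^+ 3)%:E <= (4 * s ^+ 3)%:E)%E.
Proof.
rewrite integral_normal_prob//; last by apply/measurable_EFinP; exact: measurable_funX.
under eq_integral do rewrite -EFinM.
rewrite (@ge0_symfun_integralT _ (fun x => `|x| ^+ 3 * p x)); last 3 first.
- by move=> x; rewrite mulr_ge0// exprn_ge0.
- move=> x; apply: cvgM; last exact: p_cont.
  by apply: (@continuous_comp _ _ _ (@Num.norm R R) (fun y => y ^+ 3));
    [exact: norm_continuous|exact: exprn_continuous].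
- by move=> x /=; rewrite normrN pN.
rewrite [X in (_ * X)%E](_ : _ = \int[mu]_(x in `[0%R, +oo[) (x ^+ 3 * p x)%:E)%E; last first.
  rewrite -set_itvcy; apply: eq_integral => x.
  by rewrite inE/= in_itv/= andbT => x0; rewrite ger0_norm.
pose F (x : R) := - ((s ^+ 2 * x ^+ 2 + 2 * s ^+ 4) * p x).
have dF (x : R) : is_derive x (1 : R) F (x ^+ 3 * p x).
  have := is_derive_p x => ?.
  by apply: is_derive_eq; rewrite /GRing.scale/=; field; rewrite gt_eqF.
have F0 : F x @[x --> +oo] --> (0 : R).
  rewrite -oppr0 -[X in _ --> - X](_ : s ^+ 2 * 0 + 2 * s ^+ 4 * 0 = 0); last by rewrite !mulr0 addr0.
  rewrite (_ : F = fun x => - (s ^+ 2 * (x ^+ 2 * p x) + 2 * s ^+ 4 * (x ^+ 0 * p x))); last first.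
    by apply/funext => x; rewrite /F; ring.
  by apply: cvgN; apply: cvgD; apply: cvgMr; exact: xp_cvg0.
have f0 x : 0 <= x -> 0 <= x ^+ 3 * p x by move=> x0; rewrite mulr_ge0// exprn_ge0.
rewrite (FTC2y f0 dF (xnp_cont (n:=3)) F0) /F.
rewrite -EFinM lee_fin [leLHS](_ : _ = 4 * (s ^+ 4 * pk)); last first.
  by rewrite pE expr0n/= oppr0 mul0r expR0; ring.
rewrite ler_wpM2l// (_ : s ^+ 3 = s ^+ 4 * s^-1); last by field; rewrite gt_eqF.
by rewrite ler_wpM2l// exprn_ge0// ltW.
Qed.

(** [(x ^ 2 - s ^ 2) * p x] is the derivative of [- s ^ 2 * x * p x], which vanishes at 0 and at
    infinity. Since it changes sign at [s], the integrals of [x ^ 2 * p x] and [s ^ 2 * p x] are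
    compared separately on [[0, s]] and on [[s, +oo[], as extended reals cannot be subtracted
    freely. *)
Let xpos_integral :
  (\int[mu]_(x in `[0%R, +oo[) (x ^+ 2 * p x)%:E = (s ^+ 2 / 2)%:E)%E.
Proof.
have mfE (f : R -> R) (D : set R) : continuous f -> measurable_fun D (fun x : R => (f x)%:E).
  move=> cf; apply/measurable_EFinP/measurable_funTS.
  exact: continuous_measurable_fun.
have mx2p (D : set R) : measurable_fun D (fun x : R => (x ^+ 2 * p x)%:E) by apply: (mfE (fun x : R => x ^+ 2 * p x)); exact: xnp_cont.
have ms2p (D : set R) : measurable_fun D (fun x : R => (s ^+ 2 * p x)%:E).
  by apply: (mfE (fun x : R => s ^+ 2 * p x)) => x; apply: cvgMr; exact: p_cont.
pose F (x : R) := - (s ^+ 2 * (x ^+ 1 * p x)).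
pose f (x : R) := x ^+ 2 * p x - s ^+ 2 * p x.
have dF (x : R) : is_derive x (1 : R) F (f x).
  have := is_derive_p x => ?.
  by apply: is_derive_eq; rewrite /f /GRing.scale/=; field; rewrite gt_eqF.
have cf : continuous f.
  by move=> x; apply: cvgB; [exact: xnp_cont|apply: cvgMr; exact: p_cont].
have F0 : F 0 = 0 by rewrite /F expr1 mul0r mulr0 oppr0.
have ge1 : (\int[mu]_(x in `[s, +oo[) (f x)%:E = (- F s)%:E)%E.
  have f0 x : s <= x -> 0 <= f x.
    move=> sx; rewrite /f -mulrBl mulr_ge0// subr_ge0.
    by rewrite lerXn2r// nnegrE ?(ltW s0)// (le_trans (ltW s0)).
  rewrite (FTC2y (l := 0) f0 dF cf) ?sub0r//.
  by rewrite -oppr0 -[X in _ --> - X](mulr0 (s ^+ 2)); apply: cvgN; apply: cvgMr; exact: xp_cvg0.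
have le1 : (\int[mu]_(x in `[0%R, s]) (- f x)%:E = (- F s)%:E)%E.
  rewrite (@continuous_FTC2 _ (fun x : R => - f x) (fun x : R => - F x) 0 s)//.
  - by rewrite F0 oppr0 sube0.
  - by apply: continuous_subspaceT => x; apply: cvgN; exact: cf.
  - have cF (x : R) : (- F y) @[y --> x] --> - F x.
      by apply: cvgN; exact: is_derive_continuous dF _.
    split; last 2 first.
    + by apply: cvg_at_right_filter; exact: cF.
    + by apply: cvg_at_left_filter; exact: cF.
    by move=> x _; apply: ex_derive; apply: is_deriveN; exact: dF.
  - by move=> x _; rewrite derive1E; have := is_deriveN (dF x) => ?; rewrite derive_val.
have splitE (g : R -> R) : continuous g -> (forall x, 0 <= g x) ->
    (\int[mu]_(x in `[0%R, +oo[) (g x)%:E = \int[mu]_(x in `[0%R, s]) (g x)%:E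
       + \int[mu]_(x in `[s, +oo[) (g x)%:E)%E.
  move=> cg g0; have -> : `[0, +oo[%classic = `[0, s] `|` `]s, +oo[ :> set R.
    by rewrite -itv_bndbnd_setU// bnd_simp ltW.
  rewrite ge0_integral_setU//=; last 3 first.
  - exact: mfE.
  - by move=> x _; rewrite lee_fin.
  - apply/disj_setPS => x /= []; rewrite !in_itv/= andbT => /andP[_ xs] /lt_geF.
    by rewrite xs.
  by rewrite integral_itv_obnd_cbnd//; exact: mfE.
have half : (\int[mu]_(x in `[0%R, +oo[) (p x)%:E = (2^-1)%:E)%E.
  have := @integral_normal_pdf R 0 s; rewrite (@ge0_symfun_integralT _ p) //; last first.
    by move=> x /=; rewrite pN.
  rewrite -set_itvcy; set I := (\int[_]_(_ in _) _)%E.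
  have : (0 <= I)%E by apply: integral_ge0 => x _; rewrite lee_fin.
  case: I => [i| |]//; last by rewrite gt0_muley ?lte_fin.
  by rewrite -EFinM => _ [H]; congr EFin; lra.
have Z (g : R -> R) (c : R) (D : set R) : measurable D -> 0 <= c -> continuous g -> (forall x, 0 <= g x) ->
    (\int[mu]_(x in D) (c * g x)%:E = c%:E * \int[mu]_(x in D) (g x)%:E)%E.
  move=> mD c0 cg g0; under eq_integral do rewrite EFinM.
  by rewrite ge0_integralZl//; [exact: mfE|move=> x _; rewrite lee_fin].
have x2p0 x : 0 <= x ^+ 2 * p x by rewrite mulr_ge0// sqr_ge0.
have s2p0 x : 0 <= s ^+ 2 * p x by rewrite mulr_ge0// sqr_ge0.
have eq1 : (\int[mu]_(x in `[s, +oo[) (x ^+ 2 * p x)%:E =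
     (- F s)%:E + \int[mu]_(x in `[s, +oo[) (s ^+ 2 * p x)%:E)%E.
  rewrite -ge1 -ge0_integralD//=.
  - by apply: eq_integral => x _; rewrite /f -EFinD subrK.
  - move=> x; rewrite in_itv/= andbT => sx.
    rewrite lee_fin /f -mulrBl mulr_ge0// subr_ge0.
    by rewrite lerXn2r// nnegrE ?(ltW s0)// (le_trans (ltW s0)).
  - exact: mfE.
  - by move=> x _; rewrite lee_fin.
  - exact: ms2p.
have eq2 : (\int[mu]_(x in `[0%R, s]) (s ^+ 2 * p x)%:E =
     (- F s)%:E + \int[mu]_(x in `[0%R, s]) (x ^+ 2 * p x)%:E)%E.
  rewrite -le1 -ge0_integralD//=.
  - by apply: eq_integral => x _; rewrite /f -EFinD; congr EFin; ring.
  - move=> x; rewrite in_itv/= => /andP[x0 xs].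
    rewrite lee_fin /f opprB -mulrBl mulr_ge0// subr_ge0.
    by rewrite lerXn2r// nnegrE (ltW s0).
  - by apply: mfE => x; apply: cvgN; exact: cf.
  - by move=> x _; rewrite lee_fin.
  - exact: mx2p.
apply: etrans (splitE (fun x : R => x ^+ 2 * p x) (xnp_cont (n := 2)) x2p0) _.
rewrite eq1 addeCA addeA -eq2.
have cs2p : continuous (fun x : R => s ^+ 2 * p x) by move=> x; apply: cvgMr; exact: p_cont.
apply: etrans (esym (splitE (fun x : R => s ^+ 2 * p x) cs2p s2p0)) _.
by rewrite (Z p (s ^+ 2)) ?sqr_ge0// half -EFinM.
Qed.

Lemma normal_sqr : (\int[normal_prob 0 s]_x (x ^+ 2)%:E = (s ^+ 2)%:E)%E.
Proof.
rewrite integral_normal_prob//; last 2 first.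
- by apply/measurable_EFinP; exact: measurable_funX.
- by move=> x; rewrite lee_fin sqr_ge0.
under eq_integral do rewrite -EFinM.
rewrite (@ge0_symfun_integralT _ (fun x : R => x ^+ 2 * p x)); last 3 first.
- by move=> x; rewrite mulr_ge0// sqr_ge0.
- exact: xnp_cont.
- by move=> x /=; rewrite sqrrN pN.
by rewrite -set_itvcy xpos_integral -EFinM; congr EFin; field.
Qed.

(** By symmetry of the density, the positive and the negative part have the same integral, finite
    because [|x| <= 1 + x ^ 2]. *)
Lemma normal_mean : ((normal_prob 0 s).-integrable setT (fun x : R => x%:E) /\
  \int[normal_prob 0 s]_x (x%:E) = 0)%E.
Proof.
have int : (normal_prob 0 s).-integrable setT (fun x : R => x%:E).
  apply/integrableP; split; first exact/measurable_EFinP.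
  apply: (@le_lt_trans _ _ (\int[normal_prob 0 s]_x (1 + x ^+ 2)%:E)%E).
    apply: ge0_integral_mono => x //; rewrite lee_fin.
    by case: (ger0P x) => _; nra.
  under eq_integral do rewrite EFinD.
  rewrite (_ : (\int[_]_x _ = \int[normal_prob 0 s]_x 1 + \int[normal_prob 0 s]_x (x ^+ 2)%:E)%E); last first.
    apply: ge0_integralD => //; try by move=> x _; rewrite lee_fin// sqr_ge0.
    by apply/measurable_EFinP; exact: measurable_funX.
  rewrite normal_sqr integral_cst// [X in (_ * X)%E]probability_setT.
  by rewrite mule1 -EFinD ltry.
split=> //.
have splitR (g : R -> R) : continuous g -> (forall x, 0 <= g x) ->
    (\int[mu]_x (g x)%:E = \int[mu]_(x in `[0%R, +oo[) (g (- x))%:E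
       + \int[mu]_(x in `[0%R, +oo[) (g x)%:E)%E.
  move=> cg g0; have mg (D : set R) : measurable_fun D (fun x : R => (g x)%:E).
    by apply/measurable_EFinP/measurable_funTS; exact: continuous_measurable_fun.
  rewrite -(setvU `[0%R, +oo[%classic) ge0_integral_setU//=; last 3 first.
  - exact: mg.
  - by move=> x _; rewrite lee_fin.
  - by apply/disj_setPS => x [h1 h2]; exact: h1 h2.
  rewrite setCitvr integral_itv_bndo_bndc; last exact: mg.
  rewrite -[in X in (X + _)%E]oppr0 ge0_integration_by_substitutionNy//.
    exact: continuous_subspaceT.
  exact: measurableC.
have cmax (g : R -> R) : continuous g -> continuous (fun x : R => Num.max (g x) 0 * p x).
  move=> cg x; apply: cvgM; last exact: p_cont.
  by apply: continuous_max; [exact: cg|exact: cvg_cst].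
have mmax (g : R -> R) : continuous g -> meas_fun (fun x : R => (Num.max (g x) 0)%:E).
  by move=> cg; apply/measurable_EFinP/measurable_maxr => //; exact: continuous_measurable_fun.
have max0 (y : R) : (0 <= Num.max y 0)%R by rewrite le_max lexx orbT.
have cid : continuous (fun x : R => x) by move=> x; exact: cvg_id.
have cN : continuous (fun x : R => - x) by move=> x; apply: cvgN; exact: cvg_id.
have posE : (\int[normal_prob 0 s]_x (((fun x : R => x%:E)^\+)%E x) =
    \int[mu]_(x in `[0%R, +oo[) (Num.max (- x) 0 * p x)%:E +
    \int[mu]_(x in `[0%R, +oo[) (Num.max x 0 * p x)%:E)%E.
  rewrite (_ : (\int[_]_x _ = \int[normal_prob 0 s]_x (Num.max x 0)%:E)%E); last first.
    by apply: eq_integral => x _; rewrite funeposE -EFin_max.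
  rewrite integral_normal_prob; [|exact: mmax|by move=> x; rewrite lee_fin].
  under eq_integral do rewrite -EFinM.
  rewrite (splitR (fun x : R => Num.max x 0 * p x)); [|exact: cmax|by move=> x; rewrite mulr_ge0].
  apply: (congr1 (fun z => z + _)%E); apply: eq_integral => x _.
  by congr (_ * _)%:E; exact: pN.
have negE : (\int[normal_prob 0 s]_x (((fun x : R => x%:E)^\-)%E x) =
    \int[mu]_(x in `[0%R, +oo[) (Num.max (- x) 0 * p x)%:E +
    \int[mu]_(x in `[0%R, +oo[) (Num.max x 0 * p x)%:E)%E.
  rewrite (_ : (\int[_]_x _ = \int[normal_prob 0 s]_x (Num.max (- x) 0)%:E)%E); last first.
    by apply: eq_integral => x _; rewrite funenegE -EFin_max.
  rewrite integral_normal_prob; [|exact: mmax|by move=> x; rewrite lee_fin].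
  under eq_integral do rewrite -EFinM.
  rewrite (splitR (fun x : R => Num.max (- x) 0 * p x)); [|exact: cmax|by move=> x; rewrite mulr_ge0].
  rewrite addeC; apply: (congr1 (fun z => _ + z)%E); apply: eq_integral => x _.
  by rewrite opprK; congr (_ * _)%:E; exact: pN.
by rewrite integralE posE -negE subee// integrable_neg_fin_num.
Qed.
End gaussian_moments.

Section antiderivative.
Context {R : realType}.
Let mu := @lebesgue_measure R.

(** The integrals from [- N], normalized to vanish at 0, agree wherever two of them are defined;
    near a given point a single one of them represents [F]. *)
Lemma antiderivative (g : R -> R) : continuous g ->
  exists F : R -> R, forall x : R, is_derive x (1 : R) F (g x).
Proof.
move=> cg.
pose I (a x : R) : R := \int[mu]_(t in `[a, x]) g t.
have ig (a b : R) : mu.-integrable `[a, b] (EFin \o g).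
  apply: continuous_compact_integrable; first exact: segment_compact.
  exact: continuous_subspaceT.
have Chasles (a b x : R) : a <= b -> b <= x -> I a x - I a b = I b x.
  move=> ab bx; rewrite /I Rintegral_itvB ?bnd_simp//.
  rewrite Rintegral_itv_obnd_cbnd//; apply: integrableS (ig b x) => //.
  by move=> z /=; rewrite !in_itv/= => /andP[/ltW -> ->].
pose F0 (N : nat) (x : R) := I (- N%:R) x - I (- N%:R) 0.
have F0E (M N : nat) (x : R) : (N <= M)%N -> - N%:R <= x -> F0 M x = F0 N x.
  move=> NM Nx; have MN : - M%:R <= - N%:R :> R by rewrite lerN2 ler_nat.
  have := Chasles _ _ x MN Nx; have := Chasles _ _ 0 MN.
  by rewrite oppr_le0 ler0n /F0 => /(_ isT) <- <-; ring.
have F0C (M N : nat) (x : R) : - M%:R <= x -> - N%:R <= x -> F0 M x = F0 N x.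
  by move=> Mx Nx; case: (leqP N M) => [|/ltnW] NM; [|apply/esym]; exact: F0E.
pose N (x : R) := (Num.truncn `|x|).+1.
have Nx (x : R) : - (N x)%:R <= x.
  have /andP[_] := truncn_itv (normr_ge0 x); rewrite -/(N x) => h.
  by have := ler_norm (- x); rewrite normrN; lra.
exists (fun x => F0 (N x) x) => x; pose M := (Num.truncn (`|x| + 1)).+2.
have Mx : `|x| + 1 < M%:R.
  have /andP[_] := truncn_itv (addr_ge0 (normr_ge0 x) ler01).
  by move=> /lt_trans; apply; rewrite ltr_nat.
have dF0 : is_derive x (1 : R) (F0 M) (g x).
  have ax : - M%:R < x.
    by have := Mx; have := ler_norm (- x); rewrite normrN; lra.
  have [] := @continuous_FTC1_closed R g (- M%:R) x (x + 1) _ (ig _ _) ax (cg x).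
    by rewrite ltrDl.
  rewrite derive1E => d1 d2.
  have d3 : is_derive x (1 : R) (fun x : R => I (- M%:R) x) (g x) by split.
  by apply: is_derive_eq; rewrite subr0.
apply: near_eq_is_derive dF0.
have : \forall y \near x, `|x - y| < 1 by apply: (@nbhsx_ballx _ R^o x 1).
apply: filterS => y xy; apply: F0C => //.
by have := ler_norm (x - y); have := ler_norm (- x); rewrite normrN; lra.
Qed.
End antiderivative.

(** * Smoothing of bounded continuous functions; a test function of order 4 at the origin *)

Section smoothing.
Context {R : realType}.

Let mean (s : R) (F : R -> R) (x : R) := (F (x + s) - F x) / s.

Let is_derive_mean (s : R) (F f : R -> R) (x : R) :
  (forall x : R, is_derive x (1 : R) F (f x)) ->
  is_derive x (1 : R) (mean s F) (mean s f x).
Proof.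
move=> dF; have dxs : is_derive x (1 : R) (fun x : R => x + s) 1.
  by apply: is_derive_eq; rewrite addr0.
have := is_derive_comp_eq dxs (dF (x + s)) erefl => ?; have := dF x => ?.
by apply: is_derive_eq; rewrite /mean /GRing.scale/=; ring.
Qed.

Let mean_mem (s : R) (F f : R -> R) (x : R) : 0 < s ->
  (forall x : R, is_derive x (1 : R) F (f x)) ->
  exists2 c, `|c - x| <= s & mean s F x = f c.
Proof.
move=> s0 dF; have [c cx e] := mean_value dF x (x + s); exists c.
  by move: cx; rewrite addrAC subrr add0r (gtr0_norm s0).
by rewrite /mean e addrAC subrr add0r mulfK// gt_eqF.
Qed.

(* [f] is [g] averaged three times over windows of length [s]. *)
Lemma smoothing (M s : R) : 0 <= M -> 0 < s -> exists2 C : R, 0 <= C &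
  forall g : R -> R, continuous g -> (forall x, `|g x| <= M) ->
  exists f f1 f2 : R -> R, [/\ taylor2 f f1 f2 C, continuous f,
    (forall x, `|f2 x| <= C) &
    forall x, exists2 c, `|c - x| <= 3 * s & f x = g c].
Proof.
(* The derivative of an average is a difference quotient, which costs a factor [2 / s]: [B] bounds
   the second derivative and [L] its Lipschitz constant. Both depend on [g] through [M] only. *)
move=> M0 s0; pose L := 8 * M / s ^+ 3; pose B := 4 * M / s ^+ 2.
have L0 : 0 <= L by rewrite divr_ge0 ?mulr_ge0 ?exprn_ge0 ?(ltW s0).
have B0 : 0 <= B by rewrite divr_ge0 ?mulr_ge0 ?exprn_ge0 ?(ltW s0).
exists (L + 2 * B); first by rewrite addr_ge0// mulr_ge0.
move=> g cg gM; have [F0 dF0] := antiderivative cg.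
have d1 (x : R) := is_derive_mean s x dF0.
have [F1 dF1] := antiderivative (is_derive_continuous d1).
have d2 (x : R) := is_derive_mean s x dF1.
have [F2 dF2] := antiderivative (is_derive_continuous d2).
have d3 (x : R) := is_derive_mean s x dF2.
set f1 := mean s F0 in d1 dF1 d2; set f2 := mean s F1 in d2 dF2 d3.
set f3 := mean s F2 in d3.
have d4 (x : R) : is_derive x (1 : R) (mean s f2) (mean s (mean s f1) x).
  exact: is_derive_mean.
have divs (a b : R) : `|a| <= b -> `|a / s| <= b / s.
  by move=> ab; rewrite normrM normfV (gtr0_norm s0) ler_wpM2r// invr_ge0 ltW.
have f1M x : `|f1 x| <= M by have [c _ e] := mean_mem x s0 dF0; rewrite /f1 e.
have m1M x : `|mean s f1 x| <= 2 * M / s.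
  apply: divs; apply: le_trans (ler_normB _ _) _.
  by have := f1M x; have := f1M (x + s); lra.
have m2M x : `|mean s (mean s f1) x| <= B.
  rewrite /B (_ : 4 * M / s ^+ 2 = (4 * M / s) / s); last by field; rewrite gt_eqF.
  apply: divs; apply: le_trans (ler_normB _ _) _.
  by have := m1M x; have := m1M (x + s); lra.
have gsM x : `|mean s g x| <= 2 * M / s.
  apply: divs; apply: le_trans (ler_normB _ _) _.
  by have := gM x; have := gM (x + s); lra.
have f1L x y : `|f1 x - f1 y| <= 2 * M / s * `|x - y| := lipschitz_derive d1 gsM x y.
have m1L x y : `|mean s f1 x - mean s f1 y| <= 4 * M / s ^+ 2 * `|x - y|.
  rewrite /mean -mulrBl (_ : 4 * M / s ^+ 2 * `|x - y| = (4 * M / s * `|x - y|) / s); last first.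
    by field; rewrite gt_eqF.
  apply: divs; rewrite (_ : _ - _ - _ = (f1 (x + s) - f1 (y + s)) - (f1 x - f1 y)); last by ring.
  apply: le_trans (ler_normB _ _) _.
  have := f1L x y; have := f1L (x + s) (y + s).
  by rewrite (_ : x + s - (y + s) = x - y); [lra|ring].
have m2L x y : `|mean s (mean s f1) x - mean s (mean s f1) y| <= L * `|x - y|.
  rewrite -[mean s (mean s f1) x]/((mean s f1 (x + s) - mean s f1 x) / s).
  rewrite -[mean s (mean s f1) y]/((mean s f1 (y + s) - mean s f1 y) / s).
  rewrite -mulrBl (_ : L * `|x - y| = (8 * M / s ^+ 2 * `|x - y|) / s); last first.
    by rewrite /L; field; rewrite gt_eqF.
  apply: divs; rewrite (_ : _ - _ - _ = (mean s f1 (x + s) - mean s f1 (y + s)) -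
    (mean s f1 x - mean s f1 y)); last by ring.
  apply: le_trans (ler_normB _ _) _.
  have := m1L x y; have := m1L (x + s) (y + s).
  by rewrite (_ : x + s - (y + s) = x - y); [lra|ring].
exists f3, (mean s f2), (mean s (mean s f1)); split.
- exact: taylor2_of_derive d3 d4 m2L m2M.
- exact: is_derive_continuous d3.
- by move=> x; apply: le_trans (m2M x) _; lra.
- move=> x; have [c3 h3 e3] := mean_mem x s0 dF2.
  have [c2 h2 e2] := mean_mem c3 s0 dF1.
  have [c1 h1 e1] := mean_mem c2 s0 dF0.
  exists c1; last by rewrite /f3 e3 /f2 e2 /f1 e1. have -> : c1 - x = (c1 - c2) + (c2 - c3) + (c3 - x) by ring.
  apply: le_trans (ler_normD _ _) _; have := ler_normD (c1 - c2) (c2 - c3); lra.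
Qed.

(** The function is [y ^ 4 / (1 + y ^ 2)]: quadratic at infinity, so that second moments control it,
    with a second derivative that vanishes at 0. Its mean at an increment over a time [h] is of
    order [h ^ (3/2)], small against [h], which permits a union bound over all blocks. *)
Lemma quartic_function : exists f f1 f2 : R -> R, exists2 M : R, 0 < M &
  [/\ taylor2 f f1 f2 M, continuous f, f 0 = 0 /\ (forall y, 0 <= f y),
      forall y, `|f2 y| <= M * `|y| &
      forall e, 0 < e -> exists2 c : R, 0 < c & forall y, e <= `|y| -> c <= f y].
Proof.
pose t (y : R) := (1 + y ^+ 2)^-1.
have p0 (y : R) : 0 < 1 + y ^+ 2 by rewrite ltr_pwDl// sqr_ge0.
have dt (y : R) : is_derive y (1 : R) t (- (2 * y * t y ^+ 2)).
  have d : is_derive y (1 : R) (fun y : R => 1 + y ^+ 2) (2 * y).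
    by apply: is_derive_eq; rewrite /GRing.scale/=; ring.
  have := @is_deriveV R (fun y : R => 1 + y ^+ 2) y _ _ (lt0r_neq0 (p0 y)) d => ?.
  by apply: is_derive_eq; rewrite /t /GRing.scale/=; field; rewrite gt_eqF.
have t0 y : 0 < t y by rewrite invr_gt0.
have t1 y : t y <= 1 by rewrite invf_le1// lerDl sqr_ge0.
have tE y : t y + y ^+ 2 * t y = 1.
  by rewrite /t; field; rewrite gt_eqF.
pose f y := y ^+ 2 - 1 + t y.
pose f1 y := 2 * y - 2 * y * t y ^+ 2.
pose f2 y := 2 - 2 * t y ^+ 2 + 8 * y ^+ 2 * t y ^+ 3.
pose f3 y := 24 * y * t y ^+ 3 - 48 * y ^+ 3 * t y ^+ 4.
have df (y : R) : is_derive y (1 : R) f (f1 y).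
  have := dt y => ?; apply: is_derive_eq; rewrite /f1 /GRing.scale/=; ring.
have df1 (y : R) : is_derive y (1 : R) f1 (f2 y).
  have := dt y => ?; apply: is_derive_eq; rewrite /f2 /GRing.scale/=; ring.
have df2 (y : R) : is_derive y (1 : R) f2 (f3 y).
  have := dt y => ?; apply: is_derive_eq; rewrite /f3 /GRing.scale/=; ring.
have yt y : `|y| * t y <= 1.
  have := tE y; have := t0 y; rewrite -(real_normK (num_real y)).
  by have := normr_ge0 y; have := t1 y; case: (leP `|y| 1) => ? ? ? ? ?; nra.
have ytn n y : `|y| ^+ n * t y ^+ n <= 1.
  by rewrite -exprMn exprn_ile1// mulr_ge0// ltW.
have tn n y : 0 <= t y ^+ n <= 1.
  by rewrite exprn_ge0 ?exprn_ile1 // ltW.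
have f3M y : `|f3 y| <= 72.
  have a1 : `|y * t y ^+ 3| <= 1.
    rewrite normrM (ger0_norm (exprn_ge0 3 (ltW (t0 y)))) exprS mulrA.
    by rewrite mulr_ile1 ?mulr_ge0 ?(ltW (t0 y))//; have /andP[] := tn 2 y.
  have a2 : `|y ^+ 3 * t y ^+ 4| <= 1.
    rewrite normrM (normrX 3 y) (ger0_norm (exprn_ge0 4 (ltW (t0 y)))) [t y ^+ 4]exprSr mulrA.
    by apply: mulr_ile1; rewrite ?ytn ?mulr_ge0 ?exprn_ge0 ?(ltW (t0 y)).
  rewrite (_ : f3 y = 24 * (y * t y ^+ 3) - 48 * (y ^+ 3 * t y ^+ 4)); last by rewrite /f3; ring.
  by move: a1 a2; rewrite !ler_norml => /andP[? ?] /andP[? ?]; apply/andP; split; lra.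
have f2L x y : `|f2 x - f2 y| <= 72 * `|x - y| := lipschitz_derive df2 f3M x y.
have f2M y : `|f2 y| <= 12.
  have /andP[? ?] := tn 2 y; have := ytn 2 y; rewrite real_normK ?num_real// => a.
  have b : 0 <= y ^+ 2 * t y ^+ 3 <= 1.
    have z : 0 <= y ^+ 2 * t y ^+ 2 by rewrite mulr_ge0// sqr_ge0.
    rewrite [t y ^+ 3]exprSr mulrA; apply/andP; split; first by rewrite mulr_ge0// ltW.
    by apply: mulr_ile1 => //; exact: ltW.
  by rewrite /f2 ler_norml; lra.
have fE y : f y = y ^+ 2 * (1 - t y) by rewrite /f; have := tE y; lra.
have f0 y : 0 <= f y by rewrite fE mulr_ge0 ?sqr_ge0// subr_ge0.
exists f, f1, f2, 96; first by [].
split.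
- rewrite (_ : 96 = 72 + 2 * 12); last by ring.
  exact: taylor2_of_derive df df1 f2L f2M.
- exact: is_derive_continuous df.
- by split=> //; rewrite fE expr0n/= mul0r.
- move=> y; have := f2L y 0; rewrite subr0.
  have -> : f2 0 = 0 by rewrite /f2 /t expr0n/= addr0 invr1; ring.
  by rewrite subr0 => /le_trans; apply; rewrite ler_wpM2r//; lra.
- move=> e e0; exists (e ^+ 2 * (1 - t e)).
    rewrite mulr_gt0 ?exprn_gt0// subr_gt0 /t invf_lt1// ltrDl exprn_gt0//.
  move=> y ey; rewrite fE.
  have e2y : e ^+ 2 <= y ^+ 2.
    by rewrite -(real_normK (num_real y)) lerXn2r// nnegrE ?(ltW e0)// (le_trans (ltW e0)).
  rewrite ler_pM ?sqr_ge0 ?subr_ge0// lerB// /t lef_pV2 ?posrE//.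
  by rewrite lerD2l.
Qed.
End smoothing.

(** * Stability of Euler approximations *)

Section wiener_increments.
Context {d} {T : measurableType d} {R : realType} (P : probability T R).
Variables (F : R -> set_system T) (W : R -> T -> R).
Hypothesis wW : wiener_process P F W.

Lemma filtration_sub t : 0 <= t -> sub_algebra (F t).
Proof. by case: wW => -[[h1 h2 _] _] _ _ _ _ t0; split; [exact: h1|exact: h2]. Qed.

Lemma filtration_mono s t : 0 <= s -> s <= t -> F s `<=` F t.
Proof. by case: wW => -[[_ _ h] _] _ _ _ _; exact: h. Qed.

Lemma meas_wrt_mono s t d' (T' : measurableType d') (f : T -> T') :
  0 <= s -> s <= t -> meas_wrt (F s) f -> meas_wrt (F t) f.
Proof.
move=> s0 st; apply: meas_wrt_sub; first exact: filtration_sub.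
  by apply: filtration_sub; exact: le_trans st.
exact: filtration_mono.
Qed.

Lemma wiener_meas_wrt t : 0 <= t -> meas_wrt (F t) (W t).
Proof.
move=> t0; apply/meas_wrtP; first exact: filtration_sub.
by case: wW => -[_ +] _ _ _ _; apply.
Qed.

Lemma increment_meas_wrt s t : 0 <= s -> s <= t ->
  meas_wrt (F t) (fun w => W t w - W s w).
Proof.
move=> s0 st; apply: measurable_funB.
  by apply: wiener_meas_wrt; exact: le_trans st.
by apply: meas_wrt_mono st _ => //; exact: wiener_meas_wrt.
Qed.

Lemma increment_measurable s t : 0 <= s -> s <= t ->
  meas_fun (fun w => W t w - W s w).
Proof.
move=> s0 st; apply: sub_meas_wrt (increment_meas_wrt s0 st).
by apply: filtration_sub; exact: le_trans st.
Qed.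

Lemma increment_indep s t : 0 <= s -> s <= t ->
  indep_of P (F s) (fun w => W t w - W s w).
Proof.
move=> s0; rewrite le_eqVlt => /predU1P[<-|st] A B FA mB.
  have -> : (fun w => W s w - W s w) @^-1` B = if 0 \in B then setT else set0.
    case: ifPn => [/set_mem B0|/negP B0]; apply/seteqP; split=> w //=; rewrite subrr//.
    by move=> /mem_set.
  case: ifPn => _; rewrite ?setIT ?setI0 ?measure0 ?mule0//.
  by rewrite probability_setT mule1.
by case: wW => _ _ _ + _; apply.
Qed.

Lemma increment_integral s t (f : R -> \bar R) : 0 <= s -> s < t ->
  meas_fun f -> (forall x, 0 <= f x)%E ->
  (\int[P]_w f (W t w - W s w)%R = \int[normal_prob 0 (Num.sqrt (t - s))]_x f x)%E.
Proof.
move=> s0 st mf f0; have mV := increment_measurable s0 (ltW st).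
have mV' : @measurable_fun _ _ T (measurableTypeR R) setT (fun w => W t w - W s w) by exact: mV.
pose V : {mfun T >-> measurableTypeR R} :=
  @mfun_Sub _ _ T (measurableTypeR R) _ (mem_set mV').
rewrite -(@ge0_integral_distribution _ _ _ _ _ P V)//.
apply: (@eq_measure_integral _ (measurableTypeR R) R setT (normal_prob 0 (Num.sqrt (t - s))) (distribution P V)) => B mB _.
by case: wW => _ _ _ _ /(_ s t s0 st B mB).
Qed.

Lemma increment_centered s t : 0 <= s -> s <= t ->
  centered P (fun w => W t w - W s w) (t - s).
Proof.
move=> s0 st; have mV := increment_measurable s0 st.
move: st; rewrite le_eqVlt => /predU1P[e|st].
  have V0 : (fun w => W t w - W s w) = cst 0 by apply/funext => w; rewrite e subrr.
  rewrite V0; split.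
  - exact: finite_measure_integrable_cst.
  - by rewrite integral0_eq.
  - by rewrite integral0_eq ?e ?subrr// => w _; rewrite expr0n.
have st0 : 0 < Num.sqrt (t - s) by rewrite sqrtr_gt0 subr_gt0.
have [ni n0] := normal_mean st0.
have n2 := normal_sqr st0.
have mV' : @measurable_fun _ _ T (measurableTypeR R) setT (fun w => W t w - W s w) by exact: mV.
pose V : {mfun T >-> measurableTypeR R} :=
  @mfun_Sub _ _ T (measurableTypeR R) _ (mem_set mV').
have dV : forall B, measurable B -> distribution P V B = normal_prob 0 (Num.sqrt (t - s)) B.
  by move=> B mB; case: wW => _ _ _ _ /(_ s t s0 st B mB).
have iV : P.-integrable setT (fun w => (W t w - W s w)%:E).
  apply/integrableP; split; first exact/measurable_EFinP.
  rewrite (increment_integral (f := fun x => `|x%:E|%E))//.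
    by case/integrableP : ni.
  by apply: measurableT_comp => //; exact/measurable_EFinP.
split=> //.
- rewrite -[LHS](@integral_distribution _ _ _ _ _ P V (fun x => x%:E))//; last first.
    exact/measurable_EFinP.
  rewrite -n0; apply: (@eq_measure_integral _ (measurableTypeR R) R setT
    (normal_prob 0 (Num.sqrt (t - s))) (distribution P V)) => B mB _.
  exact: dV.
- rewrite (increment_integral (f := fun x => (x ^+ 2)%:E))//; last 2 first.
  + by apply/measurable_EFinP; exact: measurable_funX.
  + by move=> x; rewrite lee_fin sqr_ge0.
  by rewrite n2 sqr_sqrtr// subr_ge0 ltW.
Qed.

Lemma increment_cubic_rem s t k : 0 <= s -> s <= t ->
  (\int[P]_w (cubic_rem (k * (W t w - W s w)))%:E <=
   (4 * `|k| ^+ 3 * Num.sqrt (t - s) ^+ 3)%:E)%E.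
Proof.
move=> s0; rewrite le_eqVlt => /predU1P[e|st].
  rewrite integral0_eq ?lee_fin ?mulr_ge0 ?exprn_ge0 ?sqrtr_ge0// => w _.
  by rewrite e subrr mulr0 /cubic_rem expr0n mul0r.
have st0 : 0 < Num.sqrt (t - s) by rewrite sqrtr_gt0 subr_gt0.
have m3 : meas_fun (fun x : R => (`|x| ^+ 3)%:E).
  by apply/measurable_EFinP; apply: measurable_funX; exact: normr_measurable.
apply: le_trans (_ : \int[P]_w (`|k| ^+ 3 * `|W t w - W s w| ^+ 3)%:E <= _)%E.
  apply: ge0_integral_mono => w; rewrite lee_fin ?cubic_rem_ge0//.
  rewrite -exprMn -normrM /cubic_rem -(real_normK (num_real (_ * _))) [leRHS]exprSr.
  by rewrite ler_wpM2l ?sqr_ge0// ge_min lexx orbT.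
rewrite ge0_integral_scale ?exprn_ge0//; last first.
  apply/measurable_EFinP/(measurableT_comp m3); exact: increment_measurable (ltW st).
rewrite (increment_integral s0 st m3); last by move=> x; rewrite lee_fin exprn_ge0.
rewrite [X in (_ <= X%:E)%E](_ : _ = `|k| ^+ 3 * (4 * Num.sqrt (t - s) ^+ 3)); last by ring.
rewrite [X in (_ <= X)%E]EFinM; apply: lee_pmul => //; last exact: normal_abs3.
by apply: integral_ge0 => x _; rewrite lee_fin exprn_ge0.
Qed.

End wiener_increments.

(** * Two discrete schemes driven by the same noise *)

Section discrete_stability.
Context {d} {T : measurableType d} {R : realType}.

Definition diffusion_coef (v x : R) : R := Num.sqrt (v * Num.max x 0).

Lemma diffusion_coef_sqr v x : 0 <= v -> diffusion_coef v x ^+ 2 = v * Num.max x 0.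
Proof. by move=> v0; rewrite sqr_sqrtr// mulr_ge0// le_max lexx orbT. Qed.

Lemma sqrt_sub_sqr (a b : R) : 0 <= a -> 0 <= b ->
  (Num.sqrt a - Num.sqrt b) ^+ 2 <= `|a - b|.
Proof.
move=> a0 b0; rewrite -[in leRHS](sqr_sqrtr a0) -[in leRHS](sqr_sqrtr b0).
have := sqrtr_ge0 a; have := sqrtr_ge0 b; set x := Num.sqrt a; set y := Num.sqrt b => y0 x0.
rewrite subr_sqr normrM (ger0_norm (addr_ge0 x0 y0)) -(real_normK (num_real (x - y))) expr2.
rewrite ler_wpM2l//; apply: le_trans (ler_normB _ _) _.
by rewrite !ger0_norm.
Qed.

Lemma max0_lipschitz (x y : R) : `|Num.max x 0 - Num.max y 0| <= `|x - y|.
Proof.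
rewrite /Num.max; case: ifPn; case: ifPn; rewrite -?leNgt => h1 h2.
- by rewrite subrr normr0.
- by rewrite sub0r normrN ger0_norm// ler0_norm; lra.
- by rewrite subr0 ger0_norm// ger0_norm; lra.
- by [].
Qed.

Lemma diffusion_coef_holder v x y : 0 <= v ->
  (diffusion_coef v x - diffusion_coef v y) ^+ 2 <= v * `|x - y|.
Proof.
move=> v0; apply: le_trans (sqrt_sub_sqr _ _) _; rewrite ?mulr_ge0 ?le_max ?lexx ?orbT//.
by rewrite -mulrBr normrM (ger0_norm v0) ler_wpM2l// max0_lipschitz.
Qed.

Lemma measurable_diffusion_coef v : meas_fun (diffusion_coef v).
Proof.
apply: measurableT_comp; first exact: continuous_measurable_fun (@sqrt_continuous R).
by apply: measurable_funM => //; exact: measurable_maxr.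
Qed.

(* [stability_data] collects two discrete-time processes driven by the same
   noise; [K i] and [K' i] are meant to be close to [diffusion_coef v (U i)] and
   [diffusion_coef v (U' i)], and [mu] bounds the square root of the time steps. *)
Definition coef_error (v : R) (dl : nat -> R) (K U : nat -> T -> R) (n : nat) (w : T) :=
  \sum_(i < n) (K i w - diffusion_coef v (U i w)) ^+ 2 * dl i.

Record stability_data (P : probability T R) (F : nat -> set_system T)
    (V : nat -> T -> R) (L mu : R) (dl : nat -> R)
    (K K' U U' : nat -> T -> R) : Prop := StabilityData {
  sd_sub : forall i, sub_algebra (F i) ;
  sd_mono : forall i, F i `<=` F i.+1 ;
  sd_dl : forall i, 0 <= dl i ;
  sd_indep : forall i, indep_of P (F i) (V i) ;
  sd_meas : forall i, meas_wrt (F i.+1) (V i) ;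
  sd_centered : forall i, centered P (V i) (dl i) ;
  sd_cubic : forall i k, (\int[P]_w (cubic_rem (k * V i w))%:E <=
    (4 * `|k| ^+ 3 * (mu * dl i))%:E)%E ;
  sd_K : forall i, meas_wrt (F i) (K i) ;
  sd_K' : forall i, meas_wrt (F i) (K' i) ;
  sd_U : forall i, meas_wrt (F i) (U i) ;
  sd_U' : forall i, meas_wrt (F i) (U' i) ;
  sd_L : forall i w, `|K i w - K' i w| <= L ;
  sd_init : forall w, U 0%N w = U' 0%N w ;
  sd_step : forall i w, U i.+1 w - U' i.+1 w =
    U i w - U' i w + (K i w - K' i w) * V i w }.

Lemma measurable_coef_error v dl (K U : nat -> T -> R) n :
  (forall i, (i < n)%N -> meas_fun (K i)) ->
  (forall i, (i < n)%N -> meas_fun (U i)) ->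
  meas_fun (coef_error v dl K U n).
Proof.
move=> mK mU; apply: measurable_sum => i; apply: measurable_funM => //.
apply: measurable_funX; apply: measurable_funB; first exact: mK.
by apply: measurableT_comp; [exact: measurable_diffusion_coef|exact: mU].
Qed.

Lemma coef_error_ge0 v dl (K U : nat -> T -> R) n w : (forall i, 0 <= dl i) ->
  0 <= coef_error v dl K U n w.
Proof. by move=> h; apply: sumr_ge0 => i _; rewrite mulr_ge0// sqr_ge0. Qed.

Lemma coef_error_mono v dl (K U : nat -> T -> R) m n w : (forall i, 0 <= dl i) ->
  (m <= n)%N -> coef_error v dl K U m w <= coef_error v dl K U n w.
Proof.
move=> h mn; rewrite -(subnKC mn); elim: (n - m)%N => [|j IH]; first by rewrite addn0.
apply: le_trans IH _; rewrite addnS /coef_error big_ord_recr/= lerDl mulr_ge0//.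
exact: sqr_ge0.
Qed.
End discrete_stability.

Section stability.
Context {d} {T : measurableType d} {R : realType}.

Section stopped.
Variables (P : probability T R) (F : nat -> set_system T) (V : nat -> T -> R).
Variables (L mu : R) (dl : nat -> R) (K K' U U' : nat -> T -> R).
Hypothesis sd : stability_data P F V L mu dl K K' U U'.
Variables (v e eta : R).
Hypotheses (v0 : 0 <= v) (e0 : 0 < e) (eta0 : 0 <= eta) (mu0 : 0 <= mu).
Let D i w := U i w - U' i w.
Let err := coef_error v dl K U.
Let err' := coef_error v dl K' U'.

(** [err i.+1] sums the coefficient errors of the indices up to [i], all known at time [i]. Hence
    [ok i] is decided before the noise [V i] is used, and [M] below, the difference [D] stopped at
    the first failure of [ok], has predictable coefficients. *)
Let ok i w := [&& `|D i w| < e, err i.+1 w <= eta & err' i.+1 w <= eta].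
Let Fixpoint alive (i : nat) (w : T) : bool := if i is j.+1 then alive j w && ok i w else ok 0%N w.
Let k i w := if alive i w then K i w - K' i w else 0.
Let Fixpoint M (i : nat) (w : T) : R := if i is j.+1 then M j w + k j w * V j w else 0.

Let sdF i : sub_algebra (F i). Proof. exact: (sd_sub sd). Qed.

Let Fmono i j : (i <= j)%N -> F i `<=` F j.
Proof.
elim: j => [|j IH]; first by rewrite leqn0 => /eqP->.
by rewrite leq_eqVlt => /predU1P[->//|/IH h A /h]; exact: (sd_mono sd).
Qed.

Let lift i j d' (T' : measurableType d') (f : T -> T') : (i <= j)%N ->
  meas_wrt (F i) f -> meas_wrt (F j) f.
Proof. by move=> ij; apply: meas_wrt_sub => //; exact: Fmono. Qed.

Let mok i : meas_wrt (F i) (ok i).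
Proof.
have me (K0 U0 : nat -> T -> R) : (forall i, meas_wrt (F i) (K0 i)) ->
    (forall i, meas_wrt (F i) (U0 i)) ->
    measurable_fun [set: g_sigma_algebraType (F i)] (coef_error v dl K0 U0 i.+1 : g_sigma_algebraType (F i) -> R).
  move=> mK mU; apply: measurable_sum => j; apply: measurable_funM => //.
  have ji : (j <= i)%N by rewrite -ltnS.
  apply: measurable_funX; apply: measurable_funB; first exact: lift ji (mK j).
  by apply: measurableT_comp; [exact: measurable_diffusion_coef|exact: lift ji (mU j)].
apply: measurable_and.
  apply: measurable_fun_ltr => //; apply: measurableT_comp; first exact: normr_measurable.
  by apply: measurable_funB; [exact: (sd_U sd)|exact: (sd_U' sd)].
apply: measurable_and; apply: measurable_fun_ler => //; apply: me.
- exact: (sd_K sd).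
- exact: (sd_U sd).
- exact: (sd_K' sd).
- exact: (sd_U' sd).
Qed.

Let malive i : meas_wrt (F i) (alive i).
Proof.
elim: i => [|i IH]; first exact: mok.
by apply: measurable_and; [exact: lift (leqnSn i) IH|exact: mok].
Qed.

Let mk i : meas_wrt (F i) (k i).
Proof.
apply: measurable_fun_if => //; first exact: malive.
  apply: measurable_funTS; apply: measurable_funB; [exact: (sd_K sd)|exact: (sd_K' sd)].
Qed.

Let mM i : meas_wrt (F i) (M i).
Proof.
elim: i => [|i IH]; first exact: measurable_cst.
have mMi := @lift i i.+1 _ _ (M i) (leqnSn i) IH.
have mki := @lift i i.+1 _ _ (k i) (leqnSn i) (@mk i).
have mVi : meas_wrt (F i.+1) (V i) by exact: (sd_meas sd).
exact: (measurable_funD mMi (measurable_funM mki mVi)).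
Qed.

Let aliveS i j w : (i <= j)%N -> alive j w -> alive i w.
Proof.
elim: j => [|j IH]; first by rewrite leqn0 => /eqP->.
by rewrite leq_eqVlt => /predU1P[->//|/IH h] /= /andP[/h].
Qed.

Let alive_ok i w : alive i w -> ok i w.
Proof. by case: i => [|i] //= /andP[]. Qed.

Let M_alive i w : (forall j, (j < i)%N -> alive j w) -> M i w = D i w.
Proof.
elim: i => [_|i IH h] /=; first by rewrite /D (sd_init sd) subrr.
rewrite IH => [|j ji]; last by apply: h; exact: ltnW.
by rewrite /D (sd_step sd) /k h.
Qed.

Let M_dead i j w : ~~ alive i w -> M (i + j)%N w = M i w.
Proof.
move=> ai; elim: j => [|j IH]; first by rewrite addn0.
rewrite addnS /= IH /k ifN ?mul0r ?addr0//.
by apply: contra ai; apply: aliveS; exact: leq_addr.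
Qed.

(** At the first index [j] where [|D j|] reaches [e], all earlier indices are alive, so [M j = D j];
    [ok j] fails there, and [M] keeps this value up to [N]. *)
Let stopped_exceeds N i w : (i <= N)%N -> e <= `|D i w| ->
  err N w <= eta -> err' N w <= eta -> e <= `|M N w|.
Proof.
move=> iN ei eN eN'.
have [j] := ex_minnP (ex_intro (fun j => e <= `|D j w|) i ei).
move=> ej jmin; have ji : (j <= i)%N by exact: jmin.
have al l0 : (l0 < j)%N -> alive l0 w.
  have okl l : (l < j)%N -> ok l w.
    move=> lj; have lN : (l.+1 <= N)%N by rewrite (leq_trans lj)// (leq_trans ji).
    apply/and3P; split.
    - by rewrite ltNge; apply/negP => /jmin; rewrite leqNgt lj.
    - by apply: le_trans eN; apply: coef_error_mono lN; exact: (sd_dl sd).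
    - by apply: le_trans eN'; apply: coef_error_mono lN; exact: (sd_dl sd).
  elim: l0 => [|l IH] lj /=; first exact: okl.
  by rewrite IH ?okl// ltnW.
have jN : (j <= N)%N by exact: leq_trans iN.
rewrite -(subnKC jN) M_dead ?M_alive//.
by apply/negP => /alive_ok /and3P[]; rewrite ltNge ej.
Qed.

Variables (f f1 f2 : R -> R) (C kap B : R).
Hypotheses (tf : taylor2 f f1 f2 C) (C0 : 0 <= C) (mf : meas_fun f)
  (f0 : forall y, 0 <= f y) (f20 : forall y, 0 <= f2 y)
  (f2k : forall y, f2 y * `|y| <= kap) (f2B : forall y, f2 y <= B).

(** [K - K'] is split through the two values of [diffusion_coef], whence the factor 3. The two
    coefficient errors are paid with the bound [B] of [f2]; the difference of the diffusion
    coefficients has square at most [v * |D|], and [f2 D * |D| <= kap]. *)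
Let step_bound i w : k i w ^+ 2 * dl i * (f2 (M i w) / 2) + C * (4 * `|k i w| ^+ 3 * (mu * dl i)) <=
  (if alive i w then 3 / 2 * B * ((err i.+1 w - err i w) + (err' i.+1 w - err' i w)) else 0)
  + (3 / 2 * v * kap + 4 * C * L ^+ 3 * mu) * dl i.
Proof.
have dl0 : 0 <= dl i by exact: (sd_dl sd).
have L0 : 0 <= L by apply: le_trans (normr_ge0 _) (sd_L sd i w).
have kap0 : 0 <= kap by apply: le_trans (f2k 0); rewrite mulr_ge0.
rewrite /k; case: ifPn => al; last first.
  rewrite expr0n/= !mul0r normr0 expr0n/= mulr0 mul0r mulr0 add0r add0r.
  by rewrite mulr_ge0// addr_ge0// !mulr_ge0// exprn_ge0.
have -> : M i w = D i w.
  by apply: M_alive => j ji; apply: aliveS al; exact: ltnW.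
rewrite /err /err' /coef_error !big_ord_recr/= !(addrAC _ _ (- _)) !subrr !add0r.
rewrite [leRHS](_ : _ = (3 / 2 * B * ((K i w - diffusion_coef v (U i w)) ^+ 2 +
  (K' i w - diffusion_coef v (U' i w)) ^+ 2) + 3 / 2 * v * kap) * dl i
  + C * (4 * L ^+ 3 * (mu * dl i))); last by ring.
apply: lerD; last first.
  rewrite ler_wpM2l// ler_wpM2r ?mulr_ge0// ler_wpM2l// lerXn2r ?nnegrE//.
  exact: (sd_L sd).
rewrite mulrAC ler_wpM2r//.
have := diffusion_coef_holder (U i w) (U' i w) v0.
have := f20 (D i w); have := f2k (D i w); have := f2B (D i w).
rewrite -/(D i w).
set a := K i w; set a' := K' i w; set s := diffusion_coef _ _; set s' := diffusion_coef _ _.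
set F2 := f2 _ => FB Fk F20 ss.
have h1 : (a - a') ^+ 2 <= 3 * ((a - s) ^+ 2 + (a' - s') ^+ 2 + v * `|D i w|).
  apply: le_trans (_ : _ <= 3 * ((a - s) ^+ 2 + (a' - s') ^+ 2 + (s - s') ^+ 2)) _.
    have := sqr_ge0 ((a - s) + (a' - s')); have := sqr_ge0 ((a - s) - (s - s')).
    have := sqr_ge0 ((a' - s') + (s - s')).
    rewrite (_ : a - a' = (a - s) - (a' - s') + (s - s')); last by ring.
    by rewrite !expr2; lra.
  by rewrite ler_wpM2l// lerD2l.
apply: le_trans (_ : 3 * ((a - s) ^+ 2 + (a' - s') ^+ 2 + v * `|D i w|) * (F2 / 2) <= _).
  by rewrite ler_wpM2r// divr_ge0.
rewrite [leLHS](_ : _ = 3 / 2 * (F2 * ((a - s) ^+ 2 + (a' - s') ^+ 2)) +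
   3 / 2 * v * (F2 * `|D i w|)); last by field.
apply: lerD; last by rewrite ler_wpM2l// mulr_ge0.
by rewrite -[leRHS]mulrA ler_wpM2l// ler_wpM2r// addr_ge0// sqr_ge0.
Qed.

Let inc i w := if alive i w then (err i.+1 w - err i w) + (err' i.+1 w - err' i w) else 0.
Let cst0 := 3 / 2 * v * kap + 4 * C * L ^+ 3 * mu.
Let Q i w := 3 / 2 * B * inc i w + cst0 * dl i.

Let B0 : 0 <= B. Proof. exact: le_trans (f20 0) (f2B 0). Qed.

Let mF d' (T' : measurableType d') i (g : T -> T') : meas_wrt (F i) g -> meas_fun g.
Proof. exact: sub_meas_wrt. Qed.

Let merr n : meas_fun (err n).
Proof.
apply: measurable_coef_error => i _.
- exact: mF (sd_K sd (i:=i)).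
- exact: mF (sd_U sd (i:=i)).
Qed.

Let merr' n : meas_fun (err' n).
Proof.
apply: measurable_coef_error => i _.
- exact: mF (sd_K' sd (i:=i)).
- exact: mF (sd_U' sd (i:=i)).
Qed.

Let inc_ge0 i w : 0 <= inc i w.
Proof.
rewrite /inc; case: ifP => // _.
by rewrite addr_ge0// subr_ge0; apply: coef_error_mono => // j; exact: (sd_dl sd).
Qed.

(** While alive, the increments telescope to [err + err'], and each is at most [eta] by [ok];
    afterwards they are 0. *)
Let inc_sum_dead i w : \sum_(j < i) inc j w <= 2 * eta /\
  (alive i w -> \sum_(j < i.+1) inc j w = err i.+1 w + err' i.+1 w).
Proof.
elim: i => [|i [IH1 IH2]].
  rewrite big_ord0; split; first by rewrite mulr_ge0.
  move=> al; rewrite big_ord_recr big_ord0/= add0r /inc (_ : alive 0 w = true)//.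
  by rewrite /err /err' /coef_error !big_ord0 !subr0.
have a2 : alive i w -> \sum_(j < i.+1) inc j w <= 2 * eta.
  by move=> al; rewrite IH2//; have /alive_ok/and3P[_] := al; lra.
split.
  case: (boolP (alive i w)) => [/a2//|al].
  by rewrite big_ord_recr/= /inc (negbTE al) addr0.
move=> al; have ali : alive i w by apply: aliveS al.
by rewrite big_ord_recr/= IH2// /inc al; ring.
Qed.

Let cst0_ge0 : 0 <= cst0.
Proof.
have kap0 : 0 <= kap by apply: le_trans (f2k 0); rewrite mulr_ge0.
have L0 : 0 <= L by apply: le_trans (normr_ge0 _) (sd_L sd 0%N point).
by rewrite addr_ge0// !mulr_ge0// exprn_ge0.
Qed.

Let Q_ge0 i w : 0 <= Q i w.
Proof.
have dl0 : 0 <= dl i by exact: (sd_dl sd).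
by rewrite addr_ge0// mulr_ge0// mulr_ge0.
Qed.

Let mQ i : meas_fun (Q i).
Proof.
apply: measurable_funD => //; apply: measurable_funM => //.
apply: measurable_fun_if => //; first exact: mF (@malive i).
by apply: measurable_funTS; apply: measurable_funD; apply: measurable_funB.
Qed.

Let stopped_step i : (\int[P]_w (f (M i.+1 w))%:E <=
  \int[P]_w (f (M i w))%:E + \int[P]_w (Q i w)%:E)%E.
Proof.
have mfM : meas_fun (fun w => f (M i w)) by apply: measurableT_comp => //; exact: mF (@mM i).
rewrite -ge0_integral_add//.
have := ito_step (sdF i) (sd_indep sd (i:=i)) (sd_centered sd i) tf C0 f0 mf (@mM i) (@mk i)
  (q := fun x => 4 * `|x| ^+ 3 * (mu * dl i)) (sd_cubic sd i).
move=> /le_trans; apply.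
apply: ge0_integral_mono => w.
  have dl0 : 0 <= dl i by exact: (sd_dl sd).
  have a : 0 <= k i w ^+ 2 * dl i * (f2 (M i w) / 2).
    by apply: mulr_ge0; [apply: mulr_ge0 => //; exact: sqr_ge0|exact: divr_ge0].
  have b : 0 <= C * (4 * `|k i w| ^+ 3 * (mu * dl i)).
    apply: mulr_ge0 => //; apply: mulr_ge0; last exact: mulr_ge0.
    by apply: mulr_ge0 => //; exact: exprn_ge0.
  by rewrite lee_fin addr_ge0// addr_ge0.
rewrite lee_fin -addrA lerD2l; apply: le_trans (step_bound i w) _.
by rewrite /Q /inc; case: ifP => _; rewrite ?mulr0.
Qed.

Lemma stopped_bound N : f 0 = 0 -> (\int[P]_w (f (M N w))%:E <=
  (3 * B * eta + cst0 * \sum_(i < N) dl i)%:E)%E.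
Proof.
move=> f00.
have /le_trans : (\int[P]_w (f (M N w))%:E <= \int[P]_w (\sum_(i < N) Q i w)%:E)%E.
  rewrite ge0_integral_sum_ord//; elim: N => [|N IH].
    by rewrite big_ord0; under eq_integral do rewrite f00; rewrite integral0.
  rewrite big_ord_recr/=; apply: le_trans (stopped_step N) _.
  exact: leeD.
apply; apply: ge0_integral_le_cst => w; first by rewrite lee_fin sumr_ge0.
rewrite lee_fin big_split/= -!mulr_sumr lerD2r.
have [h _] := inc_sum_dead N w.
apply: le_trans (ler_wpM2l _ h) _; first by rewrite mulr_ge0.
by rewrite le_eqVlt; apply/orP; left; apply/eqP; field.
Qed.

Lemma measurable_stopped N : meas_fun (fun w => f (M N w)).
Proof. by apply: measurableT_comp => //; exact: mF (@mM N). Qed.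

Lemma most_discrete_stability N (r eps : R) : f 0 = 0 -> r < e ->
  (forall y, `|y| - r <= f y) ->
  3 * B * eta + cst0 * \sum_(i < N) dl i <= (e - r) * eps ->
  most P eta (fun w => err N w <= eta) -> most P eta (fun w => err' N w <= eta) ->
  most P (eta + eta + eps) (fun w => forall i, (i <= N)%N -> `|U i w - U' i w| < e).
Proof.
move=> f00 re fr le_eps m1 m2.
have m3 : most P eps (fun w => f (M N w) < e - r).
  apply: most_markov; rewrite ?subr_gt0//; first exact: measurable_stopped.
  apply: le_trans (stopped_bound N f00) _; by rewrite lee_fin.
apply: most_imp (most_and (most_and m1 m2) m3) => w [[h1 h2] h3] i iN.
rewrite ltNge; apply/negP => ei; move: h3; rewrite ltNge => /negP; apply.
by apply: le_trans (fr _); rewrite lerD2r; exact: stopped_exceeds iN ei h1 h2.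
Qed.
End stopped.

(** [kap] is chosen first; it determines the bound [B] of [f2], and [eta] and [lam] are then small
    compared with [1 / B]. Each of the three contributions to the mean of [f] is at most
    [e ^ 2 / 16], while Markov's inequality at level [e - e / 2] and probability [e / 2] allows
    [e ^ 2 / 4]. *)
Lemma discrete_stability (v t e : R) : 0 <= v -> 0 <= t -> 0 < e ->
  exists2 eta : R, 0 < eta & exists2 lam : R, 0 < lam &
  forall (P : probability T R) F V L mu dl K K' U U' N,
  @stability_data d T R P F V L mu dl K K' U U' -> 0 <= mu ->
  \sum_(i < N) dl i <= t -> L ^+ 3 * mu <= lam ->
  most P eta (fun w => coef_error v dl K U N w <= eta) ->
  most P eta (fun w => coef_error v dl K' U' N w <= eta) ->
  most P e (fun w => forall i, (i <= N)%N -> `|U i w - U' i w| < e).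
Proof.
move=> v0 t0 e0; pose kap := e ^+ 2 / (24 * (v * t + 1)).
have vt : 0 < v * t + 1 by rewrite ltr_wpDl// mulr_ge0.
have kap0 : 0 < kap by rewrite divr_gt0 ?exprn_gt0 ?mulr_gt0.
have e20 : 0 < e / 2 by rewrite divr_gt0.
have [f [f1 [f2 [B B0 [tf [mf mf2] [f00 f0] fr [f20 f2k f2B _]]]]]] :=
  yamada_watanabe_function kap0 e20.
pose eta := Num.min (e / 8) (e ^+ 2 / (48 * B)).
have eta0 : 0 < eta by rewrite lt_min !divr_gt0 ?mulr_gt0 ?exprn_gt0.
pose lam := e ^+ 2 / (192 * B * (t + 1)).
have t1 : 0 < t + 1 by rewrite ltr_wpDl.
have lam0 : 0 < lam.
  apply: divr_gt0; first exact: exprn_gt0.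
  apply: mulr_gt0; last exact: t1.
  by apply: mulr_gt0; [rewrite ltr0n|exact: B0].
exists eta => //; exists lam => // P F V L mu dl K K' U U' N sd mu0 sdl Llam m1 m2.
have C0 : 0 <= 3 * B by rewrite mulr_ge0// ltW.
have ee : e / 2 < e by rewrite ltr_pdivrMr// ltr_pMr// ltr1n.
have Lmu : 0 <= L ^+ 3 * mu.
  by rewrite mulr_ge0// exprn_ge0// (le_trans (normr_ge0 _) (sd_L sd 0%N point)).
have sdl0 : 0 <= \sum_(i < N) dl i by apply: sumr_ge0 => i _; exact: (sd_dl sd).
have := most_discrete_stability sd v0 (ltW eta0) mu0 tf C0 mf f0 f20 f2k f2B
  (N := N) (r := e / 2) (eps := e / 2) f00 ee fr _ m1 m2.
move=> /(_ _)/most_le; apply.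
- have : eta <= e / 8 by rewrite ge_min lexx.
  lra.
- have a1 : 3 * B * eta <= e ^+ 2 / 16.
    apply: le_trans (_ : 3 * B * (e ^+ 2 / (48 * B)) <= _).
      by rewrite ler_wpM2l// ge_min lexx orbT.
    by rewrite le_eqVlt; apply/orP; left; apply/eqP; field; rewrite gt_eqF.
  have e16 : 0 <= e ^+ 2 / 16 by rewrite divr_ge0// sqr_ge0.
  have a2 : 3 / 2 * v * kap * \sum_(i < N) dl i <= e ^+ 2 / 16.
    apply: le_trans (_ : 3 / 2 * v * kap * t <= _).
      by rewrite ler_wpM2l// mulr_ge0 ?(ltW kap0)// mulr_ge0.
    rewrite [leLHS](_ : _ = e ^+ 2 / 16 * (v * t / (v * t + 1))); last first.
      by rewrite /kap; field; rewrite gt_eqF.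
    by rewrite ler_piMr// ler_pdivrMr// mul1r lerDl.
  have a3 : 4 * (3 * B) * L ^+ 3 * mu * \sum_(i < N) dl i <= e ^+ 2 / 16.
    apply: le_trans (_ : 12 * B * lam * t <= _).
      rewrite [leLHS](_ : _ = 12 * B * (L ^+ 3 * mu) * \sum_(i < N) dl i); last by ring.
      apply: ler_pM => //; first by rewrite mulr_ge0// mulr_ge0// ltW.
      by rewrite ler_wpM2l// mulr_ge0// ltW.
    rewrite [leLHS](_ : _ = e ^+ 2 / 16 * (t / (t + 1))); last first.
      by rewrite /lam; field; rewrite !gt_eqF.
    by rewrite ler_piMr// ler_pdivrMr// mul1r lerDl.
  have -> : (e - e / 2) * (e / 2) = e ^+ 2 / 4 by field.
  apply: le_trans (_ : 3 * B * eta + (3 / 2 * v * kap * \sum_(i < N) dl i +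
    4 * (3 * B) * L ^+ 3 * mu * \sum_(i < N) dl i) <= _); first by rewrite -mulrDl.
  have := sqr_ge0 e; lra.
Qed.
End stability.

(** * Continuous paths on the half-line *)

Section continuous_path.
Context {R : realType}.
Implicit Types x y : R -> R.

(* Epsilon-delta form of [{within `[0, +oo[, continuous x}]. *)
Definition cpath x := forall s e : R, 0 <= s -> 0 < e ->
  exists2 dt : R, 0 < dt & forall s', 0 <= s' -> `|s' - s| < dt -> `|x s' - x s| < e.

Lemma cpathP x : {within `[0, +oo[, continuous x} <-> cpath x.
Proof.
split.
- move=> /subspace_continuousP cx s e s0 e0.
  have /(_ _)/cvgrPdist_lt/(_ _ e0) := cx s.
  rewrite /= in_itv/= s0 => /(_ isT).
  rewrite near_withinE => /nbhs_ballP[dt /= dt0 h]; exists dt => // s' s'0 ss'.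
  by rewrite distrC; apply: h; rewrite ?in_itv/= ?s'0// /ball/= distrC.
- move=> cx; apply/continuous_within_itvcyP; split.
  + move=> s; rewrite in_itv/= andbT => s0; apply/cvgrPdist_lt => e e0.
    have [dt dt0 h] := cx s e (ltW s0) e0.
    near=> s'; rewrite distrC; apply: h; last by rewrite distrC; near: s'; exact: (@nbhsx_ballx _ R^o).
    by apply: ltW; near: s'; exact: lt_nbhsr.
  + apply/cvgrPdist_lt => e e0; have [dt dt0 h] := cx 0 e (lexx 0) e0.
    near=> s'; rewrite distrC; apply: h; first by apply: ltW; near: s'; exact: nbhs_right_gt.
    have s0 : 0 < s' by near: s'; exact: nbhs_right_gt.
    by rewrite subr0 gtr0_norm//; near: s'; exact: nbhs_right_lt.
Unshelve. all: by end_near. Qed.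

Lemma cpathD x y : cpath x -> cpath y -> cpath (fun s => x s + y s).
Proof.
move=> cx cy s e s0 e0; have e20 : 0 < e / 2 by rewrite divr_gt0.
have [d1 d10 h1] := cx s _ s0 e20; have [d2 d20 h2] := cy s _ s0 e20.
exists (Num.min d1 d2) => [|s' s'0]; first by rewrite lt_min d10.
rewrite lt_min => /andP[/(h1 _ s'0) a /(h2 _ s'0) b].
rewrite (_ : _ - _ = (x s' - x s) + (y s' - y s)); last by ring.
by apply: le_lt_trans (ler_normD _ _) _; lra.
Qed.

Lemma cpathZ (c : R) x : cpath x -> cpath (fun s => c * x s).
Proof.
move=> cx s e s0 e0; have c0 : 0 < `|c| + 1 by rewrite ltr_wpDl.
have [d1 d10 h1] := cx s (e / (`|c| + 1)) s0 (divr_gt0 e0 c0).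
exists d1 => // s' s'0 /(h1 _ s'0); rewrite -mulrBr normrM ltr_pdivlMr// => h.
by apply: le_lt_trans h; rewrite mulrC ler_wpM2l// lerDl.
Qed.

Lemma cpath_id : cpath id.
Proof. by move=> s e _ e0; exists e. Qed.

Lemma cpath_sub x y : cpath x -> cpath y -> cpath (fun s => x s - y s).
Proof.
move=> cx cy; have := cpathD cx (cpathZ (-1) cy).
by congr cpath; apply/funext => s; rewrite mulN1r.
Qed.

Lemma cpath_min (a : R) x : cpath x -> cpath (fun s => x (Num.min a s)).
Proof.
move=> cx s e s0 e0; case: (leP a 0) => a0.
  exists 1 => // s' s'0 _; rewrite !min_l ?subrr ?normr0// (le_trans a0)//.
have as0 : 0 <= Num.min a s by rewrite le_min (ltW a0).
have [d1 d10 h1] := cx (Num.min a s) e as0 e0.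
exists d1 => // s' s'0 ss'; apply: h1; rewrite ?le_min ?(ltW a0)//.
apply: le_lt_trans ss'; rewrite /Num.min; case: ifPn; case: ifPn; rewrite -?leNgt => h1 h2 //.
- by rewrite subrr normr0.
- by rewrite ger0_norm ?ger0_norm; lra.
- by rewrite ler0_norm ?ler0_norm; lra.
Qed.

Lemma cpath_sum n (x : nat -> R -> R) :
  (forall i, (i < n)%N -> cpath (x i)) -> cpath (fun s => \sum_(i < n) x i s).
Proof.
elim: n => [_ s e s0 e0|n IH h].
  by exists 1 => // s' _ _; rewrite !big_ord0 subr0 normr0.
have := cpathD (IH (fun i h' => h i (ltnW h'))) (h n (ltnSn n)).
by congr cpath; apply/funext => s; rewrite big_ord_recr.
Qed.

(** Heine's theorem by a supremum: if the modulus exists on [[0, s]] for [s] close to [sup A],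
    continuity at [sup A] extends it beyond, so [sup A] is [t]. *)
Lemma cpath_uniform x (t e : R) : cpath x -> 0 <= t -> 0 < e ->
  exists2 dt : R, 0 < dt & forall s s', 0 <= s <= t -> 0 <= s' <= t ->
    `|s' - s| <= dt -> `|x s' - x s| <= e.
Proof.
move=> cx t0 e0.
pose G s := exists2 dt : R, 0 < dt & forall a b, 0 <= a <= s -> 0 <= b <= s ->
  `|b - a| <= dt -> `|x b - x a| <= e.
pose A := [set s | 0 <= s <= t /\ G s].
have A0 : A 0.
  split; first by rewrite lexx.
  exists 1 => // a b a0 b0 _; have -> : a = b by lra.
  by rewrite subrr normr0 ltW.
have hA : has_sup A by split; [exists 0|exists t => s [/andP[]]].
have ubA s : A s -> s <= sup A by exact: sup_ubound hA.2 _.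
have s0 : 0 <= sup A by exact: ubA.
have st : sup A <= t by apply: ge_sup; [exists 0|move=> s [/andP[]]].
have e20 : 0 < e / 2 by rewrite divr_gt0.
have [dt dt0 hd] := cx _ _ s0 e20.
have [s [s0t [d1 d10 h1]] ss] : exists2 s, A s & sup A - dt / 2 < s.
  by apply: sup_adherent => //; rewrite divr_gt0.
pose s' := Num.min (sup A + dt / 2) t.
have Gs' : G s'.
  exists (Num.min d1 (dt / 2)); first by rewrite lt_min d10 divr_gt0.
  move=> a b /andP[a0 as'] /andP[b0 bs']; rewrite le_min => /andP[abd abdt].
  have s'd : s' <= sup A + dt / 2 by rewrite ge_min lexx.
  have key : s < a \/ s < b -> `|x b - x a| <= e.
    move: abdt; rewrite ler_norml => /andP[ab1 ab2] sab.
    have ha : `|a - sup A| < dt by rewrite ltr_norml; case: sab => ?; lra.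
    have hb : `|b - sup A| < dt by rewrite ltr_norml; case: sab => ?; lra.
    have := hd _ a0 ha; have := hd _ b0 hb.
    rewrite (_ : x b - x a = (x b - x (sup A)) - (x a - x (sup A))); last by ring.
    by move=> q1 q2; apply: le_trans (ler_normB _ _) _; lra.
  have [sa|sa] := leP a s; last by apply: key; left.
  have [sb|sb] := leP b s; last by apply: key; right.
  by apply: h1; rewrite ?a0 ?b0.
have s'0 : 0 <= s' by rewrite le_min t0 addr_ge0// ltW// divr_gt0.
have As' : A s' by split=> //; rewrite s'0 ge_min lexx orbT.
have := ubA _ As'; rewrite ge_min => /orP[|ts].
  by rewrite gerDl leNgt divr_gt0.
move: Gs' => [d2 d20 h2]; exists d2 => // a b a0 b0; apply: h2.
- by rewrite /s' min_r//; lra.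
- by rewrite /s' min_r//; lra.
Qed.
End continuous_path.

(** * Subdivisions adapted to given times *)

Section grid.
Context {R : realType}.

(* A subdivision of [0, t], constant from rank [N] on, whose cells contain no
   point of [ts] in their interior. *)
Definition grid (t : R) (ts : seq R) (mesh : R) (p : nat -> R) (N : nat) :=
  [/\ p 0%N = 0, p N = t, forall i, p i <= p i.+1 <= t, forall i, p i.+1 - p i <= mesh &
      forall i x, x \in ts -> x <= p i \/ p i.+1 <= x].

Lemma grid_le t ts m m' p N ts' : m <= m' -> {subset ts' <= ts} ->
  grid t ts m p N -> grid t ts' m' p N.
Proof.
move=> mm sub [h1 h2 h3 h4 h5]; split=> // [i|i x /sub]; last exact: h5.
by apply: le_trans mm; exact: h4.
Qed.

Lemma grid_mono t ts m p N i j : grid t ts m p N -> (i <= j)%N -> p i <= p j.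
Proof.
move=> [_ _ h _ _] ij; rewrite -(subnKC ij); elim: (j - i)%N => [|k IH].
  by rewrite addn0.
by apply: le_trans IH _; rewrite addnS; have /andP[] := h (i + k)%N.
Qed.

Lemma grid_ge0 t ts m p N i : grid t ts m p N -> 0 <= p i.
Proof. by move=> g; have := grid_mono g (leq0n i); case: g => ->. Qed.

Lemma grid_le_t t ts m p N i : grid t ts m p N -> p i <= t.
Proof. by case=> _ _ h _ _; have /andP[] := h i; exact: le_trans. Qed.

Lemma grid_sum t ts m p N : grid t ts m p N -> \sum_(i < N) (p i.+1 - p i) = t.
Proof.
move=> [p0 pN _ _ _]; rewrite -(big_mkord xpredT (fun i => p i.+1 - p i)).
by rewrite telescope_sumr// p0 pN subr0.
Qed.

Lemma grid_near t ts m p N s : grid t ts m p N -> 0 <= s <= t -> 0 <= m ->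
  exists2 i, (i <= N)%N & p i <= s <= p i + m.
Proof.
move=> g /andP[s0 st] m0; have [p0 pN h1 h2 _] := g.
have [|j sj jmin] := @ex_minnP (fun j => s <= p j); first by exists N; rewrite pN.
have jN : (j <= N)%N by apply: jmin; rewrite pN.
case: j => [|j] in sj jmin jN *.
  by exists 0%N => //; rewrite p0 add0r s0; move: sj; rewrite p0; lra.
exists j; first exact: ltnW.
have js : p j < s by rewrite ltNge; apply/negP => /jmin; rewrite ltnn.
by rewrite (ltW js)/=; have := h2 j; lra.
Qed.

Lemma grid_exists (t : R) (ts : seq R) (mesh : R) : 0 <= t -> 0 < mesh ->
  exists p N, grid t ts mesh p N.
Proof.
move=> t0 m0; pose n := (Num.truncn (t / mesh)).+1.
have n0 : 0 < n%:R :> R by rewrite ltr0n.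
have tn : t / n%:R <= mesh.
  rewrite ler_pdivrMr// mulrC -ler_pdivrMr//.
  by have /andP[_ /ltW] := truncn_itv (divr_ge0 t0 (ltW m0)).
pose l := sort <=%R ([seq x <- ts | 0 <= x <= t] ++ [seq t * k%:R / n%:R | k <- iota 0 n.+1]).
have lP x : x \in l -> 0 <= x <= t.
  rewrite mem_sort mem_cat => /orP[|/mapP[k]].
    by rewrite mem_filter => /andP[].
  rewrite mem_iota add0n ltnS => /andP[_ kn] ->.
  rewrite divr_ge0 ?mulr_ge0 ?(ltW n0)//= ler_pdivrMr// ler_wpM2l// ler_nat//.
have kl k : (k <= n)%N -> t * k%:R / n%:R \in l.
  move=> kn; rewrite mem_sort mem_cat; apply/orP; right; apply/mapP; exists k => //.
  by rewrite mem_iota.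
have sl : sorted <=%R l by apply: sort_sorted => x y; exact: le_total.
(* The default value [t] makes [p] constant from rank [size l] on. *)
pose p i := nth t l i.
have pt i : 0 <= p i <= t.
  have [il|il] := ltnP i (size l); first by apply: lP; exact: mem_nth.
  by rewrite /p nth_default// t0 lexx.
have mono i j : (i <= j)%N -> p i <= p j.
  move=> ij; have [jl|jl] := ltnP j (size l).
    apply: (sorted_leq_nth le_trans lexx) => //; rewrite inE//.
    exact: leq_ltn_trans jl.
  by rewrite [p j]nth_default//; have /andP[] := pt i.
have between i x : x \in l -> x <= p i \/ p i.+1 <= x.
  move=> xl; pose j := index x l; have -> : x = p j by rewrite /p nth_index.
  by case: (leqP j i) => ji; [left|right]; exact: mono.
have p0 : p 0%N = 0.
  apply/eqP; rewrite eq_le; have /andP[-> _] := pt 0%N; rewrite andbT.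
  have : 0 \in l by have := kl 0%N (leq0n _); rewrite mulr0 mul0r.
  by move=> h; have := mono 0%N (index 0 l) (leq0n _); rewrite {2}/p nth_index.
exists p, (size l); split=> //.
- by rewrite /p nth_default.
- by move=> i; rewrite mono//=; case/andP: (pt i.+1).
- move=> i; rewrite leNgt; apply/negP => big.
  have /andP[pi0 _] := pt i; have /andP[_ pi1] := pt i.+1.
  have ex : exists k, p i < t * k%:R / n%:R.
    by exists n; rewrite mulfK ?gt_eqF//; lra.
  have [[|k] hk kmin] := ex_minnP ex.
    by move: hk; rewrite mulr0 mul0r ltNge pi0.
  have kn : (k < n)%N.
    by apply: kmin; rewrite mulfK ?gt_eqF//; lra.
  have hk' : t * k%:R / n%:R <= p i by rewrite leNgt; apply/negP => /kmin; rewrite ltnn.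
  have e : t * k.+1%:R / n%:R = t * k%:R / n%:R + t / n%:R.
    by rewrite -natr1; field; rewrite gt_eqF.
  have [h|h] := between i _ (kl k.+1 kn); lra.
- move=> i x xts; have [x0|x0] := ltP x 0.
    by left; case/andP: (pt i) => + _; lra.
  have [xt|xt] := leP x t; last by right; case/andP: (pt i.+1) => _; lra.
  by apply: between; rewrite mem_sort mem_cat mem_filter x0 xt xts.
Qed.
End grid.

(** * Simple processes and their integrals along grids *)

Section simple_processes.
Context {d} {T : measurableType d} {R : realType} (P : probability T R).
Variables (F : R -> set_system T) (W : R -> T -> R).
Hypothesis wW : wiener_process P F W.
Implicit Type S : simple_process R T.

Definition times S : seq R := [seq sp_time S i | i <- iota 0 (sp_size S).+1].

(** A candidate solution with drift [m] and diffusion integrand [S]. Euler schemes and the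
    approximations of an arbitrary solution both have this form, so one stability statement serves
    for all comparisons. *)
Definition drifted (m : R) (V : R -> T -> R) S (t : R) (w : T) := m * t + simple_integral S V t w.

Lemma times_mem S i : (i <= sp_size S)%N -> sp_time S i \in times S.
Proof. by move=> iS; rewrite map_f// mem_iota. Qed.

(** [S] is constant on the cell, which is open on the left: its value is read at the right end [q],
    although it is known at time [p]. *)
Lemma simple_integral_step S (p q : R) w : simple_predictable F S -> p <= q ->
  (forall x, x \in times S -> x <= p \/ q <= x) ->
  simple_integral S W q w - simple_integral S W p w =
    simple_value S q w * (W q w - W p w).
Proof.
move=> [_ mono _ _] pq between; have [->|pnq] := eqVneq p q; first by rewrite !subrr mulr0.
have {}pq : p < q by rewrite lt_neqAle pnq.
rewrite /simple_integral /simple_value -sumrB mulr_suml; apply: eq_bigr => i _.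
have ab := mono i (ltn_ord i).
rewrite -mulrBr -mulrA; congr (_ * _); rewrite indicE.
have [h1|h1] := between _ (times_mem (ltn_ord i : (i.+1 <= sp_size S)%N)).
  rewrite !min_l; [|lra..].
  by rewrite memNset ?mul0r ?subrr//= in_itv/= => /andP[_]; rewrite leNgt (le_lt_trans h1 pq).
have [h2|h2] := between _ (times_mem (ltnW (ltn_ord i))); last first.
  rewrite !min_r; [|lra..].
  by rewrite memNset ?mul0r ?subrr//= in_itv/= => /andP[+ _]; rewrite ltNge h2.
rewrite mem_set ?mul1r/= ?in_itv/= ?h1 ?(le_lt_trans h2 pq)//.
by rewrite !(min_r (_ : _ <= sp_time S i.+1)) ?(min_l h2) ?(min_l (le_trans h2 (ltW pq)))//; [ring|lra].
Qed.

Lemma simple_integral0 S w : simple_predictable F S -> simple_integral S W 0 w = 0.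
Proof.
move=> [t0 mono _ _]; apply: big1 => i _.
have ti j : (j <= sp_size S)%N -> 0 <= sp_time S j.
  elim: j => [//|j IH] jS; apply: le_trans (IH (ltnW jS)) _.
  by apply: ltW; exact: mono.
by rewrite !min_r ?subrr ?mulr0// ti// ltnW.
Qed.

Lemma predictable_time_ge0 S i : simple_predictable F S -> (i <= sp_size S)%N -> 0 <= sp_time S i.
Proof.
move=> [t0 mono _ _]; elim: i => [//|i IH] iS; apply: le_trans (IH (ltnW iS)) _.
by apply: ltW; exact: mono.
Qed.

Lemma coef_meas_wrt S i (p : R) : simple_predictable F S -> (i < sp_size S)%N ->
  sp_time S i <= p -> meas_wrt (F p) (sp_coef S i).
Proof.
move=> pS iS ip; have i0 := predictable_time_ge0 pS (ltnW iS).
apply: (meas_wrt_mono wW i0 ip); apply/meas_wrtP.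
  exact: filtration_sub wW _ i0.
by case: pS => _ _ h _; exact: h.
Qed.

Lemma simple_value_meas_wrt S (p q : R) : simple_predictable F S -> 0 <= p -> p <= q ->
  (forall x, x \in times S -> x <= p \/ q <= x) ->
  meas_wrt (F p) (simple_value S q).
Proof.
move=> pS p0 pq between; apply: measurable_sum => i; rewrite indicE.
case: (boolP (q \in _)) => [/set_mem/=|_]; last first.
  by under eq_fun do rewrite mulr0; exact: measurable_cst.
rewrite in_itv/= => /andP[iq _]; under eq_fun do rewrite mulr1.
apply: coef_meas_wrt => //.
by case: (between _ (times_mem (ltnW (ltn_ord i)))) => //; rewrite leNgt iq.
Qed.

Lemma simple_value_bounded S : simple_predictable F S ->
  exists2 B : R, 0 <= B & forall q w, `|simple_value S q w| <= B.
Proof.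
move=> [_ _ _ [M hM]]; exists ((sp_size S)%:R * `|M|); first by rewrite mulr_ge0.
move=> q w; apply: le_trans (ler_norm_sum _ _ _) _.
apply: le_trans (_ : \sum_(i < sp_size S) `|M| <= _); last first.
  by rewrite sumr_const card_ord mulr_natl.
apply: ler_sum => i _; rewrite normrM.
apply: le_trans (_ : `|sp_coef S i w| * 1 <= _).
  by rewrite ler_wpM2l// indicE; case: (_ \in _); rewrite ?normr1 ?normr0.
by rewrite mulr1; apply: le_trans (hM i w (ltn_ord i)) _; exact: ler_norm.
Qed.

Lemma simple_integral_meas_wrt S (t : R) : simple_predictable F S -> 0 <= t ->
  meas_wrt (F t) (simple_integral S W t).
Proof.
move=> pS t0; apply: measurable_sum => i.
have i0 := predictable_time_ge0 pS (ltnW (ltn_ord i)).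
have i10 := predictable_time_ge0 pS (ltn_ord i).
have [it|] := boolP (sp_time S i <= t).
  have mW (s : R) : 0 <= s -> meas_wrt (F t) (W (Num.min s t)).
    move=> s0; apply: (meas_wrt_mono wW (s := Num.min s t)).
    - by rewrite le_min s0.
    - by rewrite ge_min lexx orbT.
    - by apply: wiener_meas_wrt wW _ _; rewrite le_min s0.
  have mc : meas_wrt (F t) (sp_coef S i) by exact: coef_meas_wrt.
  have m1 : meas_wrt (F t) (W (Num.min (sp_time S i.+1) t)) := mW _ i10.
  have m0 : meas_wrt (F t) (W (Num.min (sp_time S i) t)) := mW _ i0.
  exact: (measurable_funM mc (measurable_funB m1 m0)).
rewrite -ltNge => ti; have tt : t <= sp_time S i.+1.
  by case: pS => _ /(_ i (ltn_ord i)) + _ _; lra.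
under eq_fun do rewrite (min_r tt) (min_r (ltW ti)) subrr mulr0.
exact: measurable_cst.
Qed.

Lemma drifted_meas_wrt m S (t : R) : simple_predictable F S -> 0 <= t ->
  meas_wrt (F t) (drifted m W S t).
Proof. by move=> pS t0; apply: measurable_funD => //; exact: simple_integral_meas_wrt. Qed.

Lemma cpath_drifted m S w : cpath (fun t => drifted m W S t w).
Proof.
have cW : cpath (W^~ w) by apply/cpathP; case: wW.
apply: cpathD; first exact: cpathZ cpath_id.
apply: (cpath_sum (x := fun i s => sp_coef S i w *
  (W (Num.min (sp_time S i.+1) s) w - W (Num.min (sp_time S i) s) w))) => i _.
by apply: cpathZ; apply: cpath_sub; exact: (cpath_min _ cW).
Qed.

(** The third absolute moment of an increment over a cell is of order the length to the power 3/2,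
    at most [sqrt mesh] times the length; hence the value of [mu]. *)
Lemma grid_stability_data m t S S' mesh p N : 0 <= mesh ->
  simple_predictable F S -> simple_predictable F S' ->
  grid t (times S ++ times S') mesh p N ->
  exists2 L, 0 <= L & stability_data P (F \o p) (fun i w => W (p i.+1) w - W (p i) w) L (Num.sqrt mesh)
    (fun i => p i.+1 - p i) (fun i => simple_value S (p i.+1)) (fun i => simple_value S' (p i.+1))
    (fun i => drifted m W S (p i)) (fun i => drifted m W S' (p i)).
Proof.
move=> mesh0 pS pS' g; have [B B0 hB] := simple_value_bounded pS.
have [B' B'0 hB'] := simple_value_bounded pS'.
have [_ _ h1 h2 h3] := g.
have p0 i : 0 <= p i := grid_ge0 i g.
have pp i : p i <= p i.+1 by case/andP: (h1 i).
have b1 i x : x \in times S -> x <= p i \/ p i.+1 <= x.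
  by move=> xS; apply: h3; rewrite mem_cat xS.
have b2 i x : x \in times S' -> x <= p i \/ p i.+1 <= x.
  by move=> xS; apply: h3; rewrite mem_cat xS orbT.
exists (B + B'); first exact: addr_ge0.
split.
- by move=> i; exact: (filtration_sub wW (p0 i)).
- by move=> i; exact: (filtration_mono wW (p0 i) (pp i)).
- by move=> i; rewrite subr_ge0.
- by move=> i; exact: (increment_indep wW (p0 i) (pp i)).
- by move=> i; exact: (increment_meas_wrt wW (p0 i) (pp i)).
- by move=> i; exact: (increment_centered wW (p0 i) (pp i)).
- move=> i k; apply: le_trans (increment_cubic_rem wW k (p0 i) (pp i)) _.
  rewrite lee_fin ler_wpM2l ?mulr_ge0 ?exprn_ge0// exprSr sqr_sqrtr ?subr_ge0// mulrC.
  by rewrite ler_wpM2r ?subr_ge0// ler_wsqrtr.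
- by move=> i; apply: simple_value_meas_wrt => //; exact: b1.
- by move=> i; apply: simple_value_meas_wrt => //; exact: b2.
- by move=> i; exact: drifted_meas_wrt.
- by move=> i; exact: drifted_meas_wrt.
- by move=> i w; apply: le_trans (ler_normB _ _) _; exact: lerD.
- by move=> w; case: g => p00 _ _ _ _; rewrite p00 /drifted !simple_integral0.
- move=> i w; have := simple_integral_step w pS (pp i) (b1 i).
  have := simple_integral_step w pS' (pp i) (b2 i).
  by rewrite /drifted mulrBl; lra.
Qed.

(* The discretization of [S] on every fine grid is close, in the sense of
   [coef_error], to the coefficient of the equation. *)
Definition near_solution (m v t : R) S (eta : R) := exists2 mesh : R, 0 < mesh &
  forall p N, grid t (times S) mesh p N ->
  most P eta (fun w => coef_error v (fun i => p i.+1 - p i)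
    (fun i => simple_value S (p i.+1)) (fun i => drifted m W S (p i)) N w <= eta).
End simple_processes.

Section stability_sup.
Context {R : realType}.

(** [discrete_stability] applies along a grid refining the times of both processes. The bound [L] on
    the coefficients depends on [S] and [S'], but the mesh is chosen afterwards so that
    [L ^ 3 * sqrt mesh <= lam]. Letting the mesh tend to 0 with [most_io], continuity of the paths
    carries the estimate from grid points to all of [[0, t]]. *)
Lemma stability_sup (m v t e : R) : 0 <= v -> 0 <= t -> 0 < e ->
  forall d (T : measurableType d), exists2 eta : R, 0 < eta &
  forall (P : probability T R) F W S S', wiener_process P F W ->
  simple_predictable F S -> simple_predictable F S' ->
  near_solution P W m v t S eta -> near_solution P W m v t S' eta ->
  most P e (fun w => forall s, 0 <= s <= t -> `|drifted m W S s w - drifted m W S' s w| <= e).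
Proof.
move=> v0 t0 e0 d T.
have [eta eta0 [lam lam0 H]] := @discrete_stability d T R v t e v0 t0 e0.
exists eta => // P F W S S' wW pS pS' [m1 m10 h1] [m2 m20 h2].
have key (mesh0 : R) : 0 < mesh0 -> most P e (fun w => exists p N mesh,
    [/\ 0 < mesh, mesh <= mesh0, grid t (times S ++ times S') mesh p N &
    forall i, (i <= N)%N -> `|drifted m W S (p i) w - drifted m W S' (p i) w| < e]).
  move=> mesh00.
  have [B B0 hB] := simple_value_bounded pS.
  have [B' B'0 hB'] := simple_value_bounded pS'.
  pose L := B + B'; have L0 : 0 <= L by exact: addr_ge0.
  pose m3 := (lam / (L ^+ 3 + 1)) ^+ 2.
  have L1 : 0 < L ^+ 3 + 1 by rewrite ltr_wpDl// exprn_ge0.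
  have m30 : 0 < m3 by rewrite exprn_gt0// divr_gt0.
  pose mesh := Num.min (Num.min m1 m2) (Num.min m3 mesh0).
  have mesh_gt0 : 0 < mesh by rewrite !lt_min m10 m20 m30.
  have [p [N g]] := grid_exists (times S ++ times S') t0 mesh_gt0.
  have g1 : grid t (times S) m1 p N.
    apply: grid_le g; first by rewrite !ge_min lexx.
    by move=> x xS; rewrite mem_cat xS.
  have g2 : grid t (times S') m2 p N.
    apply: grid_le g; first by rewrite !ge_min lexx !orbT.
    by move=> x xS; rewrite mem_cat xS orbT.
  have [L' L'0 sd] := grid_stability_data wW m (ltW mesh_gt0) pS pS' g.
  have sd' : stability_data P (F \o p) (fun i w => W (p i.+1) w - W (p i) w) L (Num.sqrt mesh)
    (fun i => p i.+1 - p i) (fun i => simple_value S (p i.+1)) (fun i => simple_value S' (p i.+1))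
    (fun i => drifted m W S (p i)) (fun i => drifted m W S' (p i)).
    case: sd => *; split => // i w; apply: le_trans (ler_normB _ _) _; exact: lerD.
  have sq : L ^+ 3 * Num.sqrt mesh <= lam.
    have hm : Num.sqrt mesh <= lam / (L ^+ 3 + 1).
      rewrite -[leRHS]gtr0_norm ?divr_gt0// -sqrtr_sqr ler_wsqrtr//.
      by rewrite !ge_min lexx !orbT.
    apply: le_trans (ler_wpM2l _ hm) _; first exact: exprn_ge0.
    by rewrite mulrCA ler_piMr ?(ltW lam0)// ler_pdivrMr// mul1r lerDl.
  have := H P _ _ L _ _ _ _ _ _ N sd' (sqrtr_ge0 _) _ sq (h1 _ _ g1) (h2 _ _ g2).
  rewrite (grid_sum g) lexx => /(_ isT); apply: most_imp => w hw.
  exists p, N, mesh; split=> //.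
  by rewrite !ge_min lexx !orbT.
have inv0 (k : nat) : 0 < k.+1%:R^-1 :> R by rewrite invr_gt0.
have := most_io (fun k : nat => key k.+1%:R^-1 (inv0 k)).
apply: most_imp => w hw s st; rewrite leNgt; apply/negP => es.
have /andP[s0 _] := st.
have cD : cpath (fun s => drifted m W S s w - drifted m W S' s w).
  by apply: cpath_sub; exact: (cpath_drifted wW).
rewrite -subr_gt0 in es.
have [dt dt0 hd] := cD s _ s0 es.
have [k] := ltr_add_invr dt0; rewrite add0r => kdt.
have [k' kk' [p [N [mesh [mesh0 meshk g hp]]]]] := hw k.
have [i iN /andP[pis spi]] := grid_near g st (ltW mesh0).
have := hd (p i) (grid_ge0 i g); rewrite ler0_norm ?subr_le0// opprB.
have lk : k'.+1%:R^-1 <= k.+1%:R^-1 :> R by rewrite lef_pV2 ?posrE// ler_nat.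
have {}meshk : mesh <= k.+1%:R^-1 by exact: le_trans lk.
have spd : s - p i < dt.
  by apply: le_lt_trans kdt; apply: le_trans meshk; rewrite lerBlDl.
move=> /(_ spd).
have := hp i iN.
set a := drifted m W S (p i) w - _; set b := drifted m W S s w - _.
have := ler_dist_dist b a; rewrite (distrC a b) ler_norml => /andP[_]; lra.
Qed.
End stability_sup.

(** * Measurability of functionals of continuous processes *)

Section path_measurability.
Context {R : realType}.

Lemma measurable_truncn : measurable_fun [set: R] (@Num.truncn R).
Proof.
have mge k : measurable [set x : R | (k <= Num.truncn x)%N].
  case: k => [|k]; first by rewrite (_ : [set _ | _] = setT)//; apply/seteqP; split.
  rewrite (_ : [set _ | _] = `[k.+1%:R, +oo[%classic)//.
  by apply/seteqP; split => x /=; rewrite in_itv/= andbT truncn_gt_nat.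
move=> _ B _; rewrite setTI.
rewrite (_ : _ @^-1` B = \bigcup_(k in B)
    ([set x : R | (k <= Num.truncn x)%N] `\` [set x : R | (k.+1 <= Num.truncn x)%N])).
  by apply: bigcup_measurable => k _; exact: measurableD.
apply/seteqP; split => [x Bx|x [k Bk []/= h1 /negP]].
  by exists (Num.truncn x) => //; split => //=; rewrite ltnn.
by rewrite -leqNgt => h2; have -> : Num.truncn x = k by apply/eqP; rewrite eqn_leq h1 h2.
Qed.

Lemma truncn_approx (x : R) (n : nat) : 0 <= x ->
  `|(Num.truncn (n.+1%:R * x))%:R / n.+1%:R - x| <= n.+1%:R^-1.
Proof.
move=> x0; have n0 : 0 < n.+1%:R :> R by [].
have /andP[h1 h2] := truncn_itv (mulr_ge0 (ltW n0) x0).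
rewrite -(ler_pM2r n0) mulVf ?gt_eqF// -[X in _ * X <= _](gtr0_norm n0) -normrM.
rewrite mulrBl divfK ?gt_eqF// [x * _]mulrC ler_norml; move: h1 h2; rewrite -[(Num.truncn _).+1%:R]natr1.
set a := (Num.truncn _)%:R; set b := _ * x; clear -a b; move=> h1 h2; lra.
Qed.

Lemma cpath_continuous x : cpath x -> continuous (fun s : R => x (Num.max 0 s)).
Proof.
move=> cx s; apply/cvgrPdist_lt => u u0.
have m0 s1 : 0 <= Num.max 0 s1 :> R by rewrite le_max lexx.
have [dt dt0 h] := cx (Num.max 0 s) u (m0 s) u0.
near=> s'; rewrite distrC; apply: h => //.
apply: le_lt_trans (_ : `|s' - s| < dt).
  by have := max0_lipschitz s' s; rewrite ![Num.max _ 0]maxC.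
by rewrite distrC; near: s'; exact: (@nbhsx_ballx _ R^o).
Unshelve. all: by end_near. Qed.

Lemma cpath_bounded x (t : R) : cpath x -> 0 <= t -> exists M : R, forall s, 0 <= s <= t -> `|x s| <= M.
Proof.
move=> cx t0; have cx' := cpath_continuous cx.
have cn : {within `[0, t], continuous (fun s : R => `|x (Num.max 0 s)|)}.
  apply: continuous_subspaceT => s; apply: continuous_comp; [exact: cx'|exact: norm_continuous].
have [c _ h] := EVT_max t0 cn.
exists `|x (Num.max 0 c)| => s /andP[s0 st]; have := h s; rewrite in_itv/= s0 st => /(_ isT).
by rewrite (max_r s0).
Qed.

Context {d} {T : measurableType d}.

(** The process is the pointwise limit of its values at the times rounded down to multiples of
    [1 / n.+1], each of which is a countable gluing of the [X (k / n.+1)]. *)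
Lemma measurable_process (X : R -> T -> R) :
  (forall s, 0 <= s -> meas_fun (X s)) -> (forall w, cpath (X^~ w)) ->
  meas_fun (fun z : T * R => X (Num.max 0 z.2) z.1).
Proof.
move=> mX cX; have m0 (s : R) : 0 <= Num.max 0 s by rewrite le_max lexx.
apply: (@measurable_fun_cvg _ _ _ setT (fun n (z : T * R) =>
    X ((Num.truncn (n.+1%:R * Num.max 0 z.2))%:R / n.+1%:R) z.1)).
- move=> n; apply: (meas_countable_index
    (N := fun z : T * R => Num.truncn (n.+1%:R * Num.max 0 z.2))
    (g := fun k (z : T * R) => X (k%:R / n.+1%:R) z.1)).
    apply: measurableT_comp; first exact: measurable_truncn.
    apply: measurable_funM => //; apply: measurable_maxr => //.
  by move=> k; apply: measurableT_comp => //; apply: mX; rewrite divr_ge0.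
- move=> z _; apply/cvgrPdist_lt => e e0.
  have [dt dt0 h] := cX z.1 (Num.max 0 z.2) e (m0 _) e0.
  have [k] := ltr_add_invr dt0; rewrite add0r => kdt.
  exists k => // n /= kn; rewrite distrC; apply: h; first by rewrite divr_ge0.
  apply: le_lt_trans (truncn_approx n (m0 _)) _; apply: le_lt_trans kdt.
  by rewrite lef_pV2 ?posrE// ler_nat.
Qed.

(** By continuity the exceedance is seen, up to [1 / k.+1], at countably many times; conversely a
    continuous path attains its maximum on [[0, t]], which is then at least [e]. *)
Lemma measurable_exceed (X : R -> T -> R) (t e : R) : 0 <= t ->
  (forall s, 0 <= s -> meas_fun (X s)) -> (forall w, cpath (X^~ w)) ->
  measurable [set w | exists2 s : R, 0 <= s <= t & e <= `|X s w|].
Proof.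
move=> t0 mX cX.
pose q (j l : nat) : R := Num.min t (j%:R / l.+1%:R).
have q0 j l : 0 <= q j l by rewrite le_min t0 divr_ge0.
have qt j l : q j l <= t by rewrite ge_min lexx.
rewrite (_ : [set w | _] = \bigcap_(k : nat) \bigcup_j \bigcup_l
    [set w | e - k.+1%:R^-1 < `|X (q j l) w|]).
  apply: bigcapT_measurable => k; apply: bigcupT_measurable => j.
  apply: bigcupT_measurable => l.
  have mX' : meas_fun (fun w => `|X (q j l) w|) by apply: measurableT_comp => //; exact: mX.
  rewrite (_ : [set w | _] = (fun w => `|X (q j l) w|) @^-1` `]e - k.+1%:R^-1, +oo[).
    by rewrite -[X in measurable X]setTI; apply: mX' => //; exact: measurable_itv.
  by apply/seteqP; split => w /=; rewrite in_itv/= andbT.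
apply/seteqP; split => w.
- move=> [s /andP[s0 st] es] k _.
  have k0 : 0 < k.+1%:R^-1 :> R by rewrite invr_gt0.
  have [dt dt0 h] := cX w s _ s0 k0.
  have [l] := ltr_add_invr dt0; rewrite add0r => ldt.
  exists (Num.truncn (l.+1%:R * s)) => //; exists l => //=.
  have := truncn_approx l s0; rewrite -/(q _ _) => ha.
  have a0 : `|q (Num.truncn (l.+1%:R * s)) l - s| < dt.
    apply: le_lt_trans ldt; apply: le_trans ha.
    have : (Num.truncn (l.+1%:R * s))%:R / l.+1%:R <= s.
      by rewrite ler_pdivrMr// mulrC truncn_le mulr_ge0.
    by rewrite /q => h2; rewrite min_r// (le_trans h2).
  have hb := h _ (q0 _ _) a0; have := ler_dist_dist (X (q (Num.truncn (l.+1%:R * s)) l) w) (X s w).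
  rewrite ler_norml => /andP[hc _]; move: hb hc es; rewrite -!/(q _ _).
  set a := `|X (q _ _) w|; set b := `|X s w|; set kk := k.+1%:R^-1 => /= ? ? ?; lra.
- move=> hw /=.
  have cn : {within `[0, t], continuous (fun s : R => `|X (Num.max 0 s) w|)}.
    apply: continuous_subspaceT => s; apply: continuous_comp; last exact: norm_continuous.
    exact: (cpath_continuous (cX w)).
  have [c ct hc] := EVT_max t0 cn; move: ct; rewrite in_itv/= => /andP[c0 ct].
  exists c; first by rewrite c0.
  apply/ler_addgt0Pr => u u0; have [k] := ltr_add_invr u0; rewrite add0r => ku.
  have [j _ [l _ /= hjl]] := hw k I.
  have := hc (q j l); rewrite in_itv/= q0 qt !max_r// => /(_ isT); move: hjl ku; set kk := k.+1%:R^-1 => ? ? ?; lra.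
Qed.

Lemma measurable_coef_int (S : simple_process R T) (X : R -> T -> R) (v t : R) :
  (forall i, (i < sp_size S)%N -> meas_fun (sp_coef S i)) ->
  (forall s, 0 <= s -> meas_fun (X s)) -> (forall w, cpath (X^~ w)) ->
  meas_fun (fun w => \int[lebesgue_measure]_(s in `[0%R, t])
     ((simple_value S s w - diffusion_coef v (X s w)) ^+ 2)%:E)%E.
Proof.
move=> mS mX cX.
pose h (z : T * R) : \bar R := (\1_(`[0, t]%classic : set R) z.2 *
  (simple_value S z.2 z.1 - diffusion_coef v (X (Num.max 0 z.2) z.1)) ^+ 2)%:E.
have mind (A : set R) : measurable A -> meas_fun (fun z : T * R => \1_A z.2 : R).
  by move=> mA; apply: (@measurableT_comp _ _ _ _ (measurableTypeR R) _ (\1_A : R -> R)) => //; exact: measurable_indic.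
have mh : meas_fun h.
  apply/measurable_EFinP; apply: measurable_funM; first exact: mind.
  apply: measurable_funX; apply: measurable_funB.
    apply: measurable_sum => i; apply: measurable_funM; last exact: mind.
    by apply: measurableT_comp => //; exact: mS.
  apply: measurableT_comp; first exact: measurable_diffusion_coef.
  exact: measurable_process.
have h0 z : (0 <= h z)%E by rewrite lee_fin mulr_ge0// ?indicE// sqr_ge0.
have := @measurable_fun_fubini_tonelli_F _ _ T (measurableTypeR R) R (@lebesgue_measure R) h mh h0.
apply: eq_measurable_fun => w _; rewrite /fubini_F [RHS]integral_mkcond.
apply: eq_integral => s _; rewrite /h patchE indicE; case: ifPn => [st|_]; last by rewrite mul0r.
by rewrite mul1r max_r//; move: st; rewrite inE/= in_itv/= => /andP[].
Qed.

End path_measurability.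

(** * Solutions as limits of simple processes *)

Section solutions.
Context {R : realType}.

(** On a cell [S] is constant and [X] stays within [c'] of the grid value, so the squared error at
    the grid point is at most [2 * (S - sigma (X)) ^ 2 + 2 * v * c'] at every time of the cell;
    integration gives the sum over the grid. *)
Lemma riemann_coef_error d (T : measurableType d) (S : simple_process R T) (W X : R -> T -> R)
    m v t mesh p N (w : T) (c c' : R) :
  0 <= v -> 0 <= t -> grid t (times S) mesh p N -> cpath (X^~ w) ->
  (\int[lebesgue_measure]_(s in `[0%R, t]) ((simple_value S s w - diffusion_coef v (X s w)) ^+ 2)%:E < c%:E)%E ->
  (forall i s, p i <= s <= p i.+1 -> `|X s w - drifted m W S (p i) w| <= c') ->
  coef_error v (fun i => p i.+1 - p i) (fun i => simple_value S (p i.+1))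
    (fun i => drifted m W S (p i)) N w <= 2 * c + 2 * v * c' * t.
Proof.
move=> v0 t0 g cX intc close.
pose Y s := X (Num.max 0 s) w.
pose h s := 2 * (simple_value S s w - diffusion_coef v (Y s)) ^+ 2 + 2 * v * c'.
have c'0 : 0 <= c'.
  apply: le_trans (normr_ge0 _) (close 0%N (p 0%N) _).
  by rewrite lexx (grid_mono g (leqnSn 0)).
have p0 i : 0 <= p i := grid_ge0 i g.
have h0 s : 0 <= h s.
  by apply: addr_ge0; [apply: mulr_ge0 => //; exact: sqr_ge0|apply: mulr_ge0 => //; exact: mulr_ge0].
have mh : meas_fun h.
  apply: measurable_funD => //; apply: measurable_funM => //; apply: measurable_funX.
  apply: measurable_funB.
    by apply: measurable_sum => i; apply: measurable_funM => //; exact: measurable_indic.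
  apply: measurableT_comp; first exact: measurable_diffusion_coef.
  apply: continuous_measurable_fun; exact: cpath_continuous cX.
have mhE D : measurable_fun D (fun s => (h s)%:E) by apply/measurable_EFinP/measurable_funTS.
have step i : ((((simple_value S (p i.+1) w - diffusion_coef v (drifted m W S (p i) w)) ^+ 2) *
    (p i.+1 - p i))%:E <= \int[lebesgue_measure]_(s in `](p i), (p i.+1)]) (h s)%:E)%E.
  have [_ _ /(_ i)/andP[pp _] _ /(_ i) between] := g.
  set z := _ ^+ 2.
  have -> : (z * (p i.+1 - p i))%:E = (\int[lebesgue_measure]_(s in `](p i), (p i.+1)]) z%:E)%E.
    rewrite integral_cst//= lebesgue_measure_itv/= lte_fin; case: ifPn => [_|].
      by rewrite -EFinB -EFinM.
    by rewrite -leNgt => pp'; rewrite mule0 (_ : _ - _ = 0) ?mulr0//; lra.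
  apply: ge0_le_integral => //.
  - by move=> s _; rewrite lee_fin sqr_ge0.
  - exact: mhE.
  - move=> s /=; rewrite in_itv/= => /andP[ps sp]; rewrite lee_fin /h /Y max_r; last exact: le_trans (ltW ps).
    have -> : simple_value S s w = simple_value S (p i.+1) w.
      apply: eq_bigr => j _; congr (_ * _); rewrite !indicE.
      have [h1|h1] := between _ (times_mem (ltnW (ltn_ord j)));
      have [h2|h2] := between _ (times_mem (ltn_ord j)).
      + rewrite !memNset//= in_itv/= => /andP[_]; rewrite leNgt; first by rewrite (le_lt_trans h2)// (lt_le_trans ps).
        by rewrite (le_lt_trans h2).
      + by rewrite !mem_set//= in_itv/= ?h2 ?(le_lt_trans h1) ?(le_trans sp)// (lt_le_trans ps).
      + rewrite !memNset//= in_itv/= => /andP[+ _]; rewrite ltNge ?h1//.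
        by rewrite (le_trans sp).
      + rewrite !memNset//= in_itv/= => /andP[+ _]; rewrite ltNge ?h1//.
        by rewrite (le_trans sp).
    have := diffusion_coef_holder (X s w) (drifted m W S (p i) w) v0.
    have := close i s; rewrite (ltW ps) sp => /(_ isT) cl.
    rewrite /z; set a := simple_value _ _ _; set b := diffusion_coef _ _; set b' := diffusion_coef _ _.
    move=> bb; apply: le_trans (_ : 2 * (a - b) ^+ 2 + 2 * (b - b') ^+ 2 <= _).
      have := sqr_ge0 ((a - b) - (b - b')); rewrite (_ : a - b' = (a - b) + (b - b')); last by ring.
      by rewrite !expr2; lra.
    rewrite lerD2l -mulrA ler_wpM2l//; apply: le_trans bb _; by rewrite ler_wpM2l.
have sum n : ((coef_error v (fun i => p i.+1 - p i) (fun i => simple_value S (p i.+1))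
    (fun i => drifted m W S (p i)) n w)%:E <= \int[lebesgue_measure]_(s in `]0%R, (p n)]) (h s)%:E)%E.
  elim: n => [|n IH]; first by rewrite /coef_error big_ord0 integral_ge0// => s _; rewrite lee_fin.
  have [_ _ /(_ n)/andP[pp _] _ _] := g.
  have -> : `]0, (p n.+1)]%classic = `]0, (p n)] `|` `](p n), (p n.+1)] :> set R.
    by rewrite -itv_bndbnd_setU// bnd_simp.
  rewrite ge0_integral_setU//=.
  - by rewrite /coef_error big_ord_recr/= EFinD leeD.
  - exact: mhE.
  - by move=> s _; rewrite lee_fin.
  - apply/disj_setPS => s /= []; rewrite !in_itv/= => /andP[_ a] /andP[b _].
    by move: b; rewrite ltNge a.
have pN : p N = t by case: g.
have := sum N; rewrite pN integral_itv_obnd_cbnd//.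
have -> : (\int[lebesgue_measure]_(s in `[0%R, t]) (h s)%:E = 2%:E *
   \int[lebesgue_measure]_(s in `[0%R, t]) ((simple_value S s w - diffusion_coef v (X s w)) ^+ 2)%:E +
   (2 * v * c' * t)%:E)%E.
  have m2 : measurable_fun `[0, t]%classic (fun s => ((simple_value S s w - diffusion_coef v (Y s)) ^+ 2)%:E).
    apply/measurable_EFinP/measurable_funTS; apply: measurable_funX; apply: measurable_funB.
      by apply: measurable_sum => i; apply: measurable_funM => //; exact: measurable_indic.
    apply: measurableT_comp; first exact: measurable_diffusion_coef.
    apply: continuous_measurable_fun; exact: cpath_continuous cX.
  under eq_integral do rewrite /h EFinD EFinM.
  rewrite ge0_integralD//=.
  - rewrite ge0_integralZl//.
    + congr (_ * _ + _)%E.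
        apply: eq_integral => s; rewrite inE/= in_itv/= => /andP[s0 _].
        by rewrite /Y max_r.
      rewrite integral_cst//= lebesgue_measure_itv/= lte_fin; case: ifPn => [_|].
        by rewrite oppr0 adde0 -EFinM.
      by rewrite -leNgt => t0'; rewrite mule0 (_ : t = 0) ?mulr0//; lra.
    + by move=> s _; rewrite lee_fin sqr_ge0.
  - by move=> s _; rewrite mule_ge0// lee_fin sqr_ge0.
  - exact: measurable_funeM.
  - by move=> s _; rewrite lee_fin; apply: mulr_ge0 => //; exact: mulr_ge0.
move=> /le_trans H; rewrite -lee_fin; apply: H.
rewrite (EFinD (2 * c)); apply: leeD => //; rewrite (EFinM 2 c); apply: lee_pmul => //; last exact: ltW.
by apply: integral_ge0 => s _; rewrite lee_fin sqr_ge0.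
Qed.

End solutions.

Section eventually.
Context {R : realType} {d} {T : measurableType d} (P : probability T R).

Lemma probability_eventually (E : nat -> set T) :
  (forall k, measurable (E k)) ->
  {ae P, forall w, exists k0, forall k, (k0 <= k)%N -> ~ E k w} ->
  P (E k) @[k --> \oo] --> 0%E.
Proof.
move=> mE ae; pose C n := \bigcup_(k in [set k | (n <= k)%N]) E k.
have mC n : measurable (C n) by apply: bigcup_measurable => k _.
have mI : measurable (\bigcap_n C n) by exact: bigcapT_measurable.
have C0 : P (\bigcap_n C n) = 0%E.
  have [B [mB PB hB]] := most_ae ae; apply/eqP; rewrite eq_le measure_ge0 andbT.
  apply: le_trans PB; apply: le_measure; rewrite ?inE// => w hw.
  apply: contrapT => /hB[k0 h]; have [k /= kk0 /(h k kk0)] := hw k0 I; exact.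
have cvC : P (C n) @[n --> \oo] --> 0%E.
  rewrite -C0; apply: nonincreasing_cvg_mu => //.
    by apply: le_lt_trans (probability_le1 P (mC 0%N)) _; rewrite ltry.
  move=> m n mn; apply/subsetPset => w [k /= nk Ek]; exists k => //=.
  exact: leq_trans nk.
apply: (squeeze_cvge _ (cvg_cst 0%E) cvC); apply: nearW => n.
rewrite measure_ge0/=; apply: le_measure; rewrite ?inE// => w Ew; by exists n => /=.
Qed.

Lemma cvg0_small (E : nat -> set T) (e : R) : 0 < e ->
  P (E k) @[k --> \oo] --> 0%E -> (forall k, measurable (E k)) -> exists k0, forall k, (k0 <= k)%N -> (P (E k) <= e%:E)%E.
Proof.
move=> e0 c0 mE; have /fine_cvgP[_ /cvgrPdist_lt/(_ _ e0)[k0 _ h]] := c0; exists k0 => k /h /=.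
rewrite sub0r normrN => /(le_lt_trans (ler_norm _)) /ltW.
by rewrite -lee_fin fineK// fin_num_measure.
Qed.

(** The event [E k] that some pair of rational times at distance less than [1 / k.+1] violates the
    modulus is measurable. Every path is uniformly continuous on [[0, t]], hence leaves [E k] for
    large [k], and the probabilities tend to 0. *)
Lemma most_modulus (X : R -> T -> R) (t e c : R) : 0 <= t -> 0 < e -> 0 < c ->
  (forall s, 0 <= s -> meas_fun (X s)) -> (forall w, cpath (X^~ w)) ->
  exists2 mesh : R, 0 < mesh & most P c (fun w => forall a b, 0 <= a <= t -> 0 <= b <= t ->
    `|a - b| <= mesh -> `|X a w - X b w| <= e).
Proof.
move=> t0 e0 c0 mX cX.
pose q (j l : nat) : R := j%:R / l.+1%:R.
have q0 j l : 0 <= q j l by rewrite divr_ge0.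
pose D (k i j l : nat) := if (`|q i l - q j l| < k.+1%:R^-1) && (q i l <= t) && (q j l <= t)
  then [set w | e < `|X (q i l) w - X (q j l) w|] else set0.
pose E (k : nat) := \bigcup_i \bigcup_j \bigcup_l D k i j l.
have mE k : measurable (E k).
  apply: bigcupT_measurable => i; apply: bigcupT_measurable => j.
  apply: bigcupT_measurable => l; rewrite /D; case: ifP => // _.
  have mXX : meas_fun (fun w => `|X (q i l) w - X (q j l) w|).
    by apply: measurableT_comp => //; apply: measurable_funB; exact: mX.
  rewrite (_ : [set w | _] = (fun w => `|X (q i l) w - X (q j l) w|) @^-1` `]e, +oo[).
    by rewrite -[X in measurable X]setTI; apply: mXX => //; exact: measurable_itv.
  by apply/seteqP; split => w /=; rewrite in_itv/= andbT.
have ev w : exists k0, forall k, (k0 <= k)%N -> ~ E k w.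
  have [dt dt0 h] := cpath_uniform (cX w) t0 e0.
  have [k0] := ltr_add_invr dt0; rewrite add0r => kdt.
  exists k0 => k k0k [i _ [j _ [l _]]]; rewrite /D; case: ifP => // /andP[/andP[a1 a2] a3] /=.
  apply/negP; rewrite -leNgt; apply: h; rewrite ?q0 ?a2 ?a3//; apply: ltW.
  apply: lt_trans kdt; apply: lt_le_trans a1 _.
  by rewrite lef_pV2 ?posrE// ler_nat.
have Ecv : P (E k) @[k --> \oo] --> 0%E.
  by apply: probability_eventually => //; exact: aeW.
have [k hk] := cvg0_small c0 Ecv mE.
(* Strictly smaller than [k.+1%:R^-1], which leaves room to move [a] and [b] to nearby rational
   times. *)
exists k.+2%:R^-1; first by rewrite invr_gt0.
exists (E k); split => // [|w nE a b /andP[a0 at_] /andP[b0 bt] ab]; first exact: hk.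
rewrite leNgt; apply/negP; rewrite -subr_gt0 => big.
have u0 : 0 < (`|X a w - X b w| - e) / 2 by rewrite divr_gt0.
set u := _ / 2 in u0.
have [d1 d10 h1] := cX w a _ a0 u0; have [d2 d20 h2] := cX w b _ b0 u0.
have kk : k.+2%:R^-1 < k.+1%:R^-1 :> R by rewrite ltf_pV2 ?posrE// ltr_nat.
pose g := Num.min (Num.min d1 d2) ((k.+1%:R^-1 - k.+2%:R^-1) / 2).
have g0 : 0 < g by rewrite !lt_min d10 d20/= divr_gt0// subr_gt0.
have [l] := ltr_add_invr g0; rewrite add0r => lg.
pose r (s : R) := Num.truncn (l.+1%:R * s).
have rs s : 0 <= s -> `|q (r s) l - s| < g.
  by move=> s0; apply: le_lt_trans (truncn_approx l s0) lg.
have rt s : 0 <= s -> s <= t -> q (r s) l <= t.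
  by move=> s0; apply: le_trans; rewrite ler_pdivrMr// mulrC truncn_le mulr_ge0.
have qa := rs _ a0; have qb := rs _ b0.
have [ga [gb gc]] : g <= d1 /\ g <= d2 /\ g <= (k.+1%:R^-1 - k.+2%:R^-1) / 2.
  by rewrite /g !ge_min !lexx !orbT.
apply: nE; exists (r a) => //; exists (r b) => //; exists l => //; rewrite /D.
rewrite !rt// !andbT ifT/=; last first.
  rewrite (_ : q (r a) l - q (r b) l = (q (r a) l - a) + (a - b) - (q (r b) l - b)); last by ring.
  apply: le_lt_trans (ler_normB _ _) _; have := ler_normD (q (r a) l - a) (a - b).
  move: qa qb gc ab; set k1 := k.+1%:R^-1; set k2 := k.+2%:R^-1 => ? ? ? ? ?; lra.
have := h1 _ (q0 _ _) (lt_le_trans qa ga); have := h2 _ (q0 _ _) (lt_le_trans qb gb) => /=.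
set xa := X (q (r a) l) w; set xb := X (q (r b) l) w => hb ha.
have : `|X a w - X b w| <= `|xa - X a w| + `|xa - xb| + `|xb - X b w|.
  rewrite (_ : X a w - X b w = - (xa - X a w) + (xa - xb) + (xb - X b w)); last by ring.
  apply: le_trans (ler_normD _ _) _; rewrite lerD2r.
  by apply: le_trans (ler_normD _ _) _; rewrite normrN.
rewrite /u in ha hb; move=> ?; lra.
Qed.
End eventually.

Section solutions_near.
Context {R : realType} {d} {T : measurableType d} (P : probability T R).
Implicit Types (F : R -> set_system T) (W X : R -> T -> R).

Lemma adapted_measurable F X : is_filtration F -> adapted F X ->
  forall s : R, 0 <= s -> meas_fun (X s).
Proof. by move=> [_ h _] aX s s0 _ B mB; rewrite setTI; apply: (h _ s0); exact: aX. Qed.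

(** A late term of the sequence provided by [ito_integral] is close to [sigma (X)] in [L ^ 2] and
    has an integral close to [I]. [riemann_coef_error] and the modulus of continuity of [X] turn
    this into the discrete condition on fine grids. *)
Lemma solution_near F W X (m v t eta : R) : 0 <= v -> 0 <= t -> 0 < eta ->
  wiener_process P F W -> sde_solution P F W (fun=> m) (diffusion_coef v) 0 X ->
  exists S, [/\ simple_predictable F S, near_solution P W m v t S eta &
    most P eta (fun w => forall s, 0 <= s <= t -> `|X s w - drifted m W S s w| <= eta)].
Proof.
move=> v0 t0 eta0 wW [aX cX X0 _ [I [aI cI [Sn [pS conv1 conv2]]] XE]].
have filF : is_filtration F by case: wW => -[].
have mX := adapted_measurable filF aX; have mI := adapted_measurable filF aI.
have {}cX w : cpath (X^~ w) by apply/cpathP; exact: cX.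
have {}cI w : cpath (I^~ w) by apply/cpathP; exact: cI.
(* The coefficient error will be at most [2 * e1 + 2 * v * (e1 + e1) * t], and three events of
   probability at most [e1] are discarded. *)
pose e1 := eta / (4 + 4 * v * t).
have vt0 : 0 <= v * t by exact: mulr_ge0.
have den0 : 0 < 4 + 4 * v * t by rewrite ltr_wpDr// -mulrA mulr_ge0.
have e10 : 0 < e1 by rewrite divr_gt0.
have e1E : (4 + 4 * v * t) * e1 = eta by rewrite mulrC divfK// gt_eqF.
have e1v : 0 <= v * t * e1 by rewrite mulr_ge0// ltW.
have e1eta : 4 * e1 <= eta by rewrite -e1E; move: e1v; set z := v * t * e1 => *; nra.
have mS k i : (i < sp_size (Sn k))%N -> meas_fun (sp_coef (Sn k) i).
  move=> iS; have i0 := predictable_time_ge0 (pS k) (ltnW iS).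
  apply: (@sub_meas_wrt _ _ (F (sp_time (Sn k) i))); first exact: (filtration_sub wW).
  exact: (coef_meas_wrt wW (pS k) iS (lexx _)).
have mSI k s : 0 <= s -> meas_fun (simple_integral (Sn k) W s).
  move=> s0; apply: (@sub_meas_wrt _ _ (F s)); first exact: (filtration_sub wW).
  by apply: (simple_integral_meas_wrt wW).
have cSI k w : cpath (fun s => simple_integral (Sn k) W s w).
  have := cpath_drifted wW 0 (Sn k) w; congr cpath; apply/funext => s.
  by rewrite /drifted mul0r add0r.
have mA k : measurable [set w | (e1%:E <= \int[lebesgue_measure]_(s in `[0%R, t])
     ((simple_value (Sn k) s w - diffusion_coef v (X s w)) ^+ 2)%:E)%E].
  have mci := @measurable_coef_int _ _ _ (Sn k) X v t (mS k) mX cX.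
  by rewrite -[X in measurable X]setTI; exact: emeasurable_fun_c_infty.
have mB k : measurable [set w | exists2 s : R, 0 <= s <= t & e1 <= `|simple_integral (Sn k) W s w - I s w|].
  apply: (measurable_exceed (X := fun s w => simple_integral (Sn k) W s w - I s w)) => //.
    by move=> s s0; apply: measurable_funB; [exact: mSI|exact: mI].
  by move=> w; exact: cpath_sub.
have [k1 h1] := cvg0_small e10 (conv1 _ _ t0 e10) mA.
have [k2 h2] := cvg0_small e10 (conv2 _ _ t0 e10) mB.
pose S := Sn (maxn k1 k2); have pSS : simple_predictable F S := pS _.
have {}h1 := h1 _ (leq_maxl k1 k2); have {}h2 := h2 _ (leq_maxr k1 k2).
have M1 : most P e1 (fun w => (\int[lebesgue_measure]_(s in `[0%R, t])
     ((simple_value S s w - diffusion_coef v (X s w)) ^+ 2)%:E < e1%:E)%E).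
  apply: most_imp (most_measurable (mA _) h1).
  by move=> w /= /negP; rewrite -ltNge.
have M2 : most P e1 (fun w => forall s, 0 <= s <= t -> `|simple_integral S W s w - I s w| < e1).
  apply: most_imp (most_measurable (mB _) h2).
  by move=> w /= + s st; rewrite ltNge => h; apply/negP => e1s; apply: h; exists s.
have [mesh mesh0 M3] := most_modulus P t0 e10 e10 mX cX.
have XE' : most P 0 (fun w => forall s, 0 <= s -> X s w = m * s + I s w).
  apply: most_ae; apply: filterS XE => w h s s0; rewrite (h s s0) add0r; congr (_ + _).
  rewrite Rintegral_cst//= lebesgue_measure_itv/= lte_fin; case: ifPn.
    by rewrite oppr0 adde0.
  by rewrite -leNgt => s0'; rewrite (_ : s = 0) ?mulr0//; apply/eqP; rewrite eq_le s0'.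
have M4 : most P e1 (fun w => forall s, 0 <= s <= t -> `|X s w - drifted m W S s w| <= e1).
  rewrite -[e1]addr0; apply: most_imp (most_and M2 XE') => w [h4 h5] s st; rewrite addr0.
  have /andP[s0 _] := st.
  by rewrite (h5 _ s0) /drifted opprD addrACA subrr add0r distrC ltW// h4.
exists S; split => //.
- exists mesh => // p N g.
  apply: (@most_le _ _ _ _ (e1 + e1 + e1)); first by lra.
  apply: most_imp (most_and (most_and M1 M3) M4) => w [[w1 w3] w4].
  apply: le_trans (riemann_coef_error v0 t0 g (cX w) w1 (c' := e1 + e1) _) _.
    move=> i s /andP[ps sp].
    have p0 := grid_ge0 i g; have pt := grid_le_t i g; have pt1 := grid_le_t i.+1 g.
    have [_ _ _ /(_ i) pm _] := g.
    rewrite (_ : _ - _ = (X s w - X (p i) w) + (X (p i) w - drifted m W S (p i) w)); last by ring.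
    apply: le_trans (ler_normD _ _) _; apply: lerD; last by apply: w4; rewrite p0.
    apply: w3; rewrite ?p0 ?(le_trans p0)//= ?(le_trans sp)//.
    by rewrite ger0_norm; lra.
  rewrite -e1E (_ : _ + _ = (2 + 4 * v * t) * e1); last by ring.
  by rewrite ler_wpM2r ?(ltW e10)// lerD2r ler_nat.
- apply: (most_le (e := e1)); first by lra.
  by apply: most_imp M4 => w h s st; apply: le_trans (h s st) _; lra.
Qed.

End solutions_near.

(** Each solution is close to a [drifted] simple process that nearly solves the equation on grids,
    and [stability_sup] compares the two simple processes. *)
Lemma pathwise_uniqueness_diffusion (R : realType) (m v : R) : 0 <= v ->
  pathwise_uniqueness (fun=> m) (diffusion_coef v) 0.
Proof.
move=> v0 d0 Omega Q F W X Y _ wW sX sY.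
suff H (n : nat) : {ae Q, forall w, forall t : R, 0 <= t <= n%:R -> X t w = Y t w}.
  have /ae_foralln := H; apply: filterS => w h t t0.
  have [n tn] : exists n : nat, t <= n%:R.
    exists (Num.truncn t).+1; exact/ltW/(truncnS_gt t).
  by apply: (h n); rewrite t0.
have n0 : 0 <= n%:R :> R by [].
have key e : 0 < e -> most Q e (fun w => forall s, 0 <= s <= n%:R -> `|X s w - Y s w| <= e).
  move=> e0; have e30 : 0 < e / 3 by rewrite divr_gt0.
  have [eta eta0 stab] := @stability_sup R m v n%:R (e / 3) v0 n0 e30 _ Omega.
  have et0 : 0 < Num.min eta (e / 3) by rewrite lt_min eta0.
  have near_le S : near_solution Q W m v n%:R S (Num.min eta (e / 3)) -> near_solution Q W m v n%:R S eta.
    have le1 : Num.min eta (e / 3) <= eta by rewrite ge_min lexx.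
    move=> [mesh mesh0 h]; exists mesh => // p N /h; move=> /(most_le le1); apply: most_imp => w.
    by move=> /le_trans; exact.
  have [S [pS nS mS]] := solution_near v0 n0 et0 wW sX.
  have [S' [pS' nS' mS']] := solution_near v0 n0 et0 wW sY.
  have le3 : Num.min eta (e / 3) <= e / 3 by rewrite ge_min lexx orbT.
  have := stab _ _ _ _ _ wW pS pS' (near_le _ nS) (near_le _ nS').
  move=> /most_and/(_ (most_and (most_le le3 mS) (most_le le3 mS'))).
  move=> H1; apply: (most_le (e := e / 3 + (e / 3 + e / 3))); first by lra.
  apply: most_imp H1.
  move=> w [h1 [h2 h3]] s st.
  have := h1 s st; have := le_trans (h2 s st) le3; have := le_trans (h3 s st) le3.
  move: (X s w) (Y s w) (drifted m W S s w) (drifted m W S' s w) => x y a b.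
  rewrite (_ : x - y = (x - a) + (a - b) - (y - b)); last by ring.
  move=> h4 h5 h6; apply: le_trans (ler_normB _ _) _.
  have := ler_normD (x - a) (a - b); lra.
apply: ae_most => e e0.
(* The probability bound stays at [e] while the distance decreases, so that [most_io] yields
   equality outside an event of probability at most [e]. *)
have key' (k : nat) : most Q e (fun w => forall s, 0 <= s <= n%:R -> `|X s w - Y s w| <= k.+1%:R^-1).
  have k0 : 0 < k.+1%:R^-1 :> R by rewrite invr_gt0.
  have mn0 : 0 < Num.min e k.+1%:R^-1 by rewrite lt_min e0.
  have le1 : Num.min e k.+1%:R^-1 <= e by rewrite ge_min lexx.
  apply: most_imp (most_le le1 (key _ mn0)) => w h s st.
  by apply: le_trans (h s st) _; rewrite ge_min lexx orbT.
apply: most_imp (most_io key') => w h t tn; apply/eqP; rewrite -subr_eq0 -normr_le0.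
apply/ler_addgt0Pr => u u0; rewrite add0r.
have [k0] := ltr_add_invr u0; rewrite add0r => ku.
have [k kk hk] := h k0; apply: le_trans (hk t tn) _; apply: le_trans (ltW ku).
by rewrite lef_pV2 ?posrE// ler_nat.
Qed.

(** The events of the natural filtration together with the null sets form a pi-system on which
    independence of the increments holds, the null sets trivially so. *)
Lemma augmented_wiener (R : realType) d (T : measurableType d) (P : probability T R) (W : R -> T -> R) : standard_wiener_process P W ->
  wiener_process P (augmented_filtration P W) W.
Proof.
move=> [[[sa sm mono] aW] cW W0 iW lW]; split => //.
- split; last by move=> t t0 B mB; apply: sub_sigma_algebra; left; exact: aW.
  split.
  + by move=> t t0; exact: smallest_sigma_algebra.
  + move=> t t0; apply: smallest_sub; first exact: sigma_algebra_measurable.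
    by move=> A [/(sm _ t0)//|[]].
  + move=> s t s0 st; apply: smallest_sub; first exact: smallest_sigma_algebra.
    move=> A [sA|nA]; apply: sub_sigma_algebra; last by right.
    by left; apply: mono sA.
- move=> s t s0 st A B FA mB.
  have t0 : 0 <= t by apply: le_trans (ltW st).
  have mW u : 0 <= u -> meas_fun (W u).
    by move=> u0 _ C mC; rewrite setTI; apply: (sm _ u0); exact: aW.
  have mC : measurable [set w | B (W t w - W s w)].
    have := measurable_funB (mW _ t0) (mW _ s0) => mD.
    by have := mD measurableT B mB; rewrite setTI.
  apply: (product_rule_generated (G := natural_filtration W s `|` null_sets P)) => //.
  + by move=> C [/(sm _ s0)//|[]].
  + have nullI (C D : set T) : null_sets P C -> measurable D -> null_sets P (C `&` D).
      move=> [mC1 PC] mD; split; first exact: measurableI.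
      by apply/eqP; rewrite eq_le measure_ge0 andbT -PC le_measure ?inE//; exact: measurableI.
    move=> C D [nC|nC] [nD|nD].
    * by left; exact: (@measurableI _ (g_sigma_algebraType _)) nC nD.
    * by right; rewrite setIC; apply: nullI => //; exact: sm nC.
    * by right; apply: nullI => //; exact: sm nD.
    * by right; apply: nullI => //; case: nD.
  + move=> C [nC|[mC1 PC]]; first exact: iW.
    rewrite PC mul0e; apply/eqP; rewrite eq_le measure_ge0 andbT -PC.
    by rewrite le_measure ?inE//; exact: measurableI.
Qed.

(** * The Euler scheme and strong existence *)

Section euler_scheme.
Context {R : realType}.
Implicit Types (m v t : R).

(** The truncation at [r.+1] makes the Euler scheme a simple process, whose coefficients have to be
    bounded; frozen population sizes are truncated at the same level. *)
Definition tcoef v (r : nat) (x : R) := Num.sqrt (v * Num.min (Num.max x 0) r.+1%:R).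

Let minmax_ge0 (r : nat) (x : R) : 0 <= Num.min (Num.max x 0) r.+1%:R.
Proof. by rewrite le_min le_max lexx orbT/=. Qed.

Lemma tcoef_sqr v r x : 0 <= v -> tcoef v r x ^+ 2 = v * Num.min (Num.max x 0) r.+1%:R.
Proof. by move=> v0; rewrite sqr_sqrtr// mulr_ge0. Qed.

Lemma tcoef_ge0 v r x : 0 <= tcoef v r x.
Proof. exact: sqrtr_ge0. Qed.

Lemma tcoef_bounded v r x : 0 <= v -> tcoef v r x <= Num.sqrt (v * r.+1%:R).
Proof. by move=> v0; rewrite ler_wsqrtr// ler_wpM2l// ge_min lexx orbT. Qed.

Lemma tcoef_sqr_le v r x : 0 <= v -> tcoef v r x ^+ 2 <= v * `|x|.
Proof.
move=> v0; rewrite tcoef_sqr// ler_wpM2l// ge_min ge_max normr_ge0 andbT.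
by rewrite ler_norm.
Qed.

Lemma measurable_tcoef v r : meas_fun (tcoef v r).
Proof.
apply: measurableT_comp; first exact: continuous_measurable_fun (@sqrt_continuous R).
apply: measurable_funM => //; apply: measurable_minr => //; exact: measurable_maxr.
Qed.

(** The truncation acts only for [x >= r.+1], where it costs at most [x <= x ^ 2 / r.+1]; second
    moments of the scheme make this small. *)
Lemma tcoef_close v r x y : 0 <= v ->
  (tcoef v r x - diffusion_coef v y) ^+ 2 <= v * (`|y - x| + x ^+ 2 / r.+1%:R).
Proof.
move=> v0; have R0 : 0 < r.+1%:R :> R by [].
apply: le_trans (sqrt_sub_sqr _ _) _.
- by rewrite mulr_ge0.
- by rewrite mulr_ge0// le_max lexx orbT.
rewrite -mulrBr normrM (ger0_norm v0) ler_wpM2l//.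
have x2 : 0 <= x ^+ 2 / r.+1%:R by rewrite divr_ge0// sqr_ge0.
have -> : Num.min (Num.max x 0) r.+1%:R - Num.max y 0 =
  (Num.max x 0 - Num.max y 0) - (Num.max x 0 - Num.min (Num.max x 0) r.+1%:R) by ring.
apply: le_trans (ler_normB _ _) _; apply: lerD; first by rewrite distrC max0_lipschitz.
rewrite ger0_norm; last by rewrite subr_ge0 ge_min lexx.
rewrite /Num.min; case: ifPn => [_|]; first by rewrite subrr.
rewrite -leNgt => Rx; apply: (@le_trans _ _ (Num.max x 0)); first by rewrite gerBl.
have {}Rx : r.+1%:R <= x by move: Rx; rewrite le_max => /orP[//|]; rewrite leNgt R0.
have x0 : 0 <= x by apply: le_trans Rx.
by rewrite max_l// ler_pdivlMr// expr2 ler_wpM2l.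
Qed.

Section scheme.
Context {d} {T : measurableType d}.
Variables (W : R -> T -> R) (m v : R) (r : nat).

Definition etime (i : nat) : R := i%:R / r.+1%:R.

Fixpoint euler (i : nat) (w : T) : R :=
  if i is j.+1 then
    euler j w + m / r.+1%:R + tcoef v r (euler j w) * (W (etime i) w - W (etime j) w)
  else 0.

(** [r.+1 ^ 2] steps of length [1 / r.+1] reach time [r.+1], beyond any fixed horizon when [r] is
    large. *)
Definition euler_process : simple_process R T :=
  SimpleProcess (r.+1 ^ 2) etime (fun i => tcoef v r \o euler i).

Lemma etime_ge0 i : 0 <= etime i.
Proof. by rewrite divr_ge0. Qed.

Lemma etime_lt i j : (etime i < etime j) = (i < j)%N.
Proof. by rewrite ltr_pM2r ?invr_gt0// ltr_nat. Qed.

Lemma etime_le i j : (etime i <= etime j) = (i <= j)%N.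
Proof. by rewrite ler_pM2r ?invr_gt0// ler_nat. Qed.

Lemma etimeS i : etime i.+1 = etime i + r.+1%:R^-1.
Proof. by rewrite /etime -natr1 mulrDl mul1r. Qed.

Lemma euler_value q j w : (j < r.+1 ^ 2)%N -> etime j < q <= etime j.+1 ->
  simple_value euler_process q w = tcoef v r (euler j w).
Proof.
move=> jN /andP[jq qj]; rewrite /simple_value (bigD1 (Ordinal jN))//= big1 ?addr0; last first.
  move=> i /negP ij; rewrite indicE memNset ?mulr0//= in_itv/= => /andP[iq qi].
  apply: ij; apply/eqP/val_inj => /=; apply/eqP; rewrite eqn_leq.
  by rewrite -ltnS -etime_lt (lt_le_trans iq)//= -ltnS -etime_lt (lt_le_trans jq).
by rewrite indicE mem_set ?mulr1//= in_itv/= jq qj.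
Qed.
End scheme.

Section euler_wiener.
Context {d} {T : measurableType d} (P : probability T R).
Variables (F : R -> set_system T) (W : R -> T -> R).
Hypothesis wW : wiener_process P F W.
Variables (m v : R) (r : nat).
Hypothesis v0 : 0 <= v.
Notation U := (euler W m v r).
Notation tm := (etime r).

Lemma euler_meas_wrt i : meas_wrt (F (tm i)) (U i).
Proof.
elim: i => [|i IH]; first exact: measurable_cst.
have ti : tm i <= tm i.+1 by rewrite etime_le.
have IH' := meas_wrt_mono wW (etime_ge0 r i) ti IH.
apply: measurable_funD; first exact: measurable_funD.
apply: measurable_funM; last exact: (increment_meas_wrt wW (etime_ge0 r i) ti).
by apply: measurableT_comp => //; exact: measurable_tcoef.
Qed.

Lemma measurable_euler i : meas_fun (U i).
Proof.
have sF := filtration_sub wW (etime_ge0 r i).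
exact: (sub_meas_wrt sF (@euler_meas_wrt i)).
Qed.

Lemma euler_predictable : simple_predictable F (euler_process W m v r).
Proof.
split => /=.
- exact: etime_ge0.
- by move=> i _; rewrite etime_lt.
- move=> i _; have sF := filtration_sub wW (etime_ge0 r i).
  have : meas_wrt (F (tm i)) (tcoef v r \o U i).
    by apply: measurableT_comp; [exact: measurable_tcoef|exact: euler_meas_wrt].
  by move/(meas_wrtP _ sF).
- exists (Num.sqrt (v * r.+1%:R)) => i w _.
  by rewrite ger0_norm ?tcoef_ge0// tcoef_bounded.
Qed.

Lemma times_euler x : x \in times (euler_process W m v r) ->
  exists2 i, (i <= r.+1 ^ 2)%N & x = tm i.
Proof. by move=> /mapP[i]; rewrite mem_iota add0n ltnS => /= iN ->; exists i. Qed.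

Let drifted_step p j w : (j < r.+1 ^ 2)%N -> tm j <= p <= tm j.+1 ->
  drifted m W (euler_process W m v r) p w = drifted m W (euler_process W m v r) (tm j) w +
    m * (p - tm j) + tcoef v r (U j w) * (W p w - W (tm j) w).
Proof.
move=> jN /andP[jp pj]; have [<-|pne] := eqVneq (tm j) p.
  by rewrite !subrr !mulr0 !addr0.
have jp' : tm j < p by rewrite lt_neqAle pne.
rewrite -(euler_value W m v (q := p) w jN) ?jp'// -(simple_integral_step W w euler_predictable (ltW jp')).
- by rewrite /drifted; ring.
- move=> x /times_euler[i iN ->]; case: (leqP i j) => ij; first by left; rewrite etime_le.
  by right; apply: le_trans pj _; rewrite etime_le.
Qed.

Lemma drifted_eulerE i w : (i <= r.+1 ^ 2)%N ->
  drifted m W (euler_process W m v r) (tm i) w = U i w.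
Proof.
elim: i => [_|i IH iN].
  by rewrite /etime mul0r /drifted mulr0 add0r (simple_integral0 W w euler_predictable).
rewrite (drifted_step _ iN) ?lexx ?etime_le ?leqnSn//= IH ?(ltnW iN)//.
by have -> : tm i.+1 - tm i = r.+1%:R^-1 by rewrite etimeS addrAC subrr add0r.
Qed.

Lemma drifted_euler p j w : (j < r.+1 ^ 2)%N -> tm j <= p <= tm j.+1 ->
  drifted m W (euler_process W m v r) p w =
    U j w + m * (p - tm j) + tcoef v r (U j w) * (W p w - W (tm j) w).
Proof. by move=> jN pj; rewrite (drifted_step _ jN)// drifted_eulerE// ltnW. Qed.

Definition euler_variance (t : R) := 2 * v * (`|m| * t + (v * t + 1) / 2).

Lemma euler_variance_ge0 t : 0 <= t -> 0 <= euler_variance t.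
Proof.
move=> t0; apply: mulr_ge0; first exact: mulr_ge0.
by apply: addr_ge0; [exact: mulr_ge0|apply: divr_ge0 => //; apply: addr_ge0 => //; exact: mulr_ge0].
Qed.

(* The constant [K = euler_variance t] solves [v (|m| t + theta/2 + t K / (2 theta)) <= K]
   for [theta = v t + 1], and [|x| <= theta/2 + x^2/(2 theta)]. *)
Lemma euler_centered_L2 t i : tm i <= t ->
  (\int[P]_w ((U i w - m * tm i) ^+ 2)%:E <= (tm i * euler_variance t)%:E)%E.
Proof.
elim: i => [t0|i IH it].
  rewrite integral0_eq.
    by rewrite lee_fin; apply: mulr_ge0; [exact: etime_ge0|apply: euler_variance_ge0; apply: le_trans t0; exact: etime_ge0].
  by move=> w _; rewrite /etime mul0r mulr0 subr0 expr0n.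
have ti : tm i <= tm i.+1 by rewrite etime_le.
have it' : tm i <= t := le_trans ti it.
have ti0 := etime_ge0 r i; have t0 : 0 <= t := le_trans ti0 it'.
set V := fun w => W (tm i.+1) w - W (tm i) w; set D := fun w => U i w - m * tm i.
set s := tm i.+1 - tm i; have sE : s = r.+1%:R^-1 by rewrite /s etimeS addrAC subrr add0r.
have s0 : 0 <= s by rewrite sE.
have mU := @euler_meas_wrt i.
have sF := filtration_sub wW ti0.
have mD : meas_wrt (F (tm i)) D by apply: measurable_funB.
have mDT := sub_meas_wrt sF mD.
have T0 : taylor2 (fun x : R => x ^+ 2) (fun x => 2 * x) (fun=> 2) 0.
  by move=> x y; rewrite mul0r (_ : _ - _ = 0) ?normr0//; field.
have -> : (fun w => ((U i.+1 w - m * tm i.+1) ^+ 2)%:E) = (fun w => ((D w + tcoef v r (U i w) * V w) ^+ 2)%:E).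
  by apply/funext => w /=; rewrite /D /V (_ : m * tm i.+1 = m * tm i + m / r.+1%:R); [congr ((_ ^+ 2)%:E); ring|rewrite etimeS mulrDr].
have cV := increment_centered wW ti0 ti.
have mK : meas_wrt (F (tm i)) (tcoef v r \o U i).
  by apply: measurableT_comp => //; exact: measurable_tcoef.
have m2 : meas_fun (fun x : R => x ^+ 2) by exact: measurable_funX.
have := ito_step sF (increment_indep wW ti0 ti) cV T0 (lexx 0) (fun y => sqr_ge0 y) m2 mD mK
  (fun k => increment_cubic_rem wW k ti0 ti).
move=> /le_trans; apply; rewrite -/s.
pose th := v * t + 1; have th0 : 0 < th by rewrite ltr_wpDl// mulr_ge0.
pose A := v * (`|m| * t + th / 2); have A0 : 0 <= A.
  by apply: mulr_ge0 => //; apply: addr_ge0; [exact: mulr_ge0|exact/ltW/divr_gt0].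
have KE : euler_variance t = 2 * A by rewrite /euler_variance /A /th; ring.
pose b := 1 + s * v / (2 * th).
have b0 : 0 <= b by apply: addr_ge0 => //; apply: divr_ge0; [exact: mulr_ge0|apply: mulr_ge0 => //; exact: ltW].
have ub w : D w ^+ 2 + (tcoef v r (U i w)) ^+ 2 * s * (2 / 2) +
    0 * (4 * `|tcoef v r (U i w)| ^+ 3 * Num.sqrt s ^+ 3) <= b * D w ^+ 2 + s * A.
  rewrite mul0r addr0 divff ?mulr1; last by rewrite pnatr_eq0.
  have h1 := tcoef_sqr_le r (U i w) v0.
  have h2 : `|U i w| <= `|m| * t + th / 2 + D w ^+ 2 / (2 * th).
    have -> : U i w = m * tm i + D w by rewrite /D; ring.
    rewrite -addrA; apply: le_trans (ler_normD _ _) _; apply: lerD.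
      by rewrite normrM (ger0_norm ti0) ler_wpM2l.
    have -> : th / 2 + D w ^+ 2 / (2 * th) = (th ^+ 2 + `|D w| ^+ 2) / (2 * th).
      by rewrite real_normK ?num_real//; field; rewrite gt_eqF.
    rewrite ler_pdivlMr ?mulr_gt0//; have := sqr_ge0 (th - `|D w|); rewrite !expr2; lra.
  have h3 : (tcoef v r (U i w)) ^+ 2 * s <= v * (`|m| * t + th / 2 + D w ^+ 2 / (2 * th)) * s.
    by apply: ler_wpM2r => //; apply: le_trans h1 _; apply: ler_wpM2l.
  have -> : b * D w ^+ 2 + s * A = D w ^+ 2 + v * (`|m| * t + th / 2 + D w ^+ 2 / (2 * th)) * s.
    by rewrite /b /A; field; rewrite gt_eqF.
  by rewrite lerD2l.
have intb : (\int[P]_w (b * D w ^+ 2 + s * A)%:E <= (b * (tm i * euler_variance t) + s * A)%:E)%E.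
  rewrite ge0_integral_add//.
  - rewrite EFinD; apply: leeD; last first.
      by rewrite integral_cst//= [X in (_ * X)%E]probability_setT mule1.
    rewrite ge0_integral_scale//.
    + by rewrite (EFinM b); apply: lee_pmul => //; [apply: integral_ge0 => w _; rewrite lee_fin sqr_ge0|exact: IH].
    + exact: measurable_funX.
    + by move=> w; exact: sqr_ge0.
  - by apply: measurable_funM => //; exact: measurable_funX.
  - by move=> w; apply: mulr_ge0 => //; exact: sqr_ge0.
  - by move=> w; exact: mulr_ge0.
apply: le_trans (ge0_integral_mono P _ _) (le_trans intb _).
- move=> w; rewrite lee_fin mul0r addr0; apply: addr_ge0; first exact: sqr_ge0.
  by apply: mulr_ge0; [apply: mulr_ge0 => //; exact: sqr_ge0|rewrite divr_ge0].
- by move=> w; rewrite lee_fin; exact: ub.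
rewrite lee_fin KE /b (_ : tm i.+1 = tm i + s); last by rewrite /s; ring.
have h4 : s * v / (2 * th) * (tm i * (2 * A)) <= s * A.
  have -> : s * v / (2 * th) * (tm i * (2 * A)) = (s * A) * (v * tm i / th) by field; rewrite gt_eqF.
  apply: ler_piMr; [exact: mulr_ge0|rewrite ler_pdivrMr// mul1r /th].
  by apply: (@le_trans _ _ (v * t)); [rewrite ler_wpM2l|rewrite lerDl].
rewrite mulrDl mul1r [leRHS]mulrDl -addrA lerD2l; lra.
Qed.

Lemma measurable_drifted (S : simple_process R T) t : simple_predictable F S -> 0 <= t ->
  meas_fun (drifted m W S t).
Proof.
move=> pS t0; apply: (sub_meas_wrt (filtration_sub wW t0)).
exact: (drifted_meas_wrt wW).
Qed.

Definition euler_bound (t : R) := 2 * (`|m| * t) ^+ 2 + 2 * (t * euler_variance t).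

Lemma euler_bound_ge0 t : 0 <= t -> 0 <= euler_bound t.
Proof.
move=> t0; apply: addr_ge0; apply: mulr_ge0 => //; first exact: sqr_ge0.
by apply: mulr_ge0 => //; exact: euler_variance_ge0.
Qed.

Lemma euler_L2 t i : tm i <= t -> (\int[P]_w (U i w ^+ 2)%:E <= (euler_bound t)%:E)%E.
Proof.
move=> it; have ti0 := etime_ge0 r i; have t0 := le_trans ti0 it.
have mD : meas_fun (fun w => U i w - m * tm i) by apply: measurable_funB => //; exact: measurable_euler.
apply: le_trans (ge0_integral_mono P (g := fun w => (2 * (`|m| * t) ^+ 2 + 2 * (U i w - m * tm i) ^+ 2)%:E) _ _) _.
- by move=> w; rewrite lee_fin sqr_ge0.
- move=> w; rewrite lee_fin; set a := m * tm i.
  have ha : a ^+ 2 <= (`|m| * t) ^+ 2.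
    rewrite -[leLHS]real_normK ?num_real// lerXn2r ?nnegrE ?mulr_ge0//.
    by rewrite /a normrM (ger0_norm ti0) ler_wpM2l.
  have := sqr_ge0 (U i w - 2 * a); rewrite !expr2 in ha *; lra.
rewrite ge0_integral_add//.
- rewrite integral_cst//= [X in (_ * X + _)%E]probability_setT mule1 ge0_integral_scale//.
  + rewrite (EFinD (2 * _)).
    apply: leeD => //; rewrite (EFinM 2 (t * _)); apply: lee_pmul => //.
      by apply: integral_ge0 => w _; rewrite lee_fin sqr_ge0.
    apply: le_trans (euler_centered_L2 it) _; rewrite lee_fin ler_wpM2r//; exact: euler_variance_ge0.
  + exact: measurable_funX.
  + by move=> w; exact: sqr_ge0.
- by apply: measurable_funM => //; exact: measurable_funX.
- by move=> w; apply: mulr_ge0 => //; exact: sqr_ge0.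
- by move=> w; apply: mulr_ge0 => //; exact: sqr_ge0.
Qed.

Let bt t := v * (`|m| + (v * (1 + euler_bound t) + 1) / 2 + euler_bound t).

(** Since its last Euler time the scheme has moved by a drift of order [h = 1 / r.+1] and a Gaussian
    term [k * z]. The bound [|k * z| <= (q * k ^ 2 + z ^ 2 / q) / 2] with [q = sqrt h] balances the
    two and gives a mean error of order [sqrt h]. *)
Lemma euler_coef_error t p N : 0 <= t -> t <= r.+1%:R ->
  grid t (times (euler_process W m v r)) 1 p N ->
  (\int[P]_w (coef_error v (fun i => p i.+1 - p i) (fun i => simple_value (euler_process W m v r) (p i.+1))
     (fun i => drifted m W (euler_process W m v r) (p i)) N w)%:E <=
   (t * (bt t * Num.sqrt r.+1%:R^-1))%:E)%E.
Proof.
move=> t0 tr g; set S := euler_process W m v r; have pS : simple_predictable F S := euler_predictable.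
have p0 i : 0 <= p i := grid_ge0 i g.
have pmono i : p i <= p i.+1 by exact: grid_mono g (leqnSn i).
set h := r.+1%:R^-1; have h0 : 0 < h by rewrite invr_gt0.
have h1 : h <= 1 by rewrite invf_le1 ?ler1n.
set q := Num.sqrt h; have q0 : 0 < q by rewrite sqrtr_gt0.
have qE : q ^+ 2 = h by rewrite sqr_sqrtr// ltW.
have q1 : q <= 1 by rewrite -sqrtr1 ler_wsqrtr.
have hq : h <= q by rewrite -qE expr2 ler_piMr// ltW.
have sF i := filtration_sub wW (p0 i).
have mval i : meas_fun (simple_value S (p i.+1)).
  apply: (sub_meas_wrt (sF i)); apply: (simple_value_meas_wrt wW) => //.
  by case: g => _ _ _ _; exact.
have mdr i : meas_fun (drifted m W S (p i)) by exact: measurable_drifted.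
have dl0 i : 0 <= p i.+1 - p i by rewrite subr_ge0.
pose f i w := (simple_value S (p i.+1) w - diffusion_coef v (drifted m W S (p i) w)) ^+ 2.
have mf i : meas_fun (f i).
  apply: measurable_funX; apply: measurable_funB => //.
  by apply: measurableT_comp => //; exact: measurable_diffusion_coef.
have f0 i w : 0 <= f i w by exact: sqr_ge0.
have B0 := euler_bound_ge0 t0; set B := euler_bound t in B0.
have step i : (\int[P]_w (f i w * (p i.+1 - p i))%:E <= ((bt t * q) * (p i.+1 - p i))%:E)%E.
  under eq_integral do rewrite mulrC.
  rewrite ge0_integral_scale// mulrC (EFinM (p i.+1 - p i)).
  have [e|ne] := eqVneq (p i) (p i.+1); first by rewrite e subrr !mul0e.
  have lt : p i < p i.+1 by rewrite lt_neqAle ne pmono.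
  apply: lee_pmul; [by rewrite lee_fin|by apply: integral_ge0 => w _; rewrite lee_fin|exact: lexx|].
  have R0 : 0 < r.+1%:R :> R by [].
  (* The Euler interval containing [p i]; as the grid refines the Euler times, the whole cell lies
     in it. *)
  pose j := Num.truncn (r.+1%:R * p i).
  have /andP[j1 j2] := truncn_itv (mulr_ge0 (ltW R0) (p0 i)).
  have jp : tm j <= p i by rewrite /tm ler_pdivrMr// mulrC.
  have pj : p i < tm j.+1 by rewrite /tm ltr_pdivlMr// mulrC.
  have pt : p i.+1 <= t := grid_le_t i.+1 g.
  have jN : (j < r.+1 ^ 2)%N.
    rewrite -(ltr_nat R) natrX; apply: le_lt_trans j1 _.
    by rewrite expr2 ltr_pM2l// (lt_le_trans lt)// (le_trans pt).
  have pj1 : p i.+1 <= tm j.+1.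
    have [_ _ _ _ /(_ i (tm j.+1))] := g; case => //.
      by apply: (@times_mem _ T _ S j.+1).
    by rewrite leNgt pj.
  have jt : tm j <= t := le_trans jp (le_trans (pmono i) pt).
  have tj0 := etime_ge0 r j.
  pose V w := W (p i) w - W (tm j) w.
  have mV := increment_measurable wW tj0 jp : meas_fun V.
  have [_ _ V2] := increment_centered wW tj0 jp.
  pose c0 := v * (`|m| + v / 2) * q; pose c1 := v * (v / 2 + 1) * q; pose c2 := v / (2 * q).
  have c00 : 0 <= c0 by rewrite /c0; apply: mulr_ge0 (ltW q0); apply: mulr_ge0 => //; apply: addr_ge0 => //; exact: divr_ge0.
  have c10 : 0 <= c1 by rewrite /c1; apply: mulr_ge0 (ltW q0); apply: mulr_ge0 => //; apply: addr_ge0 => //; exact: divr_ge0.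
  have c20 : 0 <= c2 by rewrite /c2; apply: divr_ge0 => //; apply: mulr_ge0 => //; exact: ltW.
  have ph : p i - tm j <= h by rewrite lerBlDl -etimeS; exact: ltW.
  have ub w : f i w <= c0 + (c1 * U j w ^+ 2 + c2 * V w ^+ 2).
    rewrite /f (euler_value W m v w jN); last by rewrite (le_lt_trans jp).
    rewrite (drifted_euler _ jN) ?jp ?(ltW pj)//; apply: le_trans (tcoef_close _ _ _ v0) _.
    set u := U j w; set k := tcoef v r u; set z := V w.
    have hk : k ^+ 2 <= v * (1 + u ^+ 2).
      apply: le_trans (tcoef_sqr_le r u v0) _; apply: ler_wpM2l => //.
      have := sqr_ge0 (`|u| - 1); rewrite -[u ^+ 2]real_normK ?num_real// !expr2; have := normr_ge0 u.
      move: `|u| => y *; nra.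
    have hd : `|u + m * (p i - tm j) + k * z - u| <= `|m| * q + (q * (v * (1 + u ^+ 2)) + z ^+ 2 / q) / 2.
      rewrite (_ : _ - u = m * (p i - tm j) + k * z); last by ring.
      apply: le_trans (ler_normD _ _) _; apply: lerD.
        rewrite normrM ler_wpM2l// ger0_norm ?subr_ge0//; exact: le_trans ph hq.
      have /le_trans : `|k * z| <= (q * k ^+ 2 + z ^+ 2 / q) / 2.
        have -> : (q * k ^+ 2 + z ^+ 2 / q) / 2 = ((q * `|k|) ^+ 2 + `|z| ^+ 2) / (2 * q).
          by rewrite exprMn !real_normK ?num_real//; field; rewrite gt_eqF.
        rewrite ler_pdivlMr ?mulr_gt0// normrM; have := sqr_ge0 (q * `|k| - `|z|).
        by rewrite !expr2; lra.
      by apply; rewrite ler_pM2r ?invr_gt0// lerD2r ler_wpM2l// ltW.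
    have hu : u ^+ 2 / r.+1%:R <= u ^+ 2 * q by rewrite ler_wpM2l// sqr_ge0.
    apply: le_trans (ler_wpM2l v0 (lerD hd hu)) _.
    rewrite /c0 /c1 /c2 le_eqVlt; apply/orP; left; apply/eqP; field; rewrite gt_eqF//.
  have mU2 : meas_fun (fun w => U j w ^+ 2) by apply: measurable_funX; exact: measurable_euler.
  have mV2 : meas_fun (fun w => V w ^+ 2) by exact: measurable_funX.
  apply: le_trans (ge0_integral_mono P (g := fun w => (c0 + (c1 * U j w ^+ 2 + c2 * V w ^+ 2))%:E) _ _) _.
  - by move=> w; rewrite lee_fin.
  - by move=> w; rewrite lee_fin.
  have g1 w : 0 <= c1 * U j w ^+ 2 by apply: mulr_ge0 => //; exact: sqr_ge0.
  have g2 w : 0 <= c2 * V w ^+ 2 by apply: mulr_ge0 => //; exact: sqr_ge0.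
  have mg1 : meas_fun (fun w => c1 * U j w ^+ 2) by exact: measurable_funM.
  have mg2 : meas_fun (fun w => c2 * V w ^+ 2) by exact: measurable_funM.
  have I1 := ge0_integral_scale P c10 mU2 (fun w => sqr_ge0 _).
  have I2 := ge0_integral_scale P c20 mV2 (fun w => sqr_ge0 _).
  have I3 := ge0_integral_add P mg1 mg2 g1 g2.
  have I4 : (\int[P]_w (c0 + (c1 * U j w ^+ 2 + c2 * V w ^+ 2))%:E =
      \int[P]_w c0%:E + \int[P]_w (c1 * U j w ^+ 2 + c2 * V w ^+ 2)%:E)%E.
    by apply: (@ge0_integral_add _ _ _ P (cst c0)) => //; [exact: measurable_funD|move=> w; exact: addr_ge0].
  have I0 : (\int[P]_w c0%:E = c0%:E)%E.
    by rewrite integral_cst//= [X in (_ * X)%E]probability_setT mule1.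
  rewrite I4 I3 I1 I2 V2 I0.
  have hB : (c1%:E * \int[P]_w (U j w ^+ 2)%:E <= (c1 * B)%:E)%E.
    rewrite (EFinM c1); apply: lee_pmul => //; last exact: euler_L2.
    by apply: integral_ge0 => w _; rewrite lee_fin sqr_ge0.
  apply: le_trans (_ : (c0%:E + ((c1 * B)%:E + (c2 * q ^+ 2)%:E) <= _)%E).
    apply: leeD => //; apply: leeD => //; rewrite (EFinM c2); apply: lee_pmul => //.
      by rewrite lee_fin subr_ge0.
    by rewrite lee_fin qE.
  rewrite -!EFinD lee_fin le_eqVlt; apply/orP; left; apply/eqP.
  by rewrite /c0 /c1 /c2 /bt -/B; field; rewrite gt_eqF.
rewrite /coef_error; have := @ge0_integral_sum_ord _ _ _ P N (fun i w => f i w * (p i.+1 - p i)).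
move=> ->; last 2 first.
- by move=> i; apply: measurable_funM.
- by move=> i w; exact: mulr_ge0.
apply: (@le_trans _ _ (\sum_(i < N) ((bt t * q) * (p i.+1 - p i))%:E)%E); first exact: lee_sum.
by rewrite sumEFin lee_fin -mulr_sumr (grid_sum g) mulrC.
Qed.
End euler_wiener.

Lemma euler_near m v t eta : 0 <= v -> 0 <= t -> 0 < eta ->
  exists r0, forall r, (r0 <= r)%N -> forall d (T : measurableType d) (P : probability T R) F W,
  wiener_process P F W -> near_solution P W m v t (euler_process W m v r) eta.
Proof.
move=> v0 t0 eta0; pose b := v * (`|m| + (v * (1 + euler_bound m v t) + 1) / 2 + euler_bound m v t).
have B0 := euler_bound_ge0 m v0 t0.
have b0 : 0 <= b.
  apply: mulr_ge0 => //; apply: addr_ge0 => //; apply: addr_ge0 => //; apply: divr_ge0 => //.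
  by apply: addr_ge0 => //; apply: mulr_ge0 => //; exact: addr_ge0.
have tb0 : 0 <= t * b by exact: mulr_ge0.
have tb1 : 0 < t * b + 1 by rewrite ltr_wpDl.
pose c := eta ^+ 2 / (t * b + 1); have c0 : 0 < c by rewrite divr_gt0// exprn_gt0.
have [k] := ltr_add_invr (exprn_gt0 2 c0); rewrite add0r => kc.
have [k' tk'] : exists k' : nat, t <= k'%:R.
  by exists (Num.truncn t).+1; exact/ltW/truncnS_gt.
exists (maxn k k') => r rk d T P F W wW; exists 1 => // p N g.
have tr : t <= r.+1%:R.
  apply: le_trans tk' _; rewrite ler_nat ltnW// ltnS.
  by apply: leq_trans rk; rewrite leq_maxr.
have sq : Num.sqrt r.+1%:R^-1 <= c.
  rewrite -[leRHS]gtr0_norm// -sqrtr_sqr ler_wsqrtr//; apply: le_trans (ltW kc).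
  rewrite lef_pV2 ?posrE// ler_nat ltnS; apply: leq_trans rk; exact: leq_maxl.
have le1 := euler_coef_error wW v0 t0 tr g.
have p0 i : 0 <= p i := grid_ge0 i g.
have pmono i : p i <= p i.+1 by exact: grid_mono g (leqnSn i).
have pS := euler_predictable wW m r v0.
have mce : meas_fun (coef_error v (fun i => p i.+1 - p i)
    (fun i => simple_value (euler_process W m v r) (p i.+1))
    (fun i => drifted m W (euler_process W m v r) (p i)) N).
  apply: measurable_coef_error => i _.
    apply: (sub_meas_wrt (filtration_sub wW (p0 i))).
    apply: (simple_value_meas_wrt wW) => //; by case: g => _ _ _ _; exact.
  exact: (measurable_drifted wW).
apply: most_imp (most_markov eta0 mce _ (le_trans le1 _)).
- by move=> w; exact: ltW.
- by move=> w; apply: coef_error_ge0 => i; rewrite subr_ge0.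
- rewrite lee_fin mulrA; apply: le_trans (ler_wpM2l tb0 sq) _.
  rewrite /c mulrCA -expr2 ler_piMr ?sqr_ge0// ler_pdivrMr// mul1r lerDl//.
Qed.

Lemma euler_cauchy m v t e : 0 <= v -> 0 <= t -> 0 < e ->
  forall d (T : measurableType d), exists r0, forall r r', (r0 <= r)%N -> (r0 <= r')%N ->
  forall (P : probability T R) F W, wiener_process P F W ->
  most P e (fun w => forall s, 0 <= s <= t ->
    `|drifted m W (euler_process W m v r) s w - drifted m W (euler_process W m v r') s w| <= e).
Proof.
move=> v0 t0 e0 d T; have [eta eta0 stab] := @stability_sup R m v t e v0 t0 e0 _ T.
have [r0 hr] := @euler_near m v t eta v0 t0 eta0.
exists r0 => r r' rr rr' P F W wW; apply: (stab P F W) => //.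
- exact: (euler_predictable wW).
- exact: (euler_predictable wW).
- exact: hr wW.
- exact: hr wW.
Qed.

Lemma solution_euler m v t e : 0 <= v -> 0 <= t -> 0 < e ->
  forall d (T : measurableType d), exists r0, forall r, (r0 <= r)%N ->
  forall (P : probability T R) F W X, wiener_process P F W ->
  sde_solution P F W (fun=> m) (diffusion_coef v) 0 X ->
  most P e (fun w => forall s, 0 <= s <= t ->
    `|X s w - drifted m W (euler_process W m v r) s w| <= e).
Proof.
move=> v0 t0 e0 d T; have e20 : 0 < e / 2 by rewrite divr_gt0.
have [eta eta0 stab] := @stability_sup R m v t (e / 2) v0 t0 e20 _ T.
have [r0 hr] := @euler_near m v t eta v0 t0 eta0.
exists r0 => r rr P F W X wW sX.
have et0 : 0 < Num.min eta (e / 2) by rewrite lt_min eta0.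
have [S [pS [mesh mesh0 nS] mS]] := solution_near v0 t0 et0 wW sX.
have le1 : Num.min eta (e / 2) <= eta by rewrite ge_min lexx.
have le2 : Num.min eta (e / 2) <= e / 2 by rewrite ge_min lexx orbT.
have nS' : near_solution P W m v t S eta.
  exists mesh => // p N /nS; move=> /(most_le le1); apply: most_imp => w h.
  exact: le_trans h le1.
have := stab _ _ _ _ _ wW pS (euler_predictable wW m r v0) nS' (hr _ rr _ _ _ _ _ wW).
move=> /(most_and (most_le le2 mS)) H; apply: (most_le (e := e / 2 + e / 2)); first by lra.
apply: most_imp H => w [h1 h2] s st; have := le_trans (h1 s st) le2; have := h2 s st.
set x := X s w; set a := drifted m W S s w; set b := drifted m W _ s w => h3 h4.
rewrite (_ : x - b = (x - a) + (a - b)); last by ring.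
apply: le_trans (ler_normD _ _) _; lra.
Qed.
End euler_scheme.

(** * Strong existence *)

Section existence.
Context {R : realType}.

Lemma dyadic_limit (u : nat -> R) (k0 : nat) :
  (forall k, (k0 <= k)%N -> `|u k - u k.+1| <= (2 ^ k.+1)%:R^-1) ->
  cvg (u n @[n --> \oo]) /\
  forall k, (k0 <= k)%N -> `|u k - lim (u n @[n --> \oo])| <= 2 * (2 ^ k.+1)%:R^-1.
Proof.
move=> hu; pose a k : R := (2 ^ k.+1)%:R^-1.
have a0 k : 0 < a k by rewrite invr_gt0 ltr0n expn_gt0.
have aS k : a k = 2 * a k.+1.
  by rewrite /a [in RHS]expnS natrM invfM mulrA divff ?mul1r// pnatr_eq0.
have hk k j : (k0 <= k)%N -> `|u k - u (k + j)%N| <= 2 * a k - 2 * a (k + j)%N.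
  move=> kk; elim: j => [|j IH]; first by rewrite addn0 !subrr normr0.
  rewrite addnS (_ : _ - _ = (u k - u (k + j)%N) + (u (k + j)%N - u (k + j).+1)); last by ring.
  apply: le_trans (ler_normD _ _) _.
  have := hu (k + j)%N (leq_trans kk (leq_addr _ _)); have := aS (k + j)%N; rewrite -/(a _); lra.
have hk' k n : (k0 <= k)%N -> (k <= n)%N -> `|u k - u n| <= 2 * a k.
  by move=> kk kn; rewrite -(subnKC kn); apply: le_trans (hk k _ kk) _; rewrite gerBl mulr_ge0// ltW.
have ale k : a k <= k.+1%:R^-1.
  by rewrite lef_pV2 ?posrE ?ltr0n ?expn_gt0// ler_nat ltnW// ltn_expl.
have cu : cvg (u n @[n --> \oo]).
  apply/cauchy_cvgP/cauchy_exP => e e0.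
  have e20 : 0 < e / 2 by rewrite divr_gt0.
  have [l] := ltr_add_invr e20; rewrite add0r => le.
  pose K := maxn k0 l; exists (u K); exists K => // n /= Kn; rewrite /ball/=.
  apply: le_lt_trans (hk' _ _ (leq_maxl _ _) Kn) _.
  have h1 : a K <= l.+1%:R^-1.
    by apply: le_trans (ale K) _; rewrite lef_pV2 ?posrE// ler_nat ltnS leq_maxr.
  move: le h1; set x := l.+1%:R^-1 => *; lra.
split=> // k kk; apply/ler_addgt0Pr => e e0.
have /cvgrPdist_lt/(_ e e0)[n0 _ hn] := cu.
have := hn _ (leq_maxr k n0); have := hk' k _ kk (leq_maxl k n0); set L := lim _; set z := u (maxn _ _).
move=> h2 h1; rewrite distrC in h1.
rewrite (_ : u k - L = (u k - z) + (z - L)); last by ring.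
by apply: le_trans (ler_normD _ _) _; apply: lerD => //; exact: ltW.
Qed.

Lemma cpath_limit (D : nat -> R -> R) (x : R -> R) :
  (forall k, cpath (D k)) ->
  (forall t e : R, 0 <= t -> 0 < e -> exists k0, forall k, (k0 <= k)%N -> forall s, 0 <= s <= t -> `|D k s - x s| <= e) ->
  cpath x.
Proof.
move=> cD lim s e s0 e0; have e30 : 0 < e / 3 by rewrite divr_gt0.
have s10 : 0 <= s + 1 by exact: addr_ge0.
have [k hk] := lim _ _ s10 e30; have {}hk := hk k (leqnn k).
have [dt dt0 h] := cD k s _ s0 e30.
exists (Num.min dt 1) => [|s' s'0]; first by rewrite lt_min dt0 ltr01.
rewrite lt_min => /andP[/(h _ s'0) h1 h2].
have h3 : 0 <= s' <= s + 1 by rewrite s'0/= -lerBlDl (le_trans (ler_norm _))// ltW.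
have h4 : 0 <= s <= s + 1 by rewrite s0 lerDl ler01.
have := hk _ h3; have := hk _ h4 => h5 h6.
rewrite (_ : x s' - x s = - (D k s' - x s') + (D k s' - D k s) + (D k s - x s)); last by ring.
have := ler_normD (- (D k s' - x s') + (D k s' - D k s)) (D k s - x s).
have := ler_normD (- (D k s' - x s')) (D k s' - D k s); rewrite normrN.
set a := `|- _ + _|; lra.
Qed.

Lemma integral_itv_le_cst (f : R -> R) (t c : R) : 0 <= t ->
  (forall s, 0 <= s <= t -> 0 <= f s <= c) ->
  (\int[lebesgue_measure]_(s in `[0%R, t]) (f s)%:E <= (c * t)%:E)%E.
Proof.
move=> t0 h.
have -> : (c * t)%:E = (\int[lebesgue_measure]_(s in `[0%R, t]) c%:E)%E.
  rewrite integral_cst//= lebesgue_measure_itv/= lte_fin; case: ifPn => [_|].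
    by rewrite oppr0 adde0 -EFinM.
  by rewrite -leNgt => t0'; rewrite mule0 (_ : t = 0) ?mulr0//; apply/eqP; rewrite eq_le t0'.
rewrite integral_mkcond [leRHS]integral_mkcond; apply: ge0_integral_mono => s.
- rewrite patchE; case: ifPn => // /set_mem/=; rewrite in_itv/= => /h/andP[? _]; by rewrite lee_fin.
- rewrite !patchE; case: ifPn => // /set_mem/=; rewrite in_itv/= => /h/andP[_ ?]; by rewrite lee_fin.
Qed.

(** Pathwise: uniform convergence of the schemes and uniform continuity of [x] bound the distance
    between [x s] and the scheme at the preceding Euler time by [u + u], and boundedness of [x]
    bounds the truncation term of [tcoef_close] by [u]. *)
Lemma euler_integrand_close (m v t e : R) d (T : measurableType d) (P : probability T R) F
    (W : R -> T -> R) (w : T) (rk : nat -> nat) (x : R -> R) :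
  0 <= v -> 0 <= t -> 0 < e -> wiener_process P F W -> (forall k, (k <= rk k)%N) ->
  cpath x -> x 0 = 0 ->
  (forall u : R, 0 < u -> exists k0, forall k, (k0 <= k)%N -> forall s, 0 <= s <= t ->
      `|drifted m W (euler_process W m v (rk k)) s w - x s| <= u) ->
  exists k0, forall k, (k0 <= k)%N ->
    (\int[lebesgue_measure]_(s in `[0%R, t])
      ((simple_value (euler_process W m v (rk k)) s w - diffusion_coef v (x s)) ^+ 2)%:E < e%:E)%E.
Proof.
move=> v0 t0 e0 wW rkk cx x0 lim.
have vt0 : 0 <= v * t by exact: mulr_ge0.
pose u := Num.min 1 (e / (3 * (v * t) + 1)).
have den0 : 0 < 3 * (v * t) + 1 by rewrite ltr_wpDl// mulr_ge0.
have u0 : 0 < u by rewrite lt_min ltr01 divr_gt0.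
have [M hM] := cpath_bounded cx t0.
have M0 : 0 <= M by apply: le_trans (hM 0 _); rewrite ?lexx.
have [dt dt0 hdt] := cpath_uniform cx t0 u0.
have [k1 hk1] := lim u u0.
pose g := Num.min dt (u / (M + 1) ^+ 2).
have M2 : 0 < (M + 1) ^+ 2 by rewrite exprn_gt0// ltr_wpDl.
have g0 : 0 < g by rewrite lt_min dt0 divr_gt0.
have [k2] := ltr_add_invr g0; rewrite add0r => k2g.
have [k3 tk3] : exists k : nat, t <= k%:R.
  by exists (Num.truncn t).+1; exact/ltW/truncnS_gt.
exists (maxn k1 (maxn k2 k3)) => k; rewrite !geq_max => /andP[kk1 /andP[kk2 kk3]].
set r := rk k; have kr : (k <= r)%N := rkk k.
have hinv : r.+1%:R^-1 <= g.
  by apply: le_trans (ltW k2g); rewrite lef_pV2 ?posrE// ler_nat ltnS (leq_trans kk2).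
have [hg1 hg2] : r.+1%:R^-1 <= dt /\ r.+1%:R^-1 <= u / (M + 1) ^+ 2.
  by move: hinv; rewrite le_min => /andP[].
have tr : t <= r%:R by apply: le_trans tk3 _; rewrite ler_nat (leq_trans kk3).
apply: (@le_lt_trans _ _ (v * (u + u + u) * t)%:E); last first.
  rewrite lte_fin; apply: (@le_lt_trans _ _ (3 * (v * t) * (e / (3 * (v * t) + 1)))).
    have -> : v * (u + u + u) * t = 3 * (v * t) * u by ring.
    by rewrite ler_wpM2l ?mulr_ge0// ge_min lexx orbT.
  by rewrite mulrCA gtr_pMr// ltr_pdivrMr// mul1r ltrDl.
apply: integral_itv_le_cst => // s /andP[s0 st]; rewrite sqr_ge0/=.
have [->|sn0] := eqVneq s 0.
  rewrite /simple_value big1 => [|i _]; last first.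
    by rewrite indicE memNset ?mulr0//= in_itv/= => /andP[+ _]; rewrite ltNge (etime_ge0).
  rewrite /diffusion_coef x0 maxxx mulr0 sqrtr0 subrr expr0n/= mulr_ge0// ?addr_ge0// ltW//.
have {}s0' : 0 < s by rewrite lt_neqAle eq_sym sn0.
have R0 : 0 < r.+1%:R :> R by [].
have ex : exists j, s <= etime r j.+1.
  exists (Num.truncn (r.+1%:R * s)); rewrite /etime ler_pdivlMr// mulrC.
  exact/ltW/truncnS_gt.
have [j hj jmin] := ex_minnP ex.
have js : etime r j < s.
  case: j hj jmin => [|j] hj jmin; first by rewrite /etime mul0r.
  by rewrite ltNge; apply/negP => /jmin; rewrite ltnn.
have jN : (j < r.+1 ^ 2)%N.
  rewrite -(@etime_lt R r); apply: lt_le_trans js _; apply: le_trans st _.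
  apply: le_trans tr _; rewrite /etime ler_pdivlMr// -natrM ler_nat expnS expn1 leq_mul//.
have j0 := etime_ge0 r j.
have jt : etime r j <= t by apply: le_trans st; exact: ltW.
rewrite (euler_value W m v w jN) ?js//; apply: le_trans (tcoef_close _ _ _ v0) _; apply: ler_wpM2l => //.
rewrite -(drifted_eulerE wW m v0 w (ltnW jN)).
have hd := hk1 k kk1 (etime r j) _; rewrite j0 jt in hd; have {hd} := hd isT; rewrite -/r.
set D := drifted _ _ _ _ _ => hd.
apply: lerD.
  rewrite (_ : x s - D = (x s - x (etime r j)) - (D - x (etime r j))); last by ring.
  apply: le_trans (ler_normB _ _) _; apply: lerD => //; apply: hdt; rewrite ?j0 ?(ltW s0')//.
  rewrite ger0_norm ?subr_ge0 ?(ltW js)//; apply: le_trans hg1.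
  by rewrite lerBlDl -etimeS.
have DM : `|D| <= M + 1.
  have := hM (etime r j); rewrite j0 jt => /(_ isT) h1.
  have := ler_normD (D - x (etime r j)) (x (etime r j)); rewrite subrK.
  have : u <= 1 by rewrite ge_min lexx.
  lra.
apply: (@le_trans _ _ ((M + 1) ^+ 2 * (u / (M + 1) ^+ 2))); last by rewrite mulrCA divff ?mulr1// gt_eqF.
apply: ler_pM => //; first exact: sqr_ge0.
by rewrite -[leLHS]real_normK ?num_real// lerXn2r// nnegrE// addr_ge0.
Qed.
End existence.

(** Along a subsequence, consecutive Euler schemes differ on [[0, k]] by at most [2 ^ - k.+1]
    outside an event of probability at most [2 ^ - k.+1]; by Borel-Cantelli they converge almost
    surely, uniformly on compact sets. The schemes themselves are the simple processes that exhibit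
    the Ito integral. *)
Lemma strong_existence_diffusion (R : realType) (m v : R) : 0 <= v ->
  strong_existence (fun=> m) (diffusion_coef v) 0.
Proof.
move=> v0 d T P W sW; set F := augmented_filtration P W.
have wW : wiener_process P F W := augmented_wiener sW.
pose D r s w := drifted m W (euler_process W m v r) s w.
pose a (k : nat) : R := (2 ^ k.+1)%:R^-1.
have a0 k : 0 < a k by rewrite invr_gt0 ltr0n expn_gt0.
have ale k : a k <= k.+1%:R^-1.
  by rewrite lef_pV2 ?posrE ?ltr0n ?expn_gt0// ler_nat ltnW// ltn_expl.
have /choice[r0 hr0] k := @euler_cauchy R m v k%:R (a k) v0 (ler0n _ k) (a0 k) _ T.
(* Both [rk k] and [rk k.+1] dominate [r0 k], so the Cauchy estimate of rank [k] applies to this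
   pair. *)
pose rk k := (k + \sum_(i < k.+1) r0 i)%N.
have rkk k : (k <= rk k)%N by exact: leq_addr.
have rk0 k : (r0 k <= rk k)%N.
  by rewrite /rk big_ord_recr/= addnA leq_addl.
have rk1 k : (r0 k <= rk k.+1)%N.
  rewrite /rk !big_ord_recr/=; apply: (leq_trans _ (leq_addl _ _)).
  by apply: (leq_trans _ (leq_addr _ _)); exact: leq_addl.
have /choice[B hB] k := hr0 k _ _ (rk0 k) (rk1 k) P F W wW.
have mB k : measurable (B k) by case: (hB k).
pose N := lim_sup_set B.
have mN : measurable N.
  by apply: bigcapT_measurable => k; apply: bigcup_measurable.
have PN : P N = 0%E.
  apply: lim_sup_set_cvg0 => //; apply: (@le_lt_trans _ _ 1%:E); last by rewrite ltry.
  apply: (le_trans _ (epsilon_trick0 xpredT (ler01 : 0 <= 1 :> R))).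
  apply: lee_nneseries => // k _; have [_ + _] := hB k.
  by rewrite div1r.
have nN : null_sets P N by [].
(* The schemes are set to 0 on the null event [N], so that every path converges to a continuous
   limit. [N] belongs to the augmented filtration at all times, hence adaptedness is kept. *)
pose Dk k s w := D (rk k) s w * \1_(~` N) w.
pose X s w := lim (Dk k s w @[k --> \oo]).
have unif w t : 0 <= t -> exists k0, forall s, 0 <= s <= t -> cvg (Dk k s w @[k --> \oo]) /\
    forall k, (k0 <= k)%N -> `|Dk k s w - X s w| <= 2 * a k.
  move=> t0; have [k1 tk1] : exists k : nat, t <= k%:R.
    by exists (Num.truncn t).+1; exact/ltW/truncnS_gt.
  have [k2 hk2] : exists k2, forall k, (k2 <= k)%N -> forall s, 0 <= s <= k%:R -> `|Dk k s w - Dk k.+1 s w| <= a k.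
    have [wN|wN] := pselect (N w).
      by exists 0%N => k _ s _; rewrite /Dk indicE memNset ?mulr0 ?subrr ?normr0 ?(ltW (a0 k))//=.
    have [k2 hk2] : exists k2, forall k, (k2 <= k)%N -> ~ B k w.
      apply: contrapT => h; apply: wN => n _; apply: contrapT => h'; apply: h; exists n => k nk Bk.
      by apply: h'; exists k.
    exists k2 => k /hk2; case: (hB k) => _ _ /[apply] h s /h.
    by rewrite /Dk indicE mem_set ?mulr1.
  exists (maxn k1 k2) => s /andP[s0 st].
  have hd k : (maxn k1 k2 <= k)%N -> `|Dk k s w - Dk k.+1 s w| <= a k.
    rewrite geq_max => /andP[kk1 kk2]; apply: hk2 => //; rewrite s0.
    by apply: le_trans st _; apply: le_trans tk1 _; rewrite ler_nat.
  exact: (dyadic_limit hd).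
have pS k : simple_predictable F (euler_process W m v (rk k)) by exact: (euler_predictable wW).
have mIN s : 0 <= s -> meas_wrt (F s) (\1_(~` N) : T -> R).
  move=> s0; apply: (@measurable_indic _ (g_sigma_algebraType (F s)) R setT).
  by apply: measurableC; apply: sub_sigma_algebra; apply: sub_sigma_algebra; right.
have mDk k s : 0 <= s -> meas_wrt (F s) (Dk k s).
  by move=> s0; apply: measurable_funM; [exact: (drifted_meas_wrt wW)|exact: mIN].
have cvX w s : 0 <= s -> Dk k s w @[k --> \oo] --> X s w.
  by move=> s0; have [k0 h] := unif w s s0; have [|cv _] := h s _; first by rewrite s0 lexx.
have mX s : 0 <= s -> meas_wrt (F s) (X s).
  move=> s0; apply: (@measurable_fun_cvg _ (g_sigma_algebraType (F s)) R setT (fun k => Dk k s)).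
    by move=> k; exact: mDk.
  by move=> w _; exact: cvX.
have sF s : 0 <= s -> sub_algebra (F s) by exact: (filtration_sub wW).
have mXT s : 0 <= s -> meas_fun (X s).
  by move=> s0; exact: (sub_meas_wrt (sF s s0) (mX s s0)).
have unif' w t u : 0 <= t -> 0 < u -> exists k0, forall k, (k0 <= k)%N -> forall s, 0 <= s <= t ->
    `|Dk k s w - X s w| <= u.
  move=> t0 u0; have [k0 h] := unif w t t0; have u20 : 0 < u / 2 by rewrite divr_gt0.
  have [l] := ltr_add_invr u20; rewrite add0r => lu.
  exists (maxn k0 l) => k; rewrite geq_max => /andP[kk0 kl] s st; have [_ /(_ k kk0)] := h s st.
  move=> /le_trans; apply; rewrite mulrC -ler_pdivlMr//; apply: le_trans (ale k) _; apply: le_trans (ltW lu).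
  by rewrite lef_pV2 ?posrE// ler_nat.
have cX w : cpath (X^~ w).
  apply: (@cpath_limit R (fun k s => Dk k s w)) => [k|t e]; last exact: unif'.
  have := cpathZ (\1_(~` N) w) (cpath_drifted wW m (euler_process W m v (rk k)) w).
  by congr cpath; apply/funext => s; rewrite mulrC.
have X0 w : X 0 w = 0.
  rewrite /X (_ : (fun k => _) = cst 0) ?lim_cst//; apply/funext => k.
  by rewrite /Dk /D /drifted mulr0 add0r (simple_integral0 W w (pS k)) mul0r.
have lim w t u : ~ N w -> 0 <= t -> 0 < u -> exists k0, forall k, (k0 <= k)%N -> forall s, 0 <= s <= t ->
    `|D (rk k) s w - X s w| <= u.
  move=> wN t0 u0; have [k0 h] := unif' w t u t0 u0; exists k0 => k kk s /(h k kk).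
  by rewrite /Dk indicE mem_set ?mulr1.
have ae_off (Q : T -> Prop) : (forall w, ~ N w -> Q w) -> {ae P, forall w, Q w}.
  by move=> h; exists N; split => // w /=; apply: contra_notP => wN; exact: h.
pose I s w := X s w - m * s.
have mI s : 0 <= s -> meas_wrt (F s) (I s).
  by move=> s0; apply: measurable_funB; [exact: mX|exact: measurable_cst].
have cI w : cpath (I^~ w).
  by apply: cpath_sub; [exact: cX|apply: cpathZ; exact: cpath_id].
exists X; split.
- by move=> t t0 C mC; have /(meas_wrtP _ (sF t t0)) := mX t t0; apply.
- by move=> w; apply/cpathP; exact: cX.
- exact: aeW.
- apply: aeW => w t t0; have [M hM] := cpath_bounded (cX w) t0.
  apply: le_lt_trans (integral_itv_le_cst (c := `|m| + v * M) t0 _) _; last by rewrite ltry.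
  move=> s st; rewrite addr_ge0 ?sqr_ge0//= lerD2l diffusion_coef_sqr// ler_wpM2l//.
  have h := hM s st; rewrite ge_max; apply/andP; split; apply: (le_trans _ h); first exact: ler_norm.
  exact: normr_ge0.
exists I; last first.
  apply: aeW => w t t0; rewrite add0r Rintegral_cst//= lebesgue_measure_itv/= lte_fin /I addrC.
  case: ifPn => [_|]; first by rewrite oppr0 adde0 subrK.
  by rewrite -leNgt => t0'; rewrite mulr0 (_ : t = 0) ?mulr0 ?subrK//; apply/eqP; rewrite eq_le t0'.
split.
- by move=> t t0 C mC; have /(meas_wrtP _ (sF t t0)) := mI t t0; apply.
- by move=> w; apply/cpathP; exact: cI.
have mSI k s : 0 <= s -> meas_fun (simple_integral (euler_process W m v (rk k)) W s).
  move=> s0; apply: (sub_meas_wrt (sF s s0)).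
  by apply: (simple_integral_meas_wrt wW).
exists (fun k => euler_process W m v (rk k)); split.
- exact: pS.
- move=> t e t0 e0; apply: probability_eventually => [k|].
    have mc := @measurable_coef_int R _ T (euler_process W m v (rk k)) X v t _ mXT cX.
    rewrite -[X in measurable X]setTI; apply: emeasurable_fun_c_infty => //; apply: mc => i _.
    apply: measurableT_comp; [exact: measurable_tcoef|exact: (measurable_euler wW)].
  apply: ae_off => w wN.
  have [u|k0 h] := euler_integrand_close v0 t0 e0 wW rkk (cX w) (X0 w) (w := w) (m := m).
    exact: lim.
  by exists k0 => k /h; rewrite /= ltNge => /negP.
- move=> t e t0 e0; apply: probability_eventually => [k|].
    apply: (measurable_exceed (X := fun s w => simple_integral (euler_process W m v (rk k)) W s w - I s w)) => //.
      move=> s s0; apply: measurable_funB; first exact: mSI.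
      exact: (sub_meas_wrt (sF s s0) (mI s s0)).
    move=> w; apply: cpath_sub => //; have := cpath_drifted wW 0 (euler_process W m v (rk k)) w.
    by congr cpath; apply/funext => s; rewrite /drifted mul0r add0r.
  apply: ae_off => w wN; have e20 : 0 < e / 2 by rewrite divr_gt0.
  have [k0 h] := lim w t (e / 2) wN t0 e20; exists k0 => k kk /= [s st].
  have := h k kk s st; rewrite /D /drifted /I.
  set x := X s w; set y := simple_integral _ _ _ _.
  have -> : m * s + y - x = y - (x - m * s) by ring.
  move=> h1 h2; have := le_trans h2 h1; lra.
Qed.

(** * Information in the Galton-Watson family *)

Section information.
Context {d d'} {T : measurableType d} {T' : measurableType d'} {R : realType}.
Context {I : choiceType}.
Variables (P : probability T R) (X : I -> T -> T').
Hypotheses (mX : forall i, meas_fun (X i))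
  (iX : mutually_independent P X).
Implicit Type S : pred I.

(** A pi-system generating the information carried by the indices in [S]; product rules are checked
    on it. *)
Definition cylinders S : set_system T := [set C | exists s A,
  [/\ uniq s, {subset s <= S}, forall i : I, measurable (A i : set T') &
      C = \bigcap_(i in [set` s]) X i @^-1` A i]].

Definition info S : set_system T := <<s cylinders S >>.

Lemma cylinders_measurable S : cylinders S `<=` measurable.
Proof.
move=> C [s [A [_ _ mA ->]]]; apply: fin_bigcap_measurable => // i _.
by rewrite -[_ @^-1` _]setTI; exact: mX.
Qed.

Lemma cylinders_setI S : setI_closed (cylinders S).
Proof.
move=> C D [s [A [us sS mA ->]]] [s' [A' [us' sS' mA' ->]]].
exists (undup (s ++ s')), (fun i => (if i \in s then A i else setT) `&` (if i \in s' then A' i else setT)).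
split.
- exact: undup_uniq.
- by move=> i; rewrite mem_undup mem_cat => /orP[/sS|/sS'].
- by move=> i; apply: measurableI; case: ifP.
- apply/seteqP; split => [w [h h'] i /= _|w h].
    by split; case: ifP => // ?; [exact: h|exact: h'].
  split => i /= is_; have := h i; rewrite /= mem_undup mem_cat is_ ?orbT => /(_ isT)[].
    by move=> + _.
  by move=> _ +.
Qed.

Lemma info_sub_algebra S : sub_algebra (info S).
Proof.
split; first exact: smallest_sigma_algebra.
by apply: smallest_sub; [exact: sigma_algebra_measurable|exact: cylinders_measurable].
Qed.

Lemma info_mono S S' : {subset S <= S'} -> info S `<=` info S'.
Proof.
move=> SS'; apply: sub_sigma_algebra2 => C [s [A [us sS mA ->]]]; exists s, A.
by split => // i /sS /SS'.
Qed.

Lemma info_measurable S i : i \in S -> meas_wrt (info S) (X i).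
Proof.
move=> iS; apply/(meas_wrtP _ (info_sub_algebra S)) => B mB.
apply: sub_sigma_algebra; exists [:: i], (fun=> B); split => //.
- by move=> j; rewrite inE => /eqP ->.
- apply/seteqP; split => [w h j /=|w /(_ i)/=]; first by rewrite inE => /eqP ->.
  by apply; rewrite inE.
Qed.

Lemma cylinders_indep S S' C D : (forall i, i \in S -> i \in S' -> False) ->
  cylinders S C -> cylinders S' D -> P (C `&` D) = (P C * P D)%E.
Proof.
move=> dis [s [A [us sS mA ->]]] [s' [A' [us' sS' mA' ->]]].
have disj i : i \in s -> (i \in s') = false.
  by move=> /sS h; apply/negP => /sS'; exact: dis.
pose B i := if i \in s then A i else A' i.
have mB i : measurable (B i) by rewrite /B; case: ifP.
have -> : \bigcap_(i in [set` s]) X i @^-1` A i `&` \bigcap_(i in [set` s']) X i @^-1` A' i =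
    \bigcap_(i in [set` (s ++ s')]) X i @^-1` B i.
  apply/seteqP; split => [w [h h'] i /=|w h].
    rewrite mem_cat /B; case: ifP => [is_ _|is_ /= is']; [exact: h|exact: h'].
  split => i /= is_; have := h i; rewrite /= mem_cat is_ ?orbT => /(_ isT); rewrite /B.
    by rewrite is_.
  by rewrite ifF//; apply/negP => /disj; rewrite is_.
have us2 : uniq (s ++ s').
  rewrite cat_uniq us us' andbT /=; apply/hasPn => i is'; apply/negP => /disj; by rewrite is'.
rewrite (iX us2 mB) (iX us mA) (iX us' mA') big_cat/=; congr (_ * _)%E; apply: eq_big_seq => i is_.
  by rewrite /B is_.
by rewrite /B ifF//; apply/negP => /disj; rewrite is_.
Qed.

Lemma info_indep S S' A B : (forall i, i \in S -> i \in S' -> False) ->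
  info S A -> info S' B -> P (A `&` B) = (P A * P B)%E.
Proof.
move=> dis iA iB; rewrite setIC muleC; move: B iB.
apply: product_rule_generated; first exact: cylinders_measurable.
- exact: cylinders_setI.
- by apply: (info_sub_algebra S).2.
- move=> D cD; rewrite setIC muleC; move: A iA.
  apply: product_rule_generated; first exact: cylinders_measurable.
  + exact: cylinders_setI.
  + exact: cylinders_measurable cD.
  + by move=> C cC; exact: (cylinders_indep dis).
Qed.

Lemma indep_of_info S S' d2 (T2 : measurableType d2) (V : T -> T2) :
  (forall i, i \in S -> i \in S' -> False) -> meas_wrt (info S') V ->
  indep_of P (info S) V.
Proof.
move=> dis /(meas_wrtP _ (info_sub_algebra S')) mV A B FA mB.
by apply: (info_indep dis) => //; exact: mV.
Qed.
End information.

Section nat_measurability.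
Context {d} {T : measurableType d}.

Lemma meas_nat_comp d' (T' : measurableType d') (h : nat -> T') (f : T -> nat) :
  meas_fun f -> meas_fun (h \o f).
Proof. by move=> mf _ B _; rewrite setTI comp_preimage -[_ @^-1` _]setTI; exact: mf. Qed.

Lemma measurable_addn (f g : T -> nat) : meas_fun f -> meas_fun g ->
  meas_fun (fun w => f w + g w)%N.
Proof.
move=> mf mg; apply: (meas_countable_index (g := fun k w => k + g w)%N) => // k.
exact: (meas_nat_comp (addn k)).
Qed.

Lemma measurable_sumn n (f : nat -> T -> nat) : (forall i, meas_fun (f i)) ->
  meas_fun (fun w => \sum_(i < n) f i w)%N.
Proof.
move=> mf; elim: n => [|n IH].
  by rewrite (_ : (fun w => _) = cst 0%N)//; apply/funext => w; rewrite big_ord0.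
rewrite (_ : (fun w => _) = (fun w => \sum_(i < n) f i w + f n w)%N).
  exact: measurable_addn.
by apply/funext => w; rewrite big_ord_recr.
Qed.
End nat_measurability.

Section gw_information.
Context {R : realType} {d} {T : measurableType d} (P : probability T R).
Variables (xi : nat -> nat -> 'I_2 -> T -> nat * nat) (eps : nat -> T -> nat * nat).
Hypothesis hfam : gw_family_law P xi eps.

Definition generation (a : (nat * nat * 'I_2) + nat) :=
  match a with inl (k, _, _) => k | inr k => k end.

Definition before (k : nat) : pred ((nat * nat * 'I_2) + nat) := fun a => (generation a < k)%N.

(** Within generation [k] only the first [j] offspring vectors of type [i] are revealed. This gives,
    for each type, a row of sigma-algebras between [past k] and [past k.+1] that adds the
    individuals one at a time. *)
Definition before_row (i : 'I_2) (k j : nat) : pred ((nat * nat * 'I_2) + nat) := fun a =>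
  (generation a < k)%N || (if a is inl (k', j', i') then (k' == k) && (j' < j)%N && (i' == i) else false).

Definition past k := info (gw_family xi eps) (before k).
Definition row_past i k j := info (gw_family xi eps) (before_row i k j).

Let mfam : forall a, meas_fun (gw_family xi eps a).
Proof. by case: hfam. Qed.

Let ifam : mutually_independent P (gw_family xi eps).
Proof. by case: hfam. Qed.

Lemma past_sub_algebra k : sub_algebra (past k).
Proof. exact: info_sub_algebra. Qed.

Lemma row_past_sub_algebra i k j : sub_algebra (row_past i k j).
Proof. exact: info_sub_algebra. Qed.

Lemma past_mono k l : (k <= l)%N -> past k `<=` past l.
Proof. by move=> kl; apply: info_mono => a; rewrite !unfold_in => /leq_trans; exact. Qed.

Lemma past_row i k j : past k `<=` row_past i k j.
Proof. by apply: info_mono => a; rewrite !unfold_in /before_row => ->. Qed.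

Lemma row_past_past i k j : row_past i k j `<=` past k.+1.
Proof.
apply: info_mono => -[[[k' j'] i']|k']; rewrite !unfold_in /before_row/before/= => /orP[/ltnW//|].
- by move=> /andP[/andP[/eqP -> _] _].
- by [].
Qed.

Lemma row_pastS i k j : row_past i k j `<=` row_past i k j.+1.
Proof.
apply: info_mono => -[[[k' j'] i']|k']; rewrite !unfold_in /before_row/= => /orP[->//|].
- by move=> /andP[/andP[-> h] ->]; rewrite (leqW h) orbT.
- by [].
Qed.

Lemma xi_row_measurable i k j : meas_wrt (row_past i k j.+1) (xi k j i).
Proof.
apply: (@info_measurable _ _ _ _ _ _ mfam _ (inl (k, j, i))).
by rewrite unfold_in /before_row/= !eqxx ltnSn orbT.
Qed.

Lemma xi_past_measurable i k j : meas_wrt (past k.+1) (xi k j i).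
Proof. by apply: (@info_measurable _ _ _ _ _ _ mfam _ (inl (k, j, i))); rewrite unfold_in /before/=. Qed.

Lemma eps_past_measurable k : meas_wrt (past k.+1) (eps k).
Proof. by apply: (@info_measurable _ _ _ _ _ _ mfam _ (inr k)); rewrite unfold_in /before/=. Qed.

Lemma xi_indep i k j : indep_of P (row_past i k j) (xi k j i).
Proof.
apply: (indep_of_info mfam ifam (S' := pred1 (inl (k, j, i)))).
  by move=> a ha /eqP ea; move: ha; rewrite ea unfold_in /before_row/= !eqxx !ltnn.
by apply: (@info_measurable _ _ _ _ _ _ mfam _ (inl (k, j, i))); rewrite inE.
Qed.

Lemma eps_indep k : indep_of P (past k) (eps k).
Proof.
apply: (indep_of_info mfam ifam (S' := pred1 (inr k))).
  by move=> a ha /eqP ea; move: ha; rewrite ea unfold_in /before/= ltnn.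
by apply: (@info_measurable _ _ _ _ _ _ mfam _ (inr k)); rewrite inE.
Qed.

Lemma later_indep k d' (T' : measurableType d') (V : T -> T') :
  meas_wrt (info (gw_family xi eps) (fun a => (k <= generation a)%N)) V ->
  indep_of P (past k) V.
Proof.
apply: (indep_of_info mfam ifam) => a; rewrite !unfold_in /before => h1 h2.
by have := leq_ltn_trans h2 h1; rewrite ltnn.
Qed.
End gw_information.

(** * Sums of independent noises with predictable coefficients *)

Section noise.
Context {R : realType} {d} {T : measurableType d} (P : probability T R).

Lemma integral_le_ge0 (f g : T -> \bar R) : (forall x, 0 <= g x)%E ->
  (forall x, f x <= g x)%E -> (\int[P]_x f x <= \int[P]_x g x)%E.
Proof.
move=> g0 fg; rewrite integralE; apply: (@le_trans _ _ (\int[P]_x f^\+ x)%E).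
  by rewrite geeDl// leeNl oppe0 integral_ge0.
by apply: ge0_integral_mono => x; rewrite funeposE ?le_max ?lexx ?orbT// ge_max fg g0.
Qed.

(* A sequence of independent centered noises [z 0, ..., z J.-1] with variance
   [v], together with the sigma-algebras [G j] generated by an initial one and
   the first [j] noises. *)
Record noise_row (J : nat) (v : R) (G : nat -> set_system T) (z : nat -> T -> R) : Prop := NoiseRow {
  nr_sub : forall j, sub_algebra (G j) ;
  nr_mono : forall j, G j `<=` G j.+1 ;
  nr_measurable : forall j, (j < J)%N -> meas_wrt (G j.+1) (z j) ;
  nr_indep : forall j, (j < J)%N -> indep_of P (G j) (z j) ;
  nr_centered : forall j, (j < J)%N -> centered P (z j) v }.

Lemma cubic_rem_mono (x y : R) : `|x| <= `|y| -> cubic_rem x <= cubic_rem y.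
Proof.
move=> xy; rewrite /cubic_rem; apply: ler_pM.
- exact: sqr_ge0.
- by rewrite le_min ler01 normr_ge0.
- by rewrite -(real_normK (num_real x)) -(real_normK (num_real y)) lerXn2r// nnegrE.
- by rewrite le_min !ge_min lexx xy orbT.
Qed.

Lemma cubic_rem_le_sqr (x : R) : cubic_rem x <= x ^+ 2.
Proof. by rewrite /cubic_rem ler_piMr ?sqr_ge0// ge_min lexx. Qed.

Definition window (lo hi : T -> nat) (j : nat) (w : T) : bool := (lo w <= j < hi w)%N.

(** A sum over the random range from [lo] to [hi], written with the deterministic number [J] of
    terms: the randomness of the range is moved into coefficients known at the beginning of the
    row. *)
Definition row_sum (K : T -> R) (lo hi : T -> nat) (z : nat -> T -> R) (J : nat) (w : T) : R :=
  \sum_(j < J) (if window lo hi j w then K w else 0) * z j w.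

Section row.
Variables (J : nat) (v c Q : R) (G : nat -> set_system T) (z : nat -> T -> R).
Hypotheses (nr : noise_row J v G z)
  (v0 : 0 <= v)
  (c0 : 0 <= c)
  (hQ : forall j, (j < J)%N -> (\int[P]_w (cubic_rem (c * z j w))%:E <= Q%:E)%E).
Variables (K : T -> R) (lo hi : T -> nat).
Hypotheses (mK : meas_wrt (G 0%N) K)
  (mlo : meas_wrt (G 0%N) lo)
  (mhi : meas_wrt (G 0%N) hi)
  (Kc : forall w, `|K w| <= c).

Let Kj j w := if window lo hi j w then K w else 0.

Let G0 j : G 0%N `<=` G j.
Proof. by elim: j => // j IH A /IH; exact: (nr_mono nr). Qed.

Let mG0 j d' (T' : measurableType d') (f : T -> T') : meas_wrt (G 0%N) f -> meas_wrt (G j) f.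
Proof. by apply: meas_wrt_sub => //; exact: (nr_sub nr). Qed.

Let mKj0 j : meas_wrt (G 0%N) (Kj j).
Proof.
apply: measurable_fun_ifT => //.
apply: measurable_and.
  exact: (meas_nat_comp (fun l => (l <= j)%N) mlo).
exact: (meas_nat_comp (fun l => (j < l)%N) mhi).
Qed.

Let mKj j : meas_wrt (G j) (Kj j).
Proof. by apply: mG0; exact: mKj0. Qed.

Let mz j : (j < J)%N -> meas_wrt (G j.+1) (z j).
Proof. exact: (nr_measurable nr). Qed.

Let mrow j : (j <= J)%N -> meas_wrt (G j) (row_sum K lo hi z j).
Proof.
elim: j => [_|j IH jJ].
  rewrite (_ : row_sum _ _ _ _ _ = cst 0); first exact: measurable_cst.
  by apply/funext => w; rewrite /row_sum big_ord0.
rewrite (_ : row_sum _ _ _ _ _ = (fun w => row_sum K lo hi z j w + Kj j w * z j w)); last first.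
  by apply/funext => w; rewrite /row_sum big_ord_recr.
apply: measurable_funD.
  exact: (meas_wrt_sub (nr_sub nr j) (nr_sub nr j.+1) (nr_mono nr (j := j)) (IH (ltnW jJ))).
apply: measurable_funM; last exact: mz.
exact: (meas_wrt_sub (nr_sub nr j) (nr_sub nr j.+1) (nr_mono nr (j := j)) (@mKj j)).
Qed.

Lemma row_sum_measurable : meas_wrt (G J) (row_sum K lo hi z J).
Proof. exact: mrow. Qed.

Let Q0 : (0 < J)%N -> 0 <= Q.
Proof.
move=> /hQ; apply: contraTT; rewrite -!ltNge => Q0; apply: lt_le_trans (_ : 0%E <= _)%E.
  by rewrite lte_fin.
by apply: integral_ge0 => w _; rewrite lee_fin cubic_rem_ge0.
Qed.

(** [ito_step] asks for a remainder bound at every coefficient. Those above [c] never occur in a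
    row, and the second moment serves for them. *)
Let q (k : R) : R := if k == 0 then 0 else if `|k| <= c then Q else k ^+ 2 * v.

Let hq j : (j < J)%N -> forall k, (\int[P]_w (cubic_rem (k * z j w))%:E <= (q k)%:E)%E.
Proof.
move=> jJ k; have [_ _ z2] := nr_centered nr jJ.
have mzT : meas_fun (z j) := sub_meas_wrt (nr_sub nr j.+1) (mz jJ).
rewrite /q; case: eqVneq => [->|_].
  by rewrite integral0_eq// => w _; rewrite mul0r /cubic_rem expr0n mul0r.
case: ifPn => [kc|_].
  apply: le_trans (hQ jJ); apply: ge0_integral_mono => w; rewrite lee_fin ?cubic_rem_ge0//.
  by apply: cubic_rem_mono; rewrite !normrM ler_wpM2r// (ger0_norm c0).
rewrite EFinM -z2 -ge0_integral_scale ?sqr_ge0//.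
- apply: ge0_integral_mono => w; rewrite lee_fin ?cubic_rem_ge0// -exprMn; exact: cubic_rem_le_sqr.
- exact: measurable_funX.
- by move=> w; exact: sqr_ge0.
Qed.

Let qKj j w : (j < J)%N -> q (Kj j w) <= Q.
Proof.
move=> jJ; have Q00 := Q0 (leq_ltn_trans (leq0n j) jJ).
rewrite /q; case: eqVneq => // _; rewrite ifT//.
by rewrite /Kj; case: ifP => _; rewrite ?normr0.
Qed.

Let Kj2 j w : Kj j w ^+ 2 <= c ^+ 2.
Proof.
rewrite -[leLHS]real_normK ?num_real// lerXn2r ?nnegrE//.
by rewrite /Kj; case: ifP => _; rewrite ?normr0.
Qed.

Lemma row_sum_L2 j : (j <= J)%N ->
  (\int[P]_w (row_sum K lo hi z j w ^+ 2)%:E <= (j%:R * (c ^+ 2 * v))%:E)%E.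
Proof.
elim: j => [_|j IH jJ].
  by rewrite integral0_eq ?mul0r// => w _; rewrite /row_sum big_ord0 expr0n.
have -> : (fun w => (row_sum K lo hi z j.+1 w ^+ 2)%:E) =
    (fun w => ((row_sum K lo hi z j w + Kj j w * z j w) ^+ 2)%:E).
  by apply/funext => w; rewrite /row_sum big_ord_recr.
have T0 : taylor2 (fun x : R => x ^+ 2) (fun x => 2 * x) (fun=> 2) 0.
  by move=> x y; rewrite mul0r (_ : _ - _ = 0) ?normr0//; field.
have m2 : meas_fun (fun x : R => x ^+ 2) by exact: measurable_funX.
have sG := nr_sub nr j; have mr := mrow (ltnW jJ).
have := ito_step sG (nr_indep nr jJ) (nr_centered nr jJ) T0 (lexx 0) (fun y => sqr_ge0 y) m2 mr (@mKj j) (hq jJ).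
move=> /le_trans; apply.
have mrT := sub_meas_wrt sG mr.
apply: le_trans (ge0_integral_mono P (g := fun w => (row_sum K lo hi z j w ^+ 2 + c ^+ 2 * v)%:E) _ _) _.
- move=> w; rewrite lee_fin mul0r addr0; apply: addr_ge0; first exact: sqr_ge0.
  by apply: mulr_ge0; [apply: mulr_ge0 => //; exact: sqr_ge0|rewrite divr_ge0].
- move=> w; rewrite lee_fin mul0r addr0 lerD2l divff ?pnatr_eq0// mulr1.
  by rewrite ler_wpM2r.
have cv0 : 0 <= c ^+ 2 * v by apply: mulr_ge0 => //; exact: sqr_ge0.
rewrite ge0_integral_add//; last 2 first.
- exact: measurable_funX.
- by move=> w; exact: sqr_ge0.
rewrite integral_cst//= [X in (_ + _ * X)%E]probability_setT mule1 -natr1 mulrDl mul1r EFinD.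
by apply: leeD => //; exact: IH (ltnW jJ).
Qed.

Variables (f f1 f2 g : R -> R) (C M : R) (D : T -> R).
Hypotheses (Tf : taylor2 f f1 f2 C)
  (C0 : 0 <= C)
  (M0 : 0 <= M)
  (f0 : forall y, 0 <= f y)
  (mf : meas_fun f)
  (g0 : forall y, 0 <= g y)
  (mg : meas_fun g)
  (f2g : forall x y, f2 (x + y) <= g x + M * `|y|)
  (mD : meas_wrt (G 0%N) D).
Variable (theta : R).
Hypothesis theta0 : 0 < theta.

(** The error per noise. Its first term comes from evaluating [f2] at the value [D] at the start of
    the row instead of [D + S], which costs [M * |S|], with [|S| <= (theta + S ^ 2 / theta) / 2] and
    the second moment of the partial sum [S]; the second term is the Taylor remainder. *)
Definition row_error := v / 2 * c ^+ 2 * M * (theta + J%:R * (c ^+ 2 * v) / theta) / 2 + C * Q.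

Let mDj j : meas_wrt (G j) D.
Proof. exact: mG0. Qed.

Let cnt (j : nat) w : R := \sum_(i < j) Kj i w ^+ 2.

Let cnt0 j w : 0 <= cnt j w.
Proof. by apply: sumr_ge0 => i _; exact: sqr_ge0. Qed.

Let mcnt j : meas_wrt (G 0%N) (cnt j).
Proof. by apply: measurable_sum => i; apply: measurable_funX; exact: mKj0. Qed.

Let toT j h : meas_wrt (G j) (h : T -> R) -> meas_fun h.
Proof. exact: sub_meas_wrt (nr_sub nr j). Qed.

Let step j : (j <= J)%N ->
  (\int[P]_w (f (D w + row_sum K lo hi z j w))%:E <=
   \int[P]_w (f (D w) + v / 2 * (cnt j w * g (D w)))%:E + (j%:R * row_error)%:E)%E.
Proof.
elim: j => [_|j IH jJ].
  rewrite mul0r adde0 le_eqVlt; apply/orP; left; apply/eqP; apply: eq_integral => w _.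
  by rewrite /row_sum /cnt !big_ord0 mul0r mulr0 !addr0.
have {}IH := IH (ltnW jJ); have J0 : (0 < J)%N := leq_ltn_trans (leq0n j) jJ.
have Q00 := Q0 J0.
set S := row_sum K lo hi z j.
have -> : (fun w => (f (D w + row_sum K lo hi z j.+1 w))%:E) =
    (fun w => (f ((D w + S w) + Kj j w * z j w))%:E).
  by apply/funext => w; rewrite /S /row_sum big_ord_recr/= addrA.
have sG := nr_sub nr j; have mr := mrow (ltnW jJ).
have mDS : meas_wrt (G j) (fun w => D w + S w) by apply: measurable_funD; [exact: mDj|exact: mr].
have := ito_step sG (nr_indep nr jJ) (nr_centered nr jJ) Tf C0 f0 mf mDS (@mKj j) (hq jJ).
move=> /le_trans; apply.
have mST := toT mr; have mDT := toT (@mDj 0%N).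
have mfDS : meas_fun (fun w => f (D w + S w)).
  by apply: measurableT_comp => //; exact: toT mDS.
have mgD : meas_fun (fun w => g (D w)) by exact: measurableT_comp.
have mK2 : meas_fun (fun w => Kj j w ^+ 2).
  by apply: measurable_funX; exact: toT (@mKj j).
have mS2 : meas_fun (fun w => S w ^+ 2) by exact: measurable_funX.
pose h1 w := v / 2 * (Kj j w ^+ 2 * g (D w)).
pose e1 := v / 2 * c ^+ 2 * M / 2.
have e10 : 0 <= e1.
  by apply: divr_ge0 => //; apply: mulr_ge0 => //; apply: mulr_ge0; [exact: divr_ge0|exact: sqr_ge0].
pose h2 w := e1 / theta * S w ^+ 2.
pose h3 := e1 * theta + C * Q.
have e1t : 0 <= e1 / theta by apply: divr_ge0 => //; exact: ltW.
have v20 : 0 <= v / 2 by exact: divr_ge0.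
have h10 w : 0 <= h1 w by apply: mulr_ge0 => //; apply: mulr_ge0 => //; exact: sqr_ge0.
have h20 w : 0 <= h2 w by apply: mulr_ge0 => //; exact: sqr_ge0.
have h30 : 0 <= h3 by apply: addr_ge0; apply: mulr_ge0 => //; exact: ltW.
have mh1 : meas_fun h1 by apply: measurable_funM => //; exact: measurable_funM.
have mh2 : meas_fun h2 by exact: measurable_funM.
have ub w : f (D w + S w) + Kj j w ^+ 2 * v * (f2 (D w + S w) / 2) + C * q (Kj j w) <=
    (f (D w + S w) + h1 w) + (h2 w + h3).
  have k2 := sqr_ge0 (Kj j w).
  have a1 : Kj j w ^+ 2 * v * (f2 (D w + S w) / 2) <= h1 w + Kj j w ^+ 2 * (v / 2 * M * `|S w|).
    have -> : Kj j w ^+ 2 * v * (f2 (D w + S w) / 2) = Kj j w ^+ 2 * (v / 2 * f2 (D w + S w)) by ring.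
    have -> : h1 w + Kj j w ^+ 2 * (v / 2 * M * `|S w|) = Kj j w ^+ 2 * (v / 2 * (g (D w) + M * `|S w|)).
      by rewrite /h1; ring.
    by apply: ler_wpM2l => //; apply: ler_wpM2l.
  have a2 : Kj j w ^+ 2 * (v / 2 * M * `|S w|) <= c ^+ 2 * (v / 2 * M * ((theta + S w ^+ 2 / theta) / 2)).
    apply: ler_pM => //; first by apply: mulr_ge0 => //; exact: mulr_ge0.
    apply: ler_wpM2l; first exact: mulr_ge0.
    have -> : (theta + S w ^+ 2 / theta) / 2 = (theta ^+ 2 + `|S w| ^+ 2) / (2 * theta).
      by rewrite real_normK ?num_real//; field; rewrite gt_eqF.
    rewrite ler_pdivlMr ?mulr_gt0//; have := sqr_ge0 (theta - `|S w|); rewrite !expr2; lra.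
  have a3 : C * q (Kj j w) <= C * Q by apply: ler_wpM2l => //; exact: qKj.
  have -> : h2 w + h3 = c ^+ 2 * (v / 2 * M * ((theta + S w ^+ 2 / theta) / 2)) + C * Q.
    by rewrite /h2 /h3 /e1; field; rewrite gt_eqF.
  lra.
apply: le_trans (_ : (\int[P]_w ((f (D w + S w) + h1 w) + (h2 w + h3))%:E <= _)%E).
  apply: integral_le_ge0 => w; rewrite lee_fin; last exact: ub.
  by apply: addr_ge0; apply: addr_ge0.
rewrite ge0_integral_add; last 4 first.
- exact: measurable_funD.
- exact: measurable_funD.
- by move=> w; exact: addr_ge0.
- by move=> w; exact: addr_ge0.
have -> : (\int[P]_w (f (D w + S w) + h1 w)%:E = \int[P]_w (f (D w + S w))%:E + \int[P]_w (h1 w)%:E)%E.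
  by apply: ge0_integral_add.
have -> : (\int[P]_w (h2 w + h3)%:E = (e1 / theta)%:E * \int[P]_w (S w ^+ 2)%:E + h3%:E)%E.
  have -> : (h3%:E = \int[P]_w h3%:E)%E.
    by rewrite integral_cst//= [X in (_ * X)%E]probability_setT mule1.
  rewrite -ge0_integral_scale//; last by move=> w; exact: sqr_ge0.
  by apply: (@ge0_integral_add _ _ _ P h2 (cst h3)).
have l2 : ((e1 / theta)%:E * \int[P]_w (S w ^+ 2)%:E + h3%:E <= row_error%:E)%E.
  apply: (@le_trans _ _ ((e1 / theta)%:E * (J%:R * (c ^+ 2 * v))%:E + h3%:E)%E).
    apply: leeD => //; apply: lee_pmul => //.
      by apply: integral_ge0 => w _; rewrite lee_fin sqr_ge0.
    apply: le_trans (row_sum_L2 (ltnW jJ)) _; rewrite lee_fin; apply: ler_wpM2r.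
      by apply: mulr_ge0 => //; exact: sqr_ge0.
    by rewrite ler_nat ltnW.
  rewrite -EFinM -EFinD lee_fin /h3 /e1 /row_error le_eqVlt; apply/orP; left; apply/eqP.
  by field; rewrite gt_eqF.
apply: le_trans (leeD (leeD IH (lexx _)) l2) _.
have -> : (\int[P]_w (f (D w) + v / 2 * (cnt j.+1 w * g (D w)))%:E =
   \int[P]_w (f (D w) + v / 2 * (cnt j w * g (D w)))%:E + \int[P]_w (h1 w)%:E)%E.
  rewrite -ge0_integral_add//.
  - by apply: eq_integral => w _; rewrite /cnt big_ord_recr/= /h1; congr (_%:E); ring.
  - apply: measurable_funD; first exact: measurableT_comp.
    apply: measurable_funM => //; apply: measurable_funM => //; exact: toT (@mcnt j).
  - move=> w; apply: addr_ge0 => //; apply: mulr_ge0 => //; exact: mulr_ge0.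
rewrite -[j.+1%:R]natr1 mulrDl mul1r (EFinD (j%:R * _)) le_eqVlt; apply/orP; left; apply/eqP.
set A := (\int[P]_w (f (D w) + _)%:E)%E; set B := (\int[P]_w (h1 w)%:E)%E.
by move: A B => A B; rewrite -!addeA; congr (_ + _)%E; exact: addeCA.
Qed.

(** The sum of the squared coefficients over the row is at most [K ^ 2 * (hi - lo)], which is known
    at the start of the row and multiplies [g (D)]. *)
Lemma row_sum_transform (B : R) :
  (\int[P]_w (K w ^+ 2 * (hi w - lo w)%:R * g (D w))%:E <= B%:E)%E ->
  (\int[P]_w (f (D w + row_sum K lo hi z J w))%:E <=
   \int[P]_w (f (D w))%:E + (v / 2 * B + J%:R * row_error)%:E)%E.
Proof.
move=> hB; apply: le_trans (step (leqnn J)) _; rewrite (EFinD (v / 2 * B)) addeA; apply: leeD => //.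
have mDT := toT (@mDj 0%N).
have count n w : (\sum_(j < n) window lo hi j w <= minn n (hi w) - lo w)%N.
  elim: n => [|n IH]; first by rewrite big_ord0.
  rewrite big_ord_recr/=; move: IH; rewrite /window; set S := (\sum_(i < n) _)%N; move: S => S.
  by case: (leqP (lo w) n); case: (ltnP n (hi w)) => /=; lia.
have cg0 w : 0 <= cnt J w * g (D w) by exact: mulr_ge0.
have cntB : (\int[P]_w (cnt J w * g (D w))%:E <= B%:E)%E.
  apply: le_trans hB; apply: ge0_integral_mono => w; rewrite lee_fin//.
  apply: ler_wpM2r => //.
  apply: (@le_trans _ _ (\sum_(j < J) K w ^+ 2 * (window lo hi j w)%:R)).
    by apply: ler_sum => j _; rewrite /Kj; case: ifP => _; rewrite ?mulr1// mulr0 expr0n.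
  rewrite -mulr_sumr ler_wpM2l ?sqr_ge0// -natr_sum ler_nat; apply: leq_trans (count J w) _.
  by apply: leq_sub2r; exact: geq_minr.
have mfD : meas_fun (fun w => f (D w)) by exact: measurableT_comp.
have mcg : meas_fun (fun w => cnt J w * g (D w)).
  by apply: measurable_funM; [exact: toT (@mcnt J)|exact: measurableT_comp].
rewrite (ge0_integral_add P (g := fun w => v / 2 * (cnt J w * g (D w))) mfD)//; last 2 first.
- exact: measurable_funM.
- by move=> w; apply: mulr_ge0 => //; exact: divr_ge0.
apply: leeD => //; rewrite (ge0_integral_scale P (f := fun w => cnt J w * g (D w)))// ?divr_ge0//.
by rewrite (EFinM (v / 2)); apply: lee_pmul => //; [rewrite lee_fin divr_ge0|apply: integral_ge0 => w _; rewrite lee_fin].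
Qed.
End row.

Section transform.
Variables (J : nat) (v c Q : R) (F : nat -> set_system T) (G : nat -> nat -> set_system T).
Variable z : nat -> nat -> T -> R.
Hypotheses (nr : forall k, noise_row J v (G k) (z k))
  (sF : forall k, sub_algebra (F k))
  (FG : forall k, F k `<=` G k 0%N)
  (GF : forall k, G k J `<=` F k.+1)
  (v0 : 0 <= v)
  (c0 : 0 <= c)
  (hQ : forall k j, (j < J)%N -> (\int[P]_w (cubic_rem (c * z k j w))%:E <= Q%:E)%E).
Variables (K : nat -> T -> R) (lo hi : nat -> T -> nat).
Hypotheses (mK : forall k, meas_wrt (F k) (K k))
  (mlo : forall k, meas_wrt (F k) (lo k))
  (mhi : forall k, meas_wrt (F k) (hi k))
  (Kc : forall k w, `|K k w| <= c).

Definition transform (N : nat) (w : T) : R :=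
  \sum_(k < N) row_sum (K k) (lo k) (hi k) (z k) J w.

Let mFG k d' (T' : measurableType d') (h : T -> T') : meas_wrt (F k) h -> meas_wrt (G k 0%N) h.
Proof. exact: (meas_wrt_sub (sF k) (nr_sub (nr k) 0%N) (@FG k)). Qed.

Lemma noise_filtration_mono k l : (k <= l)%N -> F k `<=` F l.
Proof.
move=> kl; rewrite -(subnKC kl); elim: (l - k)%N => [|n IH]; first by rewrite addn0.
rewrite addnS => A /IH /FG.
suff H j : G (k + n)%N 0%N `<=` G (k + n)%N j by move/(H J)/GF.
by elim: j => // j IHj B /IHj; exact: (nr_mono (nr _)).
Qed.

Lemma row_sum_adapted k : meas_wrt (F k.+1) (row_sum (K k) (lo k) (hi k) (z k) J).
Proof.
apply: (meas_wrt_sub (nr_sub (nr k) J) (sF k.+1) (@GF k)).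
by apply: (row_sum_measurable (nr k)); apply: mFG.
Qed.

Lemma transform_adapted N : meas_wrt (F N) (transform N).
Proof.
apply: measurable_sum => k.
apply: (meas_wrt_sub (sF k.+1) (sF N)); first exact: noise_filtration_mono.
exact: row_sum_adapted.
Qed.

Variables (f f1 f2 g : R -> R) (C M theta : R).
Hypotheses (Tf : taylor2 f f1 f2 C)
  (C0 : 0 <= C)
  (M0 : 0 <= M)
  (f0 : forall y, 0 <= f y)
  (mf : meas_fun f)
  (g0 : forall y, 0 <= g y)
  (mg : meas_fun g)
  (f2g : forall x y, f2 (x + y) <= g x + M * `|y|)
  (theta0 : 0 < theta).

Lemma transform_bound (B : nat -> R) N :
  (forall k, (k < N)%N ->
    (\int[P]_w (K k w ^+ 2 * (hi k w - lo k w)%:R * g (transform k w))%:E <= (B k)%:E)%E) ->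
  (\int[P]_w (f (transform N w))%:E <=
   (f 0 + \sum_(k < N) (v / 2 * B k) + N%:R * (J%:R * row_error J v c Q C M theta))%:E)%E.
Proof.
elim: N => [_|N IH hB].
  have -> : (fun w => (f (transform 0 w))%:E) = cst (f 0)%:E.
    by apply/funext => w; rewrite /transform big_ord0.
  by rewrite integral_cst//= [X in (_ * X)%E]probability_setT mule1 big_ord0 mul0r !addr0.
have -> : (fun w => (f (transform N.+1 w))%:E) =
    (fun w => (f (transform N w + row_sum (K N) (lo N) (hi N) (z N) J w))%:E).
  by apply/funext => w; rewrite /transform big_ord_recr.
have hBN := hB N (ltnSn N).
have mO : meas_wrt (G N 0%N) (transform N) by apply: mFG; exact: transform_adapted.
have mK' := mFG (@mK N); have mlo' := mFG (@mlo N); have mhi' := mFG (@mhi N).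
have := row_sum_transform (nr N) v0 c0 (@hQ N) mK' mlo' mhi' (@Kc N) Tf C0 M0 f0 mf g0 mg f2g mO theta0 hBN.
move=> /le_trans; apply.
apply: le_trans (leeD (IH (fun k kN => hB k (ltnW kN))) (lexx _)) _.
rewrite -EFinD lee_fin big_ord_recr/= -[N.+1%:R]natr1 mulrDl mul1r le_eqVlt; apply/orP; left; apply/eqP.
by ring.
Qed.
End transform.
End noise.

(** * Moments of the offspring and immigration noises *)

Section laws.
Context {R : realType} {d} {T : measurableType d} (P : probability T R).

Lemma integral_same_law d' (T' : measurableType d') (X Y : T -> T') (h : T' -> \bar R) :
  meas_fun X -> meas_fun Y -> identically_distributed P X Y ->
  meas_fun h -> (forall x, 0 <= h x)%E ->
  (\int[P]_w h (X w) = \int[P]_w h (Y w))%E.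
Proof.
move=> mX mY XY mh h0.
have E (Z : T -> T') : meas_fun Z ->
    (\int[P]_w h (Z w) = \int[pushforward P Z]_y h y)%E.
  move=> mZ; pose V : {mfun T >-> T'} := @mfun_Sub _ _ T T' _ (mem_set mZ).
  by rewrite (@ge0_integral_pushforward _ _ T T' R V).
rewrite (E _ mX) (E _ mY).
apply: eq_measure_integral => A mA _; rewrite /pushforward; exact: XY.
Qed.

Lemma centered_nonneg (Y : T -> R) (mu s2 : R) : meas_fun Y -> (forall w, 0 <= Y w) ->
  (\int[P]_w (Y w)%:E = mu%:E)%E -> (\int[P]_w (Y w ^+ 2)%:E = s2%:E)%E ->
  centered P (fun w => Y w - mu) (s2 - mu ^+ 2).
Proof.
move=> mY Y0 Y1 Y2.
have iY : P.-integrable setT (EFin \o Y).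
  apply/integrableP; split; first exact/measurable_EFinP.
  rewrite (eq_integral (fun w => (Y w)%:E)) ?Y1 ?ltry// => w _.
  by rewrite /= ger0_norm.
have ic (c : R) : P.-integrable setT (EFin \o cst c) by exact: finite_measure_integrable_cst.
have iY2 : P.-integrable setT (EFin \o (fun w => Y w ^+ 2)).
  apply/integrableP; split; first by apply/measurable_EFinP; exact: measurable_funX.
  rewrite (eq_integral (fun w => (Y w ^+ 2)%:E)) ?Y2 ?ltry// => w _.
  by rewrite /= ger0_norm// sqr_ge0.
have c1 (c : R) : (\int[P]_w c%:E = c%:E)%E.
  by rewrite integral_cst//= [X in (_ * X)%E]probability_setT mule1.
split.
- exact: (integrableB measurableT iY (ic mu)).
- under eq_integral do rewrite EFinB.
  by rewrite (integralB_EFin measurableT iY (ic mu)) Y1 c1 subee.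
- have iW : P.-integrable setT (EFin \o (fun w => 2 * mu * Y w)).
    have := integrableZl measurableT (2 * mu) iY; congr integrable.
  have iZ : P.-integrable setT (EFin \o (fun w => mu ^+ 2 - 2 * mu * Y w)).
    exact: (integrableB measurableT (ic (mu ^+ 2)) iW).
  rewrite (eq_integral (fun w => (Y w ^+ 2 + (mu ^+ 2 - 2 * mu * Y w))%:E)); last first.
    by move=> w _; congr _%:E; ring.
  under eq_integral do rewrite EFinD.
  have IZ : (\int[P]_w (mu ^+ 2 - 2 * mu * Y w)%:E = (mu ^+ 2 - 2 * mu * mu)%:E)%E.
    under eq_integral do rewrite EFinB.
    rewrite (integralB_EFin measurableT (ic (mu ^+ 2)) iW) c1.
    under eq_integral do rewrite EFinM.
    by rewrite (integralZl measurableT iY) Y1 -EFinM -EFinB.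
  rewrite (integralD_EFin measurableT iY2 iZ) Y2 [X in (_ + X)%E](_ : _ = (mu ^+ 2 - 2 * mu * mu)%:E); last exact: IZ.
  by rewrite -EFinD; congr _%:E; ring.
Qed.

(** Divided by the squared scale, the integrand is [V ^ 2 * min 1 (|V| / n.+1)], which tends to 0
    and is dominated by the integrable [V ^ 2]. This is Lindeberg's condition for identically
    distributed variables. *)
Lemma cubic_rem_vanishes (V : T -> R) (s : R) : centered P V s ->
  forall e : R, 0 < e -> exists n0, forall n, (n0 <= n)%N ->
  (\int[P]_w (cubic_rem (n.+1%:R^-1 * V w))%:E <= (e * n.+1%:R^-1 ^+ 2)%:E)%E.
Proof.
move=> cV e e0; have mV := centered_measurable cV; have [_ _ V2] := cV.
pose h n w : R := V w ^+ 2 * Num.min 1 `|n.+1%:R^-1 * V w|.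
have mh n : meas_fun (h n).
  apply: measurable_funM; first exact: measurable_funX.
  by apply: measurable_minr => //; apply: measurableT_comp => //; exact: measurable_funM.
have h0 n w : 0 <= h n w by rewrite mulr_ge0 ?sqr_ge0// le_min ler01 normr_ge0.
have iV2 : P.-integrable setT (fun w => (V w ^+ 2)%:E).
  apply/integrableP; split; first by apply/measurable_EFinP; exact: measurable_funX.
  rewrite (eq_integral (fun w => (V w ^+ 2)%:E)) ?V2 ?ltry// => w _.
  by rewrite /= ger0_norm// sqr_ge0.
have cv0 : (\int[P]_w (h n w)%:E @[n --> \oo] --> \int[P]_w (cst 0%E w))%E.
  have [] := @dominated_convergence _ T R P setT measurableT (fun n w => (h n w)%:E) (cst 0%E)
    (fun w => (V w ^+ 2)%:E) _ _ _ iV2 _ => //.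
  - by move=> n; apply/measurable_EFinP.
  - apply: aeW => w _; apply: cvg_EFin; first exact: nearW.
    apply/cvgrPdist_lt => u u0.
    have den0 : 0 < `|V w| ^+ 3 + 1 by rewrite ltr_wpDl// exprn_ge0.
    have u1 : 0 < u / (`|V w| ^+ 3 + 1) by rewrite divr_gt0.
    have [l] := ltr_add_invr u1; rewrite add0r => lu.
    exists l => // n /= ln; rewrite sub0r normrN ger0_norm//.
    apply: (@le_lt_trans _ _ (`|V w| ^+ 3 * n.+1%:R^-1)).
      rewrite /h -[V w ^+ 2]real_normK ?num_real// [`|V w| ^+ 3]exprSr -mulrA.
      apply: ler_wpM2l; first exact: sqr_ge0.
      by rewrite ge_min normrM mulrC [`|_^-1|]ger0_norm ?lexx ?orbT// invr_ge0.
    apply: (@le_lt_trans _ _ (`|V w| ^+ 3 * l.+1%:R^-1)).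
      by rewrite ler_wpM2l ?exprn_ge0// lef_pV2 ?posrE// ler_nat.
    apply: (@le_lt_trans _ _ ((`|V w| ^+ 3 + 1) * l.+1%:R^-1)).
      by rewrite ler_wpM2r ?invr_ge0// lerDl.
    by rewrite mulrC -ltr_pdivlMr.
  - by apply: aeW => w n _; rewrite /= lee_fin ger0_norm// /h ler_piMr ?sqr_ge0// ge_min lexx.
rewrite integral0 in cv0.
have /fine_cvgP[[n1 _ fin] /cvgrPdist_lt/(_ _ e0)[n2 _ hn]] := cv0.
exists (maxn n1 n2) => n; rewrite geq_max => /andP[n1n n2n].
have -> : (\int[P]_w (cubic_rem (n.+1%:R^-1 * V w))%:E = (n.+1%:R^-1 ^+ 2)%:E * \int[P]_w (h n w)%:E)%E.
  rewrite -(ge0_integral_scale P (sqr_ge0 _) (mh n) (h0 n)).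
  by apply: eq_integral => w _; rewrite /cubic_rem /h exprMn mulrA.
rewrite mulrC (EFinM (_ ^+ 2)); apply: lee_pmul => //.
  by apply: integral_ge0 => w _; rewrite lee_fin.
have := hn _ n2n; rewrite sub0r normrN => /(le_lt_trans (ler_norm _))/ltW.
by rewrite -lee_fin fineK//; exact: fin.
Qed.
End laws.

Section gw_noise.
Context {R : realType} {d} {T : measurableType d} (P : probability T R).
Variables (xi : nat -> nat -> 'I_2 -> T -> nat * nat) (eps : nat -> T -> nat * nat).
Hypothesis hfam : gw_family_law P xi eps.

Let mxi k j i : meas_fun (xi k j i).
Proof. by case: hfam => /(_ (inl (k, j, i))). Qed.

Let meps k : meas_fun (eps k).
Proof. by case: hfam => /(_ (inr k)). Qed.

Lemma measurable_realize (pr : nat * nat -> nat) (c : R) : meas_fun pr ->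
  meas_fun (fun x : nat * nat => (pr x)%:R - c).
Proof. by move=> mpr; exact: (meas_nat_comp (fun n => n%:R - c) mpr). Qed.

Definition offspring_noise (i : 'I_2) (pr : nat * nat -> nat) k j w : R := (pr (xi k j i w))%:R - 1.

Definition immigration_noise (m : R) k w : R := (eps k w).1%:R - m.

Lemma offspring_noise_centered i pr v : meas_fun pr ->
  (\int[P]_w (pr (xi 0 0 i w))%:R%:E = 1)%E ->
  (\int[P]_w ((pr (xi 0 0 i w))%:R ^+ 2)%:E = (v + 1)%:E)%E ->
  forall k j, centered P (offspring_noise i pr k j) v.
Proof.
move=> mpr e1 e2 k j; have [_ _ idx _] := hfam.
have mreal : meas_fun (fun x : nat * nat => (pr x)%:R : R).
  exact: (meas_nat_comp (fun n => n%:R : R) mpr).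
have := @centered_nonneg _ _ _ P (fun w => (pr (xi k j i w))%:R) 1 (v + 1).
rewrite expr1n addrK; apply => //.
- exact: (measurableT_comp mreal (mxi k j i)).
- rewrite (@integral_same_law _ _ _ P _ _ (xi k j i) (xi 0 0 i) (fun x => (pr x)%:R%:E))//.
  exact/measurable_EFinP.
- rewrite (@integral_same_law _ _ _ P _ _ (xi k j i) (xi 0 0 i) (fun x => ((pr x)%:R ^+ 2)%:E))//.
  by apply/measurable_EFinP; exact: measurable_funX.
Qed.

Lemma offspring_noise_cubic i pr : meas_fun pr -> forall c k j,
  (\int[P]_w (cubic_rem (c * offspring_noise i pr k j w))%:E =
   \int[P]_w (cubic_rem (c * offspring_noise i pr 0 0 w))%:E)%E.
Proof.
move=> mpr c k j; have [_ _ idx _] := hfam.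
apply: (@integral_same_law _ _ _ P _ _ (xi k j i) (xi 0 0 i)
   (fun x => (cubic_rem (c * ((pr x)%:R - 1)))%:E)) => //.
- apply/measurable_EFinP; apply: measurableT_comp; first exact: measurable_cubic_rem.
  by apply: measurable_funM => //; exact: measurable_realize.
- by move=> x; rewrite lee_fin cubic_rem_ge0.
Qed.

Lemma offspring_noise_row i pr v k J : meas_fun pr ->
  (forall k j, centered P (offspring_noise i pr k j) v) ->
  noise_row P J v (row_past xi eps i k) (offspring_noise i pr k).
Proof.
move=> mpr cen; split.
- by move=> j; exact: (row_past_sub_algebra hfam).
- by move=> j; exact: row_pastS.
- move=> j _; exact: (measurableT_comp (measurable_realize 1 mpr) (@xi_row_measurable _ _ _ _ _ _ hfam i k j)).
- move=> j _; exact: (indep_of_comp (measurable_realize 1 mpr) (@xi_indep _ _ _ _ _ _ hfam i k j)).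
- by move=> j _; exact: cen.
Qed.

Lemma immigration_centered m s2 : (\int[P]_w ((eps 0 w).1)%:R%:E = m%:E)%E ->
  (\int[P]_w ((eps 0 w).1%:R ^+ 2)%:E = s2%:E)%E ->
  forall k, centered P (immigration_noise m k) (s2 - m ^+ 2).
Proof.
move=> e1 e2 k; have [_ _ _ ide] := hfam.
have mreal : meas_fun (fun x : nat * nat => x.1%:R : R).
  exact: (meas_nat_comp (fun n => n%:R : R) measurable_fst).
apply: centered_nonneg => //.
- exact: (measurableT_comp mreal (meps k)).
- rewrite (@integral_same_law _ _ _ P _ _ (eps k) (eps 0) (fun x => x.1%:R%:E))//.
  exact/measurable_EFinP.
- rewrite (@integral_same_law _ _ _ P _ _ (eps k) (eps 0) (fun x => (x.1%:R ^+ 2)%:E))//.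
  by apply/measurable_EFinP; exact: measurable_funX.
Qed.

Lemma immigration_noise_row m s k : (forall k, centered P (immigration_noise m k) s) ->
  noise_row P 1 s (fun j => if j is 0 then past xi eps k else past xi eps k.+1) (fun=> immigration_noise m k).
Proof.
move=> cen; have mr := measurable_realize m (@measurable_fst _ _ nat nat).
split => [[|j]|[|j]|[|//] _|[|//] _|[|//] _] //; try exact: (past_sub_algebra hfam).
- exact: past_mono.
- exact: (measurableT_comp mr (@eps_past_measurable _ _ _ _ _ _ hfam k)).
- exact: (indep_of_comp mr (@eps_indep _ _ _ _ _ _ hfam k)).
Qed.
End gw_noise.

(** * Frozen population sizes *)

Section linear_arithmetic.
Context {R : realFieldType}.
Implicit Types a b c : R.

(** Linear facts over abstract variables, to be applied to large terms in [frozen_close]. *)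
Lemma linear_level a b : 0 <= b -> a + 1 + b + a + 1 <= 2 * (a + 1 + b).
Proof. by move=> *; lra. Qed.

Lemma linear_half a b c : 0 <= b -> a <= c / 2 -> a / 2 - b / 2 <= c / 4.
Proof. by move=> *; lra. Qed.

Lemma linear_half_le a b : 0 < a -> a <= b -> a / 2 <= b.
Proof. by move=> *; lra. Qed.

Lemma linear_quarters a1 a2 a3 a4 c : a1 <= c / 4 -> a2 <= c / 4 -> a3 <= c / 4 -> a4 <= c / 4 ->
  a1 + a2 + a3 + a4 <= c.
Proof. by move=> *; lra. Qed.
End linear_arithmetic.

Section frozen_process.
Context {R : realType} {d} {T : measurableType d} (P : probability T R).
Variables (F : nat -> set_system T) (G : nat -> nat -> set_system T).
Variables (ze : nat -> nat -> T -> R) (eta : nat -> T -> R) (m v s : R).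
Variable X : nat -> T -> nat.
Hypotheses (sF : forall k, sub_algebra (F k))
  (FG : forall k, F k `<=` G k 0%N)
  (GF : forall k J, G k J `<=` F k.+1)
  (nr : forall J k, noise_row P J v (G k) (ze k))
  (nri : forall k, noise_row P 1 s (fun j => if j is 0 then F k else F k.+1) (fun=> eta k))
  (v0 : 0 <= v)
  (s0 : 0 <= s)
  (mX : forall k, meas_wrt (F k) (X k))
  (X0 : forall w, X 0%N w = 0%N).
Hypothesis XS : forall k w,
  (X k.+1 w)%:R = (X k w)%:R + \sum_(j < X k w) ze k j w + eta k w + m.

Lemma row_sum_window (K : T -> R) (lo hi : T -> nat) (z : nat -> T -> R) J w : (hi w <= J)%N ->
  row_sum K lo hi z J w = K w * \sum_(lo w <= j < hi w) z j w.
Proof.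
move=> hJ; rewrite /row_sum mulr_sumr.
have [lh|hl] := leqP (lo w) (hi w); last first.
  rewrite (big_geq (ltnW hl)) big1// => j _; rewrite /window; case: ifP => [|_]; last by rewrite mul0r.
  by move=> /andP[h1 h2]; move: (leq_ltn_trans h1 h2); rewrite ltnNge (ltnW hl).
rewrite -(big_mkord xpredT (fun j => (if window lo hi j w then K w else 0) * z j w)).
rewrite (big_cat_nat (n := lo w))//=; last exact: leq_trans hJ.
rewrite big_nat_cond big1 ?add0r; last first.
  by move=> j /andP[/andP[_ jl] _]; rewrite /window leqNgt jl/= mul0r.
rewrite (big_cat_nat (n := hi w))//= [X in _ + X]big_nat_cond [X in _ + X]big1 ?addr0; last first.
  by move=> j /andP[/andP[jl _] _]; rewrite /window ltnNge jl andbF mul0r.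
apply: eq_big_nat => j /andP[j1 j2]; by rewrite /window j1 j2.
Qed.

Lemma row_sum_eq0 (K : T -> R) (lo hi : T -> nat) (z : nat -> T -> R) J w : K w = 0 ->
  row_sum K lo hi z J w = 0.
Proof. by move=> K0; rewrite /row_sum big1// => j _; rewrite K0 if_same mul0r. Qed.

Lemma transformS J (zz : nat -> nat -> T -> R) (K : nat -> T -> R) lo hi k w :
  transform J zz K lo hi k.+1 w = transform J zz K lo hi k w + row_sum (K k) (lo k) (hi k) (zz k) J w.
Proof. by rewrite /transform big_ord_recr. Qed.

Section parameters.
Variables (n r L Kmax : nat) (dl dO C : R).
Hypothesis L0 : (0 < L)%N.
Notation N := (n.+1%:R : R).

Definition cap := (n.+1 * r.+1)%N.

(** The clipping to [[0, r.+1]] is the one of [tcoef], so that the variance of a frozen generation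
    matches the Euler coefficient; it also bounds the number of individuals by [cap]. *)
Definition population (z : R) : nat := Num.truncn (N * Num.min (Num.max z 0) r.+1%:R).

(* The first component is the process whose generations reproduce with a
   population size frozen at the last multiple of [L]; the second one is its
   value at that time. *)
Fixpoint frozen (k : nat) (w : T) : R * R :=
  if k is k'.+1 then
    let y := (frozen k' w).1 + m / N +
      row_sum (fun=> N^-1) (fun=> 0%N) (fun w => population (frozen k' w).2) (ze k') cap w in
    (y, if (L %| k'.+1)%N then y else (frozen k' w).2)
  else (0, 0).

Let y k w := (frozen k w).1.
Let z k w := (frozen k w).2.
Let b k w := population (z k w).

Lemma population_cap x : (population x <= cap)%N.
Proof.
rewrite /population truncn_le_nat /cap; apply: (@le_lt_trans _ _ (n.+1 * r.+1)%N%:R).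
  by rewrite natrM ler_wpM2l// ge_min lexx orbT.
by rewrite ltr_nat.
Qed.

Lemma measurable_population : meas_fun population.
Proof.
apply: measurableT_comp; first exact: measurable_truncn.
by apply: measurable_funM => //; apply: measurable_minr => //; exact: measurable_maxr.
Qed.

Let Fmono k l : (k <= l)%N -> F k `<=` F l.
Proof. exact: (noise_filtration_mono (nr cap) FG (fun k => GF (k := k) (J := cap))). Qed.

Let up k l d' (T' : measurableType d') (f : T -> T') : (k <= l)%N -> meas_wrt (F k) f -> meas_wrt (F l) f.
Proof. by move=> kl; apply: meas_wrt_sub => //; exact: Fmono. Qed.

Lemma frozen_adapted k : meas_wrt (F k) (y k) /\ meas_wrt (F k) (z k).
Proof.
elim: k => [|k [IHy IHz]]; first by split; exact: measurable_cst.
have mb : meas_wrt (F k) (b k).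
  exact: (measurableT_comp measurable_population IHz).
have my : meas_wrt (F k.+1) (y k.+1).
  apply: measurable_funD; first by apply: measurable_funD => //; exact: (up (leqnSn k) IHy).
  have mG d' (T' : measurableType d') (f : T -> T') : meas_wrt (F k) f -> meas_wrt (G k 0%N) f.
    exact: (meas_wrt_sub (sF k) (nr_sub (nr 0 k) 0%N) (FG (k := k))).
  apply: (meas_wrt_sub (nr_sub (nr cap k) cap) (sF k.+1) (GF (k := k) (J := cap))).
  apply: (row_sum_measurable (nr cap k)).
  - exact: measurable_cst.
  - exact: measurable_cst.
  - exact: mG mb.
split=> //; have -> : z k.+1 = if (L %| k.+1)%N then y k.+1 else z k.
  by apply/funext => w; rewrite /z /y /=; case: ifP.
by case: (L %| k.+1)%N; [exact: my|exact: (up (leqnSn k) IHz)].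
Qed.

Definition immigration k w : R := \sum_(l < k) eta l w / N.

(** Adding the immigration noise removes it from the difference of the two processes: what remains
    is a pure sum of offspring noises over the individuals that belong to one population only. *)
Let O k w := y k w - (X k w)%:R / N + immigration k w.

Definition good k w : bool := [&& (k <= Kmax)%N, `|immigration k w| < dl, `|O k w| < dO,
  `|y k w - m * k%:R / N| < C & `|y k w - z k w| < dl].

Fixpoint all_good k w : bool := good k w && (if k is k'.+1 then all_good k' w else true).

Let A := all_good.

Lemma all_goodP k w : reflect (forall l, (l <= k)%N -> good l w) (all_good k w).
Proof.
apply: (iffP idP); elim: k => [|k IH] /=.
- by move=> /andP[h _] l; rewrite leqn0 => /eqP ->.
- by move=> /andP[h /IH h'] l; rewrite leq_eqVlt => /predU1P[->//|/h'].
- by move=> h; rewrite h.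
- by move=> h; rewrite h//=; apply: IH => l lk; apply: h; exact: leqW.
Qed.

Lemma immigration_adapted k : meas_wrt (F k) (immigration k).
Proof.
apply: measurable_sum => l; apply: measurable_funM => //.
have h := nr_measurable (nri l) (ltn0Sn 0) : meas_wrt (F l.+1) (eta l).
exact: (up (ltn_ord l) h).
Qed.

Let my k : meas_wrt (F k) (y k). Proof. by case: (frozen_adapted k). Qed.
Let mz k : meas_wrt (F k) (z k). Proof. by case: (frozen_adapted k). Qed.
Let mb k : meas_wrt (F k) (b k).
Proof. exact: (measurableT_comp measurable_population (@mz k)). Qed.

Lemma good_adapted k : meas_wrt (F k) (good k).
Proof.
have mx : meas_wrt (F k) (fun w => (X k w)%:R / N : R).
  exact: (meas_nat_comp (fun j => j%:R / N) (@mX k)).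
have mnorm (f : T -> R) (e : R) : meas_wrt (F k) f -> meas_wrt (F k) (fun w => `|f w| < e).
  move=> mf; apply: measurable_fun_ltr; last exact: measurable_cst.
  by apply: measurableT_comp.
have mi := @immigration_adapted k.
apply: measurable_and; first exact: measurable_cst.
apply: measurable_and; first exact: mnorm.
apply: measurable_and.
  by apply: mnorm; apply: measurable_funD => //; apply: measurable_funB => //; exact: my.
apply: measurable_and; apply: mnorm.
  by apply: measurable_funB; [exact: my|exact: measurable_cst].
by apply: measurable_funB; [exact: my|exact: mz].
Qed.

Let mA k : meas_wrt (F k) (A k).
Proof.
elim: k => [|k IH]; first by apply: measurable_and; [exact: good_adapted|exact: measurable_cst].
by apply: measurable_and; [exact: good_adapted|exact: (up (leqnSn k) IH)].
Qed.

Definition stop_coef k w : R := if A k w then N^-1 else 0.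
(** The sign tells which of the two populations contains the individuals with index between [X k]
    and [b k]. *)
Definition diff_coef k w : R := if A k w then (if (X k w <= b k w)%N then N^-1 else - N^-1) else 0.
Definition block_coef i k w : R := if (k %/ L)%N == i then stop_coef k w else 0.

Lemma stop_coef_adapted k : meas_wrt (F k) (stop_coef k).
Proof. by apply: measurable_fun_ifT; [exact: mA|exact: measurable_cst|exact: measurable_cst]. Qed.

Lemma block_coef_adapted i k : meas_wrt (F k) (block_coef i k).
Proof.
have -> : block_coef i k = if (k %/ L)%N == i then stop_coef k else cst 0.
  by apply/funext => w; rewrite /block_coef; case: ifP.
by case: (_ == _); [exact: stop_coef_adapted|exact: measurable_cst].
Qed.

Lemma diff_coef_adapted k : meas_wrt (F k) (diff_coef k).
Proof.
apply: measurable_fun_ifT; [exact: mA| |exact: measurable_cst].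
apply: measurable_fun_ifT; [|exact: measurable_cst|exact: measurable_cst].
apply: (@meas_countable_index _ (g_sigma_algebraType (F k)) _ _ (X k) (fun j w => (j <= b k w)%N) (@mX k)).
by move=> j; exact: (meas_nat_comp (fun l => (j <= l)%N) (@mb k)).
Qed.

Lemma stop_coef_le k w : `|stop_coef k w| <= N^-1.
Proof. by rewrite /stop_coef; case: ifP => _; rewrite ?normr0 ?ger0_norm. Qed.

Lemma block_coef_le i k w : `|block_coef i k w| <= N^-1.
Proof. by rewrite /block_coef; case: ifP => _; [exact: stop_coef_le|rewrite normr0]. Qed.

Lemma diff_coef_le k w : `|diff_coef k w| <= N^-1.
Proof.
by rewrite /diff_coef; case: ifP => _; [case: ifP => _|]; rewrite ?normrN ?normr0 ?ger0_norm.
Qed.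

Definition lo k w := minn (b k w) (X k w).
Definition hi k w := maxn (b k w) (X k w).

Lemma lo_adapted k : meas_wrt (F k) (lo k).
Proof.
apply: (@meas_countable_index _ (g_sigma_algebraType (F k)) _ _ (X k) (fun j w => minn (b k w) j) (@mX k)).
by move=> j; exact: (meas_nat_comp (fun l => minn l j) (@mb k)).
Qed.

Lemma hi_adapted k : meas_wrt (F k) (hi k).
Proof.
apply: (@meas_countable_index _ (g_sigma_algebraType (F k)) _ _ (X k) (fun j w => maxn (b k w) j) (@mX k)).
by move=> j; exact: (meas_nat_comp (fun l => maxn l j) (@mb k)).
Qed.

Notation Itr := (transform 1 (fun k => fun=> eta k) stop_coef (fun=> fun=> 0%N) (fun=> fun=> 1%N)).
Notation Mtr := (transform cap ze stop_coef (fun=> fun=> 0%N) b).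
Notation Otr := (transform cap ze diff_coef lo hi).
Notation Str i := (transform cap ze (block_coef i) (fun=> fun=> 0%N) b).

Variable (t : nat).
Hypotheses (Kt : (Kmax <= t * n.+1)%N)
  (dl1 : dl <= 1)
  (dO1 : dO <= 1)
  (C0 : 0 <= C).
Notation C1 := (C + `|m| * t%:R).
Hypothesis C1r : C1 + 2 <= r.+1%:R.

Lemma good_bounds k w : good k w ->
  [/\ `|y k w| <= C1, `|z k w| <= C1 + 1 & (X k w)%:R / N <= C1 + 2].
Proof.
move=> /and5P[kK hI hO hM hz].
have hy : `|y k w| <= C1.
  rewrite -[y k w](subrK (m * k%:R / N)); apply: le_trans (ler_normD _ _) _; apply: lerD; first exact: ltW.
  rewrite -mulrA normrM ler_wpM2l// ger0_norm ?divr_ge0// ler_pdivrMr// -natrM ler_nat.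
  exact: leq_trans kK Kt.
have h2 : (X k w)%:R / N <= C1 + 2.
  have -> : (X k w)%:R / N = y k w - O k w + immigration k w by rewrite /O; ring.
  have := ler_norm (y k w - O k w + immigration k w).
  have := ler_normD (y k w - O k w) (immigration k w); have := ler_normB (y k w) (O k w).
  move: hI hO hy dl1 dO1; set a := `|y k w| ; lra.
split=> //; rewrite -[z k w](subKr (y k w)); apply: le_trans (ler_normB _ _) _; apply: lerD => //.
exact: le_trans (ltW hz) dl1.
Qed.

Let A_good k w : A k w -> good k w.
Proof. by move=> /all_goodP; exact. Qed.

(* On [all_good k], the population sizes stay below the truncation levels. *)
Lemma capC k w : A k w -> (X k w <= cap)%N.
Proof.
move=> /A_good/good_bounds[_ _ h]; rewrite -(ler_nat R) /cap natrM mulrC -ler_pdivrMr//.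
exact: le_trans h C1r.
Qed.

Let frozenS k w : y k.+1 w = y k w + m / N + N^-1 * \sum_(0 <= j < b k w) ze k j w.
Proof. by rewrite /y /= row_sum_window// population_cap. Qed.

(** Before stopping, every range of individuals fits below [cap], so that the truncated sums are the
    true ones and the recursions coincide. *)
Lemma transform_exact k w : (forall l, (l < k)%N -> A l w) ->
  [/\ Itr k w = immigration k w, Mtr k w = y k w - m * k%:R / N & Otr k w = O k w].
Proof.
elim: k => [_|k IH h].
  rewrite /transform /O /immigration !big_ord0 /y /= X0 mulr0 !mul0r !subr0 addr0//.
have [h1 h2 h3] := IH (fun l lk => h l (ltnW lk)).
have Ak := h k (ltnSn k); have Xc := capC Ak; have bc : (b k w <= cap)%N := population_cap _.
have yS := frozenS k w.
split.
- rewrite transformS h1 row_sum_window//.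
  by rewrite /immigration big_ord_recr/= big_nat1 /stop_coef Ak mulrC.
- rewrite transformS h2 row_sum_window// yS /stop_coef Ak.
  by rewrite -[k.+1%:R]natr1; ring.
- rewrite transformS h3 row_sum_window; last by rewrite geq_max bc Xc.
  rewrite /O yS XS /immigration big_ord_recr/= /diff_coef Ak /lo /hi.
  have -> : \sum_(j < X k w) ze k j w = \sum_(0 <= j < X k w) ze k j w by rewrite big_mkord.
  case: (leqP (X k w) (b k w)) => [xb|bx].
  + by rewrite (big_cat_nat (m := 0%N) (n := X k w) (p := b k w))//=; ring.
  + by rewrite (big_cat_nat (m := 0%N) (n := b k w) (p := X k w))//= ?(ltnW bx)//; ring.
Qed.

Lemma block_exact k w : (forall l, (l < k)%N -> A l w) ->
  y k w - z k w = m * (k %% L)%:R / N + Str (k %/ L)%N k w.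
Proof.
have zero i k' : (forall l, (l < k')%N -> (l %/ L)%N != i) -> Str i k' w = 0.
  move=> h; rewrite /transform big1// => l _; apply: row_sum_eq0.
  by rewrite /block_coef (negbTE (h l (ltn_ord l))).
elim: k => [_|k IH h].
  by rewrite mod0n zero// /y /z /= mulr0 mul0r subrr addr0.
have [Lk|Lk] := boolP (L %| k.+1)%N.
  have -> : y k.+1 w - z k.+1 w = 0 by rewrite /y /z /= Lk subrr.
  rewrite (eqP Lk) mulr0 mul0r add0r zero// => l lk.
  by rewrite neq_ltn; apply/orP; left; rewrite ltn_divLR// divnK.
have Ak := h k (ltnSn k).
have dE : (k.+1 %/ L = k %/ L)%N by rewrite divnS// (negbTE Lk) add0n.
have mE : (k.+1 %% L)%N = (k %% L).+1.
  have := divn_eq k.+1 L; rewrite dE {1}(divn_eq k L); lia.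
have zE : z k.+1 w = z k w by rewrite /z /= (negbTE Lk).
have := IH (fun l lk => h l (ltnW lk)); rewrite dE mE zE frozenS transformS.
rewrite row_sum_window ?population_cap// /block_coef eqxx /stop_coef Ak.
rewrite -[(k %% L).+1%:R]natr1 => e.
have -> : y k w = z k w + (y k w - z k w) by ring.
by rewrite e; ring.
Qed.

Lemma transform_stopped J (zz : nat -> nat -> T -> R) (K : nat -> T -> R) lo1 hi1 k k' w : (k <= k')%N ->
  (forall l, (k <= l)%N -> K l w = 0) -> transform J zz K lo1 hi1 k' w = transform J zz K lo1 hi1 k w.
Proof.
move=> kk h; rewrite -(subnKC kk); elim: (k' - k)%N => [|j IH]; first by rewrite addn0.
rewrite addnS transformS IH row_sum_eq0 ?addr0//.
by apply: h; exact: leq_addr.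
Qed.

(** At the last generation [l] of a block, [z l] is still the value at its beginning; the difference
    is the increment over the whole block, whose transform no longer changes after [l.+1]. *)
Lemma block_jump l k w : (forall j, (j <= l)%N -> A j w) -> (L %| l.+1)%N -> (l < k)%N ->
  y l.+1 w - z l w = m * L%:R / N + Str (l %/ L)%N k w.
Proof.
move=> h Ll lk; have e := block_exact (fun j jl => h j (ltnW jl)).
have dE : (l.+1 %/ L = (l %/ L).+1)%N by rewrite divnS// Ll add1n.
have mE : ((l %% L).+1 = L)%N.
  apply/eqP; rewrite eqn_leq ltn_mod L0 /=; apply: dvdn_leq => //.
  by rewrite -(dvdn_addr _ (dvdn_mull (l %/ L) (dvdnn L))) addnS -divn_eq.
rewrite (transform_stopped _ _ _ _ lk); last first.
  move=> j lj; rewrite /block_coef ifF//; apply/negbTE; rewrite neq_ltn orbC.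
  by rewrite -dE leq_div2r.
rewrite transformS frozenS row_sum_window ?population_cap// /block_coef eqxx /stop_coef (h l (leqnn l)).
rewrite -[L%:R](congr1 (fun j => j%:R : R) mE) -[(l %% L).+1%:R]natr1.
by rewrite -[y l w](subrK (z l w)) e; ring.
Qed.

(** Bootstrap: at the first bad generation [l] all previous ones are good, so the transforms equal
    the true quantities there; as they do not change after [l], their bounds at [k] show that [l] is
    good. *)
Lemma all_good_of_transforms k w : (k <= Kmax)%N ->
  `|Itr k w| < dl -> `|Otr k w| < dO -> `|Mtr k w| < C ->
  (forall i, (i <= k %/ L)%N -> `|m| * L%:R / N + `|Str i k w| < dl) -> A k w.
Proof.
move=> kK hI hO hM hS; apply: contrapT => nA.
have ex : exists l, (l <= k)%N && ~~ A l w by exists k; rewrite leqnn; apply/negP.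
have [l /andP[lk nAl] lmin] := ex_minnP ex.
have before j : (j < l)%N -> A j w.
  move=> jl; apply: contraT => nAj; have := lmin j; rewrite nAj (ltnW (leq_trans jl lk)) => /(_ isT).
  by rewrite leqNgt jl.
have after j : (l <= j)%N -> A j w = false.
  move=> lj; apply/negbTE; apply: contra nAl => /all_goodP h; apply/all_goodP => i il.
  by apply: h; exact: leq_trans lj.
have [eI eM eO] := transform_exact before; have eS := block_exact before.
have cut J (zz : nat -> nat -> T -> R) (K : nat -> T -> R) lo1 hi1 : (forall j, A j w = false -> K j w = 0) ->
    transform J zz K lo1 hi1 k w = transform J zz K lo1 hi1 l w.
  by move=> h; apply: transform_stopped => // j lj; apply: h; exact: after.
have cs j : A j w = false -> stop_coef j w = 0 by rewrite /stop_coef => ->.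
have cd j : A j w = false -> diff_coef j w = 0 by rewrite /diff_coef => ->.
have cb i j : A j w = false -> block_coef i j w = 0 by move=> h; rewrite /block_coef cs// if_same.
rewrite (cut _ _ _ _ _ cs) eI in hI; rewrite (cut _ _ _ _ _ cs) eM in hM; rewrite (cut _ _ _ _ _ cd) eO in hO.
have gl : good l w.
  rewrite /good (leq_trans lk kK) hI hM hO /= eS; have := hS (l %/ L)%N (leq_div2r L lk); rewrite (cut _ _ _ _ _ (cb _)).
  apply: le_lt_trans; apply: le_trans (ler_normD _ _) _; rewrite lerD2r.
  rewrite !normrM [`|_^-1|]ger0_norm ?invr_ge0// ler_wpM2r ?invr_ge0// ler_wpM2l// ger0_norm// ler_nat.
  by rewrite ltnW// ltn_mod.
move/negP: nAl; apply; apply/all_goodP => j; rewrite leq_eqVlt => /predU1P[->//|jl].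
by have /all_goodP := before j jl; exact.
Qed.

Lemma count_window (a c K : nat) : (\sum_(k < K) (a <= k < c) <= c - a)%N.
Proof.
suff : (\sum_(k < K) (a <= k < c) <= minn K c - a)%N.
  by move/leq_trans; apply; apply: leq_sub2r; exact: geq_minr.
elim: K => [|K IH]; first by rewrite big_ord0.
rewrite big_ord_recr/=; move: IH; set S := (\sum_(i < K) _)%N; move: S => S.
by case: (leqP a K); case: (ltnP K c) => /=; lia.
Qed.

Lemma population_le x : (population x)%:R <= N * `|x|.
Proof.
have h0 : 0 <= N * Num.min (Num.max x 0) r.+1%:R by rewrite mulr_ge0// le_min le_max lexx orbT/=.
have /andP[/le_trans h _] := truncn_itv h0; apply: h; rewrite ler_wpM2l// ge_min ge_max ler_norm normr_ge0.
by [].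
Qed.

Lemma population_near x : `|x| <= r.+1%:R -> `|(population x)%:R - N * Num.max x 0| <= 1.
Proof.
move=> xr; have m0 : 0 <= Num.max x 0 by rewrite le_max lexx orbT.
rewrite /population min_l; last by rewrite ge_max (le_trans (ler_norm _) xr)/=.
have /andP[h1 h2] := truncn_itv (mulr_ge0 (ler0n R n.+1) m0).
move: h1 h2; rewrite -[(Num.truncn _).+1%:R]natr1 ler_norml; set a := (Num.truncn _)%:R; set c := N * _ => h1 h2.
by apply/andP; split; lra.
Qed.

Let N0 : 0 < N. Proof. by []. Qed.

Lemma stop_coef_rate k w : stop_coef k w ^+ 2 * (b k w - 0)%:R <= (C1 + 1) / N.
Proof.
rewrite /stop_coef; have c1 : 0 <= C1 + 1 by rewrite addr_ge0// addr_ge0// mulr_ge0.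
case: ifP => [/A_good/good_bounds[_ hz _]|_]; last by rewrite expr0n mul0r divr_ge0.
rewrite subn0; apply: le_trans (ler_wpM2l (sqr_ge0 _) (population_le (z k w))) _.
rewrite expr2 -mulrA mulKf ?gt_eqF// mulrC; exact: ler_wpM2r.
Qed.

Lemma block_coef_rate i k w : block_coef i k w ^+ 2 * (b k w - 0)%:R <= (i * L <= k < i.+1 * L)%:R * ((C1 + 1) / N).
Proof.
rewrite /block_coef; have -> : (k %/ L == i)%N = (i * L <= k < i.+1 * L)%N.
  by rewrite eqn_leq -ltnS ltn_divLR// leq_divRL// andbC.
case: ifP => _; last by rewrite expr0n !mul0r.
by rewrite mul1r; exact: stop_coef_rate.
Qed.

(** The window has [|b - X|] individuals: up to a rounding error 1, this is [N] times a distance at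
    most [|y - z| + |O| + |immigration|]. The part [|O|] is absorbed by the Yamada-Watanabe
    function. *)
Lemma diff_coef_rate k w : diff_coef k w ^+ 2 * (hi k w - lo k w)%:R <=
  (if A k w then (1 + N * (2 * dl + `|O k w|)) / N ^+ 2 else 0).
Proof.
rewrite /diff_coef; case: ifP => [Ak|_]; last by rewrite expr0n mul0r.
have -> : (if (X k w <= b k w)%N then N^-1 else - N^-1) ^+ 2 = (N ^+ 2)^-1 by case: ifP => _; rewrite ?sqrrN exprVn.
rewrite mulrC ler_pM2r ?invr_gt0 ?exprn_gt0//.
have -> : (hi k w - lo k w)%:R = `|(b k w)%:R - (X k w)%:R| :> R.
  rewrite /hi /lo; case: (leqP (X k w) (b k w)) => h; rewrite natrB ?(ltnW h)//.
    by rewrite ger0_norm// subr_ge0 ler_nat.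
  by rewrite ler0_norm ?opprB// subr_le0 ler_nat ltnW.
have [_ hz _] := good_bounds (A_good Ak); have /and5P[_ hI hO hM hyz] := A_good Ak.
have zr : `|z k w| <= r.+1%:R by apply: le_trans hz _; apply: le_trans C1r; rewrite lerD2l ler1n.
have X0' : 0 <= (X k w)%:R / N by rewrite divr_ge0.
have h2 : `|Num.max (z k w) 0 - (X k w)%:R / N| <= 2 * dl + `|O k w|.
  have -> : (X k w)%:R / N = Num.max ((X k w)%:R / N) 0 by rewrite max_l.
  apply: le_trans (max0_lipschitz _ _) _.
  have -> : z k w - (X k w)%:R / N = - (y k w - z k w) + O k w - immigration k w by rewrite /O; ring.
  have := ler_normB (- (y k w - z k w) + O k w) (immigration k w).
  have := ler_normD (- (y k w - z k w)) (O k w); rewrite normrN.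
  move: hI hyz; set p := `|immigration k w|; set q := `|_ - z k w|; set u := `|- _ + _|; set u' := `|_ - immigration _ _|.
  lra.
have -> : (b k w)%:R - (X k w)%:R = ((population (z k w))%:R - N * Num.max (z k w) 0) +
    N * (Num.max (z k w) 0 - (X k w)%:R / N) by rewrite mulrBr mulrCA divff ?mulr1 ?gt_eqF// /b; ring.
apply: le_trans (ler_normD _ _) _; apply: lerD; first exact: population_near.
by rewrite normrM ger0_norm// ler_wpM2l.
Qed.

Let sqr_taylor : taylor2 (fun x : R => x ^+ 2) (fun x => 2 * x) (fun=> 2) 0.
Proof. by move=> x x'; rewrite mul0r (_ : _ - _ = 0) ?normr0//; field. Qed.

Let msqr : meas_fun (fun x : R => x ^+ 2).
Proof. exact: measurable_funX. Qed.

(** This is [transform_bound] for the square, whose second-order expansion is exact: [row_error]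
    vanishes with [C = M = 0]. *)
Lemma transform_L2 J V (G' : nat -> nat -> set_system T) (zz : nat -> nat -> T -> R)
    (K : nat -> T -> R) (lo1 hi1 : nat -> T -> nat) (be : nat -> R) (k : nat) :
  (forall k, noise_row P J V (G' k) (zz k)) -> 0 <= V ->
  (forall k, F k `<=` G' k 0%N) -> (forall k, G' k J `<=` F k.+1) ->
  (forall k, meas_wrt (F k) (K k)) -> (forall k, meas_wrt (F k) (lo1 k)) ->
  (forall k, meas_wrt (F k) (hi1 k)) -> (forall k w, `|K k w| <= N^-1) ->
  (forall k w, K k w ^+ 2 * (hi1 k w - lo1 k w)%:R <= be k) ->
  (\int[P]_w (transform J zz K lo1 hi1 k w ^+ 2)%:E <= (\sum_(l < k) V * be l)%:E)%E.
Proof.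
move=> nr' V0 FG' GF' mK mlo mhi Kc hbe.
have c0 : 0 <= N^-1 by rewrite invr_ge0.
have hQ k' j : (j < J)%N -> (\int[P]_w (cubic_rem (N^-1 * zz k' j w))%:E <= (N^-1 ^+ 2 * V)%:E)%E.
  move=> jJ; have [_ _ z2] := nr_centered (nr' k') jJ.
  have mz' := sub_meas_wrt (nr_sub (nr' k') j.+1) (nr_measurable (nr' k') jJ).
  rewrite EFinM -z2 -ge0_integral_scale ?sqr_ge0//.
  - apply: ge0_integral_mono => w; rewrite lee_fin ?cubic_rem_ge0// -exprMn; exact: cubic_rem_le_sqr.
  - exact: measurable_funX.
  - by move=> w; exact: sqr_ge0.
have hB k' : (k' < k)%N -> (\int[P]_w (K k' w ^+ 2 * (hi1 k' w - lo1 k' w)%:R * (fun=> 2) (transform J zz K lo1 hi1 k' w))%:E <= (be k' * 2)%:E)%E.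
  move=> _; apply: ge0_integral_le_cst => w; rewrite lee_fin.
    by apply: mulr_ge0 => //; apply: mulr_ge0 => //; exact: sqr_ge0.
  by apply: ler_wpM2r.
have := @transform_bound _ _ _ P J V N^-1 _ F G' zz nr' sF FG' GF' V0 c0 hQ K lo1 hi1 mK mlo mhi Kc
  _ _ _ (fun=> 2) 0 0 1 sqr_taylor (lexx 0) (lexx 0) (fun x => sqr_ge0 x) msqr (fun=> ler0n _ 2) _ _ ltr01 _ k hB.
move=> H; apply: le_trans (H _ _) _.
- exact: measurable_cst.
- by move=> x x'; rewrite mul0r addr0.
rewrite lee_fin expr0n add0r /row_error !(mulr0, mul0r) !(add0r, addr0) !mulr0 addr0.
by apply: ler_sum => l _; rewrite le_eqVlt; apply/orP; left; apply/eqP; field.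
Qed.

Lemma immigration_transform_L2 k : (\int[P]_w (Itr k w ^+ 2)%:E <= (k%:R * (s / N ^+ 2))%:E)%E.
Proof.
apply: le_trans (transform_L2 (be := fun=> (N ^+ 2)^-1) k nri s0 _ _ stop_coef_adapted _ _ stop_coef_le _) _.
- by move=> k' B.
- by move=> k' B.
- by move=> k'; exact: measurable_cst.
- by move=> k'; exact: measurable_cst.
- by move=> k' w; rewrite subn0 mulr1 /stop_coef; case: ifP => _; rewrite ?exprVn// expr0n invr_ge0 sqr_ge0.
by rewrite sumr_const card_ord mulr_natl.
Qed.

Lemma martingale_transform_L2 k : (\int[P]_w (Mtr k w ^+ 2)%:E <= (k%:R * (v * ((C1 + 1) / N)))%:E)%E.
Proof.
apply: le_trans (transform_L2 (be := fun=> (C1 + 1) / N) k (nr cap) v0 _ _ stop_coef_adapted _ mb stop_coef_le stop_coef_rate) _.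
- by [].
- by move=> k'; exact: GF.
- by move=> k'; exact: measurable_cst.
by rewrite sumr_const card_ord mulr_natl.
Qed.

Let count_block i k : \sum_(l < k) (i * L <= l < i.+1 * L)%:R <= L%:R :> R.
Proof.
rewrite -natr_sum ler_nat; apply: leq_trans (count_window _ _ _) _.
by rewrite -mulnBl subSnn mul1n.
Qed.

Let C10 : 0 <= C1 + 1. Proof. by rewrite addr_ge0// addr_ge0// mulr_ge0. Qed.

Lemma block_transform_L2 i k : (\int[P]_w (Str i k w ^+ 2)%:E <= (v * ((C1 + 1) * (L%:R / N)))%:E)%E.
Proof.
apply: le_trans (transform_L2 (be := fun k => (i * L <= k < i.+1 * L)%:R * ((C1 + 1) / N)) k (nr cap) v0 _ _ (block_coef_adapted i) _ mb (block_coef_le i) (block_coef_rate i)) _.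
- by [].
- by move=> k'; exact: GF.
- by move=> k'; exact: measurable_cst.
rewrite lee_fin -mulr_sumr ler_wpM2l// -mulr_suml.
have -> : (C1 + 1) * (L%:R / N) = L%:R * ((C1 + 1) / N) by ring.
by apply: ler_wpM2r; [exact: divr_ge0|exact: count_block].
Qed.

Variable Q : R.
Hypothesis hQ : forall k j, (\int[P]_w (cubic_rem (N^-1 * ze k j w))%:E <= Q%:E)%E.

Lemma difference_transform_bound (f f1 f2 : R -> R) (M kap C' theta : R) k :
  taylor2 f f1 f2 C' -> 0 <= C' -> 0 <= M -> f 0 = 0 -> (forall x, 0 <= f x) ->
  meas_fun f -> meas_fun f2 ->
  (forall x, 0 <= f2 x) -> (forall x, f2 x * `|x| <= kap) -> (forall x, f2 x <= M) ->
  (forall x x', `|f2 x - f2 x'| <= M * `|x - x'|) -> 0 < theta -> 0 <= dl -> 0 <= kap ->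
  (\int[P]_w (f (Otr k w))%:E <= (k%:R * (v / 2 * ((M / N + (2 * dl * M + kap)) / N)) +
     k%:R * (cap%:R * row_error cap v N^-1 Q C' M theta))%:E)%E.
Proof.
move=> Tf C'0 M0 f00 f0 mf mf2 f20 f2k f2M f2L th0 dl0 kap0.
have c0 : 0 <= N^-1 by rewrite invr_ge0.
have lip x x' : f2 (x + x') <= f2 x + M * `|x'|.
  by have := f2L (x + x') x; rewrite addrAC subrr add0r => /(le_trans (ler_norm _)); rewrite lerBlDl.
have be0 : 0 <= (M / N + (2 * dl * M + kap)) / N.
  apply: divr_ge0 => //; apply: addr_ge0; first exact: divr_ge0.
  by apply: addr_ge0 => //; apply: mulr_ge0 => //; exact: mulr_ge0.
have hB k' : (k' < k)%N -> (\int[P]_w (diff_coef k' w ^+ 2 * (hi k' w - lo k' w)%:R * f2 (Otr k' w))%:E <= ((M / N + (2 * dl * M + kap)) / N)%:E)%E.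
  move=> _; apply: ge0_integral_le_cst => w; rewrite lee_fin.
    by apply: mulr_ge0 => //; apply: mulr_ge0 => //; exact: sqr_ge0.
  apply: le_trans (ler_wpM2r (f20 _) (diff_coef_rate k' w)) _.
  case: ifP => [Ak|_]; last by rewrite mul0r.
  have [|_ _ ->] := @transform_exact k' w.
    by move=> l lk; have /all_goodP h := Ak; apply/all_goodP => j jl; apply: h; exact: leq_trans (ltnW lk).
  set x := O k' w.
  have -> : (M / N + (2 * dl * M + kap)) / N = (M + N * (2 * dl * M + kap)) / N ^+ 2.
    by field; rewrite gt_eqF.
  rewrite mulrAC ler_pM2r ?invr_gt0 ?exprn_gt0// mulrDl mul1r -[N * _ * f2 x]mulrA.
  apply: lerD => //; apply: ler_wpM2l => //; rewrite mulrDl [`|x| * _]mulrC; apply: lerD => //.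
  by apply: ler_wpM2l => //; exact: mulr_ge0.
have := @transform_bound _ _ _ P cap v N^-1 Q F G ze (nr cap) sF FG (fun k => @GF k cap) v0 c0 (fun k j _ => hQ k j)
  diff_coef lo hi diff_coef_adapted lo_adapted hi_adapted diff_coef_le
  f f1 f2 f2 C' M theta Tf C'0 M0 f0 mf f20 mf2 lip th0 _ k hB.
move/le_trans; apply; rewrite lee_fin f00 add0r sumr_const card_ord -[_ *+ k]mulr_natl; exact: lexx.
Qed.

(** The second derivative is at most [M * |Str|], and the mean of [|Str|] is bounded through
    [(q + Str ^ 2 / q) / 2]. Only the [L] generations of block [i] contribute. *)
Lemma block_transform_bound (f f1 f2 : R -> R) (M C' theta q : R) i k :
  taylor2 f f1 f2 C' -> 0 <= C' -> 0 <= M -> f 0 = 0 -> (forall x, 0 <= f x) ->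
  meas_fun f -> (forall x, `|f2 x| <= M * `|x|) -> 0 < theta -> 0 < q ->
  (\int[P]_w (f (Str i k w))%:E <=
     (v / 2 * ((C1 + 1) * (L%:R / N)) * (M * ((q + v * ((C1 + 1) * (L%:R / N)) / q) / 2)) +
     k%:R * (cap%:R * row_error cap v N^-1 Q C' M theta))%:E)%E.
Proof.
move=> Tf C'0 M0 f00 f0 mf f2M th0 q0.
have c0 : 0 <= N^-1 by rewrite invr_ge0.
pose g (x : R) := M * `|x|.
have lip x x' : f2 (x + x') <= g x + M * `|x'|.
  apply: le_trans (ler_norm _) _; apply: le_trans (f2M _) _; rewrite /g -mulrDr ler_wpM2l//; exact: ler_normD.
have g0 x : 0 <= g x by exact: mulr_ge0.
have mg : meas_fun g by apply: measurable_funM => //; exact: measurableT_comp.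
set D := M * ((q + v * ((C1 + 1) * (L%:R / N)) / q) / 2).
have D0 : 0 <= D.
  apply: mulr_ge0 => //; apply: divr_ge0 => //; apply: addr_ge0; first exact: ltW.
  by apply: divr_ge0; [apply: mulr_ge0 => //; apply: mulr_ge0 => //; exact: divr_ge0|exact: ltW].
have gD l : (\int[P]_w (g (Str i l w))%:E <= D%:E)%E.
  have mS : meas_fun (Str i l).
    apply: (sub_meas_wrt (sF l)).
    apply: (transform_adapted (nr cap) sF FG (fun k => @GF k cap) (block_coef_adapted i) _ mb).
    by move=> l'; exact: measurable_cst.
  apply: le_trans (_ : (\int[P]_w (M * q / 2 + M / (2 * q) * Str i l w ^+ 2)%:E <= _)%E).
    apply: ge0_integral_mono => w; rewrite lee_fin//.
    have -> : M * q / 2 + M / (2 * q) * Str i l w ^+ 2 = M * ((q ^+ 2 + `|Str i l w| ^+ 2) / (2 * q)).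
      by rewrite real_normK ?num_real//; field; rewrite gt_eqF.
    apply: ler_wpM2l => //; rewrite ler_pdivlMr ?mulr_gt0//.
    have := sqr_ge0 (q - `|Str i l w|); rewrite !expr2; lra.
  have a0 : 0 <= M * q / 2 by apply: divr_ge0 => //; apply: mulr_ge0 => //; exact: ltW.
  have b0 : 0 <= M / (2 * q) by apply: divr_ge0 => //; apply: mulr_ge0 => //; exact: ltW.
  have mS2 : meas_fun (fun w => Str i l w ^+ 2) by exact: measurable_funX.
  have bS0 w : 0 <= M / (2 * q) * Str i l w ^+ 2 by apply: mulr_ge0 => //; exact: sqr_ge0.
  have mbS : meas_fun (fun w => M / (2 * q) * Str i l w ^+ 2) by exact: measurable_funM.
  have -> : (\int[P]_w (M * q / 2 + M / (2 * q) * Str i l w ^+ 2)%:E = \int[P]_w (M * q / 2)%:E + \int[P]_w (M / (2 * q) * Str i l w ^+ 2)%:E)%E.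
    exact: (@ge0_integral_add _ _ _ P (cst (M * q / 2))).
  rewrite integral_cst//= [X in (_ * X + _)%E]probability_setT mule1.
  rewrite (ge0_integral_scale P b0 mS2 (fun w => sqr_ge0 _)).
  apply: (@le_trans _ _ ((M * q / 2)%:E + (M / (2 * q))%:E * (v * ((C1 + 1) * (L%:R / N)))%:E)%E).
    apply: leeD => //; apply: lee_pmul => //; last exact: block_transform_L2.
    by apply: integral_ge0 => w _; rewrite lee_fin sqr_ge0.
  rewrite -EFinM -EFinD lee_fin /D le_eqVlt; apply/orP; left; apply/eqP.
  by field; rewrite !gt_eqF.
have hB k' : (k' < k)%N -> (\int[P]_w (block_coef i k' w ^+ 2 * (b k' w - 0)%:R * g (Str i k' w))%:E <=
    ((i * L <= k' < i.+1 * L)%:R * ((C1 + 1) / N) * D)%:E)%E.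
  move=> _; set be := (_ <= _ < _)%:R * _; have be0 : 0 <= be by rewrite mulr_ge0// divr_ge0.
  apply: le_trans (_ : (\int[P]_w (be * g (Str i k' w))%:E <= _)%E).
    apply: ge0_integral_mono => w; rewrite lee_fin.
      by apply: mulr_ge0 => //; apply: mulr_ge0 => //; exact: sqr_ge0.
    by apply: ler_wpM2r => //; exact: block_coef_rate.
  rewrite ge0_integral_scale//.
  - rewrite (EFinM be); apply: lee_pmul; [by rewrite lee_fin|by apply: integral_ge0 => w _; rewrite lee_fin|exact: lexx|].
    exact: gD.
  - apply: measurableT_comp => //; apply: (sub_meas_wrt (sF k')).
    apply: (transform_adapted (nr cap) sF FG (fun k => @GF k cap) (block_coef_adapted i) _ mb).
    by move=> l'; exact: measurable_cst.
have := @transform_bound _ _ _ P cap v N^-1 Q F G ze (nr cap) sF FG (fun k => @GF k cap) v0 c0 (fun k j _ => hQ k j)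
  (block_coef i) (fun=> fun=> 0%N) b (block_coef_adapted i) (fun k => @measurable_cst _ _ _ _ setT 0%N) mb (block_coef_le i)
  f f1 f2 g C' M theta Tf C'0 M0 f0 mf g0 mg lip th0 _ k hB.
move/le_trans; apply; rewrite f00 add0r lee_fin lerD2r.
have -> : \sum_(l < k) v / 2 * ((i * L <= l < i.+1 * L)%:R * ((C1 + 1) / N) * D) =
    (\sum_(l < k) (i * L <= l < i.+1 * L)%:R) * (v / 2 * ((C1 + 1) / N) * D).
  by rewrite mulr_suml; apply: eq_bigr => l _; ring.
have -> : v / 2 * ((C1 + 1) * (L%:R / N)) * D = L%:R * (v / 2 * ((C1 + 1) / N) * D) by ring.
apply: ler_wpM2r; last exact: count_block.
by apply: mulr_ge0 => //; apply: mulr_ge0; exact: divr_ge0.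
Qed.

Lemma measurable_transforms k : [/\ meas_fun (Itr k), meas_fun (Mtr k),
  meas_fun (Otr k) & forall i, meas_fun (Str i k)].
Proof.
have m0 (c : nat) k' : meas_wrt (F k') (fun=> c) by exact: measurable_cst.
have toT f : meas_wrt (F k) f -> meas_fun (f : T -> R).
  exact: (sub_meas_wrt (sF k)).
have GF' k' : G k' cap `<=` F k'.+1 by exact: GF.
split=> [|||i]; apply: toT.
- by apply: (transform_adapted nri sF _ _ stop_coef_adapted) => // k' B.
- by apply: (transform_adapted (nr cap) sF FG GF' stop_coef_adapted _ mb).
- exact: (transform_adapted (nr cap) sF FG GF' diff_coef_adapted lo_adapted hi_adapted).
- by apply: (transform_adapted (nr cap) sF FG GF' (block_coef_adapted i) _ mb).
Qed.
End parameters.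

Hypothesis vanishing : forall e : R, 0 < e -> exists n0, forall n, (n0 <= n)%N -> forall k j,
  (\int[P]_w (cubic_rem (n.+1%:R^-1 * ze k j w))%:E <= (e * n.+1%:R^-1 ^+ 2)%:E)%E.

Let large (a : R) : 0 < a -> exists n0, forall n, (n0 <= n)%N -> n.+1%:R^-1 <= a.
Proof.
move=> a0; have [k] := ltr_add_invr a0; rewrite add0r => ka; exists k => n kn.
by apply: le_trans (ltW ka); rewrite lef_pV2 ?posrE// ler_nat.
Qed.

(** There are [t * n.+1] rows of [cap] noises, of order [n ^ 2] in all, each weighted by
    [n.+1 ^ -2]. One takes [theta] small, then [n] so large that [1 / (n.+1 * theta)] is small, and
    [Q] a small multiple of [n.+1 ^ -2]. *)
Lemma row_error_small (t r : nat) (C' M e : R) : 0 <= C' -> 0 <= M -> 0 < e ->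
  exists2 theta : R, 0 < theta & exists n0, forall n, (n0 <= n)%N -> exists2 Q : R,
    (forall k j, (\int[P]_w (cubic_rem (n.+1%:R^-1 * ze k j w))%:E <= Q%:E)%E) &
    (t * n.+1)%:R * ((cap n r)%:R * row_error (cap n r) v n.+1%:R^-1 Q C' M theta) <= e.
Proof.
move=> C'0 M0 e0; pose a : R := (t * r.+1)%:R.
have a0 : 0 <= a by [].
have d10 : 0 < a * v * M + 1 by rewrite ltr_wpDl// mulr_ge0// mulr_ge0.
have d20 : 0 < a * C' + 1 by rewrite ltr_wpDl// mulr_ge0.
pose th := e / (a * v * M + 1); have th0 : 0 < th by rewrite divr_gt0.
pose q := e / 2 / (a * C' + 1); have q0 : 0 < q by rewrite !divr_gt0.
have d30 : 0 < r.+1%:R * v + 1 by rewrite ltr_wpDl// mulr_ge0.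
have [n1 hn1] := large (divr_gt0 (exprn_gt0 2 th0) d30).
have [n2 hn2] := vanishing q0.
exists th => //; exists (maxn n1 n2) => n; rewrite geq_max => /andP[/hn1 h1 /hn2 h2].
exists (q * n.+1%:R^-1 ^+ 2) => //; have N0 : 0 < n.+1%:R :> R by [].
set N := n.+1%:R in h1 N0 *.
have -> : (t * n.+1)%:R * ((cap n r)%:R * row_error (cap n r) v N^-1 (q * N^-1 ^+ 2) C' M th) =
  a * v * M / 4 * (th + r.+1%:R * v * N^-1 / th) + a * C' * q.
  by rewrite /row_error /cap /a !natrM -/N; field; rewrite !gt_eqF.
have h3 : r.+1%:R * v * N^-1 / th <= th.
  rewrite ler_pdivrMr// -expr2; apply: (@le_trans _ _ ((r.+1%:R * v + 1) * N^-1)).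
    by apply: ler_wpM2r; [rewrite invr_ge0|rewrite lerDl].
  by rewrite mulrC -ler_pdivlMr.
have h4 : a * C' * q <= e / 2.
  rewrite /q mulrCA ler_piMr ?divr_ge0 ?(ltW e0)// ler_pdivrMr// mul1r lerDl//.
have h5 : a * v * M * th <= e.
  rewrite /th mulrCA ler_piMr ?(ltW e0)// ler_pdivrMr// mul1r lerDl//.
have h6 : a * v * M / 4 * (th + r.+1%:R * v * N^-1 / th) <= a * v * M / 4 * (th + th).
  by apply: ler_wpM2l; [rewrite divr_ge0// mulr_ge0// mulr_ge0|rewrite lerD2l].
apply: le_trans (lerD h6 h4) _.
have -> : a * v * M / 4 * (th + th) = a * v * M * th / 2 by field.
by move: h5; set u := a * v * M * th => h5; lra.
Qed.

Lemma most_sqr (f : T -> R) (B c e : R) : meas_fun f -> 0 < c ->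
  (\int[P]_w (f w ^+ 2)%:E <= B%:E)%E -> B <= c ^+ 2 * e -> most P e (fun w => `|f w| < c).
Proof.
move=> mf c0 fB Be; have m2 : meas_fun (fun w => f w ^+ 2) by exact: measurable_funX.
apply: most_imp (most_markov (exprn_gt0 2 c0) m2 (fun w => sqr_ge0 _) (le_trans fB _)); last by rewrite lee_fin.
move=> w; rewrite -[f w ^+ 2]real_normK ?num_real// ltr_pXn2r// ?nnegrE// ltW//.
Qed.

(** Constants are chosen in the order [kap], the bound [M] of the Yamada-Watanabe function, the lag
    [dl], the fineness [r] of the blocks and finally [n]. Four families of transforms are
    controlled, each with probability loss [ep = e' / 4]: immigration, difference, martingale part
    and blocks, the last by a union bound. *)
Lemma frozen_close (t : nat) (e : R) : 0 < e -> exists (C : R) (r0 : nat), forall r, (r0 <= r)%N ->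
  exists n0, forall n, (n0 <= n)%N -> (0 < n.+1 %/ r.+1)%N /\
  most P e (fun w => forall k, (k <= t * n.+1)%N ->
    let yz := frozen n r (n.+1 %/ r.+1) k w in
    [/\ `|(X k w)%:R / n.+1%:R - yz.1| <= e, `|yz.1 - yz.2| <= e, `|yz.1| <= C &
      (0 < k)%N -> (n.+1 %/ r.+1 %| k)%N -> `|yz.1 - (frozen n r (n.+1 %/ r.+1) k.-1 w).2| <= e]).
Proof.
move=> e0; pose e' := Num.min e 1; have e'0 : 0 < e' by rewrite lt_min e0 ltr01.
have e'e : e' <= e by rewrite ge_min lexx.
have e'1 : e' <= 1 by rewrite ge_min lexx orbT.
pose ep := e' / 4; have ep0 : 0 < ep by rewrite divr_gt0.
pose dO := e' / 2; have dO0 : 0 < dO by rewrite divr_gt0.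
have dO1 : dO <= 1 by rewrite /dO; lra.
have vt0 : 0 <= v * t%:R by rewrite mulr_ge0.
(* Chebyshev's inequality for the martingale part needs [v * t * (C1 + 1) <= C ^ 2 * ep], where [C1]
   itself grows with [C]: indeed [C1 + 1 <= 2 * C] and [2 * v * t / ep <= C]. *)
pose C := `|m| * t%:R + 1 + 2 * (v * t%:R) / ep.
have mt0 : 0 <= `|m| * t%:R by rewrite mulr_ge0.
have vte0 : 0 <= 2 * (v * t%:R) / ep by apply: divr_ge0; [apply: mulr_ge0|exact: ltW].
have C0 : 0 < C by rewrite /C; lra.
pose C1 := C + `|m| * t%:R; have C10 : 0 <= C1 by rewrite addr_ge0// ltW.
pose be := dO / 2 * ep; have be0 : 0 < be by rewrite mulr_gt0// divr_gt0.
have vt1 : 0 < v * t%:R + 1 by rewrite ltr_wpDl.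
pose kap := be / (2 * (v * t%:R + 1)); have kap0 : 0 < kap by rewrite divr_gt0// mulr_gt0.
have dO20 : 0 < dO / 2 by rewrite divr_gt0.
have [f [f1 [f2 [M M0 [Tf [mf mf2] [f00 f0] fr [f20 f2k f2M f2L]]]]]] := yamada_watanabe_function kap0 dO20.
have M30 : 0 <= 3 * M by rewrite mulr_ge0// ltW.
(* Chosen after [M]: the lag and the immigration noise enter the comparison multiplied by the bound
   of [f2]. *)
pose dl := Num.min (e' / 2) (be / (4 * ((v * t%:R + 1) * M))).
have dl0 : 0 < dl by rewrite lt_min dO0/= divr_gt0// mulr_gt0// mulr_gt0.
have dle : dl <= e' / 2 by rewrite ge_min lexx.
have dl1 : dl <= 1 by lra.
have dlb : dl <= be / (4 * ((v * t%:R + 1) * M)) by rewrite ge_min lexx orbT.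
have [g [g1 [g2 [Mg Mg0 [Tg cg [g00 g0] g2M gc]]]]] := @quartic_function R.
have mg : meas_fun g by exact: continuous_measurable_fun.
have dl20 : 0 < dl / 2 by rewrite divr_gt0.
have [c c0 hc] := gc _ dl20.
pose D0 := v / 2 * (C1 + 1) * (Mg * (1 + v * (C1 + 1)) / 2).
have D00 : 0 <= D0.
  apply: mulr_ge0; first by apply: mulr_ge0; [exact: divr_ge0|exact: addr_ge0].
  apply: divr_ge0 => //; apply: mulr_ge0; first exact: ltW.
  by apply: addr_ge0 => //; apply: mulr_ge0 => //; exact: addr_ge0.
have t10 : 0 < 2 * t%:R + 1 :> R by rewrite ltr_wpDl// mulr_ge0.
(* A block of length [h] contributes at most [D0 * q * h] with [q = sqrt h]; over [nb] blocks, with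
   [nb * h <= 2 * t + 1], the total has to stay below [c * ep / 2], which bounds [q] by [qm]. *)
pose qm := c * ep / (2 * ((D0 + 1) * (2 * t%:R + 1))).
have qm0 : 0 < qm by rewrite divr_gt0 ?mulr_gt0// ltr_wpDl.
have [r1 hr1] := large (exprn_gt0 2 qm0).
have m10 : 0 < `|m| + 1 by rewrite ltr_wpDl.
have [r2 hr2] := large (divr_gt0 dl20 m10).
have [r3 hr3] : exists k : nat, C1 + 2 <= k%:R.
  by exists (Num.truncn (C1 + 2)).+1; exact/ltW/truncnS_gt.
exists C1, (maxn r1 (maxn r2 r3)) => r; rewrite !geq_max => /andP[/hr1 h1 /andP[/hr2 h2 h3]].
set h := r.+1%:R^-1 in h1 h2; have h0 : 0 < h by rewrite invr_gt0.
have C1r : C1 + 2 <= r.+1%:R by apply: le_trans hr3 _; rewrite ler_nat (leq_trans h3).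
have mh : `|m| * h <= dl / 2.
  apply: (@le_trans _ _ ((`|m| + 1) * h)); first by rewrite ler_wpM2r ?(ltW h0)// lerDl.
  by rewrite mulrC -ler_pdivlMr.
pose q := Num.sqrt h; have q0 : 0 < q by rewrite sqrtr_gt0.
have q2 : q ^+ 2 = h by rewrite sqr_sqrtr// ltW.
have qqm : q <= qm by rewrite -[leRHS]gtr0_norm// -sqrtr_sqr ler_wsqrtr.
pose nb := (2 * r.+1 * t).+1.
have nb0 : 0 < nb%:R :> R by rewrite ltr0n.
have nbh : nb%:R * h <= 2 * t%:R + 1.
  rewrite /nb -natr1 !natrM mulrDl mul1r mulrAC -[2 * _ * h]mulrA divff ?pnatr_eq0// mulr1.
  by rewrite mulrC lerD2l invf_le1// ler1n.
have be40 : 0 < be / 4 by rewrite divr_gt0.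
have [th th0 [n1 hn1]] := row_error_small t r M30 (ltW M0) be40.
have cnb0 : 0 < c * ep / (2 * nb%:R) by rewrite divr_gt0 ?mulr_gt0.
have [th' th'0 [n2 hn2]] := row_error_small t r (ltW Mg0) (ltW Mg0) cnb0.
have a30 : 0 < be / (2 * ((v * t%:R + 1) * M)) by rewrite divr_gt0// mulr_gt0// mulr_gt0.
have [n3 hn3] := large a30.
have ts0 : 0 < t%:R * s + 1 by rewrite ltr_wpDl// mulr_ge0.
have [n4 hn4] := large (divr_gt0 (mulr_gt0 (exprn_gt0 2 dl0) ep0) ts0).
exists (maxn (maxn n1 n2) (maxn (maxn n3 n4) (2 * r.+1)%N)) => n.
rewrite !geq_max => /andP[/andP[/hn1[Q hQ err1] /hn2[Q' hQ' err2]] /andP[/andP[/hn3 h5 /hn4 h6] nr2]].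
set L := (n.+1 %/ r.+1)%N; have L0 : (0 < L)%N.
  by rewrite divn_gt0//; apply: leq_trans (leqW nr2); rewrite leq_pmull.
split=> //; set N := n.+1%:R in h5 h6 err1 err2 *; have N0 : 0 < N by rewrite ltr0n.
have LN : L%:R / N <= h by rewrite ler_pdivrMr// mulrC ler_pdivlMr// -natrM ler_nat leq_trunc_div.
pose K := (t * n.+1)%N; have KE : K%:R = t%:R * N by rewrite /K natrM.
have KL : (K %/ L < nb)%N.
  rewrite ltn_divLR//; have := ltn_ceil n.+1 (ltn0Sn r); rewrite -/L => hL.
  have : (n.+1 <= 2 * r.+1 * L)%N by clear -hL L0; move: L L0 hL => L L0 hL; nia.
  rewrite /K /nb => hN; clear -hN L0; move: L L0 hN => L L0 hN; nia.
have Kt : (K <= t * n.+1)%N by [].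
have C0' := ltW C0.
have [mI mM mO mS] := measurable_transforms n r L K dl dO C K.
have pI := most_sqr (e := ep) mI dl0 (immigration_transform_L2 n r L K dl dO C K) _.
have pM := most_sqr (e := ep) mM C0 (martingale_transform_L2 r L Kt dl1 dO1 C0' K).
have pS i := @most_markov _ _ _ P _ c (ep / nb%:R) c0 (measurableT_comp mg (mS i)) (fun w => g0 _).
have bS i := block_transform_bound L0 Kt dl1 dO1 C0' C1r hQ' i K Tg (ltW Mg0) (ltW Mg0) g00 g0 mg g2M th'0 q0.
have bO := difference_transform_bound L Kt dl1 dO1 C1r hQ K Tf M30 (ltW M0) f00 f0 mf mf2 f20 f2k f2M f2L th0 (ltW dl0) (ltW kap0).
have pO := @most_markov _ _ _ P _ (dO / 2) ep dO20 (measurableT_comp mf mO) (fun w => f0 _).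
have {}pI : most P ep (fun w => `|transform 1 (fun k => fun=> eta k) (stop_coef n r L K dl dO C) (fun=> fun=> 0%N) (fun=> fun=> 1%N) K w| < dl).
  apply: pI; rewrite KE; have -> : t%:R * N * (s / N ^+ 2) = t%:R * s * N^-1 by field; rewrite gt_eqF.
  have := h6; rewrite ler_pdivlMr// mulrC => /(le_trans _); apply.
  by rewrite ler_wpM2r ?invr_ge0 ?(ltW N0)// lerDl.
have {}pM : most P ep (fun w => `|transform (cap n r) ze (stop_coef n r L K dl dO C) (fun=> fun=> 0%N)
    (fun k w => population n r (frozen n r L k w).2) K w| < C).
  apply: pM; rewrite KE -/C1.
  have -> : t%:R * N * (v * ((C1 + 1) / N)) = v * t%:R * (C1 + 1) by field; rewrite gt_eqF.
  have hC : C1 + 1 <= 2 * C by rewrite /C1 /C; exact: linear_level.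
  apply: (@le_trans _ _ (v * t%:R * (2 * C))); first exact: ler_wpM2l.
  have -> : v * t%:R * (2 * C) = (2 * (v * t%:R) / ep) * (C * ep) by field; rewrite gt_eqF.
  have -> : C ^+ 2 * ep = C * (C * ep) by ring.
  apply: ler_wpM2r; first by rewrite mulr_ge0// ltW.
  by rewrite /C lerDr addr_ge0.
have {}pO : most P ep (fun w => `|transform (cap n r) ze (diff_coef n r L K dl dO C) (lo n r L) (hi n r L) K w| < dO).
  apply: most_imp (pO (le_trans bO _)).
    by move=> w /=; set x := transform _ _ _ _ _ _ _ => hx; have := le_lt_trans (fr x) hx; rewrite ltrBlDr -splitr.
  rewrite lee_fin -/be KE; rewrite -/K KE in err1.
  have -> : t%:R * N * (v / 2 * ((M / N + (2 * dl * M + kap)) / N)) =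
    v * t%:R / 2 * (M / N) + v * t%:R * (dl * M) + v * t%:R * kap / 2 by field; rewrite gt_eqF.
  have e1 : v * t%:R / 2 * (M / N) <= be / 4.
    have : (v * t%:R + 1) * M * N^-1 <= be / 2.
      have -> : be / 2 = (v * t%:R + 1) * M * (be / (2 * ((v * t%:R + 1) * M))) by field; rewrite !gt_eqF.
      by apply: ler_wpM2l => //; rewrite ltW// mulr_gt0.
    have : 0 <= M * N^-1 by rewrite mulr_ge0 ?invr_ge0// ltW.
    have -> : v * t%:R / 2 * (M / N) = (v * t%:R + 1) * M * N^-1 / 2 - M * N^-1 / 2 by field; rewrite gt_eqF.
    by move=> ? ?; exact: linear_half.
  have e2 : v * t%:R * (dl * M) <= be / 4.
    have : (v * t%:R + 1) * M * dl <= be / 4.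
      have -> : be / 4 = (v * t%:R + 1) * M * (be / (4 * ((v * t%:R + 1) * M))) by field; rewrite !gt_eqF.
      by apply: ler_wpM2l => //; rewrite ltW// mulr_gt0.
    have : 0 <= M * dl by rewrite mulr_ge0// ltW.
    have -> : v * t%:R * (dl * M) = (v * t%:R + 1) * M * dl - M * dl by ring.
    by move=> ? ?; rewrite lerBlDr; apply: ler_wpDr.
  have e3 : v * t%:R * kap / 2 <= be / 4.
    have -> : be / 4 = (v * t%:R + 1) * kap / 2 by rewrite /kap; field; rewrite gt_eqF.
    by rewrite ler_pM2r ?invr_gt0// ler_wpM2r ?(ltW kap0)// lerDl.
  exact: linear_quarters e1 e2 e3 err1.
have {}pS i : (i < nb)%N -> most P (ep / nb%:R) (fun w => `|transform (cap n r) ze (block_coef n r L K dl dO C i) (fun=> fun=> 0%N)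
    (fun k w => population n r (frozen n r L k w).2) K w| < dl / 2).
  move=> _; apply: most_imp (pS i (le_trans (bS i) _)).
    move=> w /=; set x := transform _ _ _ _ _ _ _ => hx; rewrite ltNge; apply/negP => /hc.
    by rewrite leNgt hx.
  rewrite lee_fin -/C1; set ln := L%:R / n.+1%:R; have ln0 : 0 <= ln by rewrite divr_ge0.
  have lnh : ln <= h by [].
  have C11 : 0 <= C1 + 1 by exact: addr_ge0.
  have vC : 0 <= v * (C1 + 1) by exact: mulr_ge0.
  have b1 : v / 2 * ((C1 + 1) * ln) * (Mg * ((q + v * ((C1 + 1) * ln) / q) / 2)) <= D0 * (q * h).
    have i1 : v / 2 * ((C1 + 1) * ln) <= v / 2 * (C1 + 1) * h.
      by rewrite mulrA; apply: ler_wpM2l => //; apply: mulr_ge0 => //; exact: divr_ge0.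
    have i2 : v * ((C1 + 1) * ln) / q <= v * (C1 + 1) * q.
      rewrite ler_pdivrMr// -[_ * q * q]mulrA -expr2 q2 mulrA; exact: ler_wpM2l.
    have -> : D0 * (q * h) = (v / 2 * (C1 + 1) * h) * (Mg * ((q + v * (C1 + 1) * q) / 2)) by rewrite /D0; ring.
    apply: ler_pM => //.
    - by apply: mulr_ge0; [exact: divr_ge0|exact: mulr_ge0].
    - apply: mulr_ge0; first exact: ltW.
      by apply: divr_ge0 => //; apply: addr_ge0; [exact: ltW|apply: divr_ge0; [apply: mulr_ge0 => //; exact: mulr_ge0|exact: ltW]].
    - apply: ler_wpM2l; first exact: ltW.
      by rewrite ler_pM2r ?invr_gt0// lerD2l.
  have b2 : D0 * (q * h) <= c * ep / (2 * nb%:R).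
    have D10 : 0 < D0 + 1 by rewrite ltr_wpDl.
    apply: (@le_trans _ _ ((D0 + 1) * (qm * h))).
      apply: ler_pM => //; [by rewrite mulr_ge0// ltW|by rewrite lerDl|by apply: ler_wpM2r => //; exact: ltW].
    have -> : (D0 + 1) * (qm * h) = c * ep / 2 * (h / (2 * t%:R + 1)) by rewrite /qm; field; rewrite !gt_eqF.
    have -> : c * ep / (2 * nb%:R) = c * ep / 2 * nb%:R^-1 by field; rewrite gt_eqF.
    apply: ler_wpM2l; first by rewrite divr_ge0// mulr_ge0// ltW.
    by rewrite ler_pdivrMr// [nb%:R^-1 * _]mulrC ler_pdivlMr// mulrC.
  have -> : c * (ep / nb%:R) = c * ep / (2 * nb%:R) + c * ep / (2 * nb%:R) by field; rewrite gt_eqF.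
  by apply: lerD => //; exact: le_trans b1 b2.
have {}pS := most_all pS.
have tot : e' = ep + (ep + (ep + \sum_(i < nb) ep / nb%:R)).
  rewrite sumr_const card_ord -[_ *+ nb]mulr_natl mulrCA divff ?mulr1 ?gt_eqF// /ep; by field.
apply: (most_le e'e); rewrite tot.
apply: most_imp (most_and pI (most_and pO (most_and pM pS))) => w [wI [wO [wM wS]]] k kK.
have : all_good n r L K dl dO C K w.
  apply: (all_good_of_transforms L0 Kt dl1 dO1 C0' C1r (leqnn K) wI wO wM) => i iK.
  have := wS i (leq_ltn_trans iK KL).
  have : `|m| * L%:R / n.+1%:R <= dl / 2.
    by rewrite -mulrA; apply: le_trans mh; exact: ler_wpM2l.
  by move=> mL hi2; apply: (lt_le_trans (ler_ltD mL hi2)); rewrite -splitr.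
move=> /all_goodP aK; have gk := aK k kK.
have [hy _ _] := good_bounds Kt dl1 dO1 gk.
have /and5P[_ hI hO _ hyz] := gk.
split; [|apply: le_trans (ltW hyz) _; apply: le_trans dle _; exact: linear_half_le|exact: hy|]; last first.
  move=> k0 Lk; have lk : (k.-1 < K)%N by rewrite prednK.
  have Aj j : (j <= k.-1)%N -> all_good n r L K dl dO C j w.
    move=> jk; apply/all_goodP => l lj; apply: aK; exact: leq_trans lj (leq_trans jk (ltnW lk)).
  have Lk' : (L %| k.-1.+1)%N by rewrite prednK.
  have J : (frozen n r L k.-1.+1 w).1 - (frozen n r L k.-1 w).2 = m * L%:R / N + transform (cap n r) ze (block_coef n r L K dl dO C (k.-1 %/ L)%N) (fun=> fun=> 0%N)
      (fun k w => population n r (frozen n r L k w).2) K w.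
    exact: (block_jump L0 Kt dl1 dO1 C0' C1r Aj Lk' lk).
  rewrite prednK// in J; rewrite J.
  have iK : (k.-1 %/ L < nb)%N by apply: leq_ltn_trans KL; exact: leq_div2r (ltnW lk).
  have := wS _ iK; have mL : `|m * L%:R / n.+1%:R| <= dl / 2.
    by rewrite -mulrA normrM [`|_ / _|]ger0_norm ?divr_ge0//; apply: le_trans mh; exact: ler_wpM2l.
  move=> hS; apply: le_trans (ler_normD _ _) _; apply: le_trans (lerD mL (ltW hS)) _.
  by rewrite -splitr; apply: le_trans dle _; exact: linear_half_le.
move: hI hO; set y := (frozen _ _ _ _ _).1; set x := _ / n.+1%:R; set im := immigration _ _ _ => hI hO.
have -> : x - y = im - (y - x + im) by ring.
apply: le_trans (ler_normB _ _) _; apply: le_trans e'e.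
by rewrite [e']splitr; apply: lerD; [exact: le_trans (ltW hI) dle|exact: ltW].
Qed.
End frozen_process.

(** * The second type *)

Section accumulation.
Context {R : realType} {d} {T : measurableType d} (P : probability T R).
Variables (F : nat -> set_system T) (G : nat -> nat -> set_system T).
Variables (ze : nat -> nat -> T -> R) (v a mu : R) (X Y E : nat -> T -> nat).
Hypotheses (sF : forall k, sub_algebra (F k))
  (FG : forall k, F k `<=` G k 0%N)
  (GF : forall k J, G k J `<=` F k.+1)
  (nr : forall J k, noise_row P J v (G k) (ze k))
  (v0 : 0 <= v)
  (a0 : 0 <= a)
  (mX : forall k, meas_wrt (F k) (X k))
  (mY : forall k, meas_wrt (F k) (Y k))
  (mE : forall k, meas_wrt (F k.+1) (E k))
  (meanE : forall k, (\int[P]_w ((E k w)%:R)%:E <= mu%:E)%E)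
  (Y0 : forall w, Y 0%N w = 0%N).
Hypothesis YS : forall k w, (Y k.+1 w)%:R =
  (Y k w)%:R + a * (X k w)%:R + \sum_(j < Y k w) ze k j w + (E k w)%:R.

Section parameters.
Variables (n K : nat) (e C : R).
Hypotheses (e1 : e <= 1)
  (C0 : 0 <= C).
Notation N2 := ((n.+1 * n.+1)%:R : R).

Let N20 : 0 < N2. Proof. by rewrite ltr0n muln_gt0. Qed.

Definition mass k w : R := (\sum_(l < k) (X l w)%:R) / N2.
Definition inflow k w : R := (\sum_(l < k) (E l w)%:R) / N2.
(** The martingale part of the second type, driven by its centered offspring noises. *)
Definition fluctuation k w : R := (Y k w)%:R / N2 - a * mass k w - inflow k w.

Definition tame k w : bool :=
  [&& (k <= K)%N, `|fluctuation k w| < e / 2, inflow k w < e / 2 & mass k w < C].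

Fixpoint all_tame k w : bool := tame k w && (if k is k'.+1 then all_tame k' w else true).

Lemma all_tameP k w : reflect (forall l, (l <= k)%N -> tame l w) (all_tame k w).
Proof.
apply: (iffP idP); elim: k => [|k IH] /=.
- by move=> /andP[h _] l; rewrite leqn0 => /eqP ->.
- by move=> /andP[h /IH h'] l; rewrite leq_eqVlt => /predU1P[->//|/h'].
- by move=> h; rewrite h.
- by move=> h; rewrite h//=; apply: IH => l lk; apply: h; exact: leqW.
Qed.

Let up k l d' (T' : measurableType d') (f : T -> T') : (k <= l)%N -> meas_wrt (F k) f -> meas_wrt (F l) f.
Proof.
move=> kl; apply: meas_wrt_sub => //.
exact: (noise_filtration_mono (nr 0) FG (fun k => GF (k := k) (J := 0%N))).
Qed.

Let mnat k (f : T -> nat) : meas_wrt (F k) f -> meas_wrt (F k) (fun w => (f w)%:R : R).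
Proof. by move=> mf; exact: (meas_nat_comp (fun j => j%:R : R) mf). Qed.

Let mmass k : meas_wrt (F k) (mass k).
Proof.
apply: measurable_funM; last exact: measurable_cst.
by apply: measurable_sum => l; apply: mnat; exact: (up (ltnW (ltn_ord l)) (@mX l)).
Qed.

Let minflow k : meas_wrt (F k) (inflow k).
Proof.
apply: measurable_funM; last exact: measurable_cst.
by apply: measurable_sum => l; apply: mnat; exact: (up (ltn_ord l) (@mE l)).
Qed.

Let mfluct k : meas_wrt (F k) (fluctuation k).
Proof.
apply: measurable_funB; last exact: minflow.
apply: measurable_funB; first by apply: measurable_funM; [exact: mnat|exact: measurable_cst].
by apply: measurable_funM; [exact: measurable_cst|exact: mmass].
Qed.

Let mtame k : meas_wrt (F k) (all_tame k).
Proof.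
have mt l : meas_wrt (F l) (tame l).
  apply: measurable_and; first exact: measurable_cst.
  apply: measurable_and.
    apply: measurable_fun_ltr; last exact: measurable_cst.
    by apply: measurableT_comp => //; exact: mfluct.
  by apply: measurable_and; apply: measurable_fun_ltr; [exact: minflow|exact: measurable_cst|exact: mmass|exact: measurable_cst].
elim: k => [|k IH]; first by apply: measurable_and; [exact: mt|exact: measurable_cst].
by apply: measurable_and; [exact: mt|exact: (up (leqnSn k) IH)].
Qed.

Definition tame_coef k w : R := if all_tame k w then N2^-1 else 0.

Let mcoef k : meas_wrt (F k) (tame_coef k).
Proof. by apply: measurable_fun_ifT; [exact: mtame|exact: measurable_cst|exact: measurable_cst]. Qed.

Let coef_le k w : `|tame_coef k w| <= N2^-1.
Proof. by rewrite /tame_coef; case: ifP => _; rewrite ?normr0 ?ger0_norm ?invr_ge0. Qed.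

Let tame_Y k w : tame k w -> (Y k w)%:R <= (1 + a * C) * N2.
Proof.
move=> /and4P[_ h1 h2 h3]; rewrite -ler_pdivrMr//.
have -> : (Y k w)%:R / N2 = fluctuation k w + a * mass k w + inflow k w by rewrite /fluctuation; ring.
have := ler_norm (fluctuation k w); have : a * mass k w <= a * C by apply: ler_wpM2l => //; exact: ltW.
by move: h1 h2 e1; lra.
Qed.

Definition size_bound := (Num.truncn ((1 + a * C) * N2)).+1.

Let Yb k w : tame k w -> (Y k w <= size_bound)%N.
Proof.
move=> /tame_Y h; rewrite -(ler_nat R); apply: le_trans h _; exact/ltW/truncnS_gt.
Qed.

Notation Tr := (transform size_bound ze tame_coef (fun=> fun=> 0%N) Y).

(** A tame generation has at most [(1 + a * C) * N2] individuals, each weighted by [1 / N2]. With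
    [K] of order [n] and [N2] of order [n ^ 2] the bound is of order [1 / n]. *)
Lemma fluctuation_L2 : (\int[P]_w (Tr K w ^+ 2)%:E <= (K%:R * (v * ((1 + a * C) / N2)))%:E)%E.
Proof.
have aC : 0 <= 1 + a * C by rewrite addr_ge0// mulr_ge0.
(* [transform_L2] is stated for a scale that is a successor; [N2] is put in this form. *)
have nE : ((n.+1 * n.+1).-1.+1)%:R = N2 by rewrite prednK// muln_gt0.
have m0 (k : nat) : meas_wrt (F k) (fun=> 0%N) by exact: measurable_cst.
have coef_le' k w : `|tame_coef k w| <= ((n.+1 * n.+1).-1.+1)%:R^-1 by rewrite nE.
have GF' k : G k size_bound `<=` F k.+1 by exact: GF.
have rate k w : tame_coef k w ^+ 2 * (Y k w - 0)%:R <= (1 + a * C) / N2.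
  rewrite /tame_coef; case: ifP => [/all_tameP h|_]; last by rewrite expr0n mul0r divr_ge0.
  have := tame_Y (h k (leqnn k)); rewrite subn0 => hY.
  have -> : (1 + a * C) / N2 = N2^-1 ^+ 2 * ((1 + a * C) * N2) by field; rewrite gt_eqF.
  by apply: ler_wpM2l => //; exact: sqr_ge0.
apply: le_trans (transform_L2 (n := (n.+1 * n.+1).-1) (be := fun=> (1 + a * C) / N2) sF K (nr size_bound) v0 FG GF' mcoef m0 mY coef_le' rate) _.
by rewrite sumr_const card_ord mulr_natl.
Qed.

Let exact_fluct k w : (forall l, (l < k)%N -> all_tame l w) -> Tr k w = fluctuation k w.
Proof.
elim: k => [_|k IH h].
  by rewrite /transform /fluctuation /mass /inflow !big_ord0 Y0 !mul0r mulr0 !subr0.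
have Ak := h k (ltnSn k); have /all_tameP/(_ k (leqnn k))/Yb Yk := Ak.
rewrite transformS (IH (fun l lk => h l (ltnW lk))) row_sum_window// /tame_coef Ak big_mkord.
by rewrite /fluctuation /mass /inflow !big_ord_recr/= YS; ring.
Qed.

(** The bootstrap of [all_good_of_transforms], at the first generation that is not tame. *)
Lemma tame_of_transform w : `|Tr K w| < e / 2 ->
  (forall k, (k <= K)%N -> inflow k w < e / 2 /\ mass k w < C) -> all_tame K w.
Proof.
move=> hT hk; apply: contrapT => nA.
have ex : exists l, (l <= K)%N && ~~ all_tame l w by exists K; rewrite leqnn; apply/negP.
have [l /andP[lk nAl] lmin] := ex_minnP ex.
have before j : (j < l)%N -> all_tame j w.
  move=> jl; apply: contraT => nAj; have := lmin j; rewrite nAj (ltnW (leq_trans jl lk)) => /(_ isT).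
  by rewrite leqNgt jl.
have after j : (l <= j)%N -> all_tame j w = false.
  move=> lj; apply/negbTE; apply: contra nAl => /all_tameP h; apply/all_tameP => i il.
  by apply: h; exact: leq_trans lj.
have eT : Tr K w = Tr l w.
  by apply: transform_stopped => // j lj; rewrite /tame_coef after.
rewrite eT (exact_fluct before) in hT.
have [h1 h2] := hk l lk.
have gl : tame l w by rewrite /tame lk hT h1 h2.
move/negP: nAl; apply; apply/all_tameP => j; rewrite leq_eqVlt => /predU1P[->//|jl].
by have /all_tameP := before j jl; exact.
Qed.

Lemma measurable_fluctuation_transform : meas_fun (Tr K).
Proof.
have m0 (k : nat) : meas_wrt (F k) (fun=> 0%N) by exact: measurable_cst.
have GF' k : G k size_bound `<=` F k.+1 by exact: GF.
apply: (sub_meas_wrt (sF K)).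
exact: (transform_adapted (nr size_bound) sF FG GF' mcoef m0 mY).
Qed.

Lemma inflow_mean : (\int[P]_w (inflow K w)%:E <= (K%:R * (mu / N2))%:E)%E.
Proof.
have mEn l : meas_fun (fun w => (E l w)%:R / N2 : R).
  apply: (sub_meas_wrt (sF l.+1)); apply: measurable_funM; last exact: measurable_cst.
  exact: mnat.
have E0 l w : 0 <= (E l w)%:R / N2 by rewrite divr_ge0.
have -> : (fun w => (inflow K w)%:E) = (fun w => (\sum_(l < K) (E l w)%:R / N2)%:E).
  by apply/funext => w; rewrite /inflow mulr_suml.
rewrite (ge0_integral_sum_ord P K mEn E0); apply: (@le_trans _ _ (\sum_(l < K) (mu / N2)%:E)%E).
  apply: lee_sum => l _.
  have mEl : meas_fun (fun w => (E l w)%:R : R).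
    apply: (sub_meas_wrt (sF l.+1)); exact: mnat.
  have c0 : 0 <= N2^-1 by rewrite invr_ge0.
  have := ge0_integral_scale P c0 mEl (fun w => ler0n R (E l w)).
  under [in X in X = _ -> _]eq_integral do rewrite mulrC.
  move=> ->; rewrite [mu / N2]mulrC (EFinM N2^-1); apply: lee_pmul => //.
  by apply: integral_ge0 => w _; rewrite lee_fin.
by rewrite sumEFin sumr_const card_ord mulr_natl.
Qed.

Lemma measurable_inflow : meas_fun (inflow K).
Proof. exact: (sub_meas_wrt (sF K) (@minflow K)). Qed.

Lemma inflow_mono k w : (k <= K)%N -> 0 <= inflow k w <= inflow K w.
Proof.
move=> kK; rewrite divr_ge0 ?sumr_ge0//= ler_wpM2r ?invr_ge0//.
rewrite -(subnKC kK); elim: (K - k)%N => [|j IH]; first by rewrite addn0.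
by apply: le_trans IH _; rewrite addnS big_ord_recr/= lerDl.
Qed.
End parameters.

Lemma accumulation_close :
  (forall (t : nat) (e : R), 0 < e -> exists (C : R) (n0 : nat), forall n, (n0 <= n)%N ->
     most P e (fun w => forall k, (k <= t * n.+1)%N -> (X k w)%:R / n.+1%:R <= C)) ->
  forall (t : nat) (e : R), 0 < e -> exists n0, forall n, (n0 <= n)%N ->
     most P e (fun w => forall k, (k <= t * n.+1)%N ->
       `|(Y k w)%:R / (n.+1 * n.+1)%:R - a * mass n k w| <= e).
Proof.
move=> hX t e e0; pose e' := Num.min e 1; have e'0 : 0 < e' by rewrite lt_min e0 ltr01.
have e'e : e' <= e by rewrite ge_min lexx.
have e'1 : e' <= 1 by rewrite ge_min lexx orbT.
pose ep := e' / 3; have ep0 : 0 < ep by rewrite divr_gt0.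
have e20 : 0 < e' / 2 by rewrite divr_gt0.
have [C1 [n1 hn1]] := hX t ep ep0.
pose C := t%:R * `|C1| + 1; have C0 : 0 <= C by rewrite addr_ge0// mulr_ge0.
have mu0 : 0 <= mu.
  rewrite -lee_fin; apply: le_trans (meanE 0); apply: integral_ge0 => w _; by rewrite lee_fin.
have aC : 0 <= 1 + a * C by rewrite addr_ge0// mulr_ge0.
pose b1 := t%:R * mu + 1; have b10 : 0 < b1 by rewrite ltr_wpDl// mulr_ge0.
pose b2 := t%:R * (v * (1 + a * C)) + 1; have b20 : 0 < b2 by rewrite ltr_wpDl// mulr_ge0// mulr_ge0.
have g1 : 0 < e' / 2 * ep / b1 by rewrite divr_gt0// mulr_gt0.
have g2 : 0 < (e' / 2) ^+ 2 * ep / b2 by rewrite divr_gt0// mulr_gt0// exprn_gt0.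
have [n2] := ltr_add_invr g1; rewrite add0r => h2.
have [n3] := ltr_add_invr g2; rewrite add0r => h3.
exists (maxn n1 (maxn n2 n3)) => n; rewrite !geq_max => /andP[/hn1 H1 /andP[n2n n3n]].
have N0 : 0 < n.+1%:R :> R by rewrite ltr0n.
have i2 : n.+1%:R^-1 <= e' / 2 * ep / b1.
  by apply: le_trans (ltW h2); rewrite lef_pV2 ?posrE// ler_nat.
have i3 : n.+1%:R^-1 <= (e' / 2) ^+ 2 * ep / b2.
  by apply: le_trans (ltW h3); rewrite lef_pV2 ?posrE// ler_nat.
pose K := (t * n.+1)%N.
have Kfrac (b : R) : K%:R * (b / (n.+1 * n.+1)%:R) = t%:R * b * n.+1%:R^-1.
  by rewrite /K !natrM; field; rewrite gt_eqF.
have H2 : most P ep (fun w => `|transform (size_bound n C) ze (tame_coef n K e' C) (fun=> fun=> 0%N) Y K w| < e' / 2).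
  apply: (most_sqr (measurable_fluctuation_transform n K e' C) e20 (fluctuation_L2 n K e'1 C0)).
  rewrite [v * _]mulrA Kfrac; have := i3; rewrite ler_pdivlMr// mulrC => /(le_trans _); apply.
  by apply: ler_wpM2r; [rewrite invr_ge0|rewrite lerDl].
have H3 : most P ep (fun w => inflow n K w < e' / 2).
  apply: (most_markov e20 (measurable_inflow n K)) => [w|]; first by have /andP[] := @inflow_mono n K K w (leqnn K).
  apply: le_trans (inflow_mean n K) _; rewrite lee_fin Kfrac.
  have := i2; rewrite ler_pdivlMr// mulrC => /(le_trans _); apply.
  by apply: ler_wpM2r; [rewrite invr_ge0|rewrite lerDl].
have tot : e' = ep + (ep + ep) by rewrite /ep; field.
apply: (most_le (e := ep + (ep + ep))); first by rewrite -tot.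
apply: most_imp (most_and H1 (most_and H2 H3)) => w [w1 [w2 w3]].
have mC k : (k <= K)%N -> mass n k w < C.
  move=> kK; apply: (@le_lt_trans _ _ (t%:R * `|C1|)); last by rewrite ltrDl.
  rewrite /mass ler_pdivrMr ?ltr0n ?muln_gt0//.
  apply: (@le_trans _ _ (\sum_(l < k) `|C1| * n.+1%:R)).
    apply: ler_sum => l _; rewrite -ler_pdivrMr//; apply: le_trans (ler_norm C1).
    by apply: w1; exact: leq_trans (ltnW (ltn_ord l)) kK.
  rewrite sumr_const card_ord -[_ *+ k]mulr_natl natrM.
  have -> : t%:R * `|C1| * (n.+1%:R * n.+1%:R) = K%:R * (`|C1| * n.+1%:R) by rewrite /K natrM; ring.
  by apply: ler_wpM2r; [exact: mulr_ge0|rewrite ler_nat].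
have tK : all_tame n K e' C K w.
  apply: (tame_of_transform e'1 w2) => k kK; split; last exact: mC.
  by have /andP[_ h] := @inflow_mono n K k w kK; exact: le_lt_trans w3.
move=> k kK; have /all_tameP/(_ k kK)/and4P[_ h1 h4 _] := tK.
have -> : (Y k w)%:R / (n.+1 * n.+1)%:R - a * mass n k w = fluctuation n k w + inflow n k w.
  by rewrite /fluctuation; ring.
have /andP[f0 _] := @inflow_mono n K k w kK.
apply: le_trans (ler_normD _ _) _; rewrite (ger0_norm f0); apply: le_trans e'e.
by rewrite [e']splitr; apply: lerD; exact: ltW.
Qed.
End accumulation.

(** * Convergence of the skeleton *)

Section bounded_mean.
Context {R : realType} {d} {T : measurableType d} (P : probability T R).
Implicit Types f g h : T -> R.

Definition mean f : R := fine (\int[P]_w (f w)%:E).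

Definition bounded_meas f := meas_fun f /\ exists M : R, forall w, `|f w| <= M.

Lemma bounded_measI f M : meas_fun f -> (forall w, `|f w| <= M) -> bounded_meas f.
Proof. by move=> mf fM; split => //; exists M. Qed.

Lemma bounded_meas_integrable f : bounded_meas f -> P.-integrable setT (EFin \o f).
Proof.
move=> [mf [M fM]]; apply/integrableP; split; first exact/measurable_EFinP.
apply: (@le_lt_trans _ _ M%:E); last by rewrite ltry.
by apply: ge0_integral_le_cst => w; rewrite /= lee_fin.
Qed.

Lemma mean_EFin f : bounded_meas f -> (\int[P]_w (f w)%:E = (mean f)%:E)%E.
Proof.
move=> bf; rewrite /mean fineK//; apply: integrable_fin_num => //.
exact: bounded_meas_integrable.
Qed.

Lemma bounded_measD f g : bounded_meas f -> bounded_meas g ->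
  bounded_meas (fun w => f w + g w).
Proof.
move=> [mf [M fM]] [mg [M' gM]]; split; first exact: measurable_funD.
by exists (M + M') => w; apply: le_trans (ler_normD _ _) _; exact: lerD.
Qed.

Lemma bounded_measZ (c : R) f : bounded_meas f -> bounded_meas (fun w => c * f w).
Proof.
move=> [mf [M fM]]; split; first exact: measurable_funM.
by exists (`|c| * M) => w; rewrite normrM ler_wpM2l.
Qed.

Lemma bounded_meas_cst (c : R) : bounded_meas (fun=> c).
Proof. by split => //; exists `|c|. Qed.

Lemma meanD f g : bounded_meas f -> bounded_meas g ->
  mean (fun w => f w + g w) = mean f + mean g.
Proof.
by move=> bf bg; rewrite /mean; exact: (RintegralD measurableT (bounded_meas_integrable bf) (bounded_meas_integrable bg)).
Qed.

Lemma meanZ (c : R) f : bounded_meas f -> mean (fun w => c * f w) = c * mean f.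
Proof.
by move=> bf; exact: (RintegralZl c measurableT (bounded_meas_integrable bf)).
Qed.

Lemma mean_cst (c : R) : mean (fun=> c) = c.
Proof. by rewrite /mean integral_cst//= [X in (_ * X)%E]probability_setT mule1. Qed.

Lemma meanDc f (c : R) : bounded_meas f -> mean (fun w => f w + c) = mean f + c.
Proof. by move=> bf; rewrite meanD ?mean_cst//; exact: bounded_meas_cst. Qed.

Lemma mean_le f g : bounded_meas f -> bounded_meas g -> (forall w, f w <= g w) ->
  mean f <= mean g.
Proof.
by move=> bf bg fg; apply: le_Rintegral => //; exact: bounded_meas_integrable.
Qed.

Lemma mean_bound f (M : R) : meas_fun f -> (forall w, `|f w| <= M) -> `|mean f| <= M.
Proof.
move=> mf fM; have bf := bounded_measI mf fM.
rewrite ler_norml -{1}(mean_cst (- M)) -{2}(mean_cst M).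
by apply/andP; split; apply: mean_le => //; (try exact: bounded_meas_cst) => w; have := fM w; rewrite ler_norml => /andP[].
Qed.

Lemma mean_sum n (f : nat -> T -> R) : (forall i, bounded_meas (f i)) ->
  bounded_meas (fun w => \sum_(i < n) f i w) /\ mean (fun w => \sum_(i < n) f i w) = \sum_(i < n) mean (f i).
Proof.
move=> bf; elim: n => [|n [IHb IH]].
  have -> : (fun w => \sum_(i < 0) f i w) = fun=> 0 by apply/funext => w; rewrite big_ord0.
  by split; [exact: bounded_meas_cst|rewrite mean_cst big_ord0].
have -> : (fun w => \sum_(i < n.+1) f i w) = fun w => \sum_(i < n) f i w + f n w.
  by apply/funext => w; rewrite big_ord_recr.
by split; [exact: bounded_measD|rewrite meanD// IH big_ord_recr].
Qed.

Lemma mean_dist f g h (c : R) : bounded_meas f -> bounded_meas g ->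
  meas_fun h -> (forall w, `|f w - g w| <= h w) ->
  (\int[P]_w (h w)%:E <= c%:E)%E -> `|mean f - mean g| <= c.
Proof.
move=> bf bg mh fgh hc.
have bfg : bounded_meas (fun w => f w + - 1 * g w).
  by apply: bounded_measD => //; exact: bounded_measZ.
have -> : mean f - mean g = mean (fun w => f w + - 1 * g w).
  by rewrite meanD// ?meanZ ?mulN1r//; exact: bounded_measZ.
have := le_normr_Rintegral measurableT (bounded_meas_integrable bfg).
move=> /le_trans; apply; rewrite -lee_fin; apply: le_trans hc.
have [mfg [M fgM]] := bfg.
have bn : bounded_meas (fun w => `|f w + - 1 * g w|).
  by apply: (@bounded_measI _ M) => [|w]; [exact: measurableT_comp|rewrite normr_id].
rewrite /Rintegral -/(mean _) -(mean_EFin bn); apply: ge0_integral_mono => w; rewrite lee_fin//.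
by rewrite mulN1r.
Qed.

Lemma mean_most f g (M e : R) : meas_fun f -> meas_fun g ->
  (forall w, `|f w| <= M) -> (forall w, `|g w| <= M) -> 0 <= e ->
  most P e (fun w => `|f w - g w| <= e) -> `|mean f - mean g| <= e + 2 * M * e.
Proof.
move=> mf mg fM gM e0 [B [mB PB hB]].
have M0 : 0 <= M by apply: le_trans (fM point).
apply: (@mean_dist _ _ (fun w => e + 2 * M * \1_B w)).
- exact: bounded_measI fM.
- exact: bounded_measI gM.
- by apply: measurable_funD => //; apply: measurable_funM => //; exact: measurable_indic.
- move=> w; rewrite indicE; case: (boolP (w \in B)) => [_|/negP wB].
    rewrite mulr1; apply: ler_wpDl => //; apply: le_trans (ler_normB _ _) _.
    by rewrite mulrDl mul1r; exact: lerD.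
  by rewrite mulr0 addr0; apply: hB => wB'; apply: wB; exact: mem_set.
- have mi : meas_fun (\1_B : T -> R) by exact: measurable_indic.
  have M20 : 0 <= 2 * M by exact: mulr_ge0.
  have i0 w : 0 <= \1_B w :> R by rewrite indicE.
  have mMi : meas_fun (fun w => 2 * M * \1_B w : R) by exact: measurable_funM.
  have Mi0 w : 0 <= 2 * M * \1_B w :> R by exact: mulr_ge0.
  have -> : (\int[P]_w (e + 2 * M * \1_B w)%:E = \int[P]_w e%:E + \int[P]_w (2 * M * \1_B w)%:E)%E.
    exact: (@ge0_integral_add _ _ _ P (cst e)).
  rewrite (ge0_integral_scale P M20 mi i0).
  rewrite integral_cst//= [X in (_ * X + _)%E]probability_setT mule1 integral_indic// setIT.
  by rewrite EFinD; apply: leeD => //; rewrite (EFinM (2 * M)); apply: lee_pmul.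
Qed.

Lemma mean_decoupling F d' (T' : measurableType d') (V : T -> T') (h : g_sigma_algebraType F * T' -> R) (M : R) :
  sub_algebra F -> meas_fun V -> indep_of P F V ->
  meas_fun h -> (forall z, `|h z| <= M) ->
  [/\ bounded_meas (fun w => h (w, V w)),
    bounded_meas (fun w => mean (fun w' => h (w, V w'))) &
    mean (fun w => h (w, V w)) = mean (fun w => mean (fun w' => h (w, V w')))].
Proof.
move=> sF mV iV mh hM.
have mX : measurable_fun [set: T] (id : T -> g_sigma_algebraType F).
  by move=> _ B; rewrite setTI /measurable/= (sigma_algebra_id sF.1) => /sF.2.
have mhV : meas_fun (fun w => h (w, V w)).
  by apply: (measurableT_comp mh); exact: measurable_fun_pair.
have b1 : bounded_meas (fun w => h (w, V w)) by apply: bounded_measI => [//|w]; exact: hM.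
have b2 w : bounded_meas (fun w' => h (w, V w')).
  apply: (@bounded_measI _ M) => [|w'//].
  by apply: (measurableT_comp mh); apply: measurable_fun_pair.
have mhM : meas_fun (fun z => (h z + M)%:E).
  by apply/measurable_EFinP; exact: measurable_funD.
have h0 z : (0 <= (h z + M)%:E)%E.
  by rewrite lee_fin -lerBlDr sub0r; have := hM z; rewrite ler_norml => /andP[].
have e w : (\int[P]_w' (h (w, V w') + M)%:E = (mean (fun w' => h (w, V w')) + M)%:E)%E.
  by rewrite -meanDc// -mean_EFin//; apply: bounded_measD => //; exact: bounded_meas_cst.
have mm : meas_fun (fun w : T => mean (fun w' => h (w, V w'))).
  have : meas_fun (fun w : T => \int[P]_w' (h (w, V w') + M)%:E)%E.
    have mhV2 : meas_fun (fun z : T * T => (h (z.1, V z.2) + M)%:E).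
      apply/measurable_EFinP; apply: measurable_funD => //; apply: (measurableT_comp mh).
      apply: measurable_fun_pair; first exact: (measurableT_comp mX measurable_fst).
      exact: (measurableT_comp mV measurable_snd).
    have := @measurable_fun_fubini_tonelli_F _ _ T T R P _ mhV2 (fun z => h0 (z.1, V z.2)); exact.
  rewrite (_ : (fun w : T => _) = (fun w => (mean (fun w' => h (w, V w')) + M)%:E)); last by apply/funext.
  move/measurable_EFinP => mm; have := measurable_funB mm (@measurable_cst _ _ _ _ setT M).
  by congr measurable_fun; apply/funext => w /=; rewrite addrK.
have bm : bounded_meas (fun w : T => mean (fun w' => h (w, V w'))).
  by apply: (bounded_measI mm) => w; apply: mean_bound => //; by case: (b2 w).
split => //; apply/(addIr M); rewrite -!meanDc// /mean.
rewrite (decoupling (h := fun z => (h z + M)%:E) sF mV iV mhM h0).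
by under eq_integral do rewrite e.
Qed.
End bounded_mean.

Lemma mean_fubini {R : realType} d (T : measurableType d) d' (T' : measurableType d')
    (P : probability T R) (P' : probability T' R) (h : T * T' -> R) (M : R) :
  meas_fun h -> (forall z, `|h z| <= M) ->
  [/\ bounded_meas (fun w => mean P' (fun w' => h (w, w'))),
     bounded_meas (fun w' => mean P (fun w => h (w, w'))) &
     mean P (fun w => mean P' (fun w' => h (w, w'))) = mean P' (fun w' => mean P (fun w => h (w, w')))].
Proof.
move=> mh hM.
have b1 w : bounded_meas (fun w' => h (w, w')).
  by apply: (@bounded_measI _ _ _ _ M) => [|w'//]; exact: (measurableT_comp mh (measurable_pair1 w)).
have b2 w' : bounded_meas (fun w => h (w, w')).
  by apply: (@bounded_measI _ _ _ _ M) => [|w//]; exact: (measurableT_comp mh (measurable_pair2 w')).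
have mhM : meas_fun (fun z => (h z + M)%:E).
  by apply/measurable_EFinP; exact: measurable_funD.
have h0 z : (0 <= (h z + M)%:E)%E.
  by rewrite lee_fin -lerBlDr sub0r; have := hM z; rewrite ler_norml => /andP[].
have e1 w : (\int[P']_w' (h (w, w') + M)%:E = (mean P' (fun w' => h (w, w')) + M)%:E)%E.
  by rewrite -meanDc// -mean_EFin//; apply: bounded_measD => //; exact: bounded_meas_cst.
have e2 w' : (\int[P]_w (h (w, w') + M)%:E = (mean P (fun w => h (w, w')) + M)%:E)%E.
  by rewrite -meanDc// -mean_EFin//; apply: bounded_measD => //; exact: bounded_meas_cst.
have m1 : meas_fun (fun w => mean P' (fun w' => h (w, w'))).
  have := @measurable_fun_fubini_tonelli_F _ _ T T' R P' _ mhM h0.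
  rewrite (_ : fubini_F _ _ = (fun w => (mean P' (fun w' => h (w, w')) + M)%:E)); last by apply/funext => w; exact: e1.
  move/measurable_EFinP => mm; have := measurable_funB mm (@measurable_cst _ _ _ _ setT M).
  by congr measurable_fun; apply/funext => w /=; rewrite addrK.
have m2 : meas_fun (fun w' => mean P (fun w => h (w, w'))).
  have := @measurable_fun_fubini_tonelli_G _ _ T T' R P _ mhM h0.
  rewrite (_ : fubini_G _ _ = (fun w' => (mean P (fun w => h (w, w')) + M)%:E)); last by apply/funext => w; exact: e2.
  move/measurable_EFinP => mm; have := measurable_funB mm (@measurable_cst _ _ _ _ setT M).
  by congr measurable_fun; apply/funext => w /=; rewrite addrK.
have c1 : bounded_meas (fun w => mean P' (fun w' => h (w, w'))).
  by apply: (bounded_measI m1) => w; apply: mean_bound => //; case: (b1 w).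
have c2 : bounded_meas (fun w' => mean P (fun w => h (w, w'))).
  by apply: (bounded_measI m2) => w; apply: mean_bound => //; case: (b2 w).
split => //; apply: (addIr M); rewrite -!meanDc// /mean.
under eq_integral do rewrite -/(mean _ _) -e1.
under [in RHS]eq_integral do rewrite -/(mean _ _) -e2.
by rewrite (@fubini_tonelli _ _ T T' R P P' _ mhM h0).
Qed.

(** [f2] is the pointwise limit of the symmetric second difference quotients of [f], in which the
    first-order terms cancel. *)
Lemma taylor2_measurable {R : realType} (f f1 f2 : R -> R) C : taylor2 f f1 f2 C -> meas_fun f ->
  meas_fun f2.
Proof.
move=> Tf mf; pose y (n : nat) : R := n.+1%:R^-1.
have y0 n : 0 < y n by rewrite invr_gt0.
apply: (@measurable_fun_cvg _ R R setT (fun n x => (f (x + y n) + f (x + - y n) - 2 * f x) / y n ^+ 2)).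
  move=> n; apply: measurable_funM => //; apply: measurable_funB; last exact: measurable_funM.
  by apply: measurable_funD; apply: measurableT_comp => //; apply: measurable_funD.
move=> x _; apply/cvgrPdist_lt => e e0.
have C1 : 0 < 2 * `|C| + 1 by rewrite ltr_wpDl// mulr_ge0.
have [k] := ltr_add_invr (divr_gt0 e0 C1); rewrite add0r => ke.
exists k => // n /= kn.
have h1 := Tf x (y n); have h2 := Tf x (- y n).
have rem z : `|z| = y n -> C * cubic_rem z <= `|C| * (y n ^+ 3).
  move=> zn; apply: le_trans (ler_wpM2r (cubic_rem_ge0 z) (ler_norm C)) _; apply: ler_wpM2l => //.
  rewrite /cubic_rem -[z ^+ 2]real_normK ?num_real// zn [y n ^+ 3]exprSr; apply: ler_wpM2l; first exact: sqr_ge0.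
  by rewrite ge_min lexx orbT.
have r1 := le_trans h1 (rem _ (gtr0_norm (y0 n))).
have r2 := le_trans h2 (rem (- y n) _); rewrite normrN gtr0_norm// in r2; have {}r2 := r2 erefl.
set D := f (x + y n) + f (x + - y n) - 2 * f x.
have hD : `|D - f2 x * y n ^+ 2| <= 2 * `|C| * y n ^+ 3.
  have -> : D - f2 x * y n ^+ 2 = (f (x + y n) - f x - f1 x * y n - f2 x / 2 * y n ^+ 2) +
    (f (x + - y n) - f x - f1 x * - y n - f2 x / 2 * (- y n) ^+ 2) by rewrite /D; field.
  have -> : 2 * `|C| * y n ^+ 3 = `|C| * y n ^+ 3 + `|C| * y n ^+ 3 by ring.
  by apply: le_trans (ler_normD _ _) _; exact: lerD.
have -> : f2 x - D / y n ^+ 2 = - ((D - f2 x * y n ^+ 2) / y n ^+ 2) by field; rewrite gt_eqF.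
have yn2 : 0 < y n ^+ 2 by rewrite exprn_gt0.
rewrite normrN normrM [`|_^-1|]gtr0_norm ?invr_gt0// ltr_pdivrMr//.
apply: le_lt_trans hD _; have -> : 2 * `|C| * y n ^+ 3 = (2 * `|C| * y n) * y n ^+ 2 by ring.
rewrite ltr_pM2r//.
have yk : y n < e / (2 * `|C| + 1).
  by apply: le_lt_trans ke; rewrite lef_pV2 ?posrE// ler_nat.
apply: (@le_lt_trans _ _ ((2 * `|C| + 1) * y n)); first by apply: ler_wpM2r; [exact: ltW|rewrite lerDl].
by rewrite mulrC -ltr_pdivlMr.
Qed.

Section bounded_mean_complements.
Context {R : realType} {d} {T : measurableType d} (P : probability T R).
Implicit Types f g h : T -> R.

Lemma mean_uniform f g (c : R) : bounded_meas f -> bounded_meas g ->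
  (forall w, `|f w - g w| <= c) -> `|mean P f - mean P g| <= c.
Proof.
move=> bf bg fg; apply: (mean_dist bf bg (h := fun=> c)) => //.
by rewrite integral_cst//= [X in (_ * X)%E]probability_setT mule1.
Qed.

(** The noise [V (N w)] is selected by an index known in [F], as when the number of reproducing
    individuals depends on the past. One decouples on each of the finitely many events [N = b] and
    sums. *)
Lemma mean_decoupling_index F d' (T' : measurableType d') (N : T -> nat) (V : nat -> T -> T')
    (h : g_sigma_algebraType F * T' -> R) (M : R) (J : nat) :
  sub_algebra F -> meas_wrt F N -> (forall w, (N w < J)%N) ->
  (forall b, meas_fun (V b)) -> (forall b, indep_of P F (V b)) ->
  meas_fun h -> (forall z, `|h z| <= M) ->
  bounded_meas (fun w : T => mean P (fun w' => h (w, V (N w) w'))) /\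
  mean P (fun w => h (w, V (N w) w)) = mean P (fun w => mean P (fun w' => h (w, V (N w) w'))).
Proof.
move=> sF mN NJ mV iV mh hM; have M0 : 0 <= M by apply: le_trans (hM point).
pose hb b (z : g_sigma_algebraType F * T') : R := (N z.1 == b)%:R * h z.
have mhb b : meas_fun (hb b).
  apply: measurable_funM => //.
  have mNb := meas_nat_comp (fun j => (j == b)%:R : R) mN.
  exact: (measurableT_comp mNb measurable_fst).
have hbM b z : `|hb b z| <= M.
  by rewrite /hb; case: (_ == _); rewrite ?mul1r// mul0r normr0.
have dec b := mean_decoupling sF (mV b) (iV b) (mhb b) (hbM b).
have E1 w : h (w, V (N w) w) = \sum_(b < J) hb b (w, V b w).
  rewrite (bigD1 (Ordinal (NJ w)))//= /hb/= eqxx mul1r big1 ?addr0// => b bN.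
  by rewrite [_ == _](_ : _ = false) ?mul0r//; apply/negbTE; apply: contra bN => /eqP e; apply/eqP/val_inj.
have E2 w : mean P (fun w' => h (w, V (N w) w')) = \sum_(b < J) mean P (fun w' => hb b (w, V b w')).
  rewrite (bigD1 (Ordinal (NJ w)))//= big1 ?addr0 => [|b bN].
    by congr mean; apply/funext => w'; rewrite /hb/= eqxx mul1r.
  rewrite -[RHS](mean_cst P); congr mean; apply/funext => w'.
  by rewrite /hb/= [_ == _](_ : _ = false) ?mul0r//; apply/negbTE; apply: contra bN => /eqP e; apply/eqP/val_inj.
have [_ e1] := @mean_sum _ _ _ P J (fun b w => hb b (w, V b w)) (fun b => let: And3 h1 _ _ := dec b in h1).
have [bm e2] := @mean_sum _ _ _ P J (fun b w => mean P (fun w' => hb b (w, V b w'))) (fun b => let: And3 _ h2 _ := dec b in h2).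
have E2' : (fun w : T => mean P (fun w' => h (w, V (N w) w'))) = (fun w => \sum_(b < J) mean P (fun w' => hb b (w, V b w'))).
  by apply/funext => w; exact: E2.
have E1' : (fun w : T => h (w, V (N w) w)) = (fun w => \sum_(b < J) hb b (w, V b w)).
  by apply/funext => w; exact: E1.
rewrite E2' E1' e1 e2; split => //.
by apply: eq_bigr => b _; case: (dec b).
Qed.

(** [ito_step] bounds means of nonnegative functions from above; applied to [f + A] and to [- f + A]
    it gives both inequalities. *)
Lemma mean_ito F V s (f f1 f2 : R -> R) (C M C2 q k : R) (D : T -> R) :
  sub_algebra F -> indep_of P F V -> centered P V s ->
  taylor2 f f1 f2 C -> 0 <= C -> (forall x, `|f x| <= M) -> (forall x, `|f2 x| <= C2) ->
  meas_fun f -> meas_fun f2 -> meas_wrt F D ->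
  (\int[P]_w (cubic_rem (k * V w))%:E <= q%:E)%E ->
  `|mean P (fun w => f (D w + k * V w)) - mean P (fun w => f (D w) + k ^+ 2 * s / 2 * f2 (D w))| <= C * q.
Proof.
move=> sF iV cV Tf C0 fM f2C mf mf2 mD hq.
have mV := centered_measurable cV; have [_ _ V2] := cV.
have mDT := sub_meas_wrt sF mD.
have s0 : 0 <= s by rewrite -lee_fin -V2; apply: integral_ge0 => w _; rewrite lee_fin sqr_ge0.
have mcub : meas_fun (fun w => cubic_rem (k * V w)).
  by apply: measurableT_comp; [exact: measurable_cubic_rem|exact: measurable_funM].
pose qf (k' : R) : R := if k' == k then q else k' ^+ 2 * s.
have hqf k' : (\int[P]_w (cubic_rem (k' * V w))%:E <= (qf k')%:E)%E.
  rewrite /qf; case: eqVneq => [->//|_]; rewrite EFinM -V2 -ge0_integral_scale ?sqr_ge0//.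
  - apply: ge0_integral_mono => w; rewrite lee_fin ?cubic_rem_ge0// -exprMn; exact: cubic_rem_le_sqr.
  - exact: measurable_funX.
  - by move=> w; exact: sqr_ge0.
have M0 : 0 <= M := le_trans (normr_ge0 _) (fM 0).
have C20 : 0 <= C2 := le_trans (normr_ge0 _) (f2C 0).
have ks0 : 0 <= k ^+ 2 * s / 2 by apply: divr_ge0 => //; apply: mulr_ge0 => //; exact: sqr_ge0.
have b1 : bounded_meas (fun w => f (D w + k * V w)).
  apply: (@bounded_measI _ _ _ _ M) => [|w //]; apply: measurableT_comp => //.
  by apply: measurable_funD => //; exact: measurable_funM.
have b2 : bounded_meas (fun w => f (D w) + k ^+ 2 * s / 2 * f2 (D w)).
  apply: bounded_measD.
    by apply: (@bounded_measI _ _ _ _ M) => [|w //]; exact: measurableT_comp.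
  apply: bounded_measZ.
  by apply: (@bounded_measI _ _ _ _ C2) => [|w //]; exact: measurableT_comp.
pose A := M + k ^+ 2 * s / 2 * C2.
have upper (g g1 g2 : R -> R) : taylor2 g g1 g2 C -> (forall x, `|g x| <= M) -> (forall x, `|g2 x| <= C2) ->
    meas_fun g -> bounded_meas (fun w => g (D w + k * V w)) ->
    bounded_meas (fun w => g (D w) + k ^+ 2 * s / 2 * g2 (D w)) ->
    mean P (fun w => g (D w + k * V w)) <= mean P (fun w => g (D w) + k ^+ 2 * s / 2 * g2 (D w)) + C * q.
  move=> Tg gM g2C mg c1 c2.
  have Tg' : taylor2 (fun x => g x + A) g1 g2 C.
    by move=> x y; rewrite (_ : _ - _ - _ - _ = g (x + y) - g x - g1 x * y - g2 x / 2 * y ^+ 2) ?Tg//; ring.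
  have gA0 x : 0 <= g x + A.
    rewrite /A addrA addr_ge0//; last exact: mulr_ge0.
    by rewrite -lerBlDr sub0r; have := gM x; rewrite ler_norml => /andP[].
  have mgA : meas_fun (fun x => g x + A) by exact: measurable_funD.
  have mk : meas_wrt F (cst k : T -> R) by exact: measurable_cst.
  have := ito_step sF iV cV Tg' C0 gA0 mgA mD mk hqf.
  have -> : (\int[P]_w (g (D w + cst k w * V w) + A)%:E = (mean P (fun w => g (D w + k * V w)) + A)%:E)%E.
    by rewrite -meanDc// -mean_EFin//; apply: bounded_measD => //; exact: bounded_meas_cst.
  have -> : (\int[P]_w (g (D w) + A + cst k w ^+ 2 * s * (g2 (D w) / 2) + C * qf (cst k w))%:E =
      (mean P (fun w => g (D w) + k ^+ 2 * s / 2 * g2 (D w)) + (A + C * q))%:E)%E.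
    rewrite -meanDc// -mean_EFin; last by apply: bounded_measD => //; exact: bounded_meas_cst.
    by apply: eq_integral => w _; rewrite /qf eqxx; congr _%:E; rewrite /=; ring.
  have ac (a1 a2 a3 : R) : a1 + (a2 + a3) = a1 + a3 + a2 by rewrite addrA addrAC.
  by rewrite lee_fin ac lerD2r.
have h1 := upper _ _ _ Tf fM f2C mf b1 b2.
have TN : taylor2 (fun x => - f x) (fun x => - f1 x) (fun x => - f2 x) C.
  move=> x y; have -> : - f (x + y) - - f x - - f1 x * y - - f2 x / 2 * y ^+ 2 =
    - (f (x + y) - f x - f1 x * y - f2 x / 2 * y ^+ 2) by ring.
  by rewrite normrN; exact: Tf.
have e1 : (fun w => - f (D w + k * V w)) = (fun w => - 1 * f (D w + k * V w)) by apply/funext => w; rewrite mulN1r.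
have e2 : (fun w => - f (D w) + k ^+ 2 * s / 2 * - f2 (D w)) = (fun w => - 1 * (f (D w) + k ^+ 2 * s / 2 * f2 (D w))).
  by apply/funext => w; ring.
have h2 := upper (fun x => - f x) _ (fun x => - f2 x) TN.
rewrite /= e1 e2 !meanZ// in h2.
have fNM x : `|- f x| <= M by rewrite normrN.
have f2NC x : `|- f2 x| <= C2 by rewrite normrN.
have mfN : meas_fun (fun x => - f x) by exact: measurableT_comp.
have {}h2 := h2 fNM f2NC mfN (bounded_measZ _ b1) (bounded_measZ _ b2).
rewrite ler_norml; apply/andP; split; lra.
Qed.
End bounded_mean_complements.

(** * Replacement of the noises by Gaussian increments *)

Section lindeberg.
Context {R : realType} {d} {T : measurableType d} (P : probability T R).
Context {d'} {T' : measurableType d'} (P' : probability T' R).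
Variables (F' : R -> set_system T') (W : R -> T' -> R).
Hypothesis wW : wiener_process P' F' W.

(* Lindeberg's replacement: in the [l]-th hybrid the first [l] noises are kept
   and the others are replaced by increments of [W]. *)
Lemma noise_clt J (v c Dl sg t Q q M C2 C x : R) (A : nat -> set_system T) (Z : nat -> T -> R) (f f1 f2 : R -> R) :
  noise_row P J v A Z -> 0 <= t -> 0 <= Dl -> sg ^+ 2 * Dl = c ^+ 2 * v ->
  (forall l, (l < J)%N -> (\int[P]_w (cubic_rem (c * Z l w))%:E <= Q%:E)%E) ->
  4 * `|sg| ^+ 3 * Num.sqrt Dl ^+ 3 <= q ->
  taylor2 f f1 f2 C -> 0 <= C -> (forall y, `|f y| <= M) -> (forall y, `|f2 y| <= C2) ->
  meas_fun f ->
  `|mean P (fun w => f (x + c * \sum_(l < J) Z l w)) -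
    mean P' (fun w => f (x + sg * (W (t + J%:R * Dl) w - W t w)))| <= J%:R * (C * Q + C * q).
Proof.
move=> nr t0 Dl0 var hQ hq Tf C0 fM f2C mf; have mf2 := taylor2_measurable Tf mf.
pose S l w := \sum_(i < l) Z i w.
pose tm (i : nat) := t + i%:R * Dl.
have tm0 i : 0 <= tm i by rewrite addr_ge0// mulr_ge0.
have tmt i : t <= tm i by rewrite lerDl mulr_ge0.
have tmS i : tm i <= tm i.+1 by rewrite lerD2l ler_wpM2r// ler_nat.
pose B i w := W (tm i) w - W t w.
have mB i : meas_fun (B i) := increment_measurable wW t0 (tmt i).
have mBF i : meas_wrt (F' (tm i)) (B i) := increment_meas_wrt wW t0 (tmt i).
have mSA l : (l <= J)%N -> meas_wrt (A l) (S l).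
  elim: l => [_|l IH lJ].
    have -> : S 0%N = cst 0 by apply/funext => w; rewrite /S big_ord0.
    exact: measurable_cst.
  have -> : S l.+1 = (fun w => S l w + Z l w) by apply/funext => w; rewrite /S big_ord_recr.
  apply: measurable_funD; last exact: (nr_measurable nr lJ).
  exact: (meas_wrt_sub (nr_sub nr l) (nr_sub nr l.+1) (nr_mono nr (j := l)) (IH (ltnW lJ))).
have mS l : (l <= J)%N -> meas_fun (S l).
  by move=> lJ; exact: (sub_meas_wrt (nr_sub nr l) (@mSA l lJ)).
pose arg l i (z : T * T') := x + c * S l z.1 + sg * B i z.2.
have marg l i : (l <= J)%N -> meas_fun (arg l i).
  move=> lJ; apply: measurable_funD.
    apply: measurable_funD => //; apply: measurable_funM => //.
    exact: (measurableT_comp (mS l lJ) measurable_fst).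
  by apply: measurable_funM => //; exact: (measurableT_comp (mB i) measurable_snd).
pose hyb l := mean P (fun w => mean P' (fun w' => f (arg l (J - l)%N (w, w')))).
have tri (a1 a2 a3 : R) : a1 - a3 = (a1 - a2) + (a2 - a3) by ring.
have step l : (l < J)%N -> `|hyb l.+1 - hyb l| <= C * Q + C * q.
  move=> lJ; pose i := (J - l.+1)%N; have iE : (J - l = i.+1)%N by rewrite /i -subSn.
  (* The second-order expansion common to both replacements, as [sg ^ 2 * Dl = c ^ 2 * v]; the
     hybrids [l.+1] and [l] are each compared with its mean. *)
  pose g y := f y + c ^+ 2 * v / 2 * f2 y.
  pose Mg := M + `|c ^+ 2 * v / 2| * C2.
  have gM y : `|g y| <= Mg.
    by apply: le_trans (ler_normD _ _) _; apply: lerD => //; rewrite normrM ler_wpM2l.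
  have mg : meas_fun g by apply: measurable_funD => //; exact: measurable_funM.
  have mfa l' i' : (l' <= J)%N -> meas_fun (fun z => f (arg l' i' z)).
    by move=> l'J; exact: (measurableT_comp mf (marg l' i' l'J)).
  have mga : meas_fun (fun z => g (arg l i z)) by exact: (measurableT_comp mg (marg l i (ltnW lJ))).
  have [a1 a2 a3] := mean_fubini P P' (mfa l.+1 i lJ) (fun z => fM _).
  have [b1 b2 b3] := mean_fubini P P' mga (fun z => gM _).
  have [c1 c2 c3] := mean_fubini P P' (mfa l i.+1 (ltnW lJ)) (fun z => fM _).
  have up : `|hyb l.+1 - mean P' (fun w' => mean P (fun w => g (arg l i (w, w'))))| <= C * Q.
    rewrite /hyb -/i a3; apply: mean_uniform => // w'.
    have mD : meas_wrt (A l) (fun w => x + c * S l w + sg * B i w').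
      apply: measurable_funD => //; apply: measurable_funD => //; apply: measurable_funM => //.
      exact: mSA (ltnW lJ).
    have := mean_ito (nr_sub nr l) (nr_indep nr lJ) (nr_centered nr lJ) Tf C0 fM f2C mf mf2 mD (hQ l lJ).
    congr (`|mean P _ - _| <= _); apply/funext => w; rewrite /arg /S big_ord_recr/=; congr f; ring.
  have dn : `|hyb l - mean P (fun w => mean P' (fun w' => g (arg l i (w, w'))))| <= C * q.
    rewrite /hyb iE; apply: mean_uniform => // w.
    have mD : meas_wrt (F' (tm i)) (fun w' => x + c * S l w + sg * B i w').
      by apply: measurable_funD => //; apply: measurable_funM => //; exact: mBF.
    have sE : tm i.+1 - tm i = Dl by rewrite /tm -natr1; ring.
    have hq' : (\int[P']_w (cubic_rem (sg * (W (tm i.+1) w - W (tm i) w)))%:E <= q%:E)%E.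
      by apply: le_trans (increment_cubic_rem wW sg (tm0 i) (tmS i)) _; rewrite sE lee_fin.
    have := mean_ito (filtration_sub wW (tm0 i)) (increment_indep wW (tm0 i) (tmS i))
      (increment_centered wW (tm0 i) (tmS i)) Tf C0 fM f2C mf mf2 mD hq'.
    rewrite sE var; congr (`|mean P' _ - _| <= _); apply/funext => w'; rewrite /arg /B; congr f; ring.
  rewrite b3 in dn; set mid := mean P' _ in up dn.
  rewrite (tri (hyb l.+1) mid); apply: le_trans (ler_normD _ _) _.
  by rewrite (distrC mid); exact: lerD.
have tele l : (l <= J)%N -> `|hyb l - hyb 0%N| <= l%:R * (C * Q + C * q).
  elim: l => [_|l IH lJ]; first by rewrite subrr normr0 mul0r.
  rewrite (tri (hyb l.+1) (hyb l)).
  apply: le_trans (ler_normD _ _) _; rewrite -natr1 mulrDl mul1r addrC.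
  by apply: lerD; [exact: IH (ltnW lJ)|exact: step].
have := tele J (leqnn J).
have -> : hyb 0%N = mean P' (fun w => f (x + sg * (W (t + J%:R * Dl) w - W t w))).
  rewrite /hyb -[RHS](mean_cst P); congr mean; apply/funext => w; congr mean; apply/funext => w'.
  by rewrite /arg /S big_ord0 mulr0 addr0 subn0.
have -> // : hyb J = mean P (fun w => f (x + c * \sum_(l < J) Z l w)).
rewrite /hyb; congr mean; apply/funext => w; rewrite -[RHS](mean_cst P'); congr mean; apply/funext => w'.
by rewrite /arg subnn /B /tm mul0r addr0 subrr mulr0 addr0.
Qed.
End lindeberg.

(** * Functions of a discrete history *)

Section histories.
Context {R : realType}.
Implicit Types (H : (nat -> R) -> R) (y : nat -> R).

(** Uniform continuity in the coordinates [0, ..., i], which entails dependence on these alone. The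
    class is preserved by the Euler kernel and contains the Lipschitz functions of skeletons. *)
Definition ucont (i : nat) H := forall e : R, 0 < e -> exists2 dt : R, 0 < dt &
  forall y y', (forall j, (j <= i)%N -> `|y j - y' j| <= dt) -> `|H y - H y'| <= e.

Definition extend y (i : nat) (x : R) : nat -> R := fun j => if (j <= i)%N then y j else x.

Lemma ucont_eq i H y y' : ucont i H -> (forall j, (j <= i)%N -> y j = y' j) -> H y = H y'.
Proof.
move=> uH yy; apply/eqP; rewrite -subr_eq0 -normr_le0; apply/ler_addgt0Pr => e e0; rewrite add0r.
have [dt dt0 h] := uH e e0; apply: h => j ji; by rewrite yy// subrr normr0 ltW.
Qed.

(** Where [|a| > dt] the trivial bound [2 * M] is at most [2 * M * a ^ 2 / dt ^ 2]. A modulus of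
    continuity thus becomes a bound that second moments can integrate. *)
Lemma modulus_sqr (u u' M e dt a : R) : `|u| <= M -> `|u'| <= M -> 0 <= e -> 0 < dt ->
  (`|a| <= dt -> `|u - u'| <= e) -> `|u - u'| <= e + 2 * M / dt ^+ 2 * a ^+ 2.
Proof.
move=> uM u'M e0 dt0 h; have M0 : 0 <= M := le_trans (normr_ge0 _) uM.
have d20 : 0 < dt ^+ 2 by rewrite exprn_gt0.
have [ab|ab] := leP `|a| dt.
  apply: ler_wpDr; last exact: h.
  by apply: mulr_ge0; [apply: divr_ge0; [exact: mulr_ge0|exact: ltW]|exact: sqr_ge0].
apply: ler_wpDl => //; apply: le_trans (ler_normB _ _) _; apply: (@le_trans _ _ (2 * M)).
  by rewrite mulrDl mul1r; exact: lerD.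
rewrite -mulrA; apply: ler_peMr; first exact: mulr_ge0.
rewrite mulrC ler_pdivlMr// mul1r -[leRHS]real_normK ?num_real//.
by apply: lerXn2r; rewrite ?nnegrE ?normr_ge0 ?(ltW dt0) ?(ltW ab).
Qed.

(* [discretize l (pickle (a, b))] is the point [(a - b) / l.+1]. *)
Definition discretize (l c : nat) : R :=
  if unpickle c is Some (a, b) then (a%:R - b%:R) / l.+1%:R else 0.

Definition cell (l : nat) (x : R) : nat :=
  pickle (Num.truncn (l.+1%:R * Num.max x 0), Num.truncn (l.+1%:R * Num.max (- x) 0)).

Lemma discretize_cell l x : `|discretize l (cell l x) - x| <= 2 * l.+1%:R^-1.
Proof.
rewrite /discretize /cell pickleK.
have m0 z : 0 <= Num.max z 0 :> R by rewrite le_max lexx orbT.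
have h1 := truncn_approx l (m0 x); have h2 := truncn_approx l (m0 (- x)).
have xE : x = Num.max x 0 - Num.max (- x) 0.
  by rewrite /Num.max oppr_lt0; case: ltgtP => [x0|x0|->]; rewrite ?subr0 ?sub0r ?opprK ?oppr0.
set p := Num.max x 0 in h1 xE *; set q := Num.max (- x) 0 in h2 xE *.
set p' := (Num.truncn _)%:R in h1 *; set q' := (Num.truncn _)%:R in h2 *.
have -> : (p' - q') / l.+1%:R - x = (p' / l.+1%:R - p) - (q' / l.+1%:R - q) by rewrite xE; ring.
by apply: le_trans (ler_normB _ _) _; rewrite mulrDl mul1r; exact: lerD.
Qed.

Lemma measurable_cell l : meas_fun (cell l).
Proof.
have mt (g : R -> R) : meas_fun g -> meas_fun (fun x => Num.truncn (l.+1%:R * Num.max (g x) 0)).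
  move=> mg; apply: measurableT_comp; first exact: measurable_truncn.
  by apply: measurable_funM => //; exact: measurable_maxr.
have mo : meas_fun (fun x : R => - x) by exact: measurableT_comp.
apply: (@meas_countable_index _ R _ _ (fun x => Num.truncn (l.+1%:R * Num.max x 0))
  (fun k x => pickle (k, Num.truncn (l.+1%:R * Num.max (- x) 0)))); first exact: mt.
by move=> k; exact: (meas_nat_comp (fun c => pickle (k, c)) (mt _ mo)).
Qed.

Lemma measurable_discrete_history d (S : measurableType d) d' (S' : measurableType d') (N : nat -> S -> nat) i :
  (forall j, (j < i)%N -> meas_fun (N j)) ->
  forall (H : (nat -> nat) -> S'), meas_fun (fun w => H (fun j => if (j < i)%N then N j w else 0%N)).
Proof.
elim: i => [_ H|i IH mN H].
  have -> : (fun w => H (fun j => if (j < 0)%N then N j w else 0%N)) = cst (H (fun=> 0%N)) by [].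
  exact: measurable_cst.
have mi : meas_fun (N i) by exact: mN.
have := @meas_countable_index _ S _ S' (N i)
  (fun c w => H (fun j => if (j < i)%N then N j w else if j == i then c else 0%N)) mi.
have h (c : nat) : meas_fun (fun w => H (fun j => if (j < i)%N then N j w else if j == i then c else 0%N)).
  rewrite (_ : (fun w => _) = (fun w => (fun z : nat -> nat =>
    H (fun j => if (j < i)%N then z j else if j == i then c else 0%N)) (fun j => if (j < i)%N then N j w else 0%N))).
    exact: (IH (fun j ji => mN j (leqW ji)) (fun z : nat -> nat => H (fun j => if (j < i)%N then z j else if j == i then c else 0%N))).
  by apply/funext => w; congr H; apply/funext => j; case: (j < i)%N.
move/(_ h) => {}h.
rewrite (_ : (fun w => _) = (fun w => H (fun j => if (j < i)%N then N j w else if j == i then N i w else 0%N)))//.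
apply/funext => w; congr H; apply/funext => j.
by rewrite ltnS; case: ltngtP => [//|//|->].
Qed.

(** With every coordinate rounded to a discrete set, [H] becomes a function of finitely many
    integers, measurable without any condition on [H]; uniform continuity gives convergence as the
    rounding gets finer. *)
Lemma measurable_ucont d (S : measurableType d) i H (Y : nat -> S -> R) : ucont i H ->
  (forall j, (j <= i)%N -> meas_fun (Y j)) ->
  meas_fun (fun w => H (fun j => Y j w)).
Proof.
move=> uH mY.
apply: (@measurable_fun_cvg _ S R setT (fun l w => H (fun j => discretize l (if (j < i.+1)%N then cell l (Y j w) else 0%N)))).
  move=> l.
  have mN j : (j < i.+1)%N -> meas_fun (fun w => cell l (Y j w)).
    by move=> ji; exact: (measurableT_comp (measurable_cell l) (mY j ji)).
  exact: (measurable_discrete_history mN (fun z => H (fun j => discretize l (z j)))).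
move=> w _; apply/cvgrPdist_lt => e e0; have e20 : 0 < e / 2 by rewrite divr_gt0.
have [dt dt0 h] := uH _ e20; have dt20 : 0 < dt / 2 by rewrite divr_gt0.
have [k] := ltr_add_invr dt20; rewrite add0r => kdt.
exists k => // l /= kl; apply: (@le_lt_trans _ _ (e / 2)); last by rewrite ltr_pdivrMr// ltr_pMr// ltr1n.
apply: h => j ji; rewrite ltnS ji distrC; apply: le_trans (discretize_cell l _) _.
rewrite mulrC -ler_pdivlMr//; apply: le_trans (ltW kdt); by rewrite lef_pV2 ?posrE// ler_nat.
Qed.

Lemma tcoef_holder (v : R) r x x' : 0 <= v -> (tcoef v r x - tcoef v r x') ^+ 2 <= v * `|x - x'|.
Proof.
move=> v0; have mm0 z : 0 <= v * Num.min (Num.max z 0) r.+1%:R by rewrite mulr_ge0// le_min le_max lexx orbT/=.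
apply: le_trans (sqrt_sub_sqr (mm0 x) (mm0 x')) _; rewrite -mulrBr normrM (ger0_norm v0) ler_wpM2l//.
apply: le_trans (max0_lipschitz x x').
move: (Num.max x 0) (Num.max x' 0) => a b; rewrite /Num.min; case: ltP => h1; case: ltP => h2 //.
- by rewrite ler0_norm ?ler0_norm; lra.
- by rewrite ger0_norm ?ger0_norm; lra.
- by rewrite subrr normr0.
Qed.
End histories.

(** * A block of generations as a single row *)

Section flat_rows.
Context {R : realType} {d} {T : measurableType d} (P : probability T R).
Variables (F : nat -> set_system T) (G : nat -> nat -> set_system T) (ze : nat -> nat -> T -> R) (v : R).
Hypotheses (FG : forall k, F k `<=` G k 0%N)
  (GF : forall k J, G k J `<=` F k.+1)
  (nr : forall J k, noise_row P J v (G k) (ze k)).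

(** The [L * b] offspring noises of a block with [b] individuals in each of [L] generations,
    enumerated as one sequence: quotient and remainder by [b] are the generation and the individual.
    Lindeberg's replacement then runs over a whole block. *)
Definition flat_sum (k0 L b : nat) (w : T) : R :=
  \sum_(l < L * b) ze (k0 + l %/ b)%N (l %% b)%N w.

Lemma flat_sumE k0 L b w : flat_sum k0 L b w = \sum_(k < L) \sum_(j < b) ze (k0 + k)%N j w.
Proof.
rewrite /flat_sum; elim: L => [|L IH]; first by rewrite mul0n !big_ord0.
case: (posnP b) => [b0|b0].
  by rewrite b0 muln0 big_ord0 big1// => k _; rewrite big_ord0.
rewrite big_ord_recr/= -IH mulSnr big_split_ord/=; congr (_ + _).
by apply: eq_bigr => j _; rewrite divnMDl// modnMDl divn_small// modn_small// addn0.
Qed.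

Lemma flat_noise_row k0 L b : noise_row P (L * b) v
  (fun l => G (k0 + l %/ b)%N (l %% b)%N) (fun l => ze (k0 + l %/ b)%N (l %% b)%N).
Proof.
have step k j l : (0 < b)%N -> (k = l %/ b)%N -> (j = l %% b)%N ->
    G (k0 + k)%N j.+1 `<=` G (k0 + l.+1 %/ b)%N (l.+1 %% b)%N.
  move=> b0 kE jE; rewrite divnS// modnS; case: (b %| l.+1)%N.
    by rewrite -kE add1n addnS; apply: (subset_trans (@GF _ _)); exact: FG.
  by rewrite -kE -jE add0n.
have b0 l : (l < L * b)%N -> (0 < b)%N by move=> /(leq_ltn_trans (leq0n l)); rewrite muln_gt0 => /andP[].
split=> l.
- exact: (nr_sub (nr 1 _)).
- case: (posnP b) => [->|bb]; first by rewrite !divn0 !modn0 addn0; exact: (nr_mono (nr 1 _)).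
  apply: (subset_trans (nr_mono (nr 1 _) (j := _))); exact: (step _ _ l bb erefl erefl).
- move=> /b0 bb; apply: (meas_wrt_sub (nr_sub (nr 1 (k0 + l %/ b)%N) (l %% b)%N.+1)).
  + exact: (nr_sub (nr 1 _)).
  + exact: (step _ _ l bb erefl erefl).
  + exact: (nr_measurable (nr b _) (ltn_pmod l bb)).
- by move=> /b0 bb; exact: (nr_indep (nr b _) (ltn_pmod l bb)).
- by move=> /b0 bb; exact: (nr_centered (nr b _) (ltn_pmod l bb)).
Qed.

Lemma measurable_flat_sum k0 L b : meas_fun (flat_sum k0 L b).
Proof.
have fr := flat_noise_row k0 L b.
rewrite /flat_sum; have -> : (fun w => \sum_(l < L * b) ze (k0 + l %/ b)%N (l %% b)%N w) =
    (fun w => \sum_(l <- index_enum 'I_(L * b)) ze (k0 + l %/ b)%N (l %% b)%N w) by [].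
by apply: measurable_sum => l; exact: (centered_measurable (nr_centered fr (ltn_ord l))).
Qed.

Lemma frozen_block (m : R) n r L i l w : (l <= L)%N -> (0 < L)%N ->
  let y := (frozen ze m n r L (i * L)%N w).1 in
  (frozen ze m n r L (i * L + l)%N w).1 =
    y + m * l%:R / n.+1%:R + n.+1%:R^-1 * \sum_(k < l) \sum_(j < population n r y) ze (i * L + k)%N j w /\
  ((l < L)%N -> (frozen ze m n r L (i * L + l)%N w).2 = y).
Proof.
move=> lL L0 y; elim: l lL => [_|l IH lL].
  rewrite addn0 mulr0 mul0r big_ord0 mulr0 !addr0; split => // _.
  rewrite /y; case: i {y}=> [|i]; first by rewrite mul0n.
  have e : (i.+1 * L)%N = (i.+1 * L).-1.+1 by rewrite prednK// muln_gt0.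
  by rewrite e/= -e dvdn_mull.
have [IH1 IH2] := IH (ltnW lL); rewrite addnS/= IH1 (IH2 lL); split.
  rewrite row_sum_window ?population_cap// big_ord_recr/= big_mkord -[l.+1%:R]natr1 (IH2 lL).
  set A := \sum_(k < l) _; set B := \sum_(j < _) _.
  set N := (n.+1%:R^-1 : R); ring.
move=> lL'; rewrite ifF//; apply/negbTE; rewrite -addnS dvdn_addr ?dvdn_mull//.
by rewrite gtnNdvd.
Qed.
End flat_rows.

(** * Transition kernels of the Euler scheme *)

Section kernels.
Context {R : realType} {d'} {T' : measurableType d'} (P' : probability T' R).
Variables (F' : R -> set_system T') (W : R -> T' -> R).
Hypothesis wW : wiener_process P' F' W.
Variables (m v : R) (r : nat).
Hypothesis v0 : 0 <= v.
Implicit Types (H : (nat -> R) -> R) (y : nat -> R).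
Notation h := (r.+1%:R^-1 : R).
Let dW i w := W (etime r i.+1) w - W (etime r i) w.
Let te i : etime r i <= etime r i.+1 :> R. Proof. by rewrite etime_le. Qed.
Let mdW i : meas_fun (dW i). Proof. exact: (increment_measurable wW (etime_ge0 r i) (te i)). Qed.

(** The conditional expectation of [H] given the values [0, ..., i] of the Euler scheme, as a
    function of these values. *)
Definition euler_kernel i H y := mean P' (fun w =>
  H (extend y i (y i + m / r.+1%:R + tcoef v r (y i) * (W (etime r i.+1) w - W (etime r i) w)))).

Lemma mean_increment_dist i (u u' : T' -> R) (e K A B : R) : bounded_meas u -> bounded_meas u' ->
  0 <= e -> 0 <= K -> (forall w, `|u w - u' w| <= e + K * (A + B * (W (etime r i.+1) w - W (etime r i) w)) ^+ 2) ->
  `|mean P' u - mean P' u'| <= e + K * (A ^+ 2 + B ^+ 2 / r.+1%:R).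
Proof.
move=> bu bu' e0 K0 uu'.
have c : centered P' (dW i) h.
  have -> : h = etime r i.+1 - etime r i by rewrite etimeS addrAC subrr add0r.
  exact: (increment_centered wW (etime_ge0 r i) (te i)).
apply: (mean_dist bu bu' _ uu').
  apply: measurable_funD; first exact: measurable_cst.
  apply: measurable_funM; first exact: measurable_cst.
  apply: measurable_funX; apply: measurable_funD; first exact: measurable_cst.
  by apply: measurable_funM; [exact: measurable_cst|exact: mdW].
have q0 w : 0 <= e + K * (A + B * dW i w) ^+ 2 by rewrite addr_ge0// mulr_ge0// sqr_ge0.
have m0 : meas_fun (fun _ : T' => 0 : R) by exact: measurable_cst.
have := @integral_quadratic_le _ _ _ P' _ _ (fun w => e + K * (A + B * dW i w) ^+ 2) (fun=> 0)
  (e + K * A ^+ 2) (2 * (K * (A * B))) (K * B ^+ 2) c m0 q0 (fun=> lexx (0 : R)).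
move=> /(_ _); rewrite integral0 adde0 => hq; apply: le_trans (hq _) _.
  by move=> w; rewrite addr0 le_eqVlt; apply/orP; left; apply/eqP; ring.
by rewrite lee_fin le_eqVlt; apply/orP; left; apply/eqP; ring.
Qed.

Lemma extend_near y y' i (a b dt : R) : (forall j, (j <= i)%N -> `|y j - y' j| <= dt) ->
  `|a - b| <= dt -> forall j, `|extend y i a j - extend y' i b j| <= dt.
Proof. by move=> yy ab j; rewrite /extend; case: ifP => // ji; exact: yy. Qed.

Lemma measurable_extend i H y d (S : measurableType d) (g : S -> R) : ucont i.+1 H ->
  meas_fun g -> meas_fun (fun w => H (extend y i (g w))).
Proof.
move=> uH mg; apply: (measurable_ucont (Y := fun j w => extend y i (g w) j) uH) => j _.
by rewrite /extend; case: (j <= i)%N => //; exact: measurable_cst.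
Qed.

Let mstep y i : meas_fun (fun w => y i + m / r.+1%:R + tcoef v r (y i) * dW i w).
Proof. by apply: measurable_funD => //; exact: measurable_funM. Qed.

Lemma kernel_bound i H (M : R) y : ucont i.+1 H -> (forall z, `|H z| <= M) -> `|euler_kernel i H y| <= M.
Proof. by move=> uH HM; apply: mean_bound => //; exact: (measurable_extend y uH (mstep y i)). Qed.

(** Two histories are continued with the same increment. Their next values differ by [A + B * dW],
    where [B ^ 2 <= v * |A|] by the Hoelder bound on [tcoef], and [modulus_sqr] integrates this. *)
Lemma ucont_kernel i H (M : R) : ucont i.+1 H -> (forall z, `|H z| <= M) -> ucont i (euler_kernel i H).
Proof.
move=> uH HM e e0; have M0 : 0 <= M := le_trans (normr_ge0 _) (HM (fun=> 0)).
have e20 : 0 < e / 2 by rewrite divr_gt0.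
have [dt dt0 hdt] := uH _ e20.
have K0 : 0 <= 2 * M / dt ^+ 2 by apply: divr_ge0; [exact: mulr_ge0|exact: sqr_ge0].
set K := 2 * M / dt ^+ 2 in K0.
have c0 : 0 < (K + 1) * (1 + v) by apply: mulr_gt0; [exact: ltr_wpDl|exact: ltr_wpDr].
pose et := Num.min (Num.min dt 1) (e / 2 / ((K + 1) * (1 + v))).
have et0 : 0 < et by rewrite !lt_min dt0 ltr01/= divr_gt0.
exists et => // y y' yy.
have etdt : et <= dt by rewrite !ge_min lexx.
have et1 : et <= 1 by rewrite !ge_min lexx orbT.
have ete : (K + 1) * (1 + v) * et <= e / 2 by rewrite mulrC -ler_pdivlMr// !ge_min lexx !orbT.
pose A := y i - y' i; pose B := tcoef v r (y i) - tcoef v r (y' i).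
have bm z : bounded_meas (fun w => H (extend z i (z i + m / r.+1%:R + tcoef v r (z i) * dW i w))).
  by apply: (bounded_measI (M := M)) => //; exact: (measurable_extend z uH (mstep z i)).
have := @mean_increment_dist i _ _ (e / 2) K A B (bm y) (bm y') (ltW e20) K0.
move=> /(_ _) h1; apply: le_trans (h1 _) _.
  move=> w; rewrite (_ : A + _ = (y i + m / r.+1%:R + tcoef v r (y i) * dW i w) - (y' i + m / r.+1%:R + tcoef v r (y' i) * dW i w)); last first.
    by rewrite /A /B /dW; ring.
  apply: modulus_sqr => //; first exact: ltW.
  move=> ab; apply: hdt => j _; apply: extend_near => // k ki; exact: le_trans (yy k ki) etdt.
have Aet : `|A| <= et by exact: yy.
have A2 : A ^+ 2 <= et.
  rewrite -[X in X <= _]real_normK ?num_real// expr2; apply: le_trans (ler_pM _ _ Aet Aet) _ => //.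
  by apply: ler_piMr => //; exact: ltW.
have B2 : B ^+ 2 / r.+1%:R <= v * et.
  apply: (@le_trans _ _ (B ^+ 2)).
    by apply: ler_piMr; [exact: sqr_ge0|rewrite invf_le1// ler1n].
  by apply: le_trans (tcoef_holder r _ _ v0) _; exact: ler_wpM2l.
rewrite [leRHS]splitr lerD2l; apply: le_trans ete.
apply: (@le_trans _ _ (K * ((1 + v) * et))).
  by apply: ler_wpM2l => //; rewrite mulrDl mul1r; exact: lerD.
rewrite -mulrA; apply: ler_wpM2r; last by rewrite lerDl.
by rewrite mulr_ge0 ?(ltW et0)// addr_ge0.
Qed.

Lemma mean_euler_step i H (M : R) : ucont i.+1 H -> (forall z, `|H z| <= M) ->
  mean P' (fun w => H (fun j => euler W m v r j w)) = mean P' (fun w => euler_kernel i H (fun j => euler W m v r j w)).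
Proof.
move=> uH HM; have sF := filtration_sub wW (etime_ge0 r i).
have mU j : (j <= i)%N -> meas_wrt (F' (etime r i)) (euler W m v r j).
  move=> ji; apply: (meas_wrt_mono wW (etime_ge0 r j)); first by rewrite etime_le.
  exact: (@euler_meas_wrt _ _ _ _ _ _ wW).
pose hh (z : g_sigma_algebraType (F' (etime r i)) * R) : R :=
  H (extend (fun j => euler W m v r j z.1) i (euler W m v r i z.1 + m / r.+1%:R + tcoef v r (euler W m v r i z.1) * z.2)).
have mhh : meas_fun hh.
  have mf j : (j <= i)%N -> meas_fun (fun z : g_sigma_algebraType (F' (etime r i)) * R => euler W m v r j z.1).
    by move=> ji; exact: (measurableT_comp (mU j ji) measurable_fst).
  have := @measurable_ucont R _ (g_sigma_algebraType (F' (etime r i)) * R)%type i.+1 H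
    (fun j z => extend (fun j => euler W m v r j z.1) i
    (euler W m v r i z.1 + m / r.+1%:R + tcoef v r (euler W m v r i z.1) * z.2) j) uH.
  apply=> j _.
  rewrite /extend; case: (leqP j i) => ji; first exact: mf.
  apply: measurable_funD; first by apply: measurable_funD => //; exact: mf.
  by apply: measurable_funM => //; apply: measurableT_comp; [exact: measurable_tcoef|exact: mf].
have [_ _ E] := mean_decoupling sF (mdW i) (increment_indep wW (etime_ge0 r i) (te i)) mhh (fun z => HM _).
rewrite -[RHS]E; congr mean; apply/funext => w; apply: (ucont_eq uH) => j ji.
rewrite /extend; case: (leqP j i) => // ij.
by rewrite (_ : j = i.+1)//; apply/eqP; rewrite eqn_leq ji.
Qed.
End kernels.

Section skeleton.
Context {R : realType} {d} {T : measurableType d} (P : probability T R).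
Variables (F : nat -> set_system T) (G : nat -> nat -> set_system T) (ze : nat -> nat -> T -> R) (m v : R).
Hypotheses (sF : forall k, sub_algebra (F k))
  (FG : forall k, F k `<=` G k 0%N)
  (GF : forall k J, G k J `<=` F k.+1)
  (nr : forall J k, noise_row P J v (G k) (ze k))
  (v0 : 0 <= v).
Hypothesis vanishing : forall e : R, 0 < e -> exists n0, forall n, (n0 <= n)%N -> forall k j,
  (\int[P]_w (cubic_rem (n.+1%:R^-1 * ze k j w))%:E <= (e * n.+1%:R^-1 ^+ 2)%:E)%E.
Hypothesis later : forall k L b, indep_of P (F k) (flat_sum ze k L b).
Context {d'} {T' : measurableType d'} (P' : probability T' R).
Variables (F' : R -> set_system T') (W : R -> T' -> R).
Hypothesis wW : wiener_process P' F' W.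
Variable r : nat.
Implicit Types (H : (nat -> R) -> R) (y : nat -> R).
Let dW i w := W (etime r i.+1) w - W (etime r i) w.
Let te i : etime r i <= etime r i.+1 :> R. Proof. by rewrite etime_le. Qed.
Let mdW i : meas_fun (dW i). Proof. exact: (increment_measurable wW (etime_ge0 r i) (te i)). Qed.

(** The block has variance [v * L * b / n.+1 ^ 2]; the Gaussian increment has variance [1 / r.+1],
    whence the factor [L * b * r.+1] under the root. The increment is cut into [L * b] pieces, one
    for each noise. *)
Lemma block_clt n (L b i k0 : nat) (Q q M C2 C x : R) (f f1 f2 : R -> R) :
  (0 < L)%N ->
  (forall k j, (\int[P]_w (cubic_rem (n.+1%:R^-1 * ze k j w))%:E <= Q%:E)%E) ->
  4 * Num.sqrt v ^+ 3 * n.+1%:R^-1 ^+ 3 <= q ->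
  taylor2 f f1 f2 C -> 0 <= C -> (forall x, `|f x| <= M) -> (forall x, `|f2 x| <= C2) ->
  meas_fun f ->
  `|mean P (fun w => f (x + n.+1%:R^-1 * flat_sum ze k0 L b w)) -
    mean P' (fun w => f (x + Num.sqrt (v * (L * b * r.+1)%:R) / n.+1%:R * dW i w))| <= (L * b)%:R * (C * Q + C * q).
Proof.
move=> L0 hQ hq Tf C0 fM f2C mf; set N := n.+1%:R.
have N0 : 0 < N by [].
case: (posnP b) => [->|b0].
  rewrite muln0 mul0n mulr0 sqrtr0 !mul0r.
  have -> : (fun w => f (x + N^-1 * flat_sum ze k0 L 0 w)) = fun=> f x.
    by apply/funext => w; rewrite flat_sumE big1 ?mulr0 ?addr0// => k _; rewrite big_ord0.
  have -> : (fun w => f (x + 0 * dW i w)) = fun=> f x by apply/funext => w; rewrite mul0r addr0.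
  by rewrite !mean_cst subrr normr0.
have J0 : (0 < L * b)%N by rewrite muln_gt0 L0.
set J := (L * b)%N in J0 *; set sg := Num.sqrt _ / N; pose Dl : R := r.+1%:R^-1 / J%:R.
have JR : 0 < J%:R :> R by rewrite ltr0n.
have Dl0 : 0 <= Dl by rewrite divr_ge0.
have rn : (r.+1%:R : R) != 0 by [].
have Jn : (J%:R : R) != 0 by rewrite lt0r_neq0.
have Nn : N != 0 by rewrite lt0r_neq0.
have sgE : sg ^+ 2 * Dl = N^-1 ^+ 2 * v.
  rewrite /sg exprMn sqr_sqrtr; last by rewrite mulr_ge0.
  rewrite /Dl natrM; move: rn Jn Nn; set a := r.+1%:R; set b1 := J%:R => rn Jn Nn; field.
  by rewrite !nat1r !pnatr_eq0 (_ : J == 0%N = false)//; apply/negbTE; rewrite -lt0n.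
have sg0 : 0 <= sg by rewrite divr_ge0 ?sqrtr_ge0// ltW.
have hq' : 4 * `|sg| ^+ 3 * Num.sqrt Dl ^+ 3 <= q.
  apply: le_trans hq; rewrite (ger0_norm sg0) -mulrA -exprMn -[leRHS]mulrA -exprMn.
  rewrite le_eqVlt; apply/orP; left; apply/eqP; congr (_ * _ ^+ 3).
  have -> : sg = Num.sqrt (sg ^+ 2) by rewrite sqrtr_sqr ger0_norm.
  rewrite -sqrtrM ?sqr_ge0// sgE mulrC sqrtrM// sqrtr_sqr ger0_norm// invr_ge0 ltW//.
have tE : etime r i.+1 = etime r i + J%:R * Dl.
  by rewrite etimeS /Dl mulrCA divff// mulr1.
have -> : (fun w => f (x + sg * dW i w)) =
    (fun w => f (x + sg * (W (etime r i + J%:R * Dl) w - W (etime r i) w))) by rewrite -tE.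
have hZ l : (l < J)%N -> (\int[P]_w (cubic_rem (N^-1 * ze (k0 + l %/ b)%N (l %% b)%N w))%:E <= Q%:E)%E by move=> _; exact: hQ.
have := noise_clt wW x (flat_noise_row FG GF nr k0 L b) (etime_ge0 r i) Dl0 sgE hZ hq' Tf C0 fM f2C mf.
exact.
Qed.

(* The variance of a frozen block differs from that of the Euler step only
   through integer parts. *)
Lemma block_coef_close n (y : R) : (r <= n)%N ->
  (Num.sqrt (v * ((n.+1 %/ r.+1) * population n r y * r.+1)%:R) / n.+1%:R - tcoef v r y) ^+ 2
    <= v * ((r.+1 ^ 2)%:R + 1) / n.+1%:R.
Proof.
move=> rn; set N := n.+1%:R; set L := (n.+1 %/ r.+1)%N; set b := population n r y.
have N0 : 0 < N :> R by []. have Nn : N != 0 :> R by rewrite lt0r_neq0.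
set mn := Num.min (Num.max y 0) r.+1%:R.
have mn0 : 0 <= mn by rewrite le_min le_max lexx orbT/=.
have bmn : `|b%:R / N - mn| <= N^-1 := truncn_approx n mn0.
have -> : Num.sqrt (v * (L * b * r.+1)%:R) / N = Num.sqrt (v * (L * b * r.+1)%:R / N ^+ 2).
  by rewrite [RHS]sqrtrM ?mulr_ge0// sqrtrV ?sqr_ge0// sqrtr_sqr ger0_norm.
have a0 : 0 <= v * (L * b * r.+1)%:R / N ^+ 2 by rewrite divr_ge0 ?mulr_ge0 ?sqr_ge0.
apply: le_trans (sqrt_sub_sqr a0 (mulr_ge0 v0 mn0)) _; rewrite -mulrA -mulrBr normrM (ger0_norm v0) -mulrA.
apply: ler_wpM2l => //.
have lE : (L * r.+1 + n.+1 %% r.+1)%N = n.+1 by rewrite -divn_eq.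
have lt := ltn_pmod n.+1 (ltn0Sn r).
have bc : b%:R / N <= r.+1%:R :> R.
  by rewrite ler_pdivrMr// -natrM ler_nat mulnC; exact: population_cap.
have b0 : 0 <= b%:R / N :> R by rewrite divr_ge0.
have -> : (L * b * r.+1)%:R / N ^+ 2 - mn = (b%:R / N - mn) - b%:R / N * ((n.+1 %% r.+1)%:R / N).
  rewrite !natrM; have -> : (n.+1 %% r.+1)%:R = N - L%:R * r.+1%:R :> R by apply/eqP; rewrite eq_sym subr_eq addrC -natrM -natrD lE.
  by field.
apply: le_trans (ler_normB _ _) _; rewrite addrC mulrDl mul1r; apply: lerD => //.
rewrite normrM !ger0_norm ?divr_ge0// natrX expr2 -mulrA; apply: ler_pM => //; first by rewrite divr_ge0.
by rewrite ler_pM2r ?invr_gt0// ler_nat ltnW.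
Qed.

Lemma block_drift_close n : (r <= n)%N -> (m * (n.+1 %/ r.+1)%:R / n.+1%:R - m / r.+1%:R) ^+ 2 <= m ^+ 2 / n.+1%:R.
Proof.
move=> rn; set N := n.+1%:R; set L := (n.+1 %/ r.+1)%N; have N0 : 0 < N :> R by [].
have lE : (L * r.+1 + n.+1 %% r.+1)%N = n.+1 by rewrite -divn_eq.
have lt := ltn_pmod n.+1 (ltn0Sn r).
have Nn : N != 0 :> R by rewrite lt0r_neq0. have rn0 : r.+1%:R != 0 :> R by [].
set p : R := (n.+1 %% r.+1)%:R / r.+1%:R.
have -> : m * L%:R / N - m / r.+1%:R = - (m * p / N).
  have pE : (n.+1 %% r.+1)%:R = N - L%:R * r.+1%:R :> R by apply/eqP; rewrite eq_sym subr_eq addrC -natrM -natrD lE.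
  rewrite /p pE; field; by rewrite !nat1r !pnatr_eq0.
have p0 : 0 <= p by rewrite divr_ge0.
have p1 : p <= 1 by rewrite ler_pdivrMr// mul1r ler_nat ltnW.
clearbody p.
rewrite sqrrN !exprMn -mulrA; apply: ler_wpM2l; first exact: sqr_ge0.
have N1 : N^-1 <= 1 :> R by rewrite invf_le1// ler1n.
have Ni : 0 <= N^-1 :> R by rewrite invr_ge0.
apply: (@le_trans _ _ (1 * N^-1)); last by rewrite mul1r.
apply: ler_pM; [exact: sqr_ge0|exact: sqr_ge0|exact: exprn_ile1|].
by rewrite expr2; exact: ler_piMr.
Qed.

(** Uniformity in [f] and [y] comes from [smoothing], whose constant depends only on the bound and
    the scale. Two [e] pay for smoothing, one for the Gaussian replacement, two for the rounding in
    the drift and in the coefficient. *)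
Lemma step_clt (M e dt : R) : 0 <= M -> 0 < e -> 0 < dt -> exists n0 : nat, forall n, (n0 <= n)%N ->
  (r <= n)%N /\
  forall (i k0 : nat) (f : R -> R) (y : R), continuous f -> (forall x, `|f x| <= M) ->
    (forall x x', `|x - x'| <= dt -> `|f x - f x'| <= e) ->
  `|mean P (fun w => f (y + m * (n.+1 %/ r.+1)%:R / n.+1%:R +
      n.+1%:R^-1 * flat_sum ze k0 (n.+1 %/ r.+1) (population n r y) w)) -
    mean P' (fun w => f (y + m / r.+1%:R + tcoef v r y * dW i w))| <= e + e + e + (e + e).
Proof.
move=> M0 e0 dt0.
have dt30 : 0 < dt / 3 by rewrite divr_gt0.
have [C C0 smooth] := smoothing M0 dt30.
have K0 : 0 <= 2 * M / dt ^+ 2 by apply: divr_ge0; [exact: mulr_ge0|exact: sqr_ge0].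
set K := 2 * M / dt ^+ 2 in K0.
have C10 : 0 < C + 1 by exact: ltr_wpDl.
pose q0 := e / 2 / (C + 1).
have q00 : 0 < q0 by rewrite !divr_gt0.
have [n1 hn1] := vanishing q00.
pose A := K * (m ^+ 2 + v * ((r.+1 ^ 2)%:R + 1)).
pose B := C * (4 * Num.sqrt v ^+ 3).
have A0 : 0 <= A by rewrite mulr_ge0// addr_ge0 ?sqr_ge0// mulr_ge0// addr_ge0.
have B0 : 0 <= B by rewrite mulr_ge0// mulr_ge0// exprn_ge0// sqrtr_ge0.
have AB0 : 0 < 2 * (A + B + 1) by rewrite mulr_gt0// ltr_wpDl// addr_ge0.
have eAB : 0 < e / (2 * (A + B + 1)) by rewrite divr_gt0.
have [n2] := ltr_add_invr eAB; rewrite add0r => hn2.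
exists (maxn r (maxn n1 n2)) => n; rewrite !geq_max => /and3P[rn n1n n2n]; split => //.
move=> i k0 f y cf fM fe; set N := n.+1%:R; set L := (n.+1 %/ r.+1)%N; set b := population n r y.
have N0 : 0 < N :> R by [].
have Ni : N^-1 <= e / (2 * (A + B + 1)).
  by apply: le_trans (ltW hn2); rewrite lef_pV2 ?posrE// ler_nat.
have NiAB : (A + B + 1) * N^-1 <= e / 2.
  by rewrite -ler_pdivlMl ?ltr_wpDl ?addr_ge0//; apply: le_trans Ni _; rewrite invfM mulrA mulrC.
have Ni0 : 0 <= N^-1 :> R by rewrite invr_ge0.
have NA : A * N^-1 <= e / 2.
  by apply: le_trans NiAB; rewrite ler_wpM2r// -addrA lerDl addr_ge0.
have NB : B * N^-1 <= e / 2.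
  by apply: le_trans NiAB; rewrite ler_wpM2r// addrAC addrC lerDl addr_ge0.
have mf : meas_fun f by exact: continuous_measurable_fun.
have [fs [f1 [f2 [Tf cfs f2C fsf]]]] := smooth f cf fM.
have mfs : meas_fun fs by exact: continuous_measurable_fun.
have fsM x : `|fs x| <= M by have [c _ ->] := fsf x.
have ffs x : `|f x - fs x| <= e.
  have [c hc ->] := fsf x; apply: fe; rewrite distrC; apply: le_trans hc _.
  by rewrite mulrC divfK.
have L0 : (0 < L)%N by rewrite divn_gt0.
set x0 := y + m * L%:R / N; set sg := Num.sqrt (v * (L * b * r.+1)%:R) / N.
have mS : meas_fun (fun w => x0 + N^-1 * flat_sum ze k0 L b w).
  apply: measurable_funD; first exact: measurable_cst.
  by apply: measurable_funM; [exact: measurable_cst|exact: measurable_flat_sum].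
have mV a (c : R) : meas_fun (fun w => a + c * dW i w).
  apply: measurable_funD; first exact: measurable_cst.
  by apply: measurable_funM; [exact: measurable_cst|exact: mdW].
have bdd d1 (S : measurableType d1) (Q : probability S R) (g : R -> R) (s : S -> R) : meas_fun g ->
    (forall x, `|g x| <= M) -> meas_fun s -> bounded_meas (fun w => g (s w)).
  by move=> mg gM ms; apply: (bounded_measI (M := M)) => //; exact: measurableT_comp.
have t1 : `|mean P (fun w => f (x0 + N^-1 * flat_sum ze k0 L b w)) - mean P (fun w => fs (x0 + N^-1 * flat_sum ze k0 L b w))| <= e.
  by apply: mean_uniform => //; exact: (bdd _ _ P).
have t2 : `|mean P' (fun w => f (x0 + sg * dW i w)) - mean P' (fun w => fs (x0 + sg * dW i w))| <= e.
  by apply: mean_uniform => //; exact: (bdd _ _ P').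
have t3 : `|mean P (fun w => fs (x0 + N^-1 * flat_sum ze k0 L b w)) - mean P' (fun w => fs (x0 + sg * dW i w))| <= e.
  apply: le_trans (block_clt b i k0 x0 L0 (hn1 n n1n) (lexx _) Tf C0 fsM f2C mfs) _.
  (* Since [b <= n.+1 * r.+1] and [L * r.+1 <= n.+1]: the number of replaced noises compensates the
     factor [N ^ -2] of the error per noise. *)
  have JN : (L * b)%:R <= N ^+ 2 :> R.
    rewrite expr2 -natrM ler_nat; apply: (@leq_trans (L * (n.+1 * r.+1))); first by rewrite leq_mul2l population_cap orbT.
    by rewrite mulnCA leq_mul2l leq_divM orbT.
  have Nn : N != 0 :> R by rewrite lt0r_neq0.
  have D0 : 0 <= C * (q0 * N^-1 ^+ 2) + C * (4 * Num.sqrt v ^+ 3 * N^-1 ^+ 3).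
    have s3 : 0 <= 4 * Num.sqrt v ^+ 3 by apply: mulr_ge0 => //; apply: exprn_ge0; exact: sqrtr_ge0.
    apply: addr_ge0; apply: mulr_ge0 => //; apply: mulr_ge0 => //; try exact: exprn_ge0.
    exact: ltW.
  apply: (le_trans (ler_wpM2r D0 JN)).
  have -> : N ^+ 2 * (C * (q0 * N^-1 ^+ 2) + C * (4 * Num.sqrt v ^+ 3 * N^-1 ^+ 3)) = C * q0 + B * N^-1.
    by rewrite /B; field.
  rewrite [leRHS]splitr; apply: lerD => //; rewrite /q0 mulrCA; apply: ler_piMr; first by rewrite divr_ge0 ?(ltW e0).
  by rewrite ler_pdivrMr// mul1r lerDl.
have t4 : `|mean P' (fun w => f (x0 + sg * dW i w)) - mean P' (fun w => f (y + m / r.+1%:R + tcoef v r y * dW i w))| <= e + e.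
  have bf a c : bounded_meas (fun w => f (a + c * dW i w)) by exact: (bdd _ _ P').
  have := mean_increment_dist wW (r := r) (i := i) (A := m * L%:R / N - m / r.+1%:R) (B := sg - tcoef v r y) (bf x0 sg) (bf (y + m / r.+1%:R) (tcoef v r y)) (ltW e0) K0.
  move=> hh; apply: le_trans (hh _) _.
    move=> w; 
    have E : m * L%:R / N - m / r.+1%:R + (sg - tcoef v r y) * dW i w =
      (x0 + sg * dW i w) - (y + m / r.+1%:R + tcoef v r y * dW i w) by rewrite /x0; ring.
    rewrite -/(dW i w) E.
    by apply: modulus_sqr => //; [exact: ltW|exact: fe].
  rewrite lerD2l; apply: (@le_trans _ _ (A * N^-1)); last by apply: le_trans NA _; rewrite ler_pdivrMr// ler_peMr ?(ltW e0)// ler1n.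
  rewrite /A -[leRHS]mulrA; apply: ler_wpM2l => //; rewrite mulrDl; apply: lerD; first exact: block_drift_close.
  apply: le_trans (block_coef_close y rn).
  by apply: ler_piMr; [exact: sqr_ge0|rewrite invf_le1// ler1n].
have tri (a1 a2 a3 a4 a5 : R) : `|a1 - a2| <= e -> `|a2 - a3| <= e -> `|a4 - a3| <= e -> `|a4 - a5| <= e + e ->
    `|a1 - a5| <= e + e + e + (e + e).
  move=> h1 h2 h3 h4; rewrite (_ : a1 - a5 = (a1 - a2) + (a2 - a3) + (a3 - a4) + (a4 - a5)); last by ring.
  apply: le_trans (ler_normD _ _) _; apply: lerD => //.
  apply: le_trans (ler_normD _ _) _; apply: lerD; last by rewrite distrC.
  by apply: le_trans (ler_normD _ _) _; apply: lerD.
exact: tri t1 t3 t2 t4.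
Qed.

Definition block n (w : T) (j : nat) : R :=
  (frozen ze m n r (n.+1 %/ r.+1) (j * (n.+1 %/ r.+1)) w).1.

Lemma block_adapted n j : meas_wrt (F (j * (n.+1 %/ r.+1))%N) (fun w => block n w j).
Proof. by case: (frozen_adapted m sF FG GF nr n r (n.+1 %/ r.+1) (j * (n.+1 %/ r.+1))). Qed.

Let up k l d1 (T1 : measurableType d1) (f : T -> T1) : (k <= l)%N -> meas_wrt (F k) f -> meas_wrt (F l) f.
Proof.
elim: l => [|l IH]; first by rewrite leqn0 => /eqP ->.
rewrite leq_eqVlt => /predU1P[->//|kl] mf; apply: (meas_wrt_sub (sF l) (sF l.+1)); last exact: IH.
exact: (subset_trans (@FG l) (@GF l 0%N)).
Qed.

Lemma measurable_block n j : meas_fun (fun w => block n w j).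
Proof. exact: (sub_meas_wrt (sF _) (@block_adapted n j)). Qed.

Lemma frozen_kernel i H (M e : R) : ucont i.+1 H -> (forall z, `|H z| <= M) -> 0 < e ->
  exists n0 : nat, forall n, (n0 <= n)%N ->
  `|mean P (fun w => H (block n w)) - mean P (fun w => euler_kernel P' W m v r i H (block n w))| <= e.
Proof.
move=> uH HM e0; have M0 : 0 <= M := le_trans (normr_ge0 _) (HM (fun=> 0)).
have e50 : 0 < e / 5 by rewrite divr_gt0.
have [dt dt0 hdt] := uH _ e50.
have [n0 hn] := step_clt M0 e50 dt0.
exists n0 => n /hn [rn {}hn]; set L := (n.+1 %/ r.+1)%N.
have L0 : (0 < L)%N by rewrite divn_gt0.
pose U := g_sigma_algebraType (F (i * L)%N).
pose N w := population n r (block n w i).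
pose h (z : U * R) : R :=
  H (extend (block n z.1) i (block n z.1 i + m * L%:R / n.+1%:R + n.+1%:R^-1 * z.2)).
have mU j : (j <= i)%N -> meas_wrt (F (i * L)%N) (fun w => block n w j).
  by move=> ji; apply: (@up (j * L)%N); [rewrite leq_mul2r ji orbT|exact: (@block_adapted n j)].
have mh : meas_fun h.
  have mf j : (j <= i)%N -> meas_fun (fun z : U * R => block n z.1 j).
    by move=> ji; exact: (measurableT_comp (mU j ji) measurable_fst).
  have := @measurable_ucont R _ (U * R)%type i.+1 H (fun j z => extend (block n z.1) i
    (block n z.1 i + m * L%:R / n.+1%:R + n.+1%:R^-1 * z.2) j) uH.
  apply=> j _; rewrite /extend; case: (leqP j i) => ji; first exact: mf.
  apply: measurable_funD; last by apply: measurable_funM => //; exact: measurable_cst.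
  by apply: measurable_funD; [exact: mf|exact: measurable_cst].
have mN : meas_wrt (F (i * L)%N) N.
  by apply: measurableT_comp; [exact: measurable_population|exact: mU].
have NJ w : (N w < (cap n r).+1)%N by rewrite ltnS; exact: population_cap.
have [bm E] := mean_decoupling_index (sF (i * L)) mN NJ (measurable_flat_sum FG GF nr (i * L) L)
  (@later (i * L)%N L) mh (fun z => HM _).
have -> : (fun w => H (block n w)) = (fun w => h (w, flat_sum ze (i * L) L (N w) w)).
  apply/funext => w; apply: (ucont_eq uH) => j ji; rewrite /extend; case: (leqP j i) => // ij.
  have -> : j = i.+1 by apply/eqP; rewrite eqn_leq ji.
  rewrite /block -/L mulSnr flat_sumE.
  by case: (frozen_block ze m n r i w (leqnn L) L0) => ->.
have bk : bounded_meas (fun w => euler_kernel P' W m v r i H (block n w)).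
  have uk := ucont_kernel wW m r v0 uH HM.
  apply: (bounded_measI (M := M)).
    by apply: (measurable_ucont (Y := fun j w => block n w j) uk) => j _; exact: measurable_block.
  by move=> w; exact: (kernel_bound wW m v r _ uH HM).
rewrite E; apply: mean_uniform => // w.
have cont : continuous (fun x => H (extend (block n w) i x)).
  move=> x; apply/cvgrPdist_le => e1 e10; have [d1 d10 h1] := uH _ e10.
  near=> x'; apply: h1 => j _; apply: extend_near => [k _|]; first by rewrite subrr normr0 ltW.
  near: x'; apply: cvgr_dist_le d10; exact: cvg_id.
have := hn i (i * L)%N (fun x => H (extend (block n w) i x)) (block n w i) cont (fun=> HM _).
have -> : e / 5 + e / 5 + e / 5 + (e / 5 + e / 5) = e by field.
apply=> x x' xx; apply: hdt => j _; apply: extend_near => [k _|//]; by rewrite subrr normr0 ltW.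
Unshelve. all: by end_near.
Qed.

(** By induction on the number of steps: the last block is integrated out with the Euler kernel, on
    both sides, and the induction hypothesis applies to the resulting function of the shorter
    history. *)
Lemma skeleton_limit i : forall H (M e : R), ucont i H -> (forall z, `|H z| <= M) -> 0 < e ->
  exists n0 : nat, forall n, (n0 <= n)%N ->
  `|mean P (fun w => H (block n w)) - mean P' (fun w => H (fun j => euler W m v r j w))| <= e.
Proof.
elim: i => [|i IH] H M e uH HM e0.
  exists 0%N => n _; rewrite (_ : (fun w => H (block n w)) = fun=> H (fun=> 0)).
    rewrite (_ : (fun w => H _) = fun=> H (fun=> 0)) ?mean_cst ?subrr ?normr0 ?ltW//.
    by apply/funext => w; apply: (ucont_eq uH) => j; rewrite leqn0 => /eqP ->.
  by apply/funext => w; apply: (ucont_eq uH) => j; rewrite leqn0 => /eqP ->.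
have e20 : 0 < e / 2 by rewrite divr_gt0.
have [n1 h1] := frozen_kernel uH HM e20.
have [n2 h2] := IH (euler_kernel P' W m v r i H) M _ (ucont_kernel wW m r v0 uH HM)
  (fun y => kernel_bound wW m v r y uH HM) e20.
exists (maxn n1 n2) => n; rewrite geq_max => /andP[/h1 {}h1 /h2 {}h2].
rewrite (mean_euler_step wW m v r uH HM) [leRHS]splitr.
by apply: le_trans (ler_distD _ _ _) _; exact: lerD h1 h2.
Qed.
End skeleton.

(** * The Skorokhod space *)

Section skorokhod_distance.
Context {R : realType}.
Implicit Types f g h : skorokhod R.

(** The cut at [1 / (1 + t)] makes late times count little, so a small supremum means uniform
    closeness on long compact intervals. *)
Let values f g : set R := [set x | exists2 t : R, 0 <= t & x = Num.min `|f t - g t| (1 + t)^-1].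

(* Uniform closeness on compact sets; convergence for this distance implies J1 convergence. *)
Definition sup_dist f g : R := sup (values f g).

Let values_le1 f g : ubound (values f g) 1.
Proof. by move=> _ [t t0 ->]; rewrite ge_min invf_le1 ?lerDl ?t0 ?orbT// ltr_pwDl. Qed.

Let values_sup f g : has_sup (values f g).
Proof. by split; [exists (Num.min `|f 0 - g 0| (1 + 0)^-1), 0|exists 1; exact: values_le1]. Qed.

Lemma sup_dist_le f g (e : R) : (forall t, 0 <= t -> Num.min `|f t - g t| (1 + t)^-1 <= e) -> sup_dist f g <= e.
Proof. by move=> h; apply: ge_sup; [case: (values_sup f g)|move=> _ [t t0 ->]; exact: h]. Qed.

Lemma sup_dist_ge f g (t : R) : 0 <= t -> Num.min `|f t - g t| (1 + t)^-1 <= sup_dist f g.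
Proof. by move=> t0; apply: ub_le_sup; [case: (values_sup f g)|exists t]. Qed.

Lemma sup_dist_ge0 f g : 0 <= sup_dist f g.
Proof. by apply: le_trans (sup_dist_ge f g (lexx 0)); rewrite le_min normr_ge0 invr_ge0 addr0 ler01. Qed.

Lemma sup_dist_refl f : sup_dist f f = 0.
Proof.
apply/eqP; rewrite eq_le sup_dist_ge0 andbT; apply: sup_dist_le => t t0.
by rewrite subrr normr0 ge_min lexx.
Qed.

Lemma sup_dist_triangle f g h : sup_dist f h <= sup_dist f g + sup_dist g h.
Proof.
apply: sup_dist_le => t t0; apply: le_trans (lerD (sup_dist_ge f g t0) (sup_dist_ge g h t0)).
have c0 : 0 <= (1 + t)^-1 by rewrite invr_ge0 addr_ge0.
have := ler_distD (g t) (f t) (h t); move: (normr_ge0 (f t - g t)) (normr_ge0 (g t - h t)).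
move: `|f t - h t| `|f t - g t| `|g t - h t| (1 + t)^-1 c0 => a b1 b2 c c0 b10 b20 ab.
by rewrite /Num.min; case: ltP => h1; case: ltP => h2; case: ltP => h3; lra.
Qed.

Lemma sup_dist_sym f g : sup_dist f g = sup_dist g f.
Proof. by rewrite /sup_dist; congr sup; apply/seteqP; split=> _ [t t0 ->]; exists t => //; rewrite distrC. Qed.

Lemma sup_dist_near f g (T e : R) : 0 <= T -> 0 <= e -> (1 + T)^-1 <= e ->
  (forall t, 0 <= t <= T -> `|f t - g t| <= e) -> sup_dist f g <= e.
Proof.
move=> T0 e0 Te h; apply: sup_dist_le => t t0; rewrite ge_min.
have [tT|Tt] := leP t T; first by rewrite h ?t0.
apply/orP; right; apply: le_trans Te; rewrite lef_pV2 ?posrE ?ltr_pwDl// lerD2l; exact: ltW.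
Qed.

Lemma J1_cvg_sup_dist (f_ : nat -> skorokhod R) f :
  (forall e : R, 0 < e -> \forall n \near \oo, sup_dist (f_ n) f <= e) -> J1_cvg f_ f.
Proof.
move=> h; exists (fun=> id); split.
- move=> n; split; [by []| |by []|by move=> A].
  by apply: continuous_subspaceT => x; exact: cvg_id.
- by move=> e e0; near=> n => t t0; rewrite subrr normr0 ltW.
- move=> K e K0 e0; pose dt := Num.min e ((1 + K)^-1 / 2).
  have K1 : 0 < (1 + K)^-1 by rewrite invr_gt0 ltr_pwDl// ltW.
  have dt0 : 0 < dt by rewrite lt_min e0 divr_gt0.
  apply: filterS (h dt dt0) => n fn t /andP[t0 tK].
  have := le_trans (sup_dist_ge (f_ n) f t0) fn; rewrite ge_min => /orP[|h2].
    by move/le_trans; apply; rewrite ge_min lexx.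
  exfalso; have : (1 + K)^-1 <= (1 + t)^-1 by rewrite lef_pV2 ?posrE ?ltr_pwDl ?lerD2l// ltW.
  move=> /le_trans/(_ h2); apply/negP; rewrite -ltNge.
  by apply: (@le_lt_trans _ _ ((1 + K)^-1 / 2)); [rewrite ge_min lexx orbT|rewrite ltr_pdivrMr// ltr_pMr// ltr1n].
Unshelve. all: by end_near.
Qed.

Definition lower_semicontinuous (F : skorokhod R -> R) := forall f (f_ : nat -> skorokhod R), J1_cvg f_ f ->
  forall e : R, 0 < e -> \forall n \near \oo, F f - e <= F (f_ n).

Variables (F : skorokhod R -> R) (M : R).
Hypothesis FM : forall f, `|F f| <= M.

Let penalized (k : nat) f : set R := [set x | exists g, x = F g + k%:R * sup_dist f g].

(** The largest minorant of [F] that is [k]-Lipschitz for [sup_dist]. *)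
Definition inf_convolution (k : nat) f : R := inf (penalized k f).

Let penalized_inf k f : has_inf (penalized k f).
Proof.
split; first by exists (F f + k%:R * sup_dist f f), f.
exists (- M) => _ [g ->]; apply: ler_wpDr; first by rewrite mulr_ge0// sup_dist_ge0.
by have := FM g; rewrite ler_norml => /andP[].
Qed.

Let inf_convolution_le k f g : inf_convolution k f <= F g + k%:R * sup_dist f g.
Proof. by apply: ge_inf; [case: (penalized_inf k f)|exists g]. Qed.

Lemma inf_convolution_le_id k f : inf_convolution k f <= F f.
Proof. by apply: le_trans (inf_convolution_le k f f) _; rewrite sup_dist_refl mulr0 addr0. Qed.

Lemma inf_convolution_ge k f (c : R) : (forall g, c <= F g + k%:R * sup_dist f g) -> c <= inf_convolution k f.
Proof. by move=> h; apply: lb_le_inf; [case: (penalized_inf k f)|move=> _ [g ->]; exact: h]. Qed.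

Lemma inf_convolution_bound k f : `|inf_convolution k f| <= M.
Proof.
rewrite ler_norml; apply/andP; split; last first.
  apply: le_trans (inf_convolution_le_id k f) _; by have := FM f; rewrite ler_norml => /andP[].
apply: inf_convolution_ge => g; apply: ler_wpDr; first by rewrite mulr_ge0// sup_dist_ge0.
by have := FM g; rewrite ler_norml => /andP[].
Qed.

Lemma inf_convolution_lipschitz k f g :
  `|inf_convolution k f - inf_convolution k g| <= k%:R * sup_dist f g.
Proof.
have half f' g' : inf_convolution k f' - inf_convolution k g' <= k%:R * sup_dist f' g'.
  rewrite lerBlDr -lerBlDl; apply: inf_convolution_ge => h; rewrite lerBlDr.
  apply: le_trans (inf_convolution_le k f' h) _; rewrite -addrA lerD2l -mulrDr ler_wpM2l//.
  by rewrite addrC; exact: sup_dist_triangle.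
by rewrite ler_norml half andbT lerNl opprB sup_dist_sym half.
Qed.

Lemma inf_convolution_mono k k' f : (k <= k')%N -> inf_convolution k f <= inf_convolution k' f.
Proof.
move=> kk; apply: inf_convolution_ge => g; apply: le_trans (inf_convolution_le k f g) _.
by rewrite lerD2l ler_wpM2r ?sup_dist_ge0// ler_nat.
Qed.

(** If all regularizations stayed below [F f - e], there would be points [g k] with
    [F (g k) < F f - e] and [k.+1 * sup_dist f (g k)] bounded; they converge to [f], against lower
    semicontinuity. *)
Lemma inf_convolution_cvg f : lower_semicontinuous F -> inf_convolution k f @[k --> \oo] --> F f.
Proof.
move=> lF; apply/cvgrPdist_le => e e0.
suff [k0 hk] : exists k0, F f - e <= inf_convolution k0 f.
  exists k0 => // k /= kk; rewrite ger0_norm ?subr_ge0 ?inf_convolution_le_id//.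
  by rewrite lerBlDr addrC -lerBlDr; apply: le_trans hk _; exact: inf_convolution_mono.
apply: contrapT => nh; have M0 : 0 <= M := le_trans (normr_ge0 _) (FM f).
have bad k : exists g, F g + k%:R * sup_dist f g < F f - e.
  apply: contrapT => ng; apply: nh; exists k; apply: inf_convolution_ge => g.
  by rewrite leNgt; apply/negP => h; apply: ng; exists g.
pose g k := projT1 (cid (bad k.+1)).
have hg k : F (g k) + k.+1%:R * sup_dist f (g k) < F f - e by exact: (projT2 (cid (bad k.+1))).
have gf : J1_cvg g f.
  apply: J1_cvg_sup_dist => e1 e10.
  have e2 : 0 < e1 / (2 * M + 1) by rewrite divr_gt0// ltr_wpDl// mulr_ge0.
  have [k1] := ltr_add_invr e2; rewrite add0r => hk1.
  exists k1 => // k /= kk; rewrite sup_dist_sym.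
  have : k.+1%:R * sup_dist f (g k) <= 2 * M + 1.
    have := hg k; have := FM f; have := FM (g k); rewrite !ler_norml => /andP[h1 _] /andP[_ h2].
    by move: (k.+1%:R * _) => x; lra.
  rewrite -ler_pdivlMl// => /le_trans; apply.
  have : k.+1%:R^-1 <= e1 / (2 * M + 1) by apply: le_trans (ltW hk1); rewrite lef_pV2 ?posrE// ler_nat.
  by rewrite ler_pdivlMr// ltr_wpDl// mulr_ge0.
have [k _ hk] := lF _ _ gf _ e0.
have := hk k (leqnn k); rewrite leNgt => /negP; apply; apply: le_lt_trans (hg k).
by rewrite lerDl mulr_ge0// sup_dist_ge0.
Qed.
End skorokhod_distance.

Lemma continuous_lower_semicontinuous {R : realType} (F : skorokhod R -> R) : continuous F -> lower_semicontinuous F.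
Proof.
move=> /continuousP cF f f_ ff e e0.
have oU : J1_open (F @^-1` [set y | F f - e < y]).
  by have := cF _ (@open_gt _ (F f - e)); rewrite /open.
have Uf : (F @^-1` [set y | F f - e < y]) f by rewrite /= ltrBlDr ltrDl.
by apply: filterS (oU f f_ Uf ff) => n /= /ltW.
Qed.

(** * From Lipschitz functions to weak convergence *)

Section weak_convergence.
Context {R : realType} {d} {T : measurableType d} (P : probability T R).
Context {d'} {T' : measurableType d'} (P' : probability T' R).
Variables (Z_ : nat -> T -> skorokhod R) (Z : T' -> skorokhod R).

Definition dist_lipschitz (G : skorokhod R -> R) := (exists M : R, forall f, `|G f| <= M) /\
  exists2 k : R, 0 <= k & forall f g, `|G f - G g| <= k * sup_dist f g.

Lemma inf_convolution_dist_lipschitz (F : skorokhod R -> R) (M : R) k : (forall f, `|F f| <= M) ->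
  dist_lipschitz (inf_convolution F k).
Proof.
move=> FM; split; first by exists M => f; exact: inf_convolution_bound.
by exists k%:R => // f g; exact: (inf_convolution_lipschitz FM).
Qed.

Lemma measurable_lower_semicontinuous d1 (S : measurableType d1) (Y : S -> skorokhod R) (F : skorokhod R -> R) (M : R) :
  (forall G, dist_lipschitz G -> meas_fun (G \o Y)) ->
  (forall f, `|F f| <= M) -> lower_semicontinuous F -> meas_fun (F \o Y).
Proof.
move=> h FM lF; apply: (@measurable_fun_cvg _ S R setT (fun k => inf_convolution F k \o Y)).
  by move=> k; apply: h; exact: inf_convolution_dist_lipschitz.
by move=> w _; exact: (inf_convolution_cvg FM).
Qed.

(** The indicator of an open set is lower semicontinuous, hence a pointwise limit of Lipschitz
    functions, and open sets generate the sigma-algebra. *)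
Lemma measurable_skorokhod d1 (S : measurableType d1) (Y : S -> skorokhod R) :
  (forall G, dist_lipschitz G -> meas_fun (G \o Y)) ->
  forall B, <<s open >> B -> measurable (Y @^-1` B).
Proof.
move=> h; apply: smallest_sub => [|U oU].
  split; first by rewrite /= preimage_set0.
    move=> A mA; rewrite setTD preimage_setC; exact: measurableC.
  by move=> A mA; rewrite preimage_bigcup; exact: bigcupT_measurable.
have FM f : `|(\1_U f : R)| <= 1 by rewrite indicE ger0_norm ?ler0n// lern1 leq_b1.
have lU : lower_semicontinuous (\1_U : skorokhod R -> R).
  move=> f f_ ff e e0; have [Uf|nUf] := pselect (U f).
    apply: filterS (oU f f_ Uf ff) => n Un; rewrite !indicE !mem_set// lerBlDr lerDl; exact: ltW.
  near=> n; rewrite [\1_U f]indicE memNset//; apply: (@le_trans _ _ 0); last by rewrite indicE.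
  by rewrite sub0r oppr_le0 ltW.
have := measurable_lower_semicontinuous h FM lU.
move=> /(_ measurableT [set 1] (measurable_set1 1)); rewrite setTI; congr measurable.
apply/seteqP; split => w /=; rewrite indicE; last by move=> Uw; rewrite mem_set.
by case: (pselect (U (Y w))) => // nU; rewrite memNset// => /eqP; rewrite eq_sym oner_eq0.
Unshelve. all: by end_near.
Qed.

Lemma mean_cvg_bounded d1 (S : measurableType d1) (Q : probability S R) (f_ : nat -> S -> R) (f : S -> R) (M : R) :
  (forall k, meas_fun (f_ k)) -> (forall k w, `|f_ k w| <= M) ->
  (forall w, f_ k w @[k --> \oo] --> f w) -> mean Q (f_ k) @[k --> \oo] --> mean Q f.
Proof.
move=> mf fM ff; have mfl : meas_fun f.
  by apply: (@measurable_fun_cvg _ S R setT f_) => // w _; exact: ff.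
have c1 : {ae Q, forall w, [set: S] w -> (f_ k w)%:E @[k --> \oo] --> (f w)%:E}.
  by apply: aeW => w _; apply: cvg_EFin; [exact: nearW|exact: ff].
have c2 : {ae Q, forall w, forall k, [set: S] w -> (`|(f_ k w)%:E| <= M%:E)%E}.
  by apply: aeW => w k _; rewrite /= lee_fin.
have [_ _ h] := @dominated_convergence _ S R Q setT measurableT (fun k w => (f_ k w)%:E) (fun w => (f w)%:E) (fun=> M%:E)
  (fun k => proj2 (measurable_EFinP _ _) (mf k)) (proj2 (measurable_EFinP _ _) mfl)
  c1
  (bounded_meas_integrable Q (bounded_meas_cst M)) c2.
apply: fine_cvg; move: h; rewrite mean_EFin//.
split=> //; exists M => w; apply/ler_addgt0Pl => e e0.
have /cvgrPdist_le/(_ e e0)[k _ /(_ k (leqnn k)) hk] := ff w.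
by rewrite -[f w](subrK (f_ k w)); apply: le_trans (ler_normD _ _) _; exact: lerD.
Qed.

Hypotheses (measurableZ_ : forall n G, dist_lipschitz G -> meas_fun (G \o Z_ n))
  (measurableZ : forall G, dist_lipschitz G -> meas_fun (G \o Z)).
Hypothesis cvg_mean : forall G, dist_lipschitz G -> forall e : R, 0 < e ->
  exists n0 : nat, forall n, (n0 <= n)%N -> `|mean P (G \o Z_ n) - mean P' (G \o Z)| <= e.

(** [F] dominates its regularizations, whose means along [Z_ n] converge; a regularization of large
    index loses at most [e / 2] in mean at [Z]. *)
Let mean_liminf (F : skorokhod R -> R) (M : R) : (forall f, `|F f| <= M) -> lower_semicontinuous F ->
  forall e : R, 0 < e -> exists n0 : nat, forall n, (n0 <= n)%N -> mean P' (F \o Z) - e <= mean P (F \o Z_ n).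
Proof.
move=> FM lF e e0; have e20 : 0 < e / 2 by rewrite divr_gt0.
have bG k f := inf_convolution_bound FM k f.
have := @mean_cvg_bounded _ _ P' (fun k => inf_convolution F k \o Z) (F \o Z) M
  (fun k => measurableZ (inf_convolution_dist_lipschitz k FM)) (fun k w => bG k (Z w))
  (fun w => inf_convolution_cvg FM lF).
move=> /cvgrPdist_le/(_ _ e20)[k _ /(_ k (leqnn k))/=].
rewrite ler_distl => /andP[_ hk].
have lipk := inf_convolution_dist_lipschitz k FM.
have [n0 hn] := cvg_mean lipk e20.
exists n0 => n /hn; rewrite ler_distl => /andP[h1 _].
have : mean P (inf_convolution F k \o Z_ n) <= mean P (F \o Z_ n).
  apply: mean_le.
  - by apply: (bounded_measI (M := M)) => [|w /=]; [exact: measurableZ_|exact: bG].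
  - by apply: (bounded_measI (M := M)) => [|w /=]; [exact: (measurable_lower_semicontinuous (@measurableZ_ n) FM)|exact: FM].
  - by move=> w; exact: (inf_convolution_le_id FM).
apply: le_trans; apply: le_trans h1.
by move: hk; move: (mean P' (F \o Z)) (mean P' (inf_convolution F k \o Z)) => a b; lra.
Qed.

Lemma cvg_expectation (F : skorokhod R -> R) : continuous F -> (exists M : R, forall f, `|F f| <= M) ->
  ('E_P[F \o Z_ n] @[n --> \oo] --> 'E_P'[F \o Z])%E.
Proof.
move=> cF [M FM]; have lF := continuous_lower_semicontinuous cF.
have NM f : `|- F f| <= M by rewrite normrN.
have lN : lower_semicontinuous (fun f => - F f).
  by apply: continuous_lower_semicontinuous => f; exact: cvgN (cF f).
have bZn n : bounded_meas (F \o Z_ n).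
  by apply: (bounded_measI (M := M)) => [|w /=]; [exact: (measurable_lower_semicontinuous (@measurableZ_ n) FM)|exact: FM].
have bZ : bounded_meas (F \o Z).
  by apply: (bounded_measI (M := M)) => [|w /=]; [exact: (measurable_lower_semicontinuous measurableZ FM)|exact: FM].
have neg d1 (S : measurableType d1) (Q : probability S R) (Y : S -> skorokhod R) : bounded_meas (F \o Y) ->
    mean Q ((fun f => - F f) \o Y) = - mean Q (F \o Y).
  by move=> bY; rewrite -mulN1r -meanZ//; congr mean; apply/funext => w; rewrite mulN1r.
have -> : ('E_P'[F \o Z] = (mean P' (F \o Z))%:E)%E by rewrite unlock; exact: mean_EFin.
have -> : (fun n => 'E_P[F \o Z_ n])%E = (fun n => (mean P (F \o Z_ n))%:E).
  by apply/funext => n; rewrite unlock; exact: mean_EFin.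
apply: cvg_EFin; first exact: nearW.
apply/cvgrPdist_le => e e0.
have [n1 h1] := mean_liminf FM lF e0; have [n2 h2] := mean_liminf NM lN e0.
exists (maxn n1 n2) => // n /=; rewrite geq_max => /andP[/h1 {}h1 /h2 {}h2].
rewrite !neg// in h2; rewrite ler_distl; apply/andP; split; first by move: h1; lra.
by move: h2; lra.
Qed.
End weak_convergence.

(** * Step paths and continuous paths as elements of the Skorokhod space *)

Section paths.
Context {R : realType}.
Implicit Types (c t e : R) (u : nat -> R * R) (x : R -> R) (y : nat -> R).

Lemma pair_norm_le (z : R * R) e : (`|z| <= e) = (`|z.1| <= e) && (`|z.2| <= e).
Proof. by rewrite [`|z|]/(Num.max _ _) ge_max. Qed.

Definition step_fun c u t : R * R := if t < 0 then 0 else u (Num.truncn (c * t)).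

Lemma step_fun_neg c u t : t < 0 -> step_fun c u t = 0.
Proof. by rewrite /step_fun => ->. Qed.

Lemma step_fun_cadlag c u : 0 <= c -> cadlag (step_fun c u).
Proof.
rewrite le_eqVlt => /predU1P[<-|c0]; split => t t0.
- apply: cvg_near_cst; near=> s.
  have ts : t < s by near: s; exact: nbhs_right_gt.
  by rewrite /step_fun !mul0r !ltNge t0 (le_trans t0 (ltW ts)).
- exists (u 0%N); apply: cvg_near_cst; near=> s.
  have s0 : 0 < s by near: s; exact: nbhs_left_gt.
  by rewrite /step_fun mul0r truncn0 ltNge ltW.
- have ct0 : 0 <= c * t by rewrite mulr_ge0// ltW.
  have /andP[kt tk] := truncn_itv ct0.
  apply: cvg_near_cst; near=> s.
  have ts : t < s by near: s; exact: nbhs_right_gt.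
  have sk : s < (Num.truncn (c * t)).+1%:R / c.
    by near: s; apply: nbhs_right_lt; rewrite ltr_pdivlMr// mulrC.
  have s0 : 0 <= s := le_trans t0 (ltW ts).
  rewrite /step_fun !ltNge t0 s0 /=; congr u; apply: truncn_def.
  rewrite [c * s]mulrC -ltr_pdivlMr// sk andbT; apply: le_trans kt _.
  by rewrite [s * c]mulrC; apply: ler_wpM2l; exact: ltW.
- have ct0 : 0 < c * t by rewrite mulr_gt0.
  have [k kt tk] : exists2 k : nat, k%:R < c * t & c * t <= k.+1%:R.
    have /andP[kt tk] := truncn_itv (ltW ct0).
    move: kt; rewrite le_eqVlt => /predU1P[kt|kt]; last by exists (Num.truncn (c * t)) => //; exact: ltW.
    case E : (Num.truncn (c * t)) kt => [|k] kt; first by move: ct0; rewrite -kt ltxx.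
    by exists k; rewrite -kt// ltr_nat.
  exists (u k); apply: cvg_near_cst; near=> s.
  have s0 : 0 < s by near: s; exact: nbhs_left_gt.
  have st : s < t by near: s; exact: nbhs_left_lt.
  have ks : k%:R / c < s by near: s; apply: nbhs_left_gt; rewrite ltr_pdivrMr// mulrC.
  rewrite /step_fun ltNge (ltW s0) /=; congr u; apply: truncn_def.
  rewrite [c * s]mulrC -ler_pdivrMr// (ltW ks)/=; apply: lt_le_trans tk.
  by rewrite [c * t]mulrC ltr_pM2r.
Unshelve. all: by end_near.
Qed.

Definition step_path c u (c0 : 0 <= c) : skorokhod R := Skorokhod (@step_fun_neg c u) (step_fun_cadlag u c0).

Lemma step_pathE c u (c0 : 0 <= c) t : 0 <= t -> step_path u c0 t = u (Num.truncn (c * t)).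
Proof. by move=> t0; rewrite /= /step_fun ltNge t0. Qed.

Lemma dist_lipschitz_cvg (G : skorokhod R -> R) (f_ : nat -> skorokhod R) f : dist_lipschitz G ->
  (forall e, 0 < e -> \forall k \near \oo, sup_dist (f_ k) f <= e) -> G (f_ k) @[k --> \oo] --> G f.
Proof.
move=> [_ [k k0 Gk]] h; apply/cvgrPdist_le => e e0.
have e1 : 0 < e / (k + 1) by rewrite divr_gt0// ltr_wpDl.
apply: filterS (h _ e1) => n hn; rewrite distrC; apply: le_trans (Gk _ _) _.
apply: (@le_trans _ _ ((k + 1) * sup_dist (f_ n) f)); first by rewrite ler_wpM2r ?sup_dist_ge0// lerDl.
by rewrite mulrC -ler_pdivlMr// ltr_wpDl.
Qed.

(** Each state is coded by one integer [V k]. Up to a fixed time the path depends on finitely many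
    of these codes, so truncated paths, measurable for any [G], converge for [sup_dist]. *)
Lemma measurable_step_path d (S : measurableType d) c (c0 : 0 <= c) (q : nat -> R * R) (V : nat -> S -> nat) (G : skorokhod R -> R) :
  dist_lipschitz G -> (forall k, meas_fun (V k)) ->
  meas_fun (fun w => G (step_path (fun k => q (V k w)) c0)).
Proof.
move=> lG mV; pose Y K (w : S) := step_path (fun k => q (if (k < K)%N then V k w else 0%N)) c0.
apply: (@measurable_fun_cvg _ S R setT (fun K w => G (Y K w))).
  move=> K; exact: (measurable_discrete_history (fun j _ => mV j) (fun z => G (step_path (fun k => q (z k)) c0))).
move=> w _; apply: dist_lipschitz_cvg => // e e0.
pose T := e^-1; have T0 : 0 <= T by rewrite invr_ge0 ltW.
exists (Num.truncn (c * T)).+1 => // K /= TK.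
apply: (@sup_dist_near _ _ _ T); rewrite ?(ltW e0)//.
  by rewrite -[leRHS]invrK lef_pV2 ?posrE ?invr_gt0 ?ltr_pwDl// lerDr.
move=> t /andP[t0 tT]; rewrite !step_pathE// ifT ?subrr ?normr0 ?ltW//.
apply: leq_ltn_trans TK; apply: le_truncn; exact: ler_wpM2l.
Qed.

Definition continuous_fun x x' t : R * R := if t < 0 then 0 else (x t, x' t).

Lemma continuous_fun_cadlag x x' : cpath x -> cpath x' -> cadlag (continuous_fun x x').
Proof.
move=> cx cx'.
have near_t t e : 0 <= t -> 0 < e -> exists2 dt : R, 0 < dt & forall s, 0 <= s -> `|s - t| < dt ->
    `|continuous_fun x x' t - continuous_fun x x' s| <= e.
  move=> t0 e0; have [d1 d10 h1] := cx _ _ t0 e0; have [d2 d20 h2] := cx' _ _ t0 e0.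
  exists (Num.min d1 d2); first by rewrite lt_min d10.
  move=> s s0; rewrite lt_min => /andP[s1 s2]; rewrite /continuous_fun !ltNge t0 s0/= pair_norm_le/=.
  by rewrite distrC ltW ?h1//= distrC ltW ?h2.
split=> t t0; last exists (continuous_fun x x' t); apply/cvgrPdist_le => e e0.
- have [dt dt0 h] := near_t t e t0 e0; near=> s.
  have ts : t < s by near: s; exact: nbhs_right_gt.
  have st : s < t + dt by near: s; apply: nbhs_right_lt; rewrite ltrDl.
  apply: h; first exact: le_trans t0 (ltW ts).
  by rewrite ger0_norm ?subr_ge0 ?(ltW ts)// ltrBlDl.
- have [dt dt0 h] := near_t t e (ltW t0) e0; near=> s.
  have s0 : 0 < s by near: s; exact: nbhs_left_gt.
  have st : s < t by near: s; exact: nbhs_left_lt.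
  have ts : t - dt < s by near: s; apply: nbhs_left_gt; rewrite ltrBlDr ltrDl.
  by apply: h; [exact: ltW|rewrite distrC ger0_norm ?subr_ge0 ?(ltW st)// ltrBlDr -ltrBlDl].
Unshelve. all: by end_near.
Qed.

Definition time_integral x t : R := \int[lebesgue_measure]_(s in `[0, t]) x s.

Lemma time_integral_increment x s t (z e : R) : cpath x -> 0 <= s -> s <= t ->
  (forall p, s <= p <= t -> `|x p - z| <= e) ->
  `|time_integral x t - time_integral x s - z * (t - s)| <= e * (t - s).
Proof.
move=> cx s0 st xz.
have cst0 (a : R) : cpath (fun=> a) by move=> a1 b1 _ b10; exists 1 => // s' _ _; rewrite subrr normr0.
have I0 (g : R -> R) : cpath g -> lebesgue_measure.-integrable `[0%R, t]%classic (EFin \o g).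
  move=> cy; apply: continuous_compact_integrable; first exact: segment_compact.
  have := proj2 (cpathP g) cy; apply: continuous_subspaceW => p /=; rewrite !in_itv/= => /andP[->].
  by [].
have I (g : R -> R) : cpath g -> lebesgue_measure.-integrable `]s, t]%classic (EFin \o g).
  by move=> cg; apply: (integrableS _ _ _ (I0 g cg)) => //; apply: subset_itvScc; rewrite bnd_simp.
have ix := I0 _ cx.
have muE : fine (lebesgue_measure `]s, t]%classic) = t - s.
  rewrite lebesgue_measure_itv/= lte_fin; case: ltP => [_|ts]; first by rewrite -EFinD.
  by rewrite (@le_anti _ _ s t) ?st// subrr.
rewrite /time_integral Rintegral_itvB ?bnd_simp//.
have -> : z * (t - s) = \int[lebesgue_measure]_(p in `]s, t]) z by rewrite Rintegral_cst// muE.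
have idf : lebesgue_measure.-integrable `]s, t]%classic (EFin \o (fun p => x p - z)) by apply: I; exact: cpath_sub.
rewrite -(RintegralB _ (I _ cx) (I _ (cst0 z)))//; apply: le_trans (le_normr_Rintegral _ idf) _ => //.
rewrite -muE -Rintegral_cst//; apply: le_Rintegral => //.
- exact: (integrable_abse idf).
- exact: (I _ (cst0 e)).
- by move=> p; rewrite /= in_itv/= => /andP[sp pt]; apply: xz; rewrite (ltW sp).
Qed.
End paths.

Lemma mean_paths_near {R : realType} G (e : R) : dist_lipschitz G -> 0 < e ->
  exists (K : nat) (dt : R), 0 < dt /\ forall d (S : measurableType d) (P : probability S R) (A B : S -> skorokhod R),
  meas_fun (G \o A) -> meas_fun (G \o B) ->
  most P dt (fun w => forall t : R, 0 <= t <= K%:R -> `|A w t - B w t| <= dt) ->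
  `|mean P (G \o A) - mean P (G \o B)| <= e.
Proof.
move=> lG e0; have [[M GM] [k k0 Gk]] := lG.
have M0 : 0 <= M := le_trans (normr_ge0 _) (GM (step_path (fun=> 0) (lexx 0))).
pose e' := e / (1 + 2 * M).
have M10 : 0 < 1 + 2 * M by rewrite ltr_pwDl// mulr_ge0.
have e'0 : 0 < e' by rewrite divr_gt0.
have k10 : 0 < k + 1 by rewrite ltr_wpDl.
pose e2 := Num.min e' (e' / (k + 1)).
have e20 : 0 < e2 by rewrite lt_min e'0 divr_gt0.
have [K hK] : exists K : nat, e2^-1 <= K%:R.
  by exists (Num.truncn e2^-1).+1; exact/ltW/truncnS_gt.
exists K, e2; split => // d S P A B mA mB h.
have eE : e' + 2 * M * e' = e by rewrite -[X in X + _]mul1r -mulrDl [LHS]mulrC divfK// gt_eqF.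
rewrite -[leRHS]eE; apply: mean_most => //; [by move=> w; exact: GM|by move=> w; exact: GM|exact: ltW|].
apply: most_le (most_imp _ h); first by rewrite ge_min lexx.
move=> w hw; apply: le_trans (Gk _ _) _; apply: (@le_trans _ _ ((k + 1) * e2)); last first.
  by rewrite mulrC -ler_pdivlMr// ge_min lexx orbT.
apply: ler_pM => //; [exact: sup_dist_ge0|by rewrite lerDl|].
apply: (@sup_dist_near _ _ _ K%:R) => //; first exact: ltW.
by rewrite -[leRHS]invrK lef_pV2 ?posrE ?invr_gt0 ?ltr_pwDl//; apply: le_trans hK _; rewrite lerDr.
Qed.

(** * The limit path and its skeletons *)

Section limit_paths.
Context {R : realType}.
Implicit Types (t e : R) (x : R -> R) (y : nat -> R).
Variable a : R.
Hypothesis a0 : 0 <= a.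

(** The second component is [a] times a left Riemann sum of the first. The index stops at
    [r.+1 ^ 2], that is at time [r.+1], so that finitely many coordinates determine the path and
    [ucont] applies. *)
Definition skeleton_path r y : skorokhod R :=
  step_path (fun k => let k' := minn k (r.+1 ^ 2) in (y k', a / r.+1%:R * \sum_(j < k') y j)) (ler0n R r.+1).

Lemma skeleton_path_near r y y' e t (B : R) : 0 <= e -> 0 <= t ->
  (minn (Num.truncn (r.+1%:R * t)) (r.+1 ^ 2))%:R <= B * r.+1%:R ->
  (forall j, (j <= minn (Num.truncn (r.+1%:R * t)) (r.+1 ^ 2))%N -> `|y j - y' j| <= e) ->
  `|skeleton_path r y t - skeleton_path r y' t| <= (1 + a * B) * e.
Proof.
move=> e0 t0; rewrite !step_pathE//; set k := minn _ _ => kB h.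
have B0 : 0 <= B by rewrite -(pmulr_lge0 _ (ltr0Sn R r)) (le_trans _ kB).
rewrite pair_norm_le/=; apply/andP; split.
  by apply: le_trans (h k (leqnn k)) _; rewrite mulrDl mul1r lerDl !mulr_ge0.
apply: (@le_trans _ _ (a * B * e)); last by rewrite mulrDl mul1r lerDr.
rewrite -mulrBr -sumrB normrM (ger0_norm (divr_ge0 a0 (ler0n _ _))) -!mulrA; apply: ler_wpM2l => //.
rewrite ler_pdivrMl//; apply: le_trans (ler_norm_sum _ _ _) _.
apply: (@le_trans _ _ (\sum_(j < k) e)); first by apply: ler_sum => j _; apply: h; exact: ltnW.
rewrite sumr_const card_ord -[e *+ k]mulr_natl; apply: le_trans (ler_wpM2r e0 kB) _.
by rewrite le_eqVlt; apply/orP; left; apply/eqP; ring.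
Qed.

Lemma ucont_skeleton r G : dist_lipschitz G -> ucont (r.+1 ^ 2) (fun y => G (skeleton_path r y)).
Proof.
move=> [_ [k k0 Gk]] e e0; pose c := (k + 1) * (1 + a * r.+1%:R).
have c0 : 0 < c.
  apply: mulr_gt0; first exact: ltr_wpDl.
  by apply: ltr_wpDr => //; exact: mulr_ge0.
exists (e / c); first by rewrite divr_gt0.
move=> y y' yy; apply: le_trans (Gk _ _) _.
have ec0 : 0 <= e / c by rewrite divr_ge0// ltW.
have D0 : 0 <= (1 + a * r.+1%:R) * (e / c) by rewrite mulr_ge0// addr_ge0// mulr_ge0.
have : sup_dist (skeleton_path r y) (skeleton_path r y') <= (1 + a * r.+1%:R) * (e / c).
  apply: sup_dist_le => t t0; rewrite ge_min skeleton_path_near//.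
    by rewrite -natrM ler_nat -[(r.+1 * r.+1)%N]/(r.+1 ^ 2)%N geq_minr.
  by move=> j jk; apply: yy; apply: leq_trans jk _; exact: geq_minr.
move=> /(ler_wpM2l k0) /le_trans; apply.
have E : (k + 1) * ((1 + a * r.+1%:R) * (e / c)) = e by rewrite mulrA -/c mulrCA divff ?mulr1 ?gt_eqF.
by rewrite -[leRHS]E ler_wpM2r// lerDl.
Qed.

Lemma cpath_time_integral x : cpath x -> cpath (time_integral x).
Proof.
move=> cx t e t0 e0; have [M hM] := cpath_bounded cx (addr_ge0 t0 ler01).
have M0 : 0 <= M by apply: le_trans (hM 0 _); rewrite // lexx addr_ge0.
have M1 : 0 < M + 1 by rewrite ltr_wpDl.
have lip s s' : 0 <= s -> s <= s' -> s' <= t + 1 -> `|time_integral x s' - time_integral x s| <= M * (s' - s).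
  move=> s0 ss st; have := time_integral_increment (z := 0) (e := M) cx s0 ss.
  rewrite mul0r subr0; apply=> p /andP[sp ps]; rewrite subr0; apply: hM.
  by rewrite (le_trans s0 sp) (le_trans ps st).
exists (Num.min 1 (e / (M + 1))); first by rewrite lt_min ltr01 divr_gt0.
move=> s' s'0; rewrite lt_min => /andP[h1 h2].
have h3 : (M + 1) * `|s' - t| < e by rewrite mulrC -ltr_pdivlMr.
apply: le_lt_trans h3; apply: (@le_trans _ _ (M * `|s' - t|)); last by rewrite ler_wpM2r// lerDl.
have [st|ts] := leP s' t.
  rewrite distrC; apply: le_trans (lip _ _ s'0 st _) _; first by rewrite lerDl.
  by rewrite distrC ger0_norm ?subr_ge0.
apply: le_trans (lip _ _ t0 (ltW ts) _) _; last by rewrite ger0_norm// subr_ge0 ltW.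
by rewrite -lerBlDl ltW//; apply: le_lt_trans h1; exact: ler_norm.
Qed.

Lemma continuous_fun_neg x x' t : t < 0 -> continuous_fun x x' t = 0.
Proof. by rewrite /continuous_fun => ->. Qed.

Definition limit_path x (cx : cpath x) : skorokhod R :=
  Skorokhod (@continuous_fun_neg x (fun t => a * time_integral x t))
    (continuous_fun_cadlag cx (cpathZ a (cpath_time_integral cx))).

(** Up to a time [T >= 1 / e], [x] oscillates by at most [e1] over a step, which controls the
    Riemann sums, and the incomplete last step costs at most [M * h]; later times are cut off by
    [sup_dist]. *)
Lemma limit_path_skeleton x (cx : cpath x) e : 0 < e -> exists r0 : nat, forall r, (r0 <= r)%N ->
  sup_dist (skeleton_path r (fun j => x (etime r j))) (limit_path cx) <= e.
Proof.
move=> e0; have [T hT] : exists T : nat, e^-1 <= T%:R.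
  by exists (Num.truncn e^-1).+1; exact/ltW/truncnS_gt.
have T0 : 0 <= T%:R :> R by [].
have [M hM] := cpath_bounded cx T0.
have M0 : 0 <= M by apply: le_trans (hM 0 _); rewrite // lexx.
pose e1 := e / (1 + 2 * a * T%:R).
have c10 : 0 < 1 + 2 * a * T%:R by rewrite ltr_pwDl// !mulr_ge0.
have e10 : 0 < e1 by rewrite divr_gt0.
have e1e : e1 <= e by rewrite ler_pdivrMr// ler_peMr ?(ltW e0)// lerDl !mulr_ge0.
have e1T : a * (e1 * T%:R) <= e / 2.
  have -> : a * (e1 * T%:R) = e / 2 * (2 * a * T%:R / (1 + 2 * a * T%:R)) by rewrite /e1; field; rewrite gt_eqF.
  by apply: ler_piMr; [rewrite divr_ge0// ltW|rewrite ler_pdivrMr// mul1r lerDr].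
have [dt dt0 hdt] := cpath_uniform cx T0 e10.
have [r1] := ltr_add_invr dt0; rewrite add0r => hr1.
have aM0 : 0 < 2 * a * M + 1 by rewrite ltr_wpDl// !mulr_ge0.
have [r2] := ltr_add_invr (divr_gt0 e0 aM0); rewrite add0r => hr2.
exists (maxn T (maxn r1 r2)) => r; rewrite !geq_max => /and3P[Tr r1r r2r].
set h := r.+1%:R^-1 : R; have h0 : 0 < h by rewrite invr_gt0.
have hdt' : h <= dt by apply: le_trans (ltW hr1); rewrite lef_pV2 ?posrE// ler_nat.
have hM' : a * (M * h) <= e / 2.
  have h2 : h <= e / (2 * a * M + 1) by apply: le_trans (ltW hr2); rewrite lef_pV2 ?posrE// ler_nat.
  have : (2 * a * M + 1) * h <= e by rewrite mulrC -ler_pdivlMr.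
  have -> : a * (M * h) = (2 * a * M * h) / 2 by field.
  rewrite ler_pM2r ?invr_gt0//; apply: le_trans; rewrite ler_wpM2r ?(ltW h0)// lerDl.
  exact: ler01.
apply: (@sup_dist_near _ _ _ T%:R) => //; first exact: ltW.
  by rewrite -[leRHS]invrK lef_pV2 ?posrE ?invr_gt0 ?ltr_pwDl//; apply: le_trans hT _; rewrite lerDr.
move=> t /andP[t0 tT].
have rt0 : 0 <= r.+1%:R * t by exact: mulr_ge0.
have /andP[kt tk] := truncn_itv rt0; set k := Num.truncn (r.+1%:R * t) in kt tk.
have ktm : etime r k <= t by rewrite ler_pdivrMr// mulrC.
have tkm : t <= etime r k.+1 by rewrite ler_pdivlMr// mulrC ltW.
have kK : (k <= r.+1 ^ 2)%N.
  rewrite -(ler_nat R); apply: le_trans kt _; rewrite natrX expr2 ler_wpM2l//; apply: le_trans tT _.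
  by rewrite ler_nat ltnW.
rewrite step_pathE// -/k /= /continuous_fun ltNge t0/= (minn_idPl kK) pair_norm_le/=.
have osc i s : (i <= k)%N -> etime r i <= s <= etime r i.+1 -> s <= t -> `|x s - x (etime r i)| <= e1.
  move=> ik /andP[is1 si] st.
  have i0 : 0 <= etime r i :> R := etime_ge0 r i.
  have it : etime r i <= T%:R :> R by apply: le_trans (le_trans ktm tT); rewrite etime_le.
  apply: hdt; rewrite ?i0 ?it ?(le_trans i0 is1) ?(le_trans st tT)//.
  by rewrite ger0_norm ?subr_ge0//; apply: le_trans hdt'; rewrite lerBlDl /h -etimeS.
apply/andP; split.
  by rewrite distrC; apply: le_trans (osc k t (leqnn k) _ (lexx t)) e1e; rewrite ktm.
have sum i : (i <= k)%N -> `|time_integral x (etime r i) - h * \sum_(j < i) x (etime r j)| <= e1 * etime r i.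
  elim: i => [_|i IH ik].
    rewrite big_ord0 mulr0 subr0 /etime !mul0r mulr0.
    have := time_integral_increment (s := 0) (t := 0) (z := 0) (e := M) cx (lexx _) (lexx _).
    rewrite /time_integral set_itv1 Rintegral_set1 normr0.
    by [].
  have it1 : etime r i.+1 <= t by apply: le_trans ktm; rewrite etime_le.
  have := @time_integral_increment R x (etime r i) (etime r i.+1) (x (etime r i)) e1 cx (etime_ge0 r i).
  rewrite etime_le => /(_ (leqnSn i)) st.
  have {}st := st (fun p hp => osc i p (ltnW ik) hp (le_trans (proj2 (andP hp)) it1)).
  have dE : etime r i.+1 - etime r i = h by rewrite etimeS addrAC subrr add0r.
  rewrite dE in st; have := lerD (IH (ltnW ik)) st => hh.
  rewrite big_ord_recr/= [in leRHS]etimeS [leRHS]mulrDr; apply: le_trans hh; apply: le_trans (ler_normD _ _).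
  by rewrite le_eqVlt; apply/orP; left; apply/eqP; congr `|_|; rewrite etimeS; ring.
have last : `|time_integral x t - time_integral x (etime r k)| <= M * h.
  have := @time_integral_increment R x (etime r k) t 0 M cx (etime_ge0 r k) ktm.
  rewrite mul0r subr0 => hl; apply: le_trans (hl _) _.
    move=> p /andP[kp pt]; rewrite subr0; apply: hM.
    by rewrite (le_trans (etime_ge0 r k) kp) (le_trans pt tT).
  by apply: ler_wpM2l => //; rewrite lerBlDl /h -etimeS.
have -> : a / r.+1%:R * \sum_(j < k) x (etime r j) - a * time_integral x t =
    - (a * ((time_integral x (etime r k) - h * \sum_(j < k) x (etime r j)) + (time_integral x t - time_integral x (etime r k)))).
  by rewrite /h; ring.
rewrite normrN normrM (ger0_norm a0) [leRHS]splitr.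
apply: le_trans (ler_wpM2l a0 (ler_normD _ _)) _; rewrite mulrDr; apply: lerD.
  apply: le_trans e1T; apply: ler_wpM2l => //; apply: le_trans (sum k (leqnn k)) _.
  by apply: ler_wpM2l; [exact: ltW|exact: le_trans ktm tT].
by apply: le_trans hM'; exact: ler_wpM2l.
Qed.

Lemma measurable_limit_path d (S : measurableType d) (X : R -> S -> R) (cX : forall w, cpath (X^~ w)) G :
  dist_lipschitz G -> (forall t, 0 <= t -> meas_fun (X t)) ->
  meas_fun (fun w => G (limit_path (cX w))).
Proof.
move=> lG mX; apply: (@measurable_fun_cvg _ S R setT (fun r w => G (skeleton_path r (fun j => X (etime r j) w)))).
  move=> r; apply: (measurable_ucont (Y := fun j w => X (etime r j) w) (ucont_skeleton r lG)) => j _.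
  by apply: mX; exact: etime_ge0.
move=> w _; apply: dist_lipschitz_cvg => // e e0.
by have [r0 h] := limit_path_skeleton (cX w) e0; exists r0 => // r; exact: h.
Qed.

(** The limit path is compared with the skeleton of the solution itself, by dominated convergence,
    and this skeleton with the one of the Euler scheme by [solution_euler]. *)
Lemma mean_limit_path d (S : measurableType d) (P : probability S R) F W (m v : R) (X : R -> S -> R)
    (cX : forall w, cpath (X^~ w)) G e : dist_lipschitz G -> 0 <= v -> 0 < e ->
  wiener_process P F W -> sde_solution P F W (fun=> m) (diffusion_coef v) 0 X ->
  exists r0 : nat, forall r, (r0 <= r)%N ->
  `|mean P (fun w => G (limit_path (cX w))) - mean P (fun w => G (skeleton_path r (fun j => euler W m v r j w)))| <= e.
Proof.
move=> lG v0 e0 wW sX; have [[M GM] _] := lG.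
have mX t : 0 <= t -> meas_fun (X t).
  by case: sX wW => aX _ _ _ _ [[fF _] _ _ _ _]; exact: (adapted_measurable fF aX).
have mgrid r : meas_fun (fun w => G (skeleton_path r (fun j => X (etime r j) w))).
  apply: (measurable_ucont (Y := fun j w => X (etime r j) w) (ucont_skeleton r lG)) => j _.
  by apply: mX; exact: etime_ge0.
have meuler r : meas_fun (fun w => G (skeleton_path r (fun j => euler W m v r j w))).
  by apply: (measurable_ucont (Y := fun j w => euler W m v r j w) (ucont_skeleton r lG)) => j _; exact: (measurable_euler wW).
have e20 : 0 < e / 2 by rewrite divr_gt0.
have [r1 _ h1] : \forall r \near \oo, `|mean P (fun w => G (limit_path (cX w))) - mean P (fun w => G (skeleton_path r (fun j => X (etime r j) w)))| <= e / 2.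
  apply: (proj1 (@cvgrPdist_le _ _ _ _ _ _ _)) => //.
  apply: (mean_cvg_bounded (M := M)) => // w; apply: dist_lipschitz_cvg => // e1 e10.
  by have [r0 h] := limit_path_skeleton (cX w) e10; exists r0 => // r; exact: h.
have [K [dt [dt0 near]]] := mean_paths_near lG e20.
have aK0 : 0 < 1 + a * K%:R by rewrite ltr_pwDl// mulr_ge0.
pose e3 := Num.min dt (dt / (1 + a * K%:R)).
have e30 : 0 < e3 by rewrite lt_min dt0 divr_gt0.
have [r2 h2] := @solution_euler R m v K%:R e3 v0 (ler0n _ _) e30 _ S.
exists (maxn r1 r2) => r; rewrite geq_max => /andP[/h1/= {}h1 /h2 {}h2].
rewrite [leRHS]splitr; apply: le_trans (ler_distD _ _ _) _; apply: lerD h1 _.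
apply: (near _ _ P (fun w => skeleton_path r (fun j => X (etime r j) w)) (fun w => skeleton_path r (fun j => euler W m v r j w)) (mgrid r) (meuler r)).
apply: most_le (most_imp _ (h2 P F W X wW sX)); first by rewrite ge_min lexx.
move=> w hw t /andP[t0 tK].
have kK : (minn (Num.truncn (r.+1%:R * t)) (r.+1 ^ 2))%:R <= K%:R * r.+1%:R :> R.
  apply: (@le_trans _ _ (Num.truncn (r.+1%:R * t))%:R); first by rewrite ler_nat geq_minl.
  have /andP[h _] := truncn_itv (mulr_ge0 (ler0n R r.+1) t0).
  by apply: le_trans h _; rewrite mulrC ler_wpM2r.
apply: (@le_trans _ _ ((1 + a * K%:R) * e3)); last by rewrite mulrC -ler_pdivlMr// ge_min lexx orbT.
apply: skeleton_path_near => //; first exact: ltW.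
move=> j jk; have jK : (j <= r.+1 ^ 2)%N by apply: leq_trans jk _; exact: geq_minr.
have := hw (etime r j); rewrite (drifted_eulerE wW m v0 w jK); apply; rewrite etime_ge0 /=.
by rewrite ler_pdivrMr//; apply: le_trans kK; rewrite ler_nat.
Qed.
End limit_paths.

(** * Deterministic comparison of a step path with its skeleton *)

Section comparison.
Context {R : realType}.
Variables (X Y : nat -> nat) (y z : nat -> R) (n r T : nat) (a e C : R).
Notation N := (n.+1%:R : R).
Notation L := (n.+1 %/ r.+1)%N.
Hypotheses (a0 : 0 <= a) (e0 : 0 <= e) (C0 : 0 <= C).
Hypotheses (Tr : (T <= r.+1)%N)
  (TL : (r.+1 * T < L)%N)
  (hX : forall k, (k <= T * n.+1)%N -> `|(X k)%:R / N - y k| <= e)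
  (hyz : forall k, (k <= T * n.+1)%N -> `|y k - z k| <= e)
  (hy : forall k, (k <= T * n.+1)%N -> `|y k| <= C)
  (hjump : forall k, (k <= T * n.+1)%N -> (0 < k)%N -> (L %| k)%N -> `|y k - z k.-1| <= e).
Hypothesis hY : forall k, (k <= T * n.+1)%N ->
  `|(Y k)%:R / (n.+1 * n.+1)%:R - a * ((\sum_(l < k) (X l)%:R) / (n.+1 * n.+1)%:R)| <= e.
Hypothesis hz : forall j l, (l < L)%N -> z (j * L + l)%N = y (j * L)%N.

Let L0 : (0 < L)%N. Proof. exact: leq_ltn_trans TL. Qed.
Let N0 : 0 < N. Proof. by []. Qed.
Let tri (a1 a2 a3 b1 b2 : R) : `|a1 - a2| <= b1 -> `|a2 - a3| <= b2 -> `|a1 - a3| <= b1 + b2.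
Proof. by move=> h1 h2; apply: le_trans (ler_distD a2 _ _) _; exact: lerD. Qed.

Let e3E : 3 * e = e + e + e. Proof. by ring. Qed.

Let block_near j q : (q < L)%N -> (j * L + q <= T * n.+1)%N -> `|(X (j * L + q)%N)%:R / N - y (j * L)%N| <= e + e.
Proof. by move=> qL kT; rewrite -(hz j qL); exact: tri (hX kT) (hyz kT). Qed.

(** Since [L * r.+1] may be less than [n.+1], the generation reached at a given time is in block [i]
    or already in block [i.+1]; in the second case one jump between consecutive block values is
    added. *)
Let value_near i k : (i * L <= k < i.+2 * L)%N -> (k <= T * n.+1)%N -> `|(X k)%:R / N - y (i * L)%N| <= 3 * e.
Proof.
move=> /andP[ik ki] kT; have kE : k = (k %/ L * L + k %% L)%N := divn_eq k L.
have kL : (k %% L < L)%N by rewrite ltn_mod.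
have h1 : `|(X k)%:R / N - y (k %/ L * L)%N| <= e + e by rewrite {1}kE; apply: block_near => //; rewrite -kE.
have [ki'|ki'] := ltnP k (i.+1 * L).
  have dE : (k %/ L = i)%N by apply/eqP; rewrite eqn_leq -ltnS ltn_divLR// ki' leq_divRL.
  by rewrite dE in h1; apply: le_trans h1 _; rewrite e3E lerDl.
have dE : (k %/ L = i.+1)%N by apply/eqP; rewrite eqn_leq -ltnS ltn_divLR// ki leq_divRL.
rewrite dE in h1; have iL0 : (0 < i.+1 * L)%N by rewrite muln_gt0.
have := hjump (leq_trans ki' kT) iL0 (dvdn_mull _ (dvdnn L)).
have -> : (i.+1 * L).-1 = (i * L + L.-1)%N by rewrite mulSnr -subn1 -addnBA// subn1.
rewrite hz ?prednK// => h2; rewrite e3E; exact: tri h1 h2.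
Qed.

Let mass_blocks i : (i * L <= T * n.+1)%N ->
  `|\sum_(l < i * L) (X l)%:R / N - L%:R * \sum_(j < i) y (j * L)%N| <= (e + e) * (i * L)%:R.
Proof.
elim: i => [_|i IH iT]; first by rewrite mul0n !big_ord0 !mulr0 subr0 normr0.
have iT' : (i * L <= T * n.+1)%N by apply: leq_trans iT; rewrite leq_mul2r leqnSn orbT.
rewrite mulSnr big_split_ord big_ord_recr/= natrD !mulrDr opprD addrACA.
apply: le_trans (ler_normD _ _) _; apply: lerD; first exact: IH.
have -> : L%:R * y (i * L)%N = \sum_(q < L) y (i * L)%N by rewrite sumr_const card_ord mulr_natl.
rewrite -sumrB; apply: le_trans (ler_norm_sum _ _ _) _.
apply: (@le_trans _ _ (\sum_(q < L) (e + e))); last by rewrite sumr_const card_ord mulr_natr.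
apply: ler_sum => q _; apply: block_near => //; apply: leq_trans iT; rewrite mulSnr leq_add2l; exact: ltnW.
Qed.

Lemma skeleton_comparison (dt t : R) : 0 <= t <= T%:R -> 3 * e <= dt ->
  e + a * (2 * e * T%:R + (r.+1 * T)%:R * C / N + 2 * (C + e) / r.+1%:R) <= dt ->
  `|step_fun N (fun k => (N^-1 * (X k)%:R, N^-2 * (Y k)%:R)) t -
    skeleton_path a r (fun j => y (j * L)%N) t| <= dt.
Proof.
move=> /andP[t0 tT] d1 d2.
have Nt0 : 0 <= N * t by exact: mulr_ge0.
have rt0 : 0 <= r.+1%:R * t by exact: mulr_ge0.
rewrite step_pathE// /step_fun ltNge t0/=.
have /andP[kt tk] := truncn_itv Nt0; have /andP[it ti] := truncn_itv rt0.
move: kt tk it ti; set k := Num.truncn (N * t); set i := Num.truncn (r.+1%:R * t) => kt tk it ti.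
have iT : (i <= r.+1 * T)%N by rewrite -(ler_nat R) natrM; apply: le_trans it _; rewrite ler_wpM2l.
have kT : (k <= T * n.+1)%N by rewrite -(ler_nat R) natrM mulrC; apply: le_trans kt _; rewrite ler_wpM2l.
have LN : (L * r.+1 <= n.+1)%N := leq_divM _ _.
have NL : (n.+1 < L.+1 * r.+1)%N by exact: ltn_ceil.
have ik : (i * L <= k)%N.
  rewrite -ltnS -(ltr_nat R); apply: le_lt_trans tk; rewrite natrM.
  apply: (@le_trans _ _ (r.+1%:R * t * L%:R)); first by rewrite ler_wpM2r.
  rewrite mulrAC ler_wpM2r// -natrM ler_nat mulnC.
  exact: LN.
have ki : (k < i.+2 * L)%N.
  have h1 : (k * r.+1 < n.+1 * i.+1)%N.
    rewrite -(ltr_nat R) !natrM; apply: (@le_lt_trans _ _ (N * t * r.+1%:R)); first by rewrite ler_wpM2r.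
    by rewrite -mulrA ltr_pM2l// mulrC.
  have h2 : (k < L.+1 * i.+1)%N.
    rewrite -(ltn_pmul2r (ltn0Sn r)); apply: (leq_trans h1).
    by rewrite mulnAC leq_mul2r; rewrite ltnW ?orbT.
  apply: (leq_trans h2); rewrite mulSn [(i.+2 * L)%N]mulSn [(i.+1 * L)%N]mulnC leq_add2r.
  exact: leq_ltn_trans iT TL.
have iK : (i <= r.+1 ^ 2)%N by apply: leq_trans iT _; rewrite -[(r.+1 ^ 2)%N]/(r.+1 * r.+1)%N leq_mul2l Tr orbT.
rewrite (minn_idPl iK) pair_norm_le/=; apply/andP; split.
  by rewrite [_^-1 * _]mulrC; apply: le_trans d1; apply: value_near => //; rewrite ik.
set Sb := \sum_(j < i) y (j * L)%N; pose Sx : R := \sum_(l < k) (X l)%:R.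
have iT' : (i * L <= T * n.+1)%N := leq_trans ik kT.
have mb := mass_blocks iT'; rewrite -/Sb in mb.
have bound l : (l <= T * n.+1)%N -> (X l)%:R / N <= C + e.
  move=> lT; have := hX lT; have := hy lT; rewrite ler_distl !ler_norml => /andP[_ h1] /andP[_ h2].
  by apply: le_trans h2 _; exact: lerD.
have rem : 0 <= Sx / N - \sum_(l < i * L) (X l)%:R / N <= 2 * L%:R * (C + e).
  have -> : Sx / N = \sum_(l < i * L + (k - i * L)) (X l)%:R / N by rewrite subnKC// mulr_suml.
  rewrite big_split_ord/= addrAC subrr add0r.
  apply/andP; split; first by apply: sumr_ge0 => q _; exact: divr_ge0.
  apply: (@le_trans _ _ (\sum_(q < k - i * L) (C + e))).
    apply: ler_sum => q _; apply: bound; apply: leq_trans kT; rewrite -ltnS.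
    by have := ltn_ord q; rewrite ltn_subRL => /leq_trans; apply; exact: leqnSn.
  rewrite sumr_const card_ord -[X in X <= _]mulr_natl ler_wpM2r ?addr_ge0// -natrM ler_nat.
  by rewrite leq_subLR -mulnDl addn2 ltnW.
have Sb_le : `|Sb| <= (r.+1 * T)%:R * C.
  apply: le_trans (ler_norm_sum _ _ _) _; apply: (@le_trans _ _ (\sum_(j < i) C)).
    apply: ler_sum => j _; apply: hy; apply: leq_trans iT'; rewrite leq_mul2r; exact/orP/or_intror/ltnW.
  by rewrite sumr_const card_ord -[X in X <= _]mulr_natl ler_wpM2r// ler_nat.
have hd : `|L%:R / N - r.+1%:R^-1| <= N^-1.
  rewrite distrC ger0_norm ?subr_ge0; last first.
    by rewrite ler_pdivrMr// ler_pdivlMl// -natrM ler_nat mulnC.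
  rewrite lerBlDr -[X in X + _]mul1r -mulrDl [1 + _]addrC natr1 ler_pdivlMr// ler_pdivrMl//.
  by rewrite -natrM ler_nat mulnC ltnW.
have NN : (n.+1 * n.+1)%:R = N ^+ 2 by rewrite natrM expr2.
(* Four errors: the second type against its accumulated mass, the replacement of complete blocks by
   their initial values, the difference between [L / N] and [1 / r.+1], and the generations after
   the [i] complete blocks. *)
have -> : N^-2 * (Y k)%:R - a / r.+1%:R * Sb =
    ((Y k)%:R / (n.+1 * n.+1)%:R - a * (Sx / (n.+1 * n.+1)%:R)) +
    a * (N^-1 * (\sum_(l < i * L) (X l)%:R / N - L%:R * Sb) + (L%:R / N - r.+1%:R^-1) * Sb +
      N^-1 * (Sx / N - \sum_(l < i * L) (X l)%:R / N)).
  by rewrite NN; field; rewrite !gt_eqF.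
apply: le_trans d2; apply: le_trans (ler_normD _ _) _; apply: lerD; first exact: hY.
rewrite normrM (ger0_norm a0); apply: ler_wpM2l => //.
have Ni : 0 <= N^-1 by rewrite invr_ge0.
apply: le_trans (ler_normD _ _) _; apply: lerD; first (apply: le_trans (ler_normD _ _) _; apply: lerD).
- rewrite normrM (ger0_norm Ni); apply: le_trans (ler_wpM2l Ni mb) _.
  rewrite mulrC ler_pdivrMr// -!mulrA; have -> : e + e = 2 * e by ring.
  by rewrite -[leLHS]mulrA; do 2 (apply: ler_wpM2l => //); rewrite -natrM ler_nat.
- rewrite normrM [leRHS]mulrC; exact: ler_pM.
- have /andP[rem0 rem1] := rem; rewrite normrM (ger0_norm Ni) (ger0_norm rem0).
  apply: le_trans (ler_wpM2l Ni rem1) _; rewrite ler_pdivlMr//.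
  have -> : N^-1 * (2 * L%:R * (C + e)) * r.+1%:R = 2 * (C + e) * (L * r.+1)%:R / N by rewrite natrM; ring.
  by rewrite ler_pdivrMr// ler_wpM2l ?ler_nat// mulr_ge0// addr_ge0.
Qed.
End comparison.

(** * Convergence for a pair of recursions *)

Section recursion_limit.
Context {R : realType} {d} {T : measurableType d} (P : probability T R).
Variables (F : nat -> set_system T) (G : nat -> nat -> set_system T).
Variables (ze : nat -> nat -> T -> R) (eta : nat -> T -> R) (m v s : R).
Variable X : nat -> T -> nat.
Hypotheses (sF : forall k, sub_algebra (F k))
  (FG : forall k, F k `<=` G k 0%N)
  (GF : forall k J, G k J `<=` F k.+1)
  (nr : forall J k, noise_row P J v (G k) (ze k))
  (nri : forall k, noise_row P 1 s (fun j => if j is 0 then F k else F k.+1) (fun=> eta k))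
  (v0 : 0 <= v)
  (s0 : 0 <= s)
  (mX : forall k, meas_wrt (F k) (X k))
  (X0 : forall w, X 0%N w = 0%N).
Hypothesis XS : forall k w,
  (X k.+1 w)%:R = (X k w)%:R + \sum_(j < X k w) ze k j w + eta k w + m.
Hypothesis vanishing : forall e : R, 0 < e -> exists n0, forall n, (n0 <= n)%N -> forall k j,
  (\int[P]_w (cubic_rem (n.+1%:R^-1 * ze k j w))%:E <= (e * n.+1%:R^-1 ^+ 2)%:E)%E.
Hypothesis later : forall k L b, indep_of P (F k) (flat_sum ze k L b).
Variables (G2 : nat -> nat -> set_system T) (z2 : nat -> nat -> T -> R) (v2 a mu : R) (Y E : nat -> T -> nat).
Hypotheses (FG2 : forall k, F k `<=` G2 k 0%N)
  (GF2 : forall k J, G2 k J `<=` F k.+1)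
  (nr2 : forall J k, noise_row P J v2 (G2 k) (z2 k))
  (v20 : 0 <= v2)
  (a0 : 0 <= a)
  (mY : forall k, meas_wrt (F k) (Y k))
  (mE : forall k, meas_wrt (F k.+1) (E k))
  (meanE : forall k, (\int[P]_w ((E k w)%:R)%:E <= mu%:E)%E)
  (Y0 : forall w, Y 0%N w = 0%N).
Hypothesis YS : forall k w, (Y k.+1 w)%:R =
  (Y k w)%:R + a * (X k w)%:R + \sum_(j < Y k w) z2 k j w + (E k w)%:R.

(** On the events of [frozen_close] and [accumulation_close] the comparison is deterministic; [r]
    large handles the incomplete blocks, and [n] large, for fixed [r], the rounding of block
    lengths. *)
Lemma recursion_near_skeleton (K : nat) (e : R) : 0 < e -> exists r0 : nat, forall r, (r0 <= r)%N ->
  exists n0 : nat, forall n, (n0 <= n)%N -> most P e (fun w => forall t : R, 0 <= t <= K%:R ->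
    `|step_fun n.+1%:R (fun k => (n.+1%:R^-1 * (X k w)%:R, n.+1%:R^-2 * (Y k w)%:R)) t -
      skeleton_path a r (block ze m r n w) t| <= e).
Proof.
move=> e0; have e30 : 0 < e / 3 by rewrite divr_gt0.
have close := frozen_close sF FG GF nr nri v0 s0 mX X0 XS vanishing.
have hX (t : nat) (c : R) : 0 < c -> exists (C : R) (n0 : nat), forall n, (n0 <= n)%N ->
     most P c (fun w => forall k, (k <= t * n.+1)%N -> (X k w)%:R / n.+1%:R <= C).
  move=> c0; have [C [r0 h]] := close t c c0; have [n0 hn] := h r0 (leqnn r0).
  exists (C + c), n0 => n /hn[_]; apply: most_imp => w hw k /hw /=; set y := (frozen _ _ _ _ _ _ _).1.
  move=> [+ _ + _]; rewrite ler_distl ler_norml => /andP[_ h1] /andP[_ h2].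
  by apply: le_trans h1 _; rewrite lerD2r.
have aK0 : 0 < 1 + a * (2 * K%:R) by rewrite ltr_pwDl// !mulr_ge0.
pose e1 := e / 3 / (1 + a * (2 * K%:R)); have e10 : 0 < e1 by rewrite divr_gt0.
have e1e : e1 <= e / 3 by rewrite ler_pdivrMr// ler_peMr ?(ltW e30)// lerDl !mulr_ge0.
have e1K : e1 + a * (2 * e1 * K%:R) = e / 3.
  by rewrite /e1; field; rewrite gt_eqF.
have [C [r1 h1]] := close K e1 e10.
have [n1 h1'] := accumulation_close sF FG2 GF2 nr2 v20 a0 mX mY mE meanE Y0 YS hX K e10.
have C0 : 0 <= `|C| by [].
have c10 : 0 < a * (2 * (`|C| + e1)) + 1 by rewrite ltr_wpDl// !mulr_ge0// addr_ge0// ltW.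
have [r2] := ltr_add_invr (divr_gt0 e30 c10); rewrite add0r => hr2.
exists (maxn r1 (maxn K r2)) => r; rewrite !geq_max => /and3P[/h1[n2 h2] Kr r2r].
have c20 : 0 < a * ((r.+1 * K)%:R * `|C|) + 1 by rewrite ltr_wpDl// !mulr_ge0.
have [n3] := ltr_add_invr (divr_gt0 e30 c20); rewrite add0r => hn3.
exists (maxn (maxn n1 n2) (maxn n3 ((r.+1 * K).+1 * r.+1))) => n.
rewrite !geq_max => /andP[/andP[n1n /h2[L0 hf]] /andP[n3n nL]].
have TL : (r.+1 * K < n.+1 %/ r.+1)%N by rewrite leq_divRL//; exact: leqW.
have small (c b : R) : 0 <= c -> 0 <= b -> b <= e / 3 / (c + 1) -> c * b <= e / 3.
  move=> c0 b0; have c11 : 0 < c + 1 by rewrite ltr_wpDl.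
  rewrite ler_pdivlMr// mulrC => /(le_trans _); apply; by rewrite ler_wpM2r// lerDl.
have sr : a * (2 * (`|C| + e1) / r.+1%:R) <= e / 3.
  rewrite mulrA; apply: small; [by rewrite !mulr_ge0// addr_ge0// ltW|by rewrite invr_ge0|].
  by apply: le_trans (ltW hr2); rewrite lef_pV2 ?posrE// ler_nat ltnS.
have sn : a * ((r.+1 * K)%:R * `|C| / n.+1%:R) <= e / 3.
  rewrite mulrA; apply: small; [by rewrite !mulr_ge0|by rewrite invr_ge0|].
  by apply: le_trans (ltW hn3); rewrite lef_pV2 ?posrE// ler_nat ltnS.
have ee : e1 + e1 <= e.
  apply: le_trans (lerD e1e e1e) _; rewrite -mulrDl ler_pdivrMr//.
  have -> : e * 3 = e + e + e by ring.
  by rewrite lerDl ltW.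
apply: (most_le ee).
apply: most_imp (most_and hf (h1' n n1n)) => w [hw hw'] t tK.
apply: (@skeleton_comparison _ (X^~ w) (Y^~ w) (fun k => (frozen ze m n r (n.+1 %/ r.+1) k w).1)
  (fun k => (frozen ze m n r (n.+1 %/ r.+1) k w).2) n r K a e1 `|C| a0 (ltW e10) C0 (leqW Kr) TL).
- by move=> k kK; case: (hw k kK).
- by move=> k kK; case: (hw k kK).
- by move=> k kK; case: (hw k kK) => _ _ + _ => /le_trans; apply; exact: ler_norm.
- by move=> k kK; case: (hw k kK).
- exact: hw'.
- by move=> j l lL; case: (frozen_block ze m n r j w (ltnW lL) L0) => _; apply.
- exact: tK.
- by rewrite mulrC -ler_pdivlMr.
- rewrite [a * (_ + _)]mulrDr [a * (_ + _)]mulrDr !addrA e1K.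
  have E3 : e / 3 + e / 3 + e / 3 = e by field.
  by rewrite -[leRHS]E3; apply: lerD => //; apply: lerD.
Qed.

Context {d'} {T' : measurableType d'} (P' : probability T' R).
Variables (F' : R -> set_system T') (W Z : R -> T' -> R).
Hypotheses (wW : wiener_process P' F' W)
  (sZ : sde_solution P' F' W (fun=> m) (diffusion_coef v) 0 Z)
  (cZ : forall w, cpath (Z^~ w)).
Variables X' Y' : nat -> T -> nat.
Hypotheses (mX' : forall k, meas_fun (X' k))
  (mY' : forall k, meas_fun (Y' k))
  (modification : {ae P, forall w, forall k, X' k w = X k w /\ Y' k w = Y k w}).

Definition scaled_path n w : skorokhod R :=
  step_path (fun k => (n%:R^-1 * (X' k w)%:R, n%:R^-2 * (Y' k w)%:R)) (ler0n R n).

Lemma measurable_scaled_path n H : dist_lipschitz H -> meas_fun (H \o scaled_path n).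
Proof.
move=> lH; pose V k w := pickle (X' k w, Y' k w).
have mV k : meas_fun (V k).
  apply: (@meas_countable_index _ T _ _ (X' k) (fun c w => pickle (c, Y' k w))); first exact: mX'.
  by move=> c; exact: (meas_nat_comp (fun b => pickle (c, b)) (mY' k)).
pose q c : R * R := if unpickle c is Some (b, b') then (n%:R^-1 * b%:R, n%:R^-2 * b'%:R) else (0, 0).
have -> : H \o scaled_path n = fun w => H (step_path (fun k => q (V k w)) (ler0n R n)).
  apply/funext => w /=; congr H; rewrite /scaled_path; congr step_path.
  by apply/funext => k; rewrite /q /V pickleK.
exact: measurable_step_path.
Qed.

(** Three errors of [e / 3]: scaled path to frozen skeleton, frozen skeleton to Euler skeleton in
    law, Euler skeleton to limit. [r] is fixed by the first and the last before [n] is chosen. *)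
Lemma mean_scaled_path_cvg H (e : R) : dist_lipschitz H -> 0 < e -> exists n0 : nat, forall n, (n0 <= n)%N ->
  `|mean P (H \o scaled_path n) - mean P' (fun w => H (limit_path a (cZ w)))| <= e.
Proof.
move=> lH e0; have e30 : 0 < e / 3 by rewrite divr_gt0.
have [[M HM] _] := lH.
have [K [dt [dt0 near]]] := mean_paths_near lH e30.
have [r1 h1] := recursion_near_skeleton K dt0.
have [r2 h2] := mean_limit_path a0 cZ lH v0 e30 wW sZ.
pose r := maxn r1 r2; have {}h1 := h1 r (leq_maxl _ _); have {}h2 := h2 r (leq_maxr _ _).
have [n1 hn1] := h1.
have uH := ucont_skeleton a0 r lH.
have [n2 hn2] := skeleton_limit m sF FG GF nr v0 vanishing later wW r uH (fun=> HM _) e30.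
(* The estimates are stated at scale [n.+1], the statement at scale [n]; the bound excludes
   [n = 0]. *)
exists (maxn n1 n2).+1 => -[//|n]; rewrite ltnS geq_max => /andP[/hn1 {}hn1 /hn2 {}hn2].
have mS : meas_fun (H \o (fun w => skeleton_path a r (block ze m r n w))).
  by apply: (measurable_ucont (Y := fun j w => block ze m r n w j) uH) => j _; exact: (measurable_block m sF FG GF nr).
have hn3 : `|mean P (H \o scaled_path n.+1) - mean P (H \o (fun w => skeleton_path a r (block ze m r n w)))| <= e / 3.
  apply: near => //; first exact: measurable_scaled_path.
  apply: (most_le (e := 0 + dt)); first by rewrite add0r.
  apply: most_imp (most_and (most_ae modification) hn1) => w [eXY hw] t tK.
  have -> : scaled_path n.+1 w t = step_fun n.+1%:R (fun k => (n.+1%:R^-1 * (X k w)%:R, n.+1%:R^-2 * (Y k w)%:R)) t.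
    by rewrite /=; congr step_fun; apply/funext => k; have [-> ->] := eXY k.
  exact: hw.
have -> : e = e / 3 + e / 3 + e / 3 by field.
apply: le_trans (ler_distD (mean P' (fun w => H (skeleton_path a r (fun j => euler W m v r j w)))) _ _) _.
apply: lerD; last by rewrite distrC.
by apply: le_trans (ler_distD _ _ _) _; apply: lerD hn3 _; exact: hn2.
Qed.
End recursion_limit.

(** * The two-type process *)

Section ae_transfer.
Context {R : realType} {d} {T : measurableType d} (P : probability T R).

Lemma ae_exists (Q : T -> Prop) : {ae P, forall w, Q w} -> exists w, Q w.
Proof.
move=> /most_ae[B [mB PB BQ]]; apply: contrapT => nQ.
have BT : B = setT by apply/seteqP; split=> // w _; apply: contrapT => nB; apply: nQ; exists w; exact: BQ.
by move: PB; rewrite BT probability_setT lee_fin ler10.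
Qed.

Lemma ae_identically_distributed d' (T' : measurableType d') (V V' : T -> T') (A : set T') :
  meas_fun V -> meas_fun V' -> identically_distributed P V V' -> measurable A ->
  {ae P, forall w, A (V' w)} -> {ae P, forall w, A (V w)}.
Proof.
move=> mV mV' VV mA [B [mB PB BA]].
have mC : measurable (~` A) by exact: measurableC.
have mVC (U : T -> T') : meas_fun U -> measurable (U @^-1` (~` A)).
  by move=> mU; rewrite -[X in measurable X]setTI; exact: mU.
exists (V @^-1` (~` A)); split; [exact: mVC|rewrite VV//|by []].
apply/eqP; rewrite eq_le measure_ge0 andbT -PB; apply: le_measure; rewrite ?inE//; exact: mVC.
Qed.
End ae_transfer.

Lemma measurable_random_sum d (S : measurableType d) (N : S -> nat) (f : nat -> S -> nat) :
  meas_fun N -> (forall j, meas_fun (f j)) ->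
  meas_fun (fun w => \sum_(j < N w) f j w)%N.
Proof.
move=> mN mf; apply: (@meas_countable_index _ S _ _ N (fun n w => \sum_(j < n) f j w)%N mN) => n.
exact: measurable_sumn.
Qed.

Section two_type_process.
Context {R : realType} {d} {T : measurableType d} (P : probability T R).
Variables (xi : nat -> nat -> 'I_2 -> T -> nat * nat) (eps : nat -> T -> nat * nat).
Hypothesis hfam : gw_family_law P xi eps.

(** [type1] and [type2] are the two recursions with the almost sure values of the cross offspring
    put in for every outcome. They satisfy the required identities everywhere and agree with the
    process almost surely. *)
Fixpoint type1 (k : nat) (w : T) : nat :=
  if k is k'.+1 then (\sum_(j < type1 k' w) (xi k' j ord0 w).1 + (eps k' w).1)%N else 0%N.

Fixpoint type2 (A k : nat) (w : T) : nat :=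
  if k is k'.+1 then
    (A * type1 k' w + \sum_(j < type2 A k' w) (xi k' j ord_max w).2 + (eps k' w).2)%N
  else 0%N.

Let mxi k j i : meas_fun (xi k j i).
Proof. by case: hfam => m _ _ _; exact: (m (inl (k, j, i))). Qed.

Let meps k : meas_fun (eps k).
Proof. by case: hfam => m _ _ _; exact: (m (inr k)). Qed.

Let mfst : measurable_fun [set: nat * nat] (@fst nat nat). Proof. exact: measurable_fst. Qed.
Let msnd : measurable_fun [set: nat * nat] (@snd nat nat). Proof. exact: measurable_snd. Qed.

Let past_up k d1 (T1 : measurableType d1) (f : T -> T1) :
  meas_wrt (past xi eps k) f -> meas_wrt (past xi eps k.+1) f.
Proof.
apply: meas_wrt_sub; [exact: (past_sub_algebra hfam)|exact: (past_sub_algebra hfam)|].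
by apply: past_mono; exact: leqnSn.
Qed.

Let xi_component (pr : nat * nat -> nat) k j i : meas_fun pr ->
  meas_wrt (past xi eps k.+1) (fun w => pr (xi k j i w)).
Proof.
move=> mpr; have h : meas_wrt (past xi eps k.+1) (xi k j i).
  exact: (xi_past_measurable hfam).
exact: (measurableT_comp mpr h).
Qed.

Let eps_component (pr : nat * nat -> nat) k : meas_fun pr ->
  meas_wrt (past xi eps k.+1) (fun w => pr (eps k w)).
Proof.
move=> mpr; have h : meas_wrt (past xi eps k.+1) (eps k).
  exact: (eps_past_measurable hfam).
exact: (measurableT_comp mpr h).
Qed.

Lemma type1_adapted k : meas_wrt (past xi eps k) (type1 k).
Proof.
elim: k => [|k IH]; first exact: measurable_cst.
pose U := g_sigma_algebraType (past xi eps k.+1).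
apply: (@measurable_addn _ U); last exact: eps_component.
apply: (@measurable_random_sum _ U (type1 k) (fun j w => (xi k j ord0 w).1)); first exact: past_up.
by move=> j; exact: xi_component.
Qed.

Lemma type2_adapted A k : meas_wrt (past xi eps k) (type2 A k).
Proof.
elim: k => [|k IH]; first exact: measurable_cst.
pose U := g_sigma_algebraType (past xi eps k.+1).
apply: (@measurable_addn _ U); last exact: eps_component.
apply: (@measurable_addn _ U).
  have h : meas_wrt (past xi eps k.+1) (type1 k) by apply: past_up; exact: type1_adapted.
  exact: (meas_nat_comp (muln A) h).
apply: (@measurable_random_sum _ U (type2 A k) (fun j w => (xi k j ord_max w).2)); first exact: past_up.
by move=> j; exact: xi_component.
Qed.

Let sum_fst n (f : nat -> nat * nat) : (\sum_(j < n) f j).1 = (\sum_(j < n) (f j).1)%N.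
Proof. by elim: n => [|n IH]; rewrite ?big_ord0// !big_ord_recr/= IH. Qed.

Let sum_snd n (f : nat -> nat * nat) : (\sum_(j < n) f j).2 = (\sum_(j < n) (f j).2)%N.
Proof. by elim: n => [|n IH]; rewrite ?big_ord0// !big_ord_recr/= IH. Qed.

Lemma gw_processS k w : gw_process xi eps k.+1 w =
  ((\sum_(j < (gw_process xi eps k w).1) (xi k j ord0 w).1 + \sum_(j < (gw_process xi eps k w).2) (xi k j ord_max w).1 + (eps k w).1)%N,
   (\sum_(j < (gw_process xi eps k w).1) (xi k j ord0 w).2 + \sum_(j < (gw_process xi eps k w).2) (xi k j ord_max w).2 + (eps k w).2)%N).
Proof.
rewrite /=; set x := gw_process xi eps k w.
by rewrite -(sum_fst _ (fun j => xi k j ord0 w)) -(sum_fst _ (fun j => xi k j ord_max w))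
  -(sum_snd _ (fun j => xi k j ord0 w)) -(sum_snd _ (fun j => xi k j ord_max w)).
Qed.

Lemma measurable_gw_process k : meas_fun (fun w => (gw_process xi eps k w).1) /\
  meas_fun (fun w => (gw_process xi eps k w).2).
Proof.
elim: k => [|k [IH1 IH2]]; first by split; exact: measurable_cst.
have step (pr : nat * nat -> nat) : meas_fun pr -> meas_fun (fun w =>
    (\sum_(j < (gw_process xi eps k w).1) pr (xi k j ord0 w) + \sum_(j < (gw_process xi eps k w).2) pr (xi k j ord_max w) + pr (eps k w))%N).
  move=> mpr; apply: measurable_addn; last exact: (measurableT_comp mpr (meps k)).
  apply: measurable_addn.
    by apply: (measurable_random_sum (f := fun j w => pr (xi k j ord0 w))) => // j; exact: (measurableT_comp mpr (mxi k j ord0)).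
  by apply: (measurable_random_sum (f := fun j w => pr (xi k j ord_max w))) => // j; exact: (measurableT_comp mpr (mxi k j ord_max)).
split.
  by rewrite (_ : (fun w => _) = (fun w => (gw_process xi eps k.+1 w).1))//; under eq_fun do rewrite gw_processS /=; exact: (step fst).
by rewrite (_ : (fun w => _) = (fun w => (gw_process xi eps k.+1 w).2))//; under eq_fun do rewrite gw_processS /=; exact: (step snd).
Qed.

Lemma gw_process_modification (A : nat) : {ae P, forall w, (xi 0%N 0%N ord_max w).1 = 0%N} ->
  {ae P, forall w, (xi 0%N 0%N ord0 w).2 = A} ->
  {ae P, forall w, forall k, (gw_process xi eps k w).1 = type1 k w /\ (gw_process xi eps k w).2 = type2 A k w}.
Proof.
move=> h21 h12; have [_ _ ixi _] := hfam.
have all (Q : nat -> nat -> T -> Prop) : (forall k j, {ae P, forall w, Q k j w}) -> {ae P, forall w, forall k j, Q k j w}.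
  by move=> h; apply: ae_foralln => k; apply: ae_foralln => j; exact: h.
have all21 : {ae P, forall w, forall k j, (xi k j ord_max w).1 = 0%N}.
  apply: all => k j; apply: (@ae_identically_distributed _ _ _ P _ _ _ (xi 0%N 0%N ord_max) (@fst nat nat @^-1` [set 0%N])) => //.
  by rewrite -[X in measurable X]setTI; exact: mfst.
have all12 : {ae P, forall w, forall k j, (xi k j ord0 w).2 = A}.
  apply: all => k j; apply: (@ae_identically_distributed _ _ _ P _ _ _ (xi 0%N 0%N ord0) (@snd nat nat @^-1` [set A])) => //.
  by rewrite -[X in measurable X]setTI; exact: msnd.
apply: filterS2 all21 all12 => w w21 w12; elim=> [//|k [IH1 IH2]].
rewrite gw_processS IH1 IH2 /= [X in (_ + X + _)%N]big1 ?addn0//; split=> //.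
rewrite (eq_bigr (fun=> A)); last by move=> j _; exact: w12.
by rewrite sum_nat_const card_ord mulnC.
Qed.

Lemma offspring_later i (pr : nat * nat -> nat) k L b : meas_fun pr ->
  indep_of P (past xi eps k) (flat_sum (offspring_noise xi i pr : nat -> nat -> T -> R) k L b).
Proof.
move=> mpr; have [mfam _ _ _] := hfam; apply: (later_indep hfam); rewrite /flat_sum.
apply: measurable_sum => l.
have := @info_measurable _ _ _ _ _ _ mfam (fun a => (k <= generation a)%N) (inl ((k + l %/ b)%N, (l %% b)%N, i)).
move=> /(_ _) h; apply: (measurableT_comp (measurable_realize 1 mpr)); apply: h.
by rewrite unfold_in /= leq_addr.
Qed.
End two_type_process.

(** * Moments of integer variables *)

Section nat_moments.
Context {R : realType} {d} {T : measurableType d} (P : probability T R).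

Lemma nat_integral_fin (N : T -> nat) (f : T -> R) : meas_fun N -> meas_fun f ->
  (forall w, (N w)%:R <= f w) -> (\int[P]_w (f w)%:E < +oo)%E ->
  (\int[P]_w ((N w)%:R : R)%:E = (fine (\int[P]_w ((N w)%:R : R)%:E))%:E)%E.
Proof.
move=> mN mf Nf hf; rewrite fineK// ge0_fin_numE; last by apply: integral_ge0 => w _; rewrite lee_fin.
apply: le_lt_trans hf; apply: ge0_integral_mono => w; first by rewrite lee_fin.
by rewrite lee_fin.
Qed.

Lemma nat_le_sqr (j : nat) : j%:R <= j%:R ^+ 2 :> R.
Proof. by rewrite -natrX ler_nat; case: j => // j; rewrite leq_pmulr. Qed.

Lemma nat_le_powR (j : nat) (dt : R) : 0 < dt -> j%:R <= j%:R `^ (1 + dt).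
Proof.
move=> d0; case: j => [|j]; first by rewrite powR_ge0.
rewrite -[leLHS]powRr1 ?ler0n//; apply: ler_powR; first by rewrite ler1n.
by rewrite lerDl ltW.
Qed.

Lemma variance_unit_mean (N : T -> nat) : meas_fun N ->
  (\int[P]_w ((N w)%:R : R)%:E = 1)%E -> (\int[P]_w (((N w)%:R : R) ^+ 2)%:E < +oo)%E ->
  0 <= fine (variance P (fun w => (N w)%:R : R)) /\
  (\int[P]_w (((N w)%:R : R) ^+ 2)%:E = (fine (variance P (fun w => (N w)%:R : R)) + 1)%:E)%E.
Proof.
move=> mN h1 h2; have mN' : meas_fun (fun w => (N w)%:R : R).
  exact: (meas_nat_comp (fun j => j%:R : R) mN).
have h2E : (\int[P]_w (((N w)%:R : R) ^+ 2)%:E = (fine (\int[P]_w (((N w)%:R : R) ^+ 2)%:E))%:E)%E.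
  by rewrite fineK// ge0_fin_numE//; apply: integral_ge0 => w _; rewrite lee_fin sqr_ge0.
have [_ _ c] := centered_nonneg mN' (fun w => ler0n R (N w)) h1 h2E.
have vE : variance P (fun w => (N w)%:R : R) = (\int[P]_w (((N w)%:R - 1 : R) ^+ 2)%:E)%E.
  rewrite /variance unlock unlock h1 /=.
  by under eq_integral => w _ do rewrite /= -expr2.
split; first by rewrite vE; apply: fine_ge0; apply: integral_ge0 => w _; rewrite lee_fin sqr_ge0.
by rewrite vE c /= expr1n subrK.
Qed.
End nat_moments.

Theorem corollary3p7 (R : realType)
    (d : measure_display) (Omega : measurableType d) (P : probability Omega R)
    (xi : nat -> nat -> 'I_2 -> Omega -> nat * nat)
    (eps : nat -> Omega -> nat * nat)
    (delta a21 : R)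
    (hfam : gw_family_law P xi eps)
    (hxi11_sq : ('E_P[fun w => ((xi 0%N 0%N ord0 w).1%:R ^+ 2)%R] < +oo)%E)
    (hxi22_sq : ('E_P[fun w => ((xi 0%N 0%N ord_max w).2%:R ^+ 2)%R] < +oo)%E)
    (heps1_sq : ('E_P[fun w => ((eps 0%N w).1%:R ^+ 2)%R] < +oo)%E)
    (hdelta : 0 < delta)
    (heps2 : ('E_P[fun w => ((eps 0%N w).2%:R `^ (1 + delta))%R] < +oo)%E)
    (hxi11_mean : ('E_P[fun w => ((xi 0%N 0%N ord0 w).1%:R)%R] = 1)%E)
    (hxi22_mean : ('E_P[fun w => ((xi 0%N 0%N ord_max w).2%:R)%R] = 1)%E)
    (hxi21 : {ae P, forall w, (xi 0%N 0%N ord_max w).1 = 0%N})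
    (ha21 : 0 <= a21)
    (hxi12 : {ae P, forall w, (xi 0%N 0%N ord0 w).2%:R = a21}) :
  let X := gw_process xi eps in
  let m := fine ('E_P[fun w => ((eps 0%N w).1%:R)%R])%E in
  let v := fine (variance P (fun w => ((xi 0%N 0%N ord0 w).1%:R)%R)) in
  let b := fun _ : R => m in
  let sigma := fun x : R => Num.sqrt (v * Num.max x 0) in
  [/\ pathwise_uniqueness b sigma 0,
      strong_existence b sigma 0 &
      forall (d' : measure_display) (Omega' : measurableType d')
        (P' : probability Omega' R) (W X1 : R -> Omega' -> R),
        standard_wiener_process P' W ->
        strong_solution P' W b sigma 0 X1 ->
        cvg_in_law_skorokhod P
          (fun n t w =>
             (n%:R^-1 * (X (Num.truncn (n%:R * t)) w).1%:R,
              n%:R^-2 * (X (Num.truncn (n%:R * t)) w).2%:R))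
          P'
          (fun t w =>
             (X1 t w, a21 * \int[lebesgue_measure]_(s in `[0, t]) X1 s w))].
Proof.
move=> X m v b sigma; have [mfam _ ixi ieps] := hfam.
have mfst : measurable_fun [set: nat * nat] (@fst nat nat) by exact: measurable_fst.
have msnd : measurable_fun [set: nat * nat] (@snd nat nat) by exact: measurable_snd.
have mxi k j i : meas_fun (xi k j i) := mfam (inl (k, j, i)).
have meps k : meas_fun (eps k) := mfam (inr k).
rewrite unlock in hxi11_sq hxi22_sq heps1_sq heps2 hxi11_mean hxi22_mean.
have [v0 h11] := variance_unit_mean (measurableT_comp mfst (mxi 0%N 0%N ord0)) hxi11_mean hxi11_sq.
have [v20 h22] := variance_unit_mean (measurableT_comp msnd (mxi 0%N 0%N ord_max)) hxi22_mean hxi22_sq.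
set v2 := fine _ in v20 h22; rewrite -[fine _]/v in v0 h11.
split; [exact: pathwise_uniqueness_diffusion|exact: strong_existence_diffusion|].
move=> d' Omega' P' W X1 sW sX.
have c11 := offspring_noise_centered hfam mfst hxi11_mean h11.
have c22 := offspring_noise_centered hfam msnd hxi22_mean h22.
have mN (pr : nat * nat -> nat) k : meas_fun pr -> meas_fun (fun w => pr (eps k w)).
  by move=> mpr; exact: (measurableT_comp mpr (meps k)).
have mE : (\int[P]_w ((eps 0%N w).1%:R : R)%:E = m%:E)%E.
  rewrite /m unlock; apply: (nat_integral_fin (mN _ 0%N mfst) _ _ heps1_sq) => [|w]; last exact: nat_le_sqr.
  exact: (meas_nat_comp (fun j => j%:R ^+ 2 : R) (mN _ 0%N mfst)).
have sE : (\int[P]_w (((eps 0%N w).1%:R : R) ^+ 2)%:E = (fine (\int[P]_w (((eps 0%N w).1%:R : R) ^+ 2)%:E))%:E)%E.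
  by rewrite fineK// ge0_fin_numE//; apply: integral_ge0 => w _; rewrite lee_fin sqr_ge0.
have ceta := immigration_centered hfam mE sE.
set s := _ - m ^+ 2 in ceta.
have s0 : 0 <= s.
  by have [_ _ h] := ceta 0%N; rewrite -lee_fin -h; apply: integral_ge0 => w _; rewrite lee_fin sqr_ge0.
have muE := nat_integral_fin (mN _ 0%N msnd)
  (meas_nat_comp (fun j => j%:R `^ (1 + delta) : R) (mN _ 0%N msnd)) (fun w => nat_le_powR _ hdelta) heps2.
set mu := fine _ in muE.
have meanE k : (\int[P]_w (((eps k w).2)%:R : R)%:E <= mu%:E)%E.
  rewrite -muE le_eqVlt; apply/orP; left; apply/eqP.
  apply: (integral_same_law (h := fun p : nat * nat => (p.2%:R : R)%:E)) => //.
  apply/measurable_EFinP; exact: (meas_nat_comp (fun j => j%:R : R) msnd).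
(* The almost sure value of an integer variable is attained at some outcome, so [a21] is a natural
   number. *)
have [A AE] : exists A : nat, a21 = A%:R.
  by have [w <-] := ae_exists hxi12; exists (xi 0%N 0%N ord0 w).2.
have hA : {ae P, forall w, (xi 0%N 0%N ord0 w).2 = A}.
  by apply: filterS hxi12 => w /eqP; rewrite AE eqr_nat => /eqP.
have vanishing (e : R) : 0 < e -> exists n0, forall n, (n0 <= n)%N -> forall k j,
  (\int[P]_w (cubic_rem (n.+1%:R^-1 * offspring_noise xi ord0 fst k j w))%:E <= (e * n.+1%:R^-1 ^+ 2)%:E)%E.
  move=> e0; have [n0 h] := cubic_rem_vanishes (c11 0%N 0%N) e0.
  by exists n0 => n /h {}h k j; rewrite (offspring_noise_cubic hfam ord0 mfst).
(* A strong solution is adapted to the augmented filtration, for which [W] has to be a Wiener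
   process as well. *)
have wW := augmented_wiener sW.
have cX w : cpath (X1^~ w) by case: sX => _ cX _ _ _; exact/cpathP/cX.
have XS k w : ((type1 xi eps k.+1 w)%:R : R) = (type1 xi eps k w)%:R +
    \sum_(j < type1 xi eps k w) offspring_noise xi ord0 fst k j w + immigration_noise eps m k w + m.
  rewrite /= natrD natr_sum sumrB sumr_const card_ord /immigration_noise.
  by rewrite [X in _ - X](_ : _ = (type1 xi eps k w)%:R)//; ring.
have YS k w : ((type2 xi eps A k.+1 w)%:R : R) = (type2 xi eps A k w)%:R + a21 * (type1 xi eps k w)%:R +
    \sum_(j < type2 xi eps A k w) offspring_noise xi ord_max snd k j w + ((eps k w).2)%:R.
  rewrite /= !natrD natrM natr_sum sumrB sumr_const card_ord AE.
  by rewrite [X in _ - X](_ : _ = (type2 xi eps A k w)%:R)//; ring.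
have mE2 k : meas_wrt (past xi eps k.+1) (fun w => (eps k w).2).
  have h : meas_wrt (past xi eps k.+1) (eps k) by exact: (eps_past_measurable hfam).
  exact: (measurableT_comp msnd h).
have sF k : sub_algebra (past xi eps k) by exact: (past_sub_algebra hfam).
have cvg := @mean_scaled_path_cvg R _ _ P (past xi eps) (row_past xi eps ord0) (offspring_noise xi ord0 fst)
  (immigration_noise eps m) m v s (type1 xi eps) sF (fun k => @past_row _ _ _ _ ord0 k 0%N) (fun k J => @row_past_past _ _ _ _ ord0 k J)
  (fun J k => offspring_noise_row hfam k J mfst c11) (fun k => immigration_noise_row hfam k ceta) v0 s0
  (fun k => @type1_adapted _ _ _ _ _ _ hfam k) (fun=> erefl) XS vanishing
  (fun k L b => @offspring_later _ _ _ _ _ _ hfam ord0 fst k L b mfst)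
  (row_past xi eps ord_max) (offspring_noise xi ord_max snd) v2 a21 mu (type2 xi eps A) (fun k w => (eps k w).2)
  (fun k => @past_row _ _ _ _ ord_max k 0%N) (fun k J => @row_past_past _ _ _ _ ord_max k J)
  (fun J k => offspring_noise_row hfam k J msnd c22) v20 ha21
  (fun k => @type2_adapted _ _ _ _ _ _ hfam A k) mE2 meanE (fun=> erefl) YS
  _ _ P' _ W X1 wW sX cX (fun k w => (X k w).1) (fun k w => (X k w).2)
  (fun k => proj1 (measurable_gw_process hfam k)) (fun k => proj2 (measurable_gw_process hfam k))
  (gw_process_modification hfam hxi21 hA).
have mZ n H := @measurable_scaled_path R _ _ (fun k w => (X k w).1) (fun k w => (X k w).2)
  (fun k => proj1 (measurable_gw_process hfam k)) (fun k => proj2 (measurable_gw_process hfam k)) n H.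
have mX1 (t : R) : 0 <= t -> meas_fun (X1 t).
  by case: sX wW => aX _ _ _ _ [[fF _] _ _ _ _]; exact: (adapted_measurable fF aX).
have mZ' H : dist_lipschitz H -> meas_fun (H \o (fun w => limit_path a21 (cX w))).
  by move=> lH; exact: (measurable_limit_path ha21 cX lH mX1).
exists (scaled_path (fun k w => (X k w).1) (fun k w => (X k w).2)), (fun w => limit_path a21 (cX w)).
split.
- split=> [n w t t0|w t t0]; first exact: step_pathE.
  by rewrite /= /continuous_fun ltNge t0.
- by move=> n; apply: measurable_skorokhod => H; exact: mZ.
- exact: measurable_skorokhod.
- move=> H cH bH; apply: (cvg_expectation mZ mZ' _ cH bH) => G lG e e0; exact: cvg.
Qed.
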